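(* Let $W_{\mathrm{KN}}=\{(z_1,z_2)\in\mathbb C^2:\mathrm{Re}\, z_2+|z_1z_2|^2+|z_1|^8+\frac{15}{7}|z_1|^2\,\mathrm{Re}\, z_1^6<0\}$ and, for a real number $t$ with $1<t<9/5$, let $W_{\mathrm{For}}=\{(z_1,z_2)\in\mathbb C^2:\mathrm{Re}\, z_2+|z_1z_2|^2+|z_1|^6+t|z_1|^2\,\mathrm{Re}\, z_1^4<0\}$. Then the Bergman metric and the Carath\'eodory metric of each of $W_{\mathrm{KN}}$ and $W_{\mathrm{For}}$ are positive and complete.
   Context: For a domain $W\subset\mathbb C^n$, let $K_W$ be its Bergman kernel (built from an orthonormal basis $\{\varphi_j\}$ of the space of square-integrable holomorphic functions: $K_W(z,w)=\sum_j\varphi_j(z)\overline{\varphi_j(w)}$); when $K_W(z,z)>0$ the Bergman metric is $\sum_{j,k}\partial_j\bar\partial_k\log K_W(z,z)\,dz_j\otimes d\bar z_k$. The Carath\'eodory pseudo-metric is $F^C_W(p,v)=\sup\{|df_p(v)|: f:W\to\Delta$ holomorphic, $f(p)=0\}$ and the (integrated) Carath\'eodory distance is the infimum of $\int_0^1F^C_W(\gamma,\gamma')dt$ over piecewise $C^1$ curves joining the points. A metric is positive if every nonzero tangent vector has positive length, and complete if the induced distance is Cauchy-complete. *)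

(* Defs.v *)
From HB Require Import structures.
From mathcomp Require Import all_boot all_order all_algebra.
From mathcomp Require Import all_classical all_reals all_analysis.
Import Order.TTheory GRing.Theory Num.Theory numFieldNormedType.Exports.

Set Implicit Arguments.
Unset Strict Implicit.
Unset Printing Implicit Defensive.

Local Open Scope classical_set_scope.
Local Open Scope ring_scope.

Section Defs.
Variable R : realType.

Definition Cx := (R * R)%type.
Definition C2 := (Cx * Cx)%type.

Definition cmul (a b : Cx) : Cx := (a.1 * b.1 - a.2 * b.2, a.1 * b.2 + a.2 * b.1).
Definition cconj (a : Cx) : Cx := (a.1, - a.2).
Definition cnorm2 (a : Cx) : R := a.1 ^+ 2 + a.2 ^+ 2.
Definition cabs (a : Cx) : R := Num.sqrt (cnorm2 a).
Definition cI : Cx := (0, 1).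
Definition cpow (a : Cx) (n : nat) : Cx := iter n (cmul a) (1, 0).
Definition cscale (c : Cx) (v : C2) : C2 := (cmul c v.1, cmul c v.2).

Definition holomorphic_on (W : set C2) (f : C2 -> Cx) : Prop :=
  forall p, W p -> differentiable f p /\
    forall h : C2, 'd f p (cscale cI h) = cmul cI ('d f p h).

Definition leb4 : set C2 -> \bar R :=
  ((@lebesgue_measure R \x @lebesgue_measure R) \x
   (@lebesgue_measure R \x @lebesgue_measure R))%E.

Definition A2 (W : set C2) (f : C2 -> Cx) : Prop :=
  holomorphic_on W f /\ leb4.-integrable W (fun z => (cnorm2 (f z))%:E).

Definition ip_re (W : set C2) (f g : C2 -> Cx) : \bar R :=
  (\int[leb4]_(z in W) ((f z).1 * (g z).1 + (f z).2 * (g z).2)%:E)%E.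
Definition ip_im (W : set C2) (f g : C2 -> Cx) : \bar R :=
  (\int[leb4]_(z in W) ((f z).2 * (g z).1 - (f z).1 * (g z).2)%:E)%E.

Definition ONB (W : set C2) (J : set nat) (phi : nat -> C2 -> Cx) : Prop :=
  (forall j, J j -> A2 W (phi j)) /\
  (forall j k, J j -> J k ->
     ip_re W (phi j) (phi k) = (if j == k then 1 else 0)%:E /\
     ip_im W (phi j) (phi k) = 0%E) /\
  (forall f, A2 W f ->
     (forall j, J j -> ip_re W f (phi j) = 0%E /\ ip_im W f (phi j) = 0%E) ->
     forall z, W z -> f z = (0, 0)).

Definition bergman_diag (W : set C2) (J : set nat) (phi : nat -> C2 -> Cx)
  (z : C2) : \bar R :=
  (\sum_(j <oo | j \in J) (cnorm2 (phi j z))%:E)%E.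

Definition ex (j : nat) : C2 := if j == 0%N then ((1, 0), (0, 0)) else ((0, 0), (1, 0)).
Definition ey (j : nat) : C2 := if j == 0%N then ((0, 1), (0, 0)) else ((0, 0), (0, 1)).
Definition vc (v : C2) (j : nat) : Cx := if j == 0%N then v.1 else v.2.

(* d_j dbar_k u (z) = 1/4 (d_{x_j} - i d_{y_j}) (d_{x_k} + i d_{y_k}) u (z) *)
Definition ddbar (u : C2 -> R) (z : C2) (j k : nat) : Cx :=
  ((1 / 4) * ('D_(ex j) ('D_(ex k) u) z + 'D_(ey j) ('D_(ey k) u) z),
   (1 / 4) * ('D_(ex j) ('D_(ey k) u) z - 'D_(ey j) ('D_(ex k) u) z)).

Definition levi (u : C2 -> R) (z v : C2) : R :=
  \sum_(j < 2) \sum_(k < 2)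
     (cmul (ddbar u z j k) (cmul (vc v j) (cconj (vc v k)))).1.

Definition bergman_pot W J phi (z : C2) : R := ln (fine (bergman_diag W J phi z)).
Definition bergman_length W J phi (z v : C2) : R :=
  Num.sqrt (levi (bergman_pot W J phi) z v).

Definition cara_metric (W : set C2) (p v : C2) : \bar R :=
  ereal_sup [set (cabs ('d f p v))%:E | f in
    [set f | holomorphic_on W f /\ (forall z, W z -> cnorm2 (f z) < 1) /\ f p = (0, 0)]].

Definition pw_C1_curve (W : set C2) (g : R -> C2) (p q : C2) : Prop :=
  g 0 = p /\ g 1 = q /\ (forall t, 0 <= t <= 1 -> W (g t)) /\
  exists (n : nat) (s : nat -> R),
    s 0%N = 0 /\ s n = 1 /\ (forall i, (i < n)%N -> s i < s i.+1) /\
    forall i, (i < n)%N -> exists h : R -> C2,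
      (forall t, derivable h t 1) /\ continuous ('D_1 h) /\
      (forall t, s i <= t <= s i.+1 -> h t = g t).

Definition curve_length (F : C2 -> C2 -> \bar R) (g : R -> C2) : \bar R :=
  (\int[@lebesgue_measure R]_(t in [set t : R | (0 <= t <= 1)%R]) F (g t) ('D_1 g t))%E.

Definition int_dist (W : set C2) (F : C2 -> C2 -> \bar R) (p q : C2) : \bar R :=
  ereal_inf [set curve_length F g | g in [set g | pw_C1_curve W g p q]].

Definition complete_dist (W : set C2) (d : C2 -> C2 -> \bar R) : Prop :=
  forall x : nat -> C2, (forall n, W (x n)) ->
   (forall e : R, 0 < e -> exists N : nat, forall m n, (N <= m)%N -> (N <= n)%N ->
        (d (x m) (x n) < e%:E)%E) ->
   exists y, W y /\ (fun n => d (x n) y) @ \oo --> 0%E.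

Definition bergman_positive (W : set C2) : Prop :=
  forall J phi, ONB W J phi -> forall z, W z ->
    (0 < bergman_diag W J phi z < +oo)%E /\
    forall v : C2, v != 0 -> 0 < bergman_length W J phi z v.

Definition bergman_complete (W : set C2) : Prop :=
  forall J phi, ONB W J phi ->
    complete_dist W (int_dist W (fun z v => (bergman_length W J phi z v)%:E)).

Definition cara_positive (W : set C2) : Prop :=
  forall p, W p -> forall v : C2, v != 0 -> (0 < cara_metric W p v)%E.

Definition cara_complete (W : set C2) : Prop :=
  complete_dist W (int_dist W (cara_metric W)).

Definition W_KN : set C2 :=
  [set z | (z.2).1 + cnorm2 z.1 * cnorm2 z.2 + cnorm2 z.1 ^+ 4
           + (15 / 7) * cnorm2 z.1 * (cpow z.1 6).1 < 0].

Definition W_For (t : R) : set C2 :=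
  [set z | (z.2).1 + cnorm2 z.1 * cnorm2 z.2 + cnorm2 z.1 ^+ 3
           + t * cnorm2 z.1 * (cpow z.1 4).1 < 0].

End Defs.

(* Main.v *)
(* Write zeta = z1, T = |zeta|^2, mu = zeta^(2m), with m = 3 for W_KN and m = 2
   for W_For. For a boundary point q put a0 = q1 q2; completing the square,
   v = - (z2 + 2 conj(a0) z1 z2 - |a0|^2) satisfies Re v > T^(m+1) + b T Re mu
   on the domain, with equality at q. The equation rho Y^(m+1) + a mu Y = v then
   has exactly one root Y with Re Y > 0 and Re Y^m > |mu|: by scaling, existence
   and uniqueness reduce to one-variable polynomial inequalities. Y is
   holomorphic, and functions of positive real part tending to 0 at a boundary
   point, or to infinity at infinity, are built from it: Y itself at infinity,
   Y(z1, v + i beta) at boundary points with q1 = 0, and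
   sqrt(1 - (zeta^2 / Y) (Y0 / q1^2)) otherwise.

   If F is such a function, (ln Re F) / 2 is 1-Lipschitz for the Caratheodory
   metric, so a Cauchy sequence stays in a compact subset of the domain. There
   the bounded functions f0 = Y(z1, 1 - z2)^(-N), f0 z1 and f0 z2 separate points
   and bound the metric below. The Bergman length dominates the
   Caratheodory length. The theory of the Bergman kernel rests on Cauchy's
   theorem for squares: the L2 norm controls point values, the A2 space is
   complete, hence Parseval's identity, and the log of the kernel can be
   differentiated termwise. *)
Require Import Defs.
From HB Require Import structures.
From mathcomp Require Import all_boot all_order all_algebra.
From mathcomp Require Import complex.
From mathcomp Require Import all_classical all_reals all_analysis.
From mathcomp Require Import measurable_realfun.
From mathcomp Require Import ring lra zify.
Import Order.TTheory GRing.Theory Num.Theory numFieldNormedType.Exports.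
Set Implicit Arguments. Unset Strict Implicit. Unset Printing Implicit Defensive.
Local Open Scope classical_set_scope.
Local Open Scope ring_scope.

(* [lra] reifies the whole context: discarding what is not an order fact first
   makes it an order of magnitude faster in large contexts. *)
Ltac order_lra :=
  repeat match goal with H : ?T |- _ =>
    lazymatch type of T with Prop =>
      lazymatch T with
      | is_true (Order.le _ _) => fail
      | is_true (Order.lt _ _) => fail
      | is_true (_ && _) => fail
      | _ = _ => fail
      | _ \/ _ => fail
      | _ => clear H
      end
    end
  end; lra.

(** * Integrals of continuous functions over intervals and around rectangles *)

Section RealIntegral.
Variable R : realType.
Implicit Types (f g : R -> R) (a b c d : R).
Local Notation leb := (@lebesgue_measure R).

(** The obstacle sits at the origin: [W_KN] is made so that any holomorphic function vanishing there
    has zeros inside the domain, hence no barrier comes from a function holomorphic across the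
    boundary. The root of the trinomial escapes this by branching at the origin. Everything is
    weighted homogeneous: scaling [T], [mu], [v] by [l], [l^m], [l^(m+1)] scales [Y] by [l], so each
    estimate is one for [T = 1] or [T = 0]. Two demands fix the coefficients. A root must not cross
    the curve [Re Y^m = T^m] while [Re v >= T^(m+1) + b T Re mu]; at [Y = T] this already asks for
    [rho + |a - b| < 1]. The derivative [(m+1) rho Y^m + a mu] must not vanish although
    [|mu| = T^m], which asks for [a <= (m+1) rho]. For [W_KN] the latter is an equality, for [W_For]
    it becomes one at [t = 9/5]. At boundary points with [q1 <> 0] the quotient [zeta^2 / Y] has
    weight zero, so that the slit condition for the square root is a statement on rotating and
    shrinking one fixed root. The metric side only sees half-plane valued and bounded functions, so
    both metrics are handled by one argument. *)

Definition rint f a b : R := \int[leb]_(x in `[a, b]) f x.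

(** Continuity is two-sided even at the end points: the integrands extend past the segment, and this
    form passes to subintervals and slices without subspace topologies. *)
Definition ccont f a b := forall x, a <= x <= b -> {for x, continuous f}.

Lemma ccont_within f a b : ccont f a b -> {within `[a, b], continuous f}.
Proof.
move=> h; apply: continuous_in_subspaceT => x; rewrite inE /= in_itv /= => hx.
exact: h.
Qed.

Lemma ccont_integrable f a b : ccont f a b ->
  leb.-integrable `[a, b] (EFin \o f).
Proof.
move=> h; apply: continuous_compact_integrable; first exact: segment_compact.
exact: ccont_within.
Qed.

Lemma ccont_sub f a b a' b' : a <= a' -> b' <= b -> ccont f a b -> ccont f a' b'.
Proof. move=> h1 h2 h x /andP[x1 x2]; apply: h; lra. Qed.

Lemma rintD f g a b : ccont f a b -> ccont g a b ->
  rint (fun x => f x + g x) a b = rint f a b + rint g a b.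
Proof. by move=> hf hg; rewrite /rint RintegralD //; exact: ccont_integrable. Qed.

Lemma rintZ f r a b : ccont f a b ->
  rint (fun x => r * f x) a b = r * rint f a b.
Proof. by move=> hf; rewrite /rint RintegralZl //; exact: ccont_integrable. Qed.

Lemma ccontZ f r a b : ccont f a b -> ccont (fun x => r * f x) a b.
Proof. by move=> hf x hx; apply: continuousM; [exact: cst_continuous|exact: hf]. Qed.

Lemma eq_rint f g a b : (forall x, a <= x <= b -> f x = g x) ->
  rint f a b = rint g a b.
Proof.
move=> h; apply: eq_Rintegral => x; rewrite inE /= in_itv /= => hx; exact: h.
Qed.

Lemma rint_split f a m b : a <= m -> m <= b -> ccont f a b ->
  rint f a b = rint f a m + rint f m b.
Proof.
move=> am mb hf; rewrite /rint.
have := @Rintegral_itvB R f (BLeft a) (BRight b) m (ccont_integrable hf).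
rewrite !bnd_simp => /(_ am mb) h.
have hm : ccont f m b by apply: ccont_sub hf.
rewrite -[X in _ = _ + X]Rintegral_itv_obnd_cbnd; first by rewrite -h; ring.
apply: integrableS (ccont_integrable hm) => //.
by apply: subset_itvr; rewrite bnd_simp.
Qed.

Lemma rint_le f g a b : ccont f a b -> ccont g a b ->
  (forall x, a <= x <= b -> f x <= g x) -> rint f a b <= rint g a b.
Proof.
move=> hf hg h; apply: le_Rintegral => //; try exact: ccont_integrable.
Qed.

Lemma rint_cst r a b : a <= b -> rint (cst r) a b = r * (b - a).
Proof.
move=> ab; rewrite /rint Rintegral_cst; last exact: measurable_itv.
have e : leb `[a, b] = (b - a)%:E.
  rewrite lebesgue_measure_itv /= lte_fin.
  by case: ltP => h //=; have -> : b = a; [lra|rewrite subrr].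
by congr (_ * _); exact: (congr1 fine e).
Qed.

Lemma ccont_cst r a b : ccont (fun=> r) a b.
Proof. by move=> x _; exact: cst_continuous. Qed.

Lemma rint_bound f M a b : a <= b -> ccont f a b ->
  (forall x, a <= x <= b -> `|f x| <= M) -> `|rint f a b| <= M * (b - a).
Proof.
move=> ab hf h; rewrite ler_norml; apply/andP; split.
- rewrite -mulNr -rint_cst //; apply: rint_le => //; first exact: ccont_cst.
  by move=> x hx /=; have := h x hx; rewrite ler_norml => /andP[].
- rewrite -rint_cst //; apply: rint_le => //; first exact: ccont_cst.
  by move=> x hx /=; have := h x hx; rewrite ler_norml => /andP[].
Qed.

Lemma ccont_id a b : ccont (fun x => x) a b.
Proof. by move=> x _; exact: cvg_id. Qed.

Lemma rint_id a b : a <= b -> rint (fun x => x) a b = (b ^+ 2 - a ^+ 2) / 2.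
Proof.
rewrite le_eqVlt => /orP[/eqP -> | ab].
  by rewrite /rint set_itv1 Rintegral_set1 subrr mul0r.
pose F (x : R) := x ^+ 2 / 2.
have dF (x : R) : is_derive x 1 F x.
  by apply: is_derive_eq; rewrite /GRing.scale /=; lra.
rewrite /rint /Rintegral (@continuous_FTC2 _ _ F) //=.
- by rewrite /F; lra.
- by apply: ccont_within; exact: ccont_id.
- split.
  + by move=> x _; exact: ex_derive.
  + apply: cvg_at_right_filter; apply: differentiable_continuous.
    by apply/derivable1_diffP; exact: ex_derive.
  + apply: cvg_at_left_filter; apply: differentiable_continuous.
    by apply/derivable1_diffP; exact: ex_derive.
- by move=> x _; rewrite derive1E; apply: derive_val.
Qed.

(** The integral of the form [u dx + v dy] around a rectangle, counterclockwise. *)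
Definition rloop (u v : R * R -> R) a b c d : R :=
  rint (fun x => u (x, c)) a b - rint (fun x => u (x, d)) a b
  + (rint (fun y => v (b, y)) c d - rint (fun y => v (a, y)) c d).

Definition rcont (u : R * R -> R) a b c d :=
  forall x y, a <= x <= b -> c <= y <= d -> {for (x, y), continuous u}.

Lemma rcont_h u a b c d y : rcont u a b c d -> c <= y <= d ->
  ccont (fun x => u (x, y)) a b.
Proof.
move=> h hy x hx.
apply: (@continuous_comp _ _ _ (fun x => (x, y)) u); last exact: h.
exact: (cvg_pair (@cvg_id _ _) (@cvg_cst _ _ _ _ _)).
Qed.

Lemma rcont_v u a b c d x : rcont u a b c d -> a <= x <= b ->
  ccont (fun y => u (x, y)) c d.
Proof.
move=> h hx y hy.
apply: (@continuous_comp _ _ _ (fun y => (x, y)) u); last exact: h.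
exact: (cvg_pair (@cvg_cst _ _ _ _ _) (@cvg_id _ _)).
Qed.

Lemma rcont_sub u a b c d a' b' c' d' :
  a <= a' -> b' <= b -> c <= c' -> d' <= d -> rcont u a b c d -> rcont u a' b' c' d'.
Proof. by move=> h1 h2 h3 h4 h x y /andP[? ?] /andP[? ?]; apply: h; lra. Qed.

Lemma rcontD u v a b c d : rcont u a b c d -> rcont v a b c d ->
  rcont (fun z => u z + v z) a b c d.
Proof. by move=> hu hv x y hx hy; apply: continuousD; [exact: hu|exact: hv]. Qed.

Lemma rloop_splith u v a m b c d : a <= m -> m <= b -> c <= d ->
  ccont (fun x => u (x, c)) a b -> ccont (fun x => u (x, d)) a b ->
  rloop u v a b c d = rloop u v a m c d + rloop u v m b c d.
Proof.
move=> am mb cd hc hd; rewrite /rloop.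
by rewrite (rint_split am mb hc) (rint_split am mb hd); ring.
Qed.

Lemma rloop_splitv u v a b c m d : c <= m -> m <= d -> a <= b ->
  ccont (fun y => v (a, y)) c d -> ccont (fun y => v (b, y)) c d ->
  rloop u v a b c d = rloop u v a b c m + rloop u v a b m d.
Proof.
move=> cm md ab ha hb; rewrite /rloop.
by rewrite (rint_split cm md ha) (rint_split cm md hb); ring.
Qed.

Lemma rloop_bound u v M a b c d : a <= b -> c <= d ->
  rcont u a b c d -> rcont v a b c d ->
  (forall x y, a <= x <= b -> c <= y <= d ->
     `|u (x, y)| <= M /\ `|v (x, y)| <= M) ->
  `|rloop u v a b c d| <= 2 * M * ((b - a) + (d - c)).
Proof.
move=> ab cd hu hv h.
have ha : a <= a <= b by lra.
have hb : a <= b <= b by lra.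
have hc : c <= c <= d by lra.
have hd : c <= d <= d by lra.
have h1 := rint_bound ab (rcont_h hu hc) (fun x hx => (h x c hx hc).1).
have h2 := rint_bound ab (rcont_h hu hd) (fun x hx => (h x d hx hd).1).
have h3 := rint_bound cd (rcont_v hv ha) (fun y hy => (h a y ha hy).2).
have h4 := rint_bound cd (rcont_v hv hb) (fun y hy => (h b y hb hy).2).
rewrite /rloop; move: h1 h2 h3 h4; rewrite !ler_norml.
by move=> /andP[? ?] /andP[? ?] /andP[? ?] /andP[? ?]; lra.
Qed.

Lemma rloopD u v u' v' a b c d : a <= b -> c <= d ->
  rcont u a b c d -> rcont v a b c d -> rcont u' a b c d -> rcont v' a b c d ->
  rloop (fun z => u z + u' z) (fun z => v z + v' z) a b c d
  = rloop u v a b c d + rloop u' v' a b c d.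
Proof.
move=> ab cd hu hv hu' hv'.
have ha : a <= a <= b by lra.
have hb : a <= b <= b by lra.
have hc : c <= c <= d by lra.
have hd : c <= d <= d by lra.
rewrite /rloop (rintD (rcont_h hu hc) (rcont_h hu' hc)).
rewrite (rintD (rcont_h hu hd) (rcont_h hu' hd)).
rewrite (rintD (rcont_v hv ha) (rcont_v hv' ha)).
rewrite (rintD (rcont_v hv hb) (rcont_v hv' hb)).
ring.
Qed.

Lemma rint_affine a b r s : a <= b ->
  rint (fun x => r + s * x) a b = r * (b - a) + s * ((b ^+ 2 - a ^+ 2) / 2).
Proof.
move=> ab; rewrite rintD; last 2 first.
- exact: ccont_cst.
- by apply: ccontZ; exact: ccont_id.
rewrite rintZ; last exact: ccont_id.
by rewrite rint_id // rint_cst.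
Qed.

(** The coefficient [B] occurs in both components: the form is closed, hence exact on the plane,
    with a quadratic primitive. *)
Lemma rloop_affine a b c d u0 v0 A B D : a <= b -> c <= d ->
  rloop (fun z => u0 + A * z.1 + B * z.2) (fun z => v0 + B * z.1 + D * z.2) a b c d = 0.
Proof.
move=> ab cd; rewrite /rloop /=.
have e1 (y : R) : rint (fun x => u0 + A * x + B * y) a b =
   (u0 + B * y) * (b - a) + A * ((b ^+ 2 - a ^+ 2) / 2).
  by rewrite -rint_affine //; apply: eq_rint => x _; ring.
by rewrite !e1 !rint_affine //; field.
Qed.

End RealIntegral.

(** * Goursat's theorem for rectangles, by bisection *)

Section Goursat.
Variable R : realType.
Implicit Types (u v : R * R -> R).

Definition fdiff u (p : R * R) (A B : R) := forall e : R, 0 < e -> exists2 dl : R, 0 < dl &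
  forall x y : R, `|x - p.1| < dl -> `|y - p.2| < dl ->
  `|u (x, y) - u p - A * (x - p.1) - B * (y - p.2)| <= e * (`|x - p.1| + `|y - p.2|).

Lemma affine_rcont (r A B a b c d : R) : rcont (fun z => r + A * z.1 + B * z.2) a b c d.
Proof.
move=> x y _ _; apply: continuousD.
  apply: continuousD; first exact: cst_continuous.
  by apply: continuousM; [exact: cst_continuous|exact: cvg_fst].
by apply: continuousM; [exact: cst_continuous|exact: cvg_snd].
Qed.

Lemma rcontN u a b c d : rcont u a b c d -> rcont (fun z => - u z) a b c d.
Proof. by move=> hu x y hx hy; apply: continuousN; exact: hu. Qed.

Lemma half_step (p q w w' : R) : 0 <= w' -> w = w' + w' ->
  q = p \/ q = p + w' -> p <= q /\ q + w' <= p + w.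
Proof. by move=> w0 -> [->|->]; split; lra. Qed.

Lemma quarter_max (t t1 t2 t3 t4 : R) : t <= t1 + t2 + t3 + t4 ->
  4 * t1 < t -> 4 * t2 < t -> 4 * t3 < t -> t <= 4 * t4.
Proof. lra. Qed.

Lemma eq_rloop u u' v v' (a b c d : R) : u =1 u' -> v =1 v' ->
  rloop u v a b c d = rloop u' v' a b c d.
Proof. by move=> /funext -> /funext ->. Qed.

Lemma rloop_quarter u v (x y w h : R) : 0 <= w -> 0 <= h ->
  rcont u x (x + w + w) y (y + h + h) -> rcont v x (x + w + w) y (y + h + h) ->
  rloop u v x (x + w + w) y (y + h + h) =
  rloop u v x (x + w) y (y + h) + rloop u v (x + w) (x + w + w) y (y + h)
  + rloop u v x (x + w) (y + h) (y + h + h)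
  + rloop u v (x + w) (x + w + w) (y + h) (y + h + h).
Proof.
move=> w0 h0 hu hv.
have uh t : y <= t <= y + h + h -> ccont (fun x => u (x, t)) x (x + w + w).
  exact: rcont_h hu.
have vv s : x <= s <= x + w + w -> ccont (fun y => v (s, y)) y (y + h + h).
  exact: rcont_v hv.
have X1 : x <= x + w by rewrite lerDl.
have X2 : x + w <= x + w + w by rewrite lerDl.
have Y1 : y <= y + h by rewrite lerDl.
have Y2 : y + h <= y + h + h by rewrite lerDl.
have X3 := le_trans X1 X2; have Y3 := le_trans Y1 Y2.
rewrite (rloop_splitv u Y1 Y2 X3); try by apply: vv; rewrite ?X3 ?lexx.
rewrite (rloop_splith v X1 X2 Y1); try by apply: uh; rewrite ?Y1 ?Y2 ?Y3 ?lexx.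
rewrite (rloop_splith v X1 X2 Y2); try by apply: uh; rewrite ?Y1 ?Y2 ?Y3 ?lexx.
by rewrite !addrA; congr (_ + _); rewrite -!addrA; congr (_ + _).
Qed.

(* The affine part of a differentiable form is exact up to a closed remainder,
   so only the remainder contributes to the integral. *)
Lemma rloop_fdiff u v (p q : R * R) (A B D e dl w h : R) :
  0 <= w -> 0 <= h -> w + h < dl -> 0 <= e ->
  q.1 <= p.1 <= q.1 + w -> q.2 <= p.2 <= q.2 + h ->
  rcont u q.1 (q.1 + w) q.2 (q.2 + h) -> rcont v q.1 (q.1 + w) q.2 (q.2 + h) ->
  (forall x y : R, `|x - p.1| < dl -> `|y - p.2| < dl ->
     `|u (x, y) - u p - A * (x - p.1) - B * (y - p.2)| <= e * (`|x - p.1| + `|y - p.2|)) ->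
  (forall x y : R, `|x - p.1| < dl -> `|y - p.2| < dl ->
     `|v (x, y) - v p - B * (x - p.1) - D * (y - p.2)| <= e * (`|x - p.1| + `|y - p.2|)) ->
  `|rloop u v q.1 (q.1 + w) q.2 (q.2 + h)| <= 2 * e * (w + h) ^+ 2.
Proof.
move=> w0 h0 whd e0 hp1 hp2 hu hv du dv.
have qa : q.1 <= q.1 + w by rewrite lerDl.
have qc : q.2 <= q.2 + h by rewrite lerDl.
pose au (z : R * R) := (u p - A * p.1 - B * p.2) + A * z.1 + B * z.2.
pose av (z : R * R) := (v p - B * p.1 - D * p.2) + B * z.1 + D * z.2.
have cau a b c d : rcont (fun z => - au z) a b c d by apply: rcontN; exact: affine_rcont.
have cav a b c d : rcont (fun z => - av z) a b c d by apply: rcontN; exact: affine_rcont.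
have eJ : rloop u v q.1 (q.1 + w) q.2 (q.2 + h) =
    rloop (fun z => u z - au z) (fun z => v z - av z) q.1 (q.1 + w) q.2 (q.2 + h).
  have ha : rloop au av q.1 (q.1 + w) q.2 (q.2 + h) = 0 by exact: rloop_affine.
  rewrite -[RHS]addr0 -ha -(rloopD qa qc (rcontD hu (cau _ _ _ _)) (rcontD hv (cav _ _ _ _))); try exact: affine_rcont.
  by apply: eq_rloop => z; rewrite subrK.
have -> : 2 * e * (w + h) ^+ 2 = 2 * (e * (w + h)) * ((q.1 + w - q.1) + (q.2 + h - q.2)).
  by rewrite ![_ + _ - _]addrAC !subrr !add0r expr2 !mulrA.
rewrite eJ; apply: (rloop_bound qa qc (rcontD hu (cau _ _ _ _)) (rcontD hv (cav _ _ _ _))).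
move=> x y hx hy.
have x1 : `|x - p.1| <= w by rewrite ler_norml; clear -hp1 hp2 hx hy; lra.
have y1 : `|y - p.2| <= h by rewrite ler_norml; clear -hp1 hp2 hx hy; lra.
have x2 : `|x - p.1| < dl by apply: le_lt_trans whd; rewrite (le_trans x1) // lerDl.
have y2 : `|y - p.2| < dl by apply: le_lt_trans whd; rewrite (le_trans y1) // lerDr.
have s1 : e * (`|x - p.1| + `|y - p.2|) <= e * (w + h) by rewrite ler_wpM2l // lerD.
split; apply: le_trans s1.
- apply: le_trans (du x y x2 y2); rewrite le_eqVlt; apply/orP; left; apply/eqP.
  by rewrite /au /=; congr (`|_|); ring.
- apply: le_trans (dv x y x2 y2); rewrite le_eqVlt; apply/orP; left; apply/eqP.
  by rewrite /av /=; congr (`|_|); ring.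
Qed.

Section Bisection.
Variables (u v : R * R -> R) (a b c d : R).
Hypotheses (ab : a <= b) (cd : c <= d).
Hypotheses (hu : rcont u a b c d) (hv : rcont v a b c d).

Definition width n := (b - a) / 2 ^+ n.
Definition height n := (d - c) / 2 ^+ n.
Definition cell n (p : R * R) := rloop u v p.1 (p.1 + width n) p.2 (p.2 + height n).
(** Keeps the first quarter that carries at least a fourth of the loop integral; if the first three
    fail, the last one must, because the four integrals add up to the whole. *)
Definition next_corner n (p : R * R) : R * R :=
  let w' := width n.+1 in let h' := height n.+1 in
  if `|cell n p| <= 4 * `|cell n.+1 p| then p else
  if `|cell n p| <= 4 * `|cell n.+1 (p.1 + w', p.2)| then (p.1 + w', p.2) else
  if `|cell n p| <= 4 * `|cell n.+1 (p.1, p.2 + h')| then (p.1, p.2 + h') else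
  (p.1 + w', p.2 + h').
Fixpoint corner n : R * R := if n is m.+1 then next_corner m (corner m) else (a, c).

Lemma width_ge0 n : 0 <= width n.
Proof. by rewrite /width divr_ge0 ?subr_ge0 // exprn_ge0. Qed.
Lemma height_ge0 n : 0 <= height n.
Proof. by rewrite /height divr_ge0 ?subr_ge0 // exprn_ge0. Qed.
Lemma widthS n : width n = width n.+1 + width n.+1.
Proof. by rewrite /width exprS; field; rewrite expf_neq0. Qed.
Lemma heightS n : height n = height n.+1 + height n.+1.
Proof. by rewrite /height exprS; field; rewrite expf_neq0. Qed.

Lemma corner_step n (p := corner n) (q := corner n.+1) :
  (q.1 = p.1 \/ q.1 = p.1 + width n.+1) /\ (q.2 = p.2 \/ q.2 = p.2 + height n.+1).
Proof.
rewrite /q /= /next_corner -/p; repeat case: ifP => _ /=; split; by [left|right].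
Qed.

Lemma corner_in n (p := corner n) :
  [/\ a <= p.1, p.1 + width n <= b, c <= p.2 & p.2 + height n <= d].
Proof.
elim: n @p => [|n]; rewrite /=; first by rewrite /width /height expr0 !divr1; split; lra.
have [H1 H2] := corner_step n; move=> /= in H1 H2 *; move=> [i1 i2 i3 i4].
have [s1 s2] := half_step (width_ge0 n.+1) (widthS n) H1.
have [s3 s4] := half_step (height_ge0 n.+1) (heightS n) H2.
by split; [exact: le_trans s1|exact: le_trans i2|exact: le_trans s3|exact: le_trans i4].
Qed.

Lemma cell_split n (p := corner n) (w' := width n.+1) (h' := height n.+1) :
  cell n p = cell n.+1 p + cell n.+1 (p.1 + w', p.2) + cell n.+1 (p.1, p.2 + h')
          + cell n.+1 (p.1 + w', p.2 + h').
Proof.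
have [i1 i2 i3 i4] := corner_in n; rewrite -/p in i1 i2 i3 i4.
rewrite (widthS n) (heightS n) !(addrA p.1) !(addrA p.2) -/w' -/h' in i2 i4.
rewrite /cell (widthS n) (heightS n) /= -/w' -/h' !(addrA p.1) !(addrA p.2).
by apply: rloop_quarter; rewrite ?width_ge0 ?height_ge0 //; [apply: rcont_sub hu|apply: rcont_sub hv].
Qed.

Lemma cell_corner n : `|cell n (corner n)| <= 4 * `|cell n.+1 (corner n.+1)|.
Proof.
rewrite [corner n.+1]/= /next_corner.
case: ifPn => // /negP c1; case: ifPn => // /negP c2; case: ifPn => // /negP c3.
move: (cell_split n) c1 c2 c3; cbv zeta.
set t := cell n _; set t1 := cell _ _; set t2 := cell _ _; set t3 := cell _ _; set t4 := cell _ _.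
move=> e /negP; rewrite -ltNge => c1 /negP; rewrite -ltNge => c2 /negP; rewrite -ltNge => c3.
apply: (quarter_max _ c1 c2 c3).
rewrite e; apply: (le_trans (ler_normD _ _)); rewrite lerD2r.
by apply: (le_trans (ler_normD _ _)); rewrite lerD2r ler_normD.
Qed.

Lemma cell_iter n : `|cell 0 (a, c)| <= 4 ^+ n * `|cell n (corner n)|.
Proof.
elim: n => [|n IH]; first by rewrite expr0 mul1r.
apply: (le_trans IH); rewrite exprSr -mulrA ler_wpM2l ?exprn_ge0 //.
exact: cell_corner.
Qed.

Lemma corner_mono m n : (m <= n)%N ->
  [/\ (corner m).1 <= (corner n).1, (corner n).1 + width n <= (corner m).1 + width m,
      (corner m).2 <= (corner n).2 & (corner n).2 + height n <= (corner m).2 + height m].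
Proof.
elim: n => [|n IH]; first by rewrite leqn0 => /eqP ->.
rewrite leq_eqVlt => /orP[/eqP -> //|]; rewrite ltnS => /IH [i1 i2 i3 i4].
have [H1 H2] := corner_step n.
have [s1 s2] := half_step (width_ge0 n.+1) (widthS n) H1.
have [s3 s4] := half_step (height_ge0 n.+1) (heightS n) H2.
by split; [exact: le_trans s1|exact: le_trans i2|exact: le_trans s3|exact: le_trans i4].
Qed.

Lemma corner_lim : exists p : R * R, forall n,
  (corner n).1 <= p.1 <= (corner n).1 + width n /\ (corner n).2 <= p.2 <= (corner n).2 + height n.
Proof.
exists (sup (range (fun n => (corner n).1)), sup (range (fun n => (corner n).2))) => n /=.
split; apply/andP; split.
- apply: ub_le_sup; last by exists n.
  by exists b => _ [m _ <-]; have [] := corner_in m; have := width_ge0 m; lra.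
- apply: ge_sup; first by exists (corner n).1, n.
  move=> _ [m _ <-]; case/orP: (leq_total m n) => mn; have [] := corner_mono mn;
  have := width_ge0 m; have := width_ge0 n; lra.
- apply: ub_le_sup; last by exists n.
  by exists d => _ [m _ <-]; have [] := corner_in m; have := height_ge0 m; lra.
- apply: ge_sup; first by exists (corner n).2, n.
  move=> _ [m _ <-]; case/orP: (leq_total m n) => mn; have [] := corner_mono mn;
  have := height_ge0 m; have := height_ge0 n; lra.
Qed.

Lemma pow2_small (t e : R) : 0 < e -> exists n, t / 2 ^+ n < e.
Proof.
move=> e0; pose n := Num.truncn (`|t| / e); exists n.+1.
rewrite ltr_pdivrMr ?exprn_gt0 //.
have h1 : `|t| / e < n.+1%:R by apply: truncnS_gt.
have h2 : (n.+1%:R : R) <= 2 ^+ n.+1 by rewrite -natrX ler_nat ltnW // ltn_expl.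
have h3 : `|t| < e * 2 ^+ n.+1.
  by rewrite ltr_pdivrMr // mulrC in h1; apply: (lt_le_trans h1); rewrite ler_pM2l.
by apply: le_lt_trans h3; exact: ler_norm.
Qed.

Lemma goursat : (forall x y, a <= x <= b -> c <= y <= d ->
   exists A B D, fdiff u (x, y) A B /\ fdiff v (x, y) B D) ->
  rloop u v a b c d = 0.
Proof.
move=> hd.
have e0 : rloop u v a b c d = cell 0 (a, c).
  by rewrite /cell /width /height expr0 !divr1 /= !subrKC.
have [p hp] := corner_lim.
have [p1 p2] := hp 0%N.
move: p1 p2; rewrite /= /width /height expr0 !divr1 => p1 p2.
have r1 : a <= p.1 <= b by lra.
have r2 : c <= p.2 <= d by lra.
have [A [B [D [du dv]]]] := hd p.1 p.2 r1 r2.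
suff hle (e : R) : 0 < e -> `|cell 0 (a, c)| <= 4 * e * ((b - a) + (d - c)) ^+ 2.
  rewrite e0; apply/eqP; rewrite -normr_le0; apply/ler_addgt0Pl => e eg.
  set K := 4 * ((b - a) + (d - c)) ^+ 2.
  have K0 : 0 <= K by rewrite /K mulr_ge0 // sqr_ge0.
  have := hle (e / (K + 1)); rewrite divr_gt0 //; last lra.
  move=> /(_ isT) h1; rewrite addr0; apply: (le_trans h1).
  have -> : 4 * (e / (K + 1)) * (b - a + (d - c)) ^+ 2 = e * (K / (K + 1)).
    by rewrite /K; field; rewrite -/K; lra.
  by rewrite -[leRHS]mulr1 ler_wpM2l ?(ltW eg) // ler_pdivrMr; lra.
move=> eg.
have [d1 d1g hd1] := du e eg; have [d2 d2g hd2] := dv e eg.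
(* A cell of this size lies where both affine approximations at [p] are accurate up to [e]. *)
have [n hn] : exists n, ((b - a) + (d - c)) / 2 ^+ n < Num.min d1 d2.
  by apply: pow2_small; rewrite lt_min d1g d2g.
have whn : width n + height n < Num.min d1 d2 by rewrite /width /height -mulrDl.
have [q1 q2] := hp n; have [i1 i2 i3 i4] := corner_in n.
apply: (le_trans (cell_iter n)).
apply: (@le_trans _ _ (4 ^+ n * (2 * e * (width n + height n) ^+ 2))).
  rewrite ler_wpM2l ?exprn_ge0 //.
  apply: (rloop_fdiff (width_ge0 n) (height_ge0 n) whn (ltW eg) q1 q2).
  - exact: rcont_sub hu.
  - exact: rcont_sub hv.
  - by move=> x y; rewrite !lt_min => /andP[? _] /andP[? _]; have := hd1 x y; rewrite -surjective_pairing; exact.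
  - by move=> x y; rewrite !lt_min => /andP[_ ?] /andP[_ ?]; have := hd2 x y; rewrite -surjective_pairing; exact.
rewrite /width /height.
have -> : (4 : R) ^+ n = 2 ^+ n * 2 ^+ n by rewrite -exprMn -natrM.
have -> : 2 ^+ n * 2 ^+ n * (2 * e * ((b - a) / 2 ^+ n + (d - c) / 2 ^+ n) ^+ 2) =
   2 * e * (b - a + (d - c)) ^+ 2 by field; rewrite expf_neq0.
by rewrite ler_wpM2r ?sqr_ge0 // ler_wpM2r ?(ltW eg) // ler_nat.
Qed.

End Bisection.
End Goursat.

(** * Complex arithmetic on pairs of reals *)

Section ComplexPlane.
Variable R : realType.
Local Notation Cx := (Cx R).
Implicit Types a b c z w : Cx.

Lemma cx_eq (a b : R * R) : a.1 = b.1 -> a.2 = b.2 -> a = b.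
Proof. by case: a b => [? ?] [? ?] /= -> ->. Qed.

Lemma cx1D (a b : R * R) : (a + b).1 = a.1 + b.1. Proof. by []. Qed.
Lemma cx2D (a b : R * R) : (a + b).2 = a.2 + b.2. Proof. by []. Qed.
Lemma cx1N (a : R * R) : (- a).1 = - a.1. Proof. by []. Qed.
Lemma cx2N (a : R * R) : (- a).2 = - a.2. Proof. by []. Qed.
Lemma cx1_0 : (0 : R * R).1 = 0. Proof. by []. Qed.
Lemma cx2_0 : (0 : R * R).2 = 0. Proof. by []. Qed.
Lemma cmul1E a b : (cmul a b).1 = a.1 * b.1 - a.2 * b.2. Proof. by []. Qed.
Lemma cmul2E a b : (cmul a b).2 = a.1 * b.2 + a.2 * b.1. Proof. by []. Qed.
Definition cxE := (cx1D, cx2D, cx1N, cx2N, cx1_0, cx2_0, cmul1E, cmul2E).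

Definition cone : Cx := (1, 0).
Definition cinv a : Cx := (a.1 / cnorm2 a, - a.2 / cnorm2 a).
Definition creal (r : R) : Cx := (r, 0).

Lemma cmulC a b : cmul a b = cmul b a.
Proof. by apply: cx_eq; rewrite !cxE; ring. Qed.
Lemma cmulA a b c : cmul a (cmul b c) = cmul (cmul a b) c.
Proof. by apply: cx_eq; rewrite !cxE; ring. Qed.
Lemma cmulDl a b c : cmul (a + b) c = cmul a c + cmul b c.
Proof. by apply: cx_eq; rewrite !cxE; ring. Qed.
Lemma cmulDr a b c : cmul a (b + c) = cmul a b + cmul a c.
Proof. by apply: cx_eq; rewrite !cxE; ring. Qed.
Lemma cmulNl a b : cmul (- a) b = - cmul a b.
Proof. by apply: cx_eq; rewrite !cxE; ring. Qed.
Lemma cmulNr a b : cmul a (- b) = - cmul a b.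
Proof. by apply: cx_eq; rewrite !cxE; ring. Qed.
Lemma cmulBl a b c : cmul (a - b) c = cmul a c - cmul b c.
Proof. by rewrite cmulDl cmulNl. Qed.
Lemma cmulBr a b c : cmul a (b - c) = cmul a b - cmul a c.
Proof. by rewrite cmulDr cmulNr. Qed.
Lemma cmul1c a : cmul cone a = a.
Proof. by apply: cx_eq; rewrite !cxE /=; ring. Qed.
Lemma cmulc1 a : cmul a cone = a. Proof. by rewrite cmulC cmul1c. Qed.
Lemma cmul0c a : cmul 0 a = 0.
Proof. by apply: cx_eq; rewrite !cxE; ring. Qed.
Lemma cmulc0 a : cmul a 0 = 0. Proof. by rewrite cmulC cmul0c. Qed.

Lemma cnorm2_ge0 a : 0 <= cnorm2 a.
Proof. by rewrite /cnorm2 addr_ge0 ?sqr_ge0. Qed.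
Lemma cnorm2_eq0 a : (cnorm2 a == 0) = (a == 0).
Proof.
rewrite /cnorm2 paddr_eq0 ?sqr_ge0 // !sqrf_eq0.
by case: a => x y; rewrite /= xpair_eqE.
Qed.
Lemma cnorm2_gt0 a : (0 < cnorm2 a) = (a != 0).
Proof. by rewrite lt_def cnorm2_ge0 cnorm2_eq0 andbT. Qed.
Lemma cnorm2M a b : cnorm2 (cmul a b) = cnorm2 a * cnorm2 b.
Proof. by rewrite /cnorm2 !cxE; ring. Qed.
Lemma cnorm2_cabs a : cnorm2 a = cabs a ^+ 2.
Proof. by rewrite /cabs sqr_sqrtr // cnorm2_ge0. Qed.

Lemma cmulVc a : a != 0 -> cmul (cinv a) a = cone.
Proof.
rewrite -cnorm2_eq0 => a0; apply: cx_eq; rewrite !cxE /=.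
  have -> : a.1 / cnorm2 a * a.1 - - a.2 / cnorm2 a * a.2 = cnorm2 a / cnorm2 a.
    by rewrite [in cnorm2 a / _]/cnorm2; ring.
  by rewrite divff.
by ring.
Qed.
Lemma cmulcV a : a != 0 -> cmul a (cinv a) = cone.
Proof. by move=> a0; rewrite cmulC cmulVc. Qed.
Lemma cmulK a b : b != 0 -> cmul (cmul a b) (cinv b) = a.
Proof. by move=> b0; rewrite -cmulA cmulcV // cmulc1. Qed.
Lemma cmul_eq0 a b : (cmul a b == 0) = (a == 0) || (b == 0).
Proof. by rewrite -cnorm2_eq0 cnorm2M mulf_eq0 !cnorm2_eq0. Qed.
Lemma cmulI a b c : c != 0 -> cmul a c = cmul b c -> a = b.
Proof. by move=> c0 h; rewrite -(cmulK a c0) h cmulK. Qed.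
Lemma cabs_ge0 a : 0 <= cabs a. Proof. exact: sqrtr_ge0. Qed.
Lemma cabsM a b : cabs (cmul a b) = cabs a * cabs b.
Proof. by rewrite /cabs cnorm2M sqrtrM // cnorm2_ge0. Qed.
Lemma cabs_eq0 a : (cabs a == 0) = (a == 0).
Proof. by rewrite -cnorm2_eq0 cnorm2_cabs sqrf_eq0. Qed.
Lemma cabs_gt0 a : (0 < cabs a) = (a != 0).
Proof. by rewrite lt_def cabs_ge0 cabs_eq0 andbT. Qed.
Lemma cabs0 : cabs (0 : Cx) = 0.
Proof. by apply/eqP; rewrite cabs_eq0. Qed.
Lemma cabs1 : cabs cone = 1.
Proof. by rewrite /cabs /cnorm2 /= expr1n expr0n addr0 sqrtr1. Qed.
Lemma cabsV a : a != 0 -> cabs (cinv a) = (cabs a)^-1.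
Proof.
move=> a0; have := cabsM (cinv a) a; rewrite cmulVc // cabs1 => h.
by apply: (mulIf (x := cabs a)); rewrite ?cabs_eq0 // -h mulVf // cabs_eq0.
Qed.
Lemma cabsN a : cabs (- a) = cabs a.
Proof. by rewrite /cabs /cnorm2 !cxE !sqrrN. Qed.
Lemma cabs_distC a b : cabs (a - b) = cabs (b - a).
Proof. by rewrite -cabsN opprB. Qed.
Lemma creal_abs r : cabs (creal r) = `|r|.
Proof. by rewrite /cabs /cnorm2 /= expr0n addr0 sqrtr_sqr. Qed.

Lemma cabs_ge_re a : `|a.1| <= cabs a.
Proof.
by rewrite -ler_sqr ?nnegrE ?cabs_ge0 // -cnorm2_cabs /cnorm2 -normrX ger0_norm ?sqr_ge0 // lerDl sqr_ge0.
Qed.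
Lemma cabs_ge_im a : `|a.2| <= cabs a.
Proof.
by rewrite -ler_sqr ?nnegrE ?cabs_ge0 // -cnorm2_cabs /cnorm2 -normrX ger0_norm ?sqr_ge0 // lerDr sqr_ge0.
Qed.
Lemma cabs_le_sum a : cabs a <= `|a.1| + `|a.2|.
Proof.
rewrite -ler_sqr ?nnegrE ?cabs_ge0 ?addr_ge0 // -cnorm2_cabs /cnorm2.
rewrite sqrrD -[a.1 ^+ 2]real_normK ?num_real // -[a.2 ^+ 2]real_normK ?num_real //.
by have : 0 <= `|a.1| * `|a.2| := mulr_ge0 (normr_ge0 _) (normr_ge0 _); lra.
Qed.
(** The topology of [R * R] comes from the max norm, whereas only [cabs] is multiplicative.
    Estimates pass between the two at the cost of a factor 2. *)
Lemma cabs_ge_norm a : `|a| <= cabs a.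
Proof. by rewrite /Num.norm /= ge_max cabs_ge_re cabs_ge_im. Qed.
Lemma cabs_le_norm a : cabs a <= 2 * `|a|.
Proof.
apply: (le_trans (cabs_le_sum a)).
have : `|a.1| <= `|a| by rewrite {2}/Num.norm /= le_max lexx.
have : `|a.2| <= `|a| by rewrite {2}/Num.norm /= le_max lexx orbT.
lra.
Qed.
Lemma re_le_norm a : `|a.1| <= `|a|.
Proof. by rewrite {2}/Num.norm /= le_max lexx. Qed.
Lemma im_le_norm a : `|a.2| <= `|a|.
Proof. by rewrite {2}/Num.norm /= le_max lexx orbT. Qed.
Lemma cabsD a b : cabs (a + b) <= cabs a + cabs b.
Proof.
rewrite -ler_sqr ?nnegrE ?addr_ge0 ?cabs_ge0 // sqrrD -!cnorm2_cabs.
have h : a.1 * b.1 + a.2 * b.2 <= cabs a * cabs b.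
  rewrite -cabsM; apply: le_trans (ler_norm _) _.
  have -> : a.1 * b.1 + a.2 * b.2 = (cmul a (cconj b)).1 by rewrite !cxE /=; ring.
  have -> : cabs (cmul a b) = cabs (cmul a (cconj b)).
    by rewrite !cabsM; congr (_ * _); rewrite /cabs /cnorm2 /= sqrrN.
  exact: cabs_ge_re.
by move: h; rewrite /cnorm2 !cxE => h; lra.
Qed.
Lemma cabsB a b : cabs (a - b) <= cabs a + cabs b.
Proof. by rewrite -(cabsN b) cabsD. Qed.
Lemma cabs_sub a b : cabs a - cabs b <= cabs (a - b).
Proof. by have := cabsD (a - b) b; rewrite subrK; lra. Qed.

End ComplexPlane.

(** * Continuity of complex operations *)

Section ComplexContinuity.
Variable R : realType.
Local Notation Cx := (Cx R).
Variables (T : topologicalType).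
Implicit Types (f g : T -> Cx) (x : T).

Lemma cont_pair (U V : topologicalType) (f : T -> U) (g : T -> V) x :
  {for x, continuous f} -> {for x, continuous g} ->
  {for x, continuous (fun t => (f t, g t))}.
Proof. by move=> hf hg; exact: (cvg_pair hf hg). Qed.

Lemma cont_fst (U V : topologicalType) (f : T -> U * V) x :
  {for x, continuous f} -> {for x, continuous (fun t => (f t).1)}.
Proof. by move=> hf; apply: (continuous_comp hf); exact: cvg_fst. Qed.

Lemma cont_snd (U V : topologicalType) (f : T -> U * V) x :
  {for x, continuous f} -> {for x, continuous (fun t => (f t).2)}.
Proof. by move=> hf; apply: (continuous_comp hf); exact: cvg_snd. Qed.

Lemma cont_cmul f g x : {for x, continuous f} -> {for x, continuous g} ->
  {for x, continuous (fun t => cmul (f t) (g t))}.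
Proof.
move=> hf hg; rewrite /cmul.
have f1 := cont_fst hf; have f2 := cont_snd hf.
have g1 := cont_fst hg; have g2 := cont_snd hg.
apply: cont_pair.
  by apply: continuousB; apply: continuousM.
by apply: continuousD; apply: continuousM.
Qed.

Lemma cont_cnorm2 f x : {for x, continuous f} ->
  {for x, continuous (fun t => cnorm2 (f t))}.
Proof.
move=> hf; rewrite /cnorm2.
have f1 := cont_fst hf; have f2 := cont_snd hf.
by apply: continuousD; apply: (continuous_comp _ (@exprn_continuous _ 2 _)).
Qed.

Lemma cont_cabs f x : {for x, continuous f} ->
  {for x, continuous (fun t => cabs (f t))}.
Proof.
move=> hf; apply: (continuous_comp (cont_cnorm2 hf)); exact: sqrt_continuous.
Qed.

Lemma cont_cinv f x : f x != 0 -> {for x, continuous f} ->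
  {for x, continuous (fun t => cinv (f t))}.
Proof.
move=> f0 hf; rewrite /cinv.
have f1 := cont_fst hf; have f2 := cont_snd hf.
have fn : {for x, continuous (fun t => (cnorm2 (f t))^-1)}.
  by apply: continuousV; [rewrite cnorm2_eq0|exact: cont_cnorm2].
apply: cont_pair; first exact: continuousM.
by apply: continuousM; [exact: continuousN|exact: fn].
Qed.

Lemma cont_add (V : normedModType R) (f g : T -> V) x :
  {for x, continuous f} -> {for x, continuous g} ->
  {for x, continuous (fun t => f t + g t)}.
Proof. by move=> hf hg; exact: continuousD. Qed.

Lemma cont_opp (V : normedModType R) (f : T -> V) x :
  {for x, continuous f} -> {for x, continuous (fun t => - f t)}.
Proof. by move=> hf; exact: continuousN. Qed.

Lemma cont_cst (U : topologicalType) (c : U) x : {for x, continuous (fun _ : T => c)}.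
Proof. exact: cst_continuous. Qed.

Lemma cont_near_eq (U : topologicalType) (f g : T -> U) x :
  (\forall t \near x, f t = g t) -> {for x, continuous f} -> {for x, continuous g}.
Proof.
move=> h hf; have e : f x = g x := nbhs_singleton h.
suff : g @ x --> g x by [].
rewrite -e; apply: cvg_trans hf; apply: near_eq_cvg.
by apply: filterS h => t ->.
Qed.

Lemma cont_neq0_near f x : f x != 0 -> {for x, continuous f} ->
  \forall t \near x, f t != 0.
Proof.
move=> f0 hf.
have h : (fun t => cnorm2 (f t)) @ x --> cnorm2 (f x) by exact: cont_cnorm2.
have h0 : 0 < cnorm2 (f x) by rewrite cnorm2_gt0.
have h1 : \forall t \near x, 0 < cnorm2 (f t) by apply: (cvgr_gt (cnorm2 (f x))).
by apply: filterS h1 => t; rewrite cnorm2_gt0.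
Qed.

End ComplexContinuity.

(** * Complex differentiability in one variable and contour integrals over squares *)

Section OneVariable.
Variable R : realType.
Local Notation Cx := (Cx R).
Implicit Types (f g F : Cx -> Cx) (z w p d : Cx) (u v : R * R -> R).

Lemma near_normP (V : normedModType R) (x : V) (P : V -> Prop) :
  (\forall y \near x, P y) <-> exists2 d : R, 0 < d & forall y, `|y - x| < d -> P y.
Proof.
split.
  move=> /nbhs_ballP[d /= d0 h]; exists d => // y hy; apply: h.
  by rewrite -ball_normE /ball_ /= distrC.
move=> [d d0 h]; apply/nbhs_ballP; exists d => //= y.
by rewrite -ball_normE /ball_ /= distrC => /h.
Qed.

Lemma cont_normP (V W : normedModType R) (f : V -> W) (x : V) :
  {for x, continuous f} <-> forall e : R, 0 < e ->
    exists2 d : R, 0 < d & forall y, `|y - x| < d -> `|f y - f x| <= e.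
Proof.
split.
  move=> hf e e0; have : \forall t \near x, `|f x - f t| <= e by apply: (cvgrPdist_le f (f x)).1.
  by move=> /near_normP[d d0 h]; exists d => // y /h; rewrite distrC.
move=> h; apply: (cvgrPdist_le f (f x)).2 => e e0; apply/near_normP.
by have [d d0 hd] := h e e0; exists d => // y /hd; rewrite distrC.
Qed.

Lemma nearT (T : topologicalType) (x : T) (P : T -> Prop) :
  (forall y, P y) -> \forall y \near x, P y.
Proof. by move=> h; exact: nearW. Qed.

(* Caratheodory's form of complex differentiability: the difference quotient
   extends continuously. *)
Definition cder f z d := exists2 q : Cx -> Cx, {for z, continuous q} /\ q z = d &
  \forall w \near z, f w = f z + cmul (q w) (w - z).

Lemma cont_sub_id z w : {for w, continuous (fun t : Cx => t - z)}.
Proof. by apply: cont_add; [exact: cvg_id|exact: cont_cst]. Qed.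

Lemma cder_cont f z d : cder f z d -> {for z, continuous f}.
Proof.
move=> [q [qc _] h].
apply: (@cont_near_eq _ _ (fun w => f z + cmul (q w) (w - z))).
  by apply: filterS h => t ->.
apply: cont_add; first exact: cont_cst.
by apply: cont_cmul => //; exact: cont_sub_id.
Qed.

Lemma cder_near f g z d : (\forall w \near z, f w = g w) -> cder f z d -> cder g z d.
Proof.
move=> h [q hq hf]; exists q => //.
rewrite -(nbhs_singleton h).
by apply: filterS2 h hf => w -> .
Qed.

Lemma cder_cst c z : cder (fun=> c) z 0.
Proof.
exists (fun=> 0); first by split => //; exact: cont_cst.
by apply: nearT => w; rewrite cmul0c addr0.
Qed.

Lemma cder_id z : cder (fun w => w) z (cone R).
Proof.
exists (fun=> cone R); first by split => //; exact: cont_cst.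
by apply: nearT => w; rewrite cmul1c addrC subrK.
Qed.

Lemma cderD f g z d d' : cder f z d -> cder g z d' -> cder (fun w => f w + g w) z (d + d').
Proof.
move=> [q [qc <-] h] [q' [qc' <-] h'].
exists (fun w => q w + q' w); first by split => //; exact: cont_add.
by apply: filterS2 h h' => w -> ->; rewrite cmulDl; ring.
Qed.

Lemma cderM f g z d d' : cder f z d -> cder g z d' ->
  cder (fun w => cmul (f w) (g w)) z (cmul d (g z) + cmul (f z) d').
Proof.
move=> hf hg; have cg := cder_cont hg; move: hf hg.
move=> [q [qc <-] h] [q' [qc' <-] h'].
exists (fun w => cmul (q w) (g w) + cmul (f z) (q' w)).
  split; last by [].
  by apply: cont_add; [exact: cont_cmul qc cg|apply: cont_cmul qc'; exact: cont_cst].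
apply: filterS2 h h' => w -> ew.
by rewrite ew; apply: cx_eq; rewrite !cxE; ring.
Qed.

Lemma cderN f z d : cder f z d -> cder (fun w => - f w) z (- d).
Proof.
move=> [q [qc <-] h].
exists (fun w => - q w).
  by split; [exact: (@cont_opp R Cx Cx q z qc)|].
by apply: filterS h => w ->; rewrite cmulNl opprD.
Qed.

Lemma cderB f g z d d' : cder f z d -> cder g z d' -> cder (fun w => f w - g w) z (d - d').
Proof. by move=> hf hg; apply: cderD => //; exact: cderN. Qed.

Lemma cderV f z d : f z != 0 -> cder f z d ->
  cder (fun w => cinv (f w)) z (- cmul d (cmul (cinv (f z)) (cinv (f z)))).
Proof.
move=> fz hf; have cf := cder_cont hf; move: hf => [q [qc <-] h].
(* From [1 / f w - 1 / f z = - q w (w - z) / (f z f w)]. *)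
exists (fun w => - cmul (q w) (cmul (cinv (f z)) (cinv (f w)))).
  split; last by [].
  apply: (@cont_opp R Cx Cx); apply: cont_cmul; first exact: qc.
  by apply: cont_cmul; [exact: cont_cst|exact: cont_cinv].
have hn := cont_neq0_near fz cf.
apply: filterS2 h hn => w ew fw.
apply: (@cmulI _ _ _ (f w)) => //; rewrite cmulVc // cmulDl cmulNl cmulNl.
rewrite -!cmulA (cmulC (w - z)) !cmulA -[cmul (cmul (cmul (q w) _) (cinv (f w))) (f w)]cmulA.
rewrite cmulVc // cmulc1 -cmulA (cmulC (cinv (f z))) cmulA {1}ew.
rewrite cmulDl cmulcV // -cmulA (cmulC (w - z)) cmulA.
by rewrite addrK.
Qed.

(** The Cauchy-Riemann equations: they make [Re (f dw)] and [Im (f dw)] closed in the sense of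
    [goursat], with [B = - d.2] and [B = d.1]. *)
Lemma cder_fdiff f z d : cder f z d ->
  fdiff (fun w => (f w).1) z d.1 (- d.2) /\ fdiff (fun w => (f w).2) z d.2 d.1.
Proof.
move=> [q [qc qd] h].
suff H (e : R) : 0 < e -> exists2 dl : R, 0 < dl &
  forall x y : R, `|x - z.1| < dl -> `|y - z.2| < dl ->
   `|(f (x, y)).1 - (f z).1 - d.1 * (x - z.1) - (- d.2) * (y - z.2)| <=
      e * (`|x - z.1| + `|y - z.2|) /\
   `|(f (x, y)).2 - (f z).2 - d.2 * (x - z.1) - d.1 * (y - z.2)| <=
      e * (`|x - z.1| + `|y - z.2|).
  by split=> e e0; have [dl d0 hd] := H e e0; exists dl => // x y hx hy;
    have [] := hd x y hx hy.
move=> e0.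
have [d1 d10 h1] := (cont_normP q z).1 qc e e0.
have /near_normP[d2 d20 h2] := h.
exists (Num.min d1 d2); first by rewrite lt_min d10 d20.
move=> x y; rewrite !lt_min => /andP[x1 x2] /andP[y1 y2].
have n1 : `|((x, y) : R * R) - z| < d1.
  by rewrite /Num.norm /= gt_max /= x1.
have n2 : `|((x, y) : R * R) - z| < d2.
  by rewrite /Num.norm /= gt_max /= x2.
rewrite (h2 _ n2) -qd; have hq := h1 _ n1.
have q1 := le_trans (re_le_norm _) hq; have q2 := le_trans (im_le_norm _) hq.
rewrite cxE in q1; rewrite cxE in q2.
rewrite !cxE /=.
have k (a b s t : R) : `|a| <= e -> `|b| <= e -> `|a * s + b * t| <= e * (`|s| + `|t|).
  move=> ha hb; apply: (le_trans (ler_normD _ _)).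
  by rewrite !normrM mulrDr lerD // ler_wpM2r.
split.
- set l := (X in `|X|).
  have -> : l = ((q (x, y)).1 - (q z).1) * (x - z.1) + (- ((q (x, y)).2 - (q z).2)) * (y - z.2).
    by rewrite /l /=; ring.
  by apply: k => //; rewrite normrN.
- set l := (X in `|X|).
  have -> : l = ((q (x, y)).2 - (q z).2) * (x - z.1) + ((q (x, y)).1 - (q z).1) * (y - z.2).
    by rewrite /l /=; ring.
  by apply: k.
Qed.

Definition sqloop u v p (s : R) := rloop u v (p.1 - s) (p.1 + s) (p.2 - s) (p.2 + s).

Definition sqint u p (s : R) :=
  rint (fun x => u (x, p.2 - s)) (p.1 - s) (p.1 + s)
  + rint (fun x => u (x, p.2 + s)) (p.1 - s) (p.1 + s)
  + (rint (fun y => u (p.1 - s, y)) (p.2 - s) (p.2 + s)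
  + rint (fun y => u (p.1 + s, y)) (p.2 - s) (p.2 + s)).

(** Real and imaginary part of the contour integral of [f dw]. Spheres of the max norm are squares,
    which is why squares replace circles. *)
Definition cloop f p (s : R) : Cx :=
  (sqloop (fun w => (f w).1) (fun w => - (f w).2) p s,
   sqloop (fun w => (f w).2) (fun w => (f w).1) p s).

Lemma norm_pair (a b : R) : `|(a, b) : R * R| = Num.max `|a| `|b|.
Proof. by []. Qed.

Definition scont u p (s : R) := forall w, `|w - p| = s -> {for w, continuous u}.

Lemma sphere_h p (s x : R) : 0 < s -> p.1 - s <= x <= p.1 + s ->
  `|(x, p.2 - s) - p| = s /\ `|(x, p.2 + s) - p| = s.
Proof.
move=> s0 hx; have e (t : R) : (x, t) - p = (x - p.1, t - p.2) by [].
have hx' : `|x - p.1| <= s by rewrite ler_norml; lra.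
rewrite !e !norm_pair; split.
  have -> : p.2 - s - p.2 = - s by ring.
  by rewrite normrN (gtr0_norm s0); apply/max_idPr.
have -> : p.2 + s - p.2 = s by ring.
by rewrite (gtr0_norm s0); apply/max_idPr.
Qed.

Lemma sphere_v p (s y : R) : 0 < s -> p.2 - s <= y <= p.2 + s ->
  `|(p.1 - s, y) - p| = s /\ `|(p.1 + s, y) - p| = s.
Proof.
move=> s0 hx; have e (t : R) : (t, y) - p = (t - p.1, y - p.2) by [].
have hx' : `|y - p.2| <= s by rewrite ler_norml; lra.
rewrite !e !norm_pair; split.
  have -> : p.1 - s - p.1 = - s by ring.
  by rewrite normrN (gtr0_norm s0); apply/max_idPl.
have -> : p.1 + s - p.1 = s by ring.
by rewrite (gtr0_norm s0); apply/max_idPl.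
Qed.

Lemma scont_ccont u p (s : R) : 0 < s -> scont u p s ->
  [/\ ccont (fun x => u (x, p.2 - s)) (p.1 - s) (p.1 + s),
      ccont (fun x => u (x, p.2 + s)) (p.1 - s) (p.1 + s),
      ccont (fun y => u (p.1 - s, y)) (p.2 - s) (p.2 + s) &
      ccont (fun y => u (p.1 + s, y)) (p.2 - s) (p.2 + s)].
Proof.
move=> s0 h; split.
- move=> x /(sphere_h s0)[/h hx _].
  apply: (@continuous_comp _ _ _ (fun x => (x, _)) u); last exact: hx.
  exact: (cvg_pair (@cvg_id _ _) (@cvg_cst _ _ _ _ _)).
- move=> x /(sphere_h s0)[_ /h hx].
  apply: (@continuous_comp _ _ _ (fun x => (x, _)) u); last exact: hx.
  exact: (cvg_pair (@cvg_id _ _) (@cvg_cst _ _ _ _ _)).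
- move=> x /(sphere_v s0)[/h hx _].
  apply: (@continuous_comp _ _ _ (fun x => (_, x)) u); last exact: hx.
  exact: (cvg_pair (@cvg_cst _ _ _ _ _) (@cvg_id _ _)).
- move=> x /(sphere_v s0)[_ /h hx].
  apply: (@continuous_comp _ _ _ (fun x => (_, x)) u); last exact: hx.
  exact: (cvg_pair (@cvg_cst _ _ _ _ _) (@cvg_id _ _)).
Qed.

Lemma rint_norm_le (f g : R -> R) (a b : R) : ccont f a b -> ccont g a b ->
  (forall x, a <= x <= b -> `|f x| <= g x) -> `|rint f a b| <= rint g a b.
Proof.
move=> hf hg h; rewrite ler_norml; apply/andP; split.
- have -> : - rint g a b = rint (fun x => -1 * g x) a b by rewrite rintZ // mulN1r.
  apply: rint_le => //; first exact: ccontZ.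
  by move=> x /h; rewrite mulN1r ler_norml => /andP[].
- by apply: rint_le => // x /h; rewrite ler_norml => /andP[].
Qed.

Lemma sqloop_le u v (g : R * R -> R) p (s : R) : 0 < s -> scont u p s -> scont v p s -> scont g p s ->
  (forall w, `|w - p| = s -> `|u w| <= g w /\ `|v w| <= g w) ->
  `|sqloop u v p s| <= sqint g p s.
Proof.
move=> s0 hu hv hg h.
have [u1 u2 _ _] := scont_ccont s0 hu.
have [_ _ v1 v2] := scont_ccont s0 hv.
have [g1 g2 g3 g4] := scont_ccont s0 hg.
have := rint_norm_le u1 g1 (fun x hx => (h _ (sphere_h s0 hx).1).1).
have := rint_norm_le u2 g2 (fun x hx => (h _ (sphere_h s0 hx).2).1).
have := rint_norm_le v1 g3 (fun x hx => (h _ (sphere_v s0 hx).1).2).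
have := rint_norm_le v2 g4 (fun x hx => (h _ (sphere_v s0 hx).2).2).
rewrite /sqloop /rloop /sqint !ler_norml.
move: (rint _ _ _) (rint _ _ _) (rint _ _ _) (rint _ _ _) (rint _ _ _) (rint _ _ _)
  (rint _ _ _) (rint _ _ _) => a1 a2 a3 a4 a5 a6 a7 a8.
by move=> /andP[? ?] /andP[? ?] /andP[? ?] /andP[? ?]; apply/andP; split; lra.
Qed.

Lemma sqint_le_cst (g : R * R -> R) (M : R) p (s : R) : 0 < s -> scont g p s ->
  (forall w, `|w - p| = s -> g w <= M) -> sqint g p s <= 8 * s * M.
Proof.
move=> s0 hg h; have [g1 g2 g3 g4] := scont_ccont s0 hg.
have := rint_le g1 (@ccont_cst _ M _ _) (fun x hx => (h _ (sphere_h s0 hx).1)).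
have := rint_le g2 (@ccont_cst _ M _ _) (fun x hx => (h _ (sphere_h s0 hx).2)).
have := rint_le g3 (@ccont_cst _ M _ _) (fun x hx => (h _ (sphere_v s0 hx).1)).
have := rint_le g4 (@ccont_cst _ M _ _) (fun x hx => (h _ (sphere_v s0 hx).2)).
have e (q : R) : q - s <= q + s by lra.
rewrite !rint_cst // /sqint.
move: (rint _ _ _) (rint _ _ _) (rint _ _ _) (rint _ _ _) => a1 a2 a3 a4.
by lra.
Qed.

(** Cuts along the sides of the square split off four rectangles that avoid [p] and contribute
    nothing. Stated for a real form so that the real and the imaginary part of a complex integral
    share it. *)
Lemma rloop_rect_square u v p (a b c d r : R) : 0 < r ->
  a <= p.1 - r -> p.1 + r <= b -> c <= p.2 - r -> p.2 + r <= d ->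
  (forall x y : R, a <= x <= b -> c <= y <= d -> (x, y) != p ->
     {for (x, y), continuous u} /\ {for (x, y), continuous v}) ->
  (forall a' b' c' d' : R, a' <= b' -> c' <= d' ->
     (forall x y : R, a' <= x <= b' -> c' <= y <= d' ->
        [/\ a <= x <= b, c <= y <= d & (x, y) != p]) ->
     rloop u v a' b' c' d' = 0) ->
  rloop u v a b c d = sqloop u v p r.
Proof.
move=> r0 ha hb hc hd hcont hz; rewrite /sqloop.
have neq (x y : R) : x <= p.1 - r \/ p.1 + r <= x \/ y <= p.2 - r \/ p.2 + r <= y -> (x, y) != p.
  move=> h; apply/eqP => e; move: h; rewrite -e /=; order_lra.
have ch (y a' b' : R) : a <= a' -> b' <= b -> c <= y <= d ->
    y <= p.2 - r \/ p.2 + r <= y -> ccont (fun x => u (x, y)) a' b'.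
  move=> ha' hb' hy hyr x hx.
  apply: (@continuous_comp _ _ _ (fun x => (x, y)) u).
    exact: (cvg_pair (@cvg_id _ _) (@cvg_cst _ _ _ _ _)).
  apply: (hcont _ _ _ _ _).1; [order_lra|order_lra|].
  by apply: neq; right; right.
have cv (x c' d' : R) : c <= c' -> d' <= d -> a <= x <= b ->
    x <= p.1 - r \/ p.1 + r <= x -> ccont (fun y => v (x, y)) c' d'.
  move=> ha' hb' hx hxr y hy.
  apply: (@continuous_comp _ _ _ (fun y => (x, y)) v).
    exact: (cvg_pair (@cvg_cst _ _ _ _ _) (@cvg_id _ _)).
  apply: (hcont _ _ _ _ _).2; [order_lra|order_lra|].
  by apply: neq; case: hxr => ?; [left|right; left].
rewrite (@rloop_splith _ _ _ _ (p.1 - r)); try order_lra; last 2 first.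
- by apply: ch; order_lra.
- by apply: ch; order_lra.
rewrite hz; try order_lra; last first.
  by move=> x y hx hy; split; [order_lra|order_lra|apply: neq; left; order_lra].
rewrite add0r (@rloop_splith _ _ _ _ (p.1 + r)); try order_lra; last 2 first.
- by apply: ch; order_lra.
- by apply: ch; order_lra.
rewrite [X in _ + X]hz; try order_lra; last first.
  by move=> x y hx hy; split; [order_lra|order_lra|apply: neq; right; left; order_lra].
rewrite addr0 (@rloop_splitv _ _ _ _ _ _ (p.2 - r)); try order_lra; last 2 first.
- by apply: cv; order_lra.
- by apply: cv; order_lra.
rewrite hz; try order_lra; last first.
  by move=> x y hx hy; split; [order_lra|order_lra|apply: neq; right; right; left; order_lra].
rewrite add0r (@rloop_splitv _ _ _ _ _ _ (p.2 + r)); try order_lra; last 2 first.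
- by apply: cv; order_lra.
- by apply: cv; order_lra.
rewrite [X in _ + X]hz; try order_lra; last first.
  by move=> x y hx hy; split; [order_lra|order_lra|apply: neq; right; right; right; order_lra].
Qed.

Lemma cloop_rect_square f p (a b c d r : R) : 0 < r ->
  a <= p.1 - r -> p.1 + r <= b -> c <= p.2 - r -> p.2 + r <= d ->
  (forall x y : R, a <= x <= b -> c <= y <= d -> (x, y) != p ->
     exists e, cder f (x, y) e) ->
  (rloop (fun w => (f w).1) (fun w => - (f w).2) a b c d,
   rloop (fun w => (f w).2) (fun w => (f w).1) a b c d) = cloop f p r.
Proof.
move=> r0 ha hb hc hd h.
have c1 (x y : R) : a <= x <= b -> c <= y <= d -> (x, y) != p ->
    {for (x, y), continuous (fun w => (f w).1)}.
  by move=> hx hy n; have [e /cder_cont/cont_fst] := h x y hx hy n.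
have c2 (x y : R) : a <= x <= b -> c <= y <= d -> (x, y) != p ->
    {for (x, y), continuous (fun w => (f w).2)}.
  by move=> hx hy n; have [e /cder_cont/cont_snd] := h x y hx hy n.
have c3 (x y : R) : a <= x <= b -> c <= y <= d -> (x, y) != p ->
    {for (x, y), continuous (fun w => - (f w).2)}.
  by move=> hx hy n; apply: continuousN; exact: c2.
have fdN (u : R * R -> R) w (A B : R) : fdiff u w A B -> fdiff (fun w => - u w) w (- A) (- B).
  move=> hu e e0; have [dl d0 hd'] := hu e e0; exists dl => // x y hx hy.
  rewrite -normrN; have := hd' x y hx hy; congr (`|_| <= _); ring.
congr (_, _).
- apply: (rloop_rect_square r0 ha hb hc hd); first by move=> x y hx hy n; split; [exact: c1|exact: c3].
  move=> a' b' c' d' ab cd hr; apply: (goursat ab cd).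
  + by move=> x y hx hy; have [? ? ?] := hr x y hx hy; exact: c1.
  + by move=> x y hx hy; have [? ? ?] := hr x y hx hy; exact: c3.
  + move=> x y hx hy; have [h1 h2 h3] := hr x y hx hy; have [e /cder_fdiff[F1 F2]] := h _ _ h1 h2 h3.
    by exists e.1, (- e.2), (- e.1); split => //; exact: fdN.
- apply: (rloop_rect_square r0 ha hb hc hd); first by move=> x y hx hy n; split; [exact: c2|exact: c1].
  move=> a' b' c' d' ab cd hr; apply: (goursat ab cd).
  + by move=> x y hx hy; have [? ? ?] := hr x y hx hy; exact: c2.
  + by move=> x y hx hy; have [? ? ?] := hr x y hx hy; exact: c1.
  + move=> x y hx hy; have [h1 h2 h3] := hr x y hx hy; have [e /cder_fdiff[F1 F2]] := h _ _ h1 h2 h3.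
    by exists e.2, e.1, (- e.2).
Qed.

Lemma norm_sub_le p (x y s : R) : p.1 - s <= x <= p.1 + s -> p.2 - s <= y <= p.2 + s ->
  `|(x, y) - p| <= s.
Proof.
move=> hx hy; have -> : (x, y) - p = (x - p.1, y - p.2) by [].
by rewrite norm_pair ge_max !ler_distl hx hy.
Qed.

Lemma cloop_shrink f p (s r : R) : 0 < r -> r <= s ->
  (forall w, `|w - p| <= s -> w != p -> exists d, cder f w d) ->
  cloop f p s = cloop f p r.
Proof.
move=> r0 rs h; apply: cloop_rect_square; rewrite ?lerD2l ?lerN2 //.
by move=> x y hx hy; apply: h; exact: norm_sub_le.
Qed.

End OneVariable.

(** * Cauchy's formula and estimates on squares *)

Section CauchySquare.
Variable R : realType.
Local Notation Cx := (Cx R).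
Implicit Types (f g F : Cx -> Cx) (z w p d : Cx).

Definition ckernel p w : Cx := cinv (w - p).

Lemma sphere_neq p (s : R) w : 0 < s -> `|w - p| = s -> w - p != 0.
Proof. by move=> s0 h; rewrite -normr_gt0 h. Qed.

Lemma ckernel_cont p w : w - p != 0 -> {for w, continuous (ckernel p)}.
Proof. by move=> h; apply: cont_cinv => //; exact: cont_sub_id. Qed.

Lemma ckernel_cder p w : w - p != 0 -> exists d, cder (ckernel p) w d.
Proof.
move=> h.
have h1 := cderB (cder_id w) (cder_cst p w).
by have := cderV (f := fun w => w - p) h h1; eexists; eassumption.
Qed.

Lemma rint_ge_cst (f : R -> R) (m a b : R) : a <= b -> ccont f a b ->
  (forall x, a <= x <= b -> m <= f x) -> m * (b - a) <= rint f a b.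
Proof.
move=> ab hf h; rewrite -rint_cst //; apply: rint_le => //; exact: ccont_cst.
Qed.

Lemma rint_le_cst (f : R -> R) (m a b : R) : a <= b -> ccont f a b ->
  (forall x, a <= x <= b -> f x <= m) -> rint f a b <= m * (b - a).
Proof.
move=> ab hf h; rewrite -rint_cst //; apply: rint_le => //; exact: ccont_cst.
Qed.

(* On each side of the square one component of [1 / (w - p)] is at least
   [1 / (2 s)] in absolute value, so the loop integral of the Cauchy kernel does
   not vanish; its exact value [2 pi i] is never used. *)
Lemma cloop_kernel p (s : R) : 0 < s -> 4 <= cabs (cloop (ckernel p) p s).
Proof.
move=> s0; apply: le_trans (cabs_ge_im _); apply: le_trans (ler_norm _).
have c1 : scont (fun w => (ckernel p w).1) p s.
  by move=> w hw; apply: cont_fst; apply: ckernel_cont; exact: sphere_neq hw.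
have c2 : scont (fun w => (ckernel p w).2) p s.
  by move=> w hw; apply: cont_snd; apply: ckernel_cont; exact: sphere_neq hw.
have [a1 a2 _ _] := scont_ccont s0 c2.
have [_ _ b1 b2] := scont_ccont s0 c1.
have key (t : R) : `|t| <= s -> (2 * s)^-1 <= s / (t ^+ 2 + s ^+ 2).
  move=> ht.
  have h1 : t ^+ 2 <= s ^+ 2 by rewrite -real_normK ?num_real // ler_sqr ?nnegrE // ltW.
  have h2 : 0 < t ^+ 2 + s ^+ 2 by rewrite ltr_wpDl ?sqr_ge0 // exprn_gt0.
  rewrite -div1r ler_pdivrMr ?mulr_gt0 // mulrAC ler_pdivlMr // mul1r.
  by rewrite expr2 in h1 *; rewrite expr2 in h2 *; nra.
have hn (x q : R) : q - s <= x <= q + s -> `|x - q| <= s by rewrite ler_norml => ?; lra.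
have e (q : R) : q - s <= q + s by lra.
have k1 : (2 * s)^-1 * (p.1 + s - (p.1 - s)) <= rint (fun x => (ckernel p (x, p.2 - s)).2) (p.1 - s) (p.1 + s).
  apply: rint_ge_cst => // x /hn hx; rewrite /ckernel /cinv /cnorm2 /=.
  have -> : p.2 - s - p.2 = - s by ring.
  by rewrite sqrrN opprK; exact: key.
have k2 : rint (fun x => (ckernel p (x, p.2 + s)).2) (p.1 - s) (p.1 + s) <= - (2 * s)^-1 * (p.1 + s - (p.1 - s)).
  apply: rint_le_cst => // x /hn hx; rewrite /ckernel /cinv /cnorm2 /=.
  have -> : p.2 + s - p.2 = s by ring.
  by rewrite mulNr lerN2; exact: key.
have k3 : rint (fun y => (ckernel p (p.1 - s, y)).1) (p.2 - s) (p.2 + s) <= - (2 * s)^-1 * (p.2 + s - (p.2 - s)).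
  apply: rint_le_cst => // x /hn hx; rewrite /ckernel /cinv /cnorm2 /=.
  have -> : p.1 - s - p.1 = - s by ring.
  by rewrite sqrrN mulNr lerN2 addrC; exact: key.
have k4 : (2 * s)^-1 * (p.2 + s - (p.2 - s)) <= rint (fun y => (ckernel p (p.1 + s, y)).1) (p.2 - s) (p.2 + s).
  apply: rint_ge_cst => // x /hn hx; rewrite /ckernel /cinv /cnorm2 /=.
  have -> : p.1 + s - p.1 = s by ring.
  by rewrite addrC; exact: key.
have e1 (q : R) : (2 * s)^-1 * (q + s - (q - s)) = 1 by field; lra.
rewrite ?mulNr e1 in k1.
rewrite ?mulNr e1 in k2.
rewrite ?mulNr e1 in k3.
rewrite ?mulNr e1 in k4.
by rewrite /cloop /sqloop /rloop /=; lra.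
Qed.

Lemma sqloopD (u v u' v' : R * R -> R) p (s : R) : 0 < s ->
  scont u p s -> scont v p s -> scont u' p s -> scont v' p s ->
  sqloop (fun z => u z + u' z) (fun z => v z + v' z) p s
  = sqloop u v p s + sqloop u' v' p s.
Proof.
move=> s0 hu hv hu' hv'.
have [u1 u2 _ _] := scont_ccont s0 hu.
have [_ _ v1 v2] := scont_ccont s0 hv.
have [g1 g2 _ _] := scont_ccont s0 hu'.
have [_ _ k1 k2] := scont_ccont s0 hv'.
rewrite /sqloop /rloop (rintD u1 g1) (rintD u2 g2) (rintD v1 k1) (rintD v2 k2).
by ring.
Qed.

Lemma sqloopZ (c : R) (u v : R * R -> R) p (s : R) : 0 < s -> scont u p s -> scont v p s ->
  sqloop (fun z => c * u z) (fun z => c * v z) p s = c * sqloop u v p s.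
Proof.
move=> s0 hu hv.
have [u1 u2 _ _] := scont_ccont s0 hu.
have [_ _ v1 v2] := scont_ccont s0 hv.
rewrite /sqloop /rloop (rintZ _ u1) (rintZ _ u2) (rintZ _ v1) (rintZ _ v2).
by ring.
Qed.

Definition ccontS f p (s : R) := forall w, `|w - p| = s -> {for w, continuous f}.

Lemma sqloop_ext (u v u' v' : R * R -> R) p (s : R) : 0 < s ->
  (forall w, `|w - p| = s -> u w = u' w /\ v w = v' w) ->
  sqloop u v p s = sqloop u' v' p s.
Proof.
move=> s0 h; rewrite /sqloop /rloop; congr (_ - _ + (_ - _)); apply: eq_rint => x hx.
- by have [] := h _ (sphere_h s0 hx).1.
- by have [] := h _ (sphere_h s0 hx).2.
- by have [] := h _ (sphere_v s0 hx).2.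
- by have [] := h _ (sphere_v s0 hx).1.
Qed.

Lemma scontN (u : R * R -> R) p (s : R) : scont u p s -> scont (fun w => - u w) p s.
Proof. by move=> h w hw; apply: continuousN; exact: h. Qed.

Lemma scontZ (c : R) (u : R * R -> R) p (s : R) : scont u p s -> scont (fun w => c * u w) p s.
Proof. by move=> h w hw; apply: continuousM; [exact: cst_continuous|exact: h]. Qed.

Lemma scontD (u v : R * R -> R) p (s : R) : scont u p s -> scont v p s ->
  scont (fun w => u w + v w) p s.
Proof. by move=> h h' w hw; apply: continuousD; [exact: h|exact: h']. Qed.

Lemma cloopDZ c f g p (s : R) : 0 < s -> ccontS f p s -> ccontS g p s ->
  cloop (fun w => cmul c (f w) + g w) p s = cmul c (cloop f p s) + cloop g p s.
Proof.
move=> s0 hf hg.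
have f1 : scont (fun w => (f w).1) p s by move=> w /hf/cont_fst.
have f2 : scont (fun w => (f w).2) p s by move=> w /hf/cont_snd.
have g1 : scont (fun w => (g w).1) p s by move=> w /hg/cont_fst.
have g2 : scont (fun w => (g w).2) p s by move=> w /hg/cont_snd.
have f2N := scontN f2; have g2N := scontN g2.
have sZ k u (h : scont u p s) := @scontZ k u p s h.
have sD u v (h : scont u p s) (h' : scont v p s) := @scontD u v p s h h'.
apply: cx_eq; rewrite !cxE /=.
- rewrite (@sqloop_ext _ _ (fun w => c.1 * (f w).1 + ((- c.2) * (f w).2 + (g w).1))
    (fun w => c.1 * (- (f w).2) + ((- c.2) * (f w).1 + - (g w).2))) //; last first.
    by move=> w _; split; ring.
  rewrite (sqloopD s0 (sZ _ _ f1) (sZ _ _ f2N) (sD _ _ (sZ _ _ f2) g1) (sD _ _ (sZ _ _ f1) g2N)).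
  rewrite (sqloopD s0 (sZ _ _ f2) (sZ _ _ f1) g1 g2N).
  by rewrite (sqloopZ _ s0 f1 f2N) (sqloopZ _ s0 f2 f1); ring.
- rewrite (@sqloop_ext _ _ (fun w => c.1 * (f w).2 + (c.2 * (f w).1 + (g w).2))
    (fun w => c.1 * (f w).1 + (c.2 * (- (f w).2) + (g w).1))) //; last first.
    by move=> w _; split; ring.
  rewrite (sqloopD s0 (sZ _ _ f2) (sZ _ _ f1) (sD _ _ (sZ _ _ f1) g2) (sD _ _ (sZ _ _ f2N) g1)).
  rewrite (sqloopD s0 (sZ _ _ f1) (sZ _ _ f2N) g2 g1).
  by rewrite (sqloopZ _ s0 f2 f1) (sqloopZ _ s0 f1 f2N); ring.
Qed.

Lemma cloop_le f (g : R * R -> R) p (s : R) : 0 < s -> ccontS f p s -> scont g p s ->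
  (forall w, `|w - p| = s -> cabs (f w) <= g w) ->
  cabs (cloop f p s) <= 2 * sqint g p s.
Proof.
move=> s0 hf hg h.
have f1 : scont (fun w => (f w).1) p s by move=> w /hf/cont_fst.
have f2 : scont (fun w => (f w).2) p s by move=> w /hf/cont_snd.
apply: (le_trans (cabs_le_sum _)); rewrite mulrDl mul1r lerD //=.
- apply: sqloop_le => //; first exact: scontN.
  by move=> w /h hw; rewrite normrN; split; apply: le_trans hw; [exact: cabs_ge_re|exact: cabs_ge_im].
- apply: sqloop_le => //.
  by move=> w /h hw; split; apply: le_trans hw; [exact: cabs_ge_im|exact: cabs_ge_re].
Qed.

Section Formula.
Variables (F : Cx -> Cx) (p : Cx) (s : R).
Hypotheses (s0 : 0 < s) (hF : forall w, `|w - p| <= s -> w != p -> exists d, cder F w d).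
Hypothesis cF : {for p, continuous F}.

Let Fcont w : `|w - p| <= s -> {for w, continuous F}.
Proof. by move=> hw; have [-> //|/hF] := eqVneq w p; move=> /(_ hw)[d /cder_cont]. Qed.

(** The product [g] of [F - F p] and the kernel is differentiable off [p], so its loop does not
    change when the square shrinks, and there it is bounded by the oscillation of [F]. Asking only
    for continuity at [p] admits functions with a removable singularity, as in [cauchy_deriv]. The
    loop of the kernel stays unevaluated. *)
Lemma cauchy_square :
  cmul (F p) (cloop (ckernel p) p s) = cloop (fun w => cmul (F w) (ckernel p w)) p s.
Proof.
pose g w := cmul (F w - F p) (ckernel p w).
have hg w : `|w - p| <= s -> w != p -> exists d, cder g w d.
  move=> hw wp; have [d hd] := hF hw wp.
  have wp' : w - p != 0 by rewrite subr_eq0.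
  have [d' hd'] := ckernel_cder wp'.
  by eexists; apply: cderM hd'; exact: cderB hd (cder_cst _ _).
have gc (r : R) w : 0 < r -> r <= s -> `|w - p| = r -> {for w, continuous g}.
  move=> r0 rs hw; have wp := sphere_neq r0 hw.
  have [||d /cder_cont //] := hg w; first by rewrite hw.
  by rewrite -subr_eq0.
have kc (r : R) : 0 < r -> ccontS (ckernel p) p r.
  by move=> r0 w hw; apply: ckernel_cont; exact: sphere_neq hw.
have g0 : cloop g p s = 0.
  apply/eqP; rewrite -cabs_eq0 eq_le cabs_ge0 andbT; apply/ler_addgt0Pl => e e0; rewrite addr0.
  (* [cabs_le_norm] doubles the bound; the perimeter [8 r] and the factor 2 of [cloop_le] account
     for the rest of 32. *)
  have e16 : 0 < e / 32 by lra.
  have [dl d0 hd] := (cont_normP F p).1 cF _ e16.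
  pose r := Num.min s (dl / 2).
  have r0 : 0 < r by rewrite lt_min s0 /=; lra.
  have rs : r <= s by rewrite ge_min lexx.
  have rd : r < dl by rewrite gt_min; apply/orP; right; lra.
  rewrite (cloop_shrink r0 rs hg).
  have h1 w : `|w - p| = r -> cabs (g w) <= (e / 16) / r.
    move=> hw; have wp := sphere_neq r0 hw.
    rewrite /g cabsM /ckernel cabsV //.
    have a1 : cabs (F w - F p) <= e / 16.
      apply: (le_trans (cabs_le_norm _)).
      have : `|F w - F p| <= e / 32 by apply: hd; rewrite hw.
      lra.
    have a2 : (cabs (w - p))^-1 <= r^-1.
      by rewrite lef_pV2 ?posrE ?cabs_gt0 // -hw cabs_ge_norm.
    by apply: ler_pM => //; rewrite ?cabs_ge0 // invr_ge0 cabs_ge0.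
  have cc : scont (fun=> (e / 16) / r) p r by move=> w _; exact: cst_continuous.
  apply: (le_trans (cloop_le r0 (fun w => gc r w r0 rs) cc h1)).
  have := sqint_le_cst r0 cc (fun w _ => lexx _).
  have -> : 8 * r * (e / 16 / r) = e / 2 by field; lra.
  lra.
have -> : cloop (fun w => cmul (F w) (ckernel p w)) p s =
          cloop (fun w => cmul (F p) (ckernel p w) + g w) p s.
  have e w : cmul (F w) (ckernel p w) = cmul (F p) (ckernel p w) + g w.
    by rewrite /g cmulBl addrC subrK.
  by apply: cx_eq; apply: sqloop_ext => // w _; rewrite e.
rewrite cloopDZ //; [by rewrite g0 addr0|exact: kc|].
by move=> w hw; apply: (gc s).
Qed.

Lemma cauchy_sqint : cabs (F p) <= sqint (fun w => cabs (F w)) p s / (2 * s).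
Proof.
have cFs : scont (fun w => cabs (F w)) p s.
  by move=> w hw; apply: cont_cabs; apply: Fcont; rewrite hw.
have cFs' : scont (fun w => s^-1 * cabs (F w)) p s by exact: scontZ.
have h1 : cabs (cloop (fun w => cmul (F w) (ckernel p w)) p s)
    <= 2 * sqint (fun w => s^-1 * cabs (F w)) p s.
  apply: cloop_le => //.
    move=> w hw; apply: cont_cmul; first by apply: Fcont; rewrite hw.
    by apply: ckernel_cont; exact: sphere_neq hw.
  move=> w hw; have wp := sphere_neq s0 hw.
  rewrite cabsM /ckernel cabsV // mulrC ler_wpM2r ?cabs_ge0 //.
  by rewrite lef_pV2 ?posrE ?cabs_gt0 // -hw cabs_ge_norm.
have h2 := cloop_kernel p s0.
have h3 : cabs (F p) * 4 <= 2 * sqint (fun w => s^-1 * cabs (F w)) p s.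
  by apply: le_trans h1; rewrite -cauchy_square cabsM ler_wpM2l ?cabs_ge0.
have [g1 g2 g3 g4] := scont_ccont s0 cFs.
have e : sqint (fun w => s^-1 * cabs (F w)) p s = s^-1 * sqint (fun w => cabs (F w)) p s.
  by rewrite /sqint (rintZ _ g1) (rintZ _ g2) (rintZ _ g3) (rintZ _ g4); ring.
rewrite e in h3; rewrite invfM; lra.
Qed.

Lemma cauchy_sup (M : R) : (forall w, `|w - p| = s -> cabs (F w) <= M) -> cabs (F p) <= 4 * M.
Proof.
move=> h; apply: (le_trans cauchy_sqint).
rewrite ler_pdivrMr ?mulr_gt0 //.
have cFs : scont (fun w => cabs (F w)) p s.
  by move=> w hw; apply: cont_cabs; apply: Fcont; rewrite hw.
have := sqint_le_cst s0 cFs h; lra.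
Qed.

End Formula.

(** The difference quotient at [p], completed by the value [d], has a removable singularity, so the
    bound on values in [cauchy_sup] is already the bound on the derivative; no differentiation under
    the integral is involved. *)
Lemma cauchy_deriv f p (s M : R) d : 0 < s ->
  (forall w, `|w - p| <= s -> exists d, cder f w d) -> cder f p d ->
  (forall w, `|w - p| = s -> cabs (f w - f p) <= M) -> cabs d <= 4 * (M / s).
Proof.
move=> s0 hf [q [qc <-] hq] hM.
pose g w := if w == p then q p else cmul (f w - f p) (ckernel p w).
have ge w : w != p -> g w = cmul (f w - f p) (ckernel p w) by rewrite /g => /negbTE ->.
have -> : q p = g p by rewrite /g eqxx.
apply: (@cauchy_sup g p s) => //.
- move=> w hw wp; have [e hd] := hf _ hw.
  have wp' : w - p != 0 by rewrite subr_eq0.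
  have [d' hd'] := ckernel_cder wp'.
  exists (cmul (e - 0) (ckernel p w) + cmul (f w - f p) d').
  apply: (@cder_near _ (fun w => cmul (f w - f p) (ckernel p w))).
    apply/near_normP; exists `|w - p|; first by rewrite normr_gt0.
    by move=> t ht; apply/esym/ge; apply: contraTneq ht => ->; rewrite distrC ltxx.
  by apply: cderM hd'; exact: cderB hd (cder_cst _ _).
- apply: (cont_near_eq _ qc); apply: filterS hq => w hw.
  rewrite /g; case: eqP => [-> //|/eqP wp]; rewrite hw addrC addKr.
  by rewrite /ckernel cmulK // subr_eq0.
- move=> w hw; have wp := sphere_neq s0 hw.
  have wp2 : w != p by rewrite -subr_eq0.
  rewrite (ge _ wp2) cabsM /ckernel (cabsV wp).
  apply: ler_pM; rewrite ?cabs_ge0 ?invr_ge0 ?cabs_ge0 //; first exact: hM.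
  by rewrite lef_pV2 ?posrE ?cabs_gt0 // -hw cabs_ge_norm.
Qed.

End CauchySquare.

(** * Derivatives along directions and along curves *)

Section DirectionalDerivative.
Variables (R : realType) (V W : normedModType R).
Implicit Types (f : V -> W) (a v : V) (d : W).

Lemma is_deriveP f a v d : is_derive a v f d <->
  forall e : R, 0 < e -> exists2 dl : R, 0 < dl &
    forall s : R, `|s| < dl -> `|f (a + s *: v) - f a - s *: d| <= e * `|s|.
Proof.
have key (s : R) : s != 0 ->
    `|f (a + s *: v) - f a - s *: d| = `|s| * `|d - s^-1 *: ((f \o shift a) (s *: v) - f a)|.
  move=> s0; rewrite -normrZ scalerBr scalerA divff // scale1r /= distrC.
  by rewrite (addrC a).
split.
- move=> [df dv] e e0.
  have : \forall s \near 0^', `|d - s^-1 *: ((f \o shift a) (s *: v) - f a)| <= e.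
    by apply: (cvgrPdist_le _ _).1 => //; rewrite -dv; exact: df.
  move=> /nbhs_ballP[dl /= dl0 h]; exists dl => // s hs.
  have [->|s0] := eqVneq s 0; first by rewrite !scale0r addr0 subrr subr0 !normr0 mulr0.
  rewrite key // mulrC ler_wpM2r //; apply: h => //.
  by rewrite /ball /= sub0r normrN.
- move=> h.
  have hc : s^-1 *: ((f \o shift a) (s *: v) - f a) @[s --> 0^'] --> d.
    apply: (cvgrPdist_le _ _).2 => e e0.
    have [dl dl0 hd] := h e e0.
    apply/nbhs_ballP; exists dl => //= s; rewrite /ball /= sub0r normrN => hs s0.
    have := hd s hs; rewrite key // mulrC ler_pM2r // normr_gt0 //.
  by apply: DeriveDef; [apply/cvg_ex; exists d|exact: cvg_lim hc].
Qed.

End DirectionalDerivative.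

Section CurveDerivative.
Variables (R : realType) (V : normedModType R).
Implicit Types (g : R -> V) (t : R) (d : V).

Definition rder g t d := exists2 k : R -> V, {for t, continuous k} /\ k t = d &
  \forall s \near t, g s = g t + (s - t) *: k s.

Lemma rderP g t d : is_derive t 1 g d <-> rder g t d.
Proof.
rewrite is_deriveP; split.
- move=> h; pose k s := if s == t then d else (s - t)^-1 *: (g s - g t).
  have kt : k t = d by rewrite /k eqxx.
  exists k.
    split=> //; apply/cont_normP => e e0; rewrite kt; have [dl dl0 hd] := h e e0.
    exists dl => // s hs; rewrite /k; case: eqP => [_|/eqP st]; first by rewrite subrr normr0 ltW.
    have st0 : s - t != 0 by rewrite subr_eq0.
    have := hd (s - t) hs; have -> : t + (s - t)%:A = s by rewrite /GRing.scale /= mulr1 addrC subrK.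
    rewrite -(ler_pM2l (x := `|s - t|^-1)) ?invr_gt0 ?normr_gt0 //.
    rewrite mulrCA mulVf ?normr_eq0 // mulr1 -normfV -normrZ scalerBr.
    by rewrite scalerA mulVf // scale1r.
  apply/(@near_normP R R^o); exists 1 => // s _; rewrite /k; case: eqP => [->|/eqP st]; first by rewrite subrr scale0r addr0.
  by rewrite scalerA divff ?subr_eq0 // scale1r addrC subrK.
- move=> [k [kc <-] h] e e0.
  have [d1 d10 h1] := (cont_normP k t).1 kc e e0.
  have /near_normP[d2 d20 h2] := h.
  exists (Num.min d1 d2); first by rewrite lt_min d10 d20.
  move=> s; rewrite lt_min => /andP[s1 s2].
  have -> : t + s%:A = t + s by rewrite /GRing.scale /= mulr1.
  have e1 : t + s - t = s by rewrite addrC addKr.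
  rewrite h2 ?e1 // [g t + _]addrC addrK -scalerBr normrZ mulrC ler_wpM2r //.
  by apply: h1; rewrite e1.
Qed.

Lemma rder_cont g t d : rder g t d -> {for t, continuous g}.
Proof.
move=> [k [kc _] h]; apply: (@cont_near_eq _ _ (fun s => g t + (s - t) *: k s)).
  by apply: filterS h => s ->.
apply: cont_add; first exact: cont_cst.
apply: continuousZ => //; apply: continuousB; [exact: cvg_id|exact: cst_continuous].
Qed.

End CurveDerivative.

Section PairScaling.
Variable R : realType.
Lemma cx1Z (r : R) (a : R * R) : (r *: a).1 = r * a.1. Proof. by []. Qed.
Lemma cx2Z (r : R) (a : R * R) : (r *: a).2 = r * a.2. Proof. by []. Qed.
Lemma c21Z (r : R) (a : C2 R) : (r *: a).1 = r *: a.1. Proof. by []. Qed.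
Lemma c22Z (r : R) (a : C2 R) : (r *: a).2 = r *: a.2. Proof. by []. Qed.
Lemma c21D (a b : C2 R) : (a + b).1 = a.1 + b.1. Proof. by []. Qed.
Lemma c22D (a b : C2 R) : (a + b).2 = a.2 + b.2. Proof. by []. Qed.
Lemma c21N (a : C2 R) : (- a).1 = - a.1. Proof. by []. Qed.
Lemma c22N (a : C2 R) : (- a).2 = - a.2. Proof. by []. Qed.
End PairScaling.
Definition c2E := (c21Z, c22Z, c21D, c22D, c21N, c22N).
Definition cxZE := (cx1Z, cx2Z).

(** * Complex differentiability in two variables *)

Section TwoVariables.
Variable R : realType.
Local Notation Cx := (Cx R).
Local Notation C2 := (C2 R).
Implicit Types (f g : C2 -> Cx) (p z h : C2) (d : Cx).

(** The two-variable analogue of [cder]. The pair [g1], [g2] is far from unique, but its values at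
    [p] are the partial derivatives ([cder2_pd]). Sums, products and compositions need no estimates
    in this form. *)
Definition cder2 f p d1 d2 := exists g1 g2 : C2 -> Cx,
  [/\ {for p, continuous g1}, {for p, continuous g2}, g1 p = d1, g2 p = d2 &
   \forall z \near p, f z = f p + (cmul (g1 z) (z.1 - p.1) + cmul (g2 z) (z.2 - p.2))].

Definition clin d1 d2 h : Cx := cmul d1 h.1 + cmul d2 h.2.

Lemma nearT2 p (P : C2 -> Prop) : (forall z, P z) -> \forall z \near p, P z.
Proof. by move=> h; apply/(@near_normP R C2); exists 1. Qed.

Lemma cont_sub1 (q : Cx) p : {for p, continuous (fun z : C2 => z.1 - q)}.
Proof. by apply: (@cont_add R _ Cx); [exact: cvg_fst|exact: cont_cst]. Qed.
Lemma cont_sub2 (q : Cx) p : {for p, continuous (fun z : C2 => z.2 - q)}.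
Proof. by apply: (@cont_add R _ Cx); [exact: cvg_snd|exact: cont_cst]. Qed.

Lemma cont_cadd (T : topologicalType) (F G : T -> Cx) (x : T) :
  {for x, continuous F} -> {for x, continuous G} -> {for x, continuous (fun t => F t + G t)}.
Proof. exact: (@cont_add R T Cx). Qed.
Lemma cont_copp (T : topologicalType) (F : T -> Cx) (x : T) :
  {for x, continuous F} -> {for x, continuous (fun t => - F t)}.
Proof. exact: (@cont_opp R T Cx). Qed.

Lemma cder2_cont f p d1 d2 : cder2 f p d1 d2 -> {for p, continuous f}.
Proof.
move=> [g1 [g2 [c1 c2 _ _ hf]]].
apply: (@cont_near_eq _ _ (fun z => f p + (cmul (g1 z) (z.1 - p.1) + cmul (g2 z) (z.2 - p.2)))).
  by apply: filterS hf => z ->.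
apply: cont_cadd; first exact: cont_cst.
by apply: cont_cadd; apply: cont_cmul; [exact: c1|exact: cont_sub1|exact: c2|exact: cont_sub2].
Qed.

Lemma cder2_near f g p d1 d2 : (\forall z \near p, f z = g z) ->
  cder2 f p d1 d2 -> cder2 g p d1 d2.
Proof.
move=> e [g1 [g2 [c1 c2 e1 e2 hf]]]; exists g1, g2; split=> //.
by rewrite -(nbhs_singleton e); apply: filterS2 e hf => z <-.
Qed.

Lemma cder2_cst c p : cder2 (fun=> c) p 0 0.
Proof.
exists (fun=> 0), (fun=> 0); split; try exact: cont_cst; try by [].
by apply: nearT2 => z; rewrite !cmul0c !addr0.
Qed.

Lemma cder2_fst p : cder2 (fun z => z.1) p (cone R) 0.
Proof.
exists (fun=> cone R), (fun=> 0); split; try exact: cont_cst; try by [].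
by apply: nearT2 => z; rewrite cmul0c cmul1c addr0 addrC subrK.
Qed.

Lemma cder2_snd p : cder2 (fun z => z.2) p 0 (cone R).
Proof.
exists (fun=> 0), (fun=> cone R); split; try exact: cont_cst; try by [].
by apply: nearT2 => z; rewrite cmul0c cmul1c add0r addrC subrK.
Qed.

Lemma cder2D f g p d1 d2 e1 e2 : cder2 f p d1 d2 -> cder2 g p e1 e2 ->
  cder2 (fun z => f z + g z) p (d1 + e1) (d2 + e2).
Proof.
move=> [g1 [g2 [c1 c2 <- <- hf]]] [k1 [k2 [b1 b2 <- <- hg]]].
exists (fun z => g1 z + k1 z), (fun z => g2 z + k2 z); split; try exact: cont_cadd; try by [].
by apply: filterS2 hf hg => z -> ->; apply: cx_eq; rewrite !cxE; ring.
Qed.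

Lemma cder2M f g p d1 d2 e1 e2 : cder2 f p d1 d2 -> cder2 g p e1 e2 ->
  cder2 (fun z => cmul (f z) (g z)) p (cmul d1 (g p) + cmul (f p) e1)
    (cmul d2 (g p) + cmul (f p) e2).
Proof.
move=> hf0 hg0; have cg := cder2_cont hg0; move: hf0 hg0.
move=> [g1 [g2 [c1 c2 <- <- hf]]] [k1 [k2 [b1 b2 <- <- hg]]].
exists (fun z => cmul (g1 z) (g z) + cmul (f p) (k1 z)),
  (fun z => cmul (g2 z) (g z) + cmul (f p) (k2 z)).
have cf : {for p, continuous (fun=> f p)} by exact: cont_cst.
split; [ | |by []|by []|].
- by apply: cont_cadd; [exact: cont_cmul c1 cg|exact: cont_cmul cf b1].
- by apply: cont_cadd; [exact: cont_cmul c2 cg|exact: cont_cmul cf b2].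
apply: filterS2 hf hg => z ef eg; rewrite ef eg.
move: (f p) (g p) (g1 z) (g2 z) (k1 z) (k2 z) (z.1 - p.1) (z.2 - p.2) => *.
by apply: cx_eq; rewrite !cxE; ring.
Qed.

Lemma cder2Z c f p d1 d2 : cder2 f p d1 d2 ->
  cder2 (fun z => cmul c (f z)) p (cmul c d1) (cmul c d2).
Proof.
by move=> h; have := cder2M (cder2_cst c p) h; rewrite !cmul0c !add0r.
Qed.

Lemma cder2B f g p d1 d2 e1 e2 : cder2 f p d1 d2 -> cder2 g p e1 e2 ->
  cder2 (fun z => f z - g z) p (d1 - e1) (d2 - e2).
Proof.
move=> hf hg; have := cder2D hf (cder2Z (- cone R) hg).
rewrite !cmulNl !cmul1c; apply: cder2_near.
by apply: nearT2 => z; rewrite cmulNl cmul1c.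
Qed.

Lemma cder2_comp (F : Cx -> Cx) f p d1 d2 d : cder F (f p) d -> cder2 f p d1 d2 ->
  cder2 (fun z => F (f z)) p (cmul d d1) (cmul d d2).
Proof.
move=> [q [qc <-] hq] hf0; have cf := cder2_cont hf0; move: hf0.
move=> [g1 [g2 [c1 c2 <- <- hf]]].
have cq : {for p, continuous (fun z => q (f z))} by apply: (continuous_comp cf).
exists (fun z => cmul (q (f z)) (g1 z)), (fun z => cmul (q (f z)) (g2 z)).
split; [exact: cont_cmul|exact: cont_cmul|by []|by []|].
have hq' : \forall z \near p, F (f z) = F (f p) + cmul (q (f z)) (f z - f p).
  exact: (cf _ hq).
apply: filterS2 hf hq' => z ef ->; congr (_ + _).
move: (q (f z)) => Q; rewrite ef.
move: (f p) (g1 z) (g2 z) (z.1 - p.1) (z.2 - p.2) => *.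
by apply: cx_eq; rewrite !cxE; ring.
Qed.

Lemma cder2V f p d1 d2 : f p != 0 -> cder2 f p d1 d2 ->
  exists e1 e2, cder2 (fun z => cinv (f z)) p e1 e2.
Proof.
move=> f0 hf; have h := cderV (f := fun w => w) f0 (cder_id (f p)).
by have := cder2_comp h hf; eexists; eexists; eassumption.
Qed.

Lemma cder2_shift f p (a : C2) d1 d2 : cder2 f (p + a) d1 d2 ->
  cder2 (fun z => f (z + a)) p d1 d2.
Proof.
move=> [g1 [g2 [c1 c2 <- <- hf]]].
have ca : {for p, continuous (fun z : C2 => z + a)}.
  by apply: (@cont_add R _ C2); [exact: cvg_id|exact: cont_cst].
exists (fun z => g1 (z + a)), (fun z => g2 (z + a)).
split; [exact: (continuous_comp ca)|exact: (continuous_comp ca)|by []|by []|].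
have hf' : \forall z \near p, f (z + a) = f (p + a) +
    (cmul (g1 (z + a)) ((z + a).1 - (p + a).1) + cmul (g2 (z + a)) ((z + a).2 - (p + a).2)).
  exact: (ca _ hf).
have e (U : zmodType) (x y b : U) : (x + b) - (y + b) = x - y.
  by rewrite opprD addrACA subrr addr0.
by apply: filterS hf' => z ->; rewrite [(z + a).1]c21D [(p + a).1]c21D [(z + a).2]c22D [(p + a).2]c22D !e.
Qed.

Lemma cder2_slice1 f p d1 d2 : cder2 f p d1 d2 -> cder (fun w => f (w, p.2)) p.1 d1.
Proof.
move=> [g1 [g2 [c1 _ <- _ hf]]].
have ca : {for p.1, continuous (fun w : Cx => (w, p.2))}.
  by apply: cont_pair; [exact: cvg_id|exact: cont_cst].
have ep : p = (p.1, p.2) by case: (p).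
rewrite {1}ep in hf; rewrite {1}ep in c1.
exists (fun w => g1 (w, p.2)).
  split; last by rewrite -ep.
  exact: (continuous_comp ca).
have hf' : \forall w \near p.1, f (w, p.2) = f p + (cmul (g1 (w, p.2)) (w - p.1) + cmul (g2 (w, p.2)) (p.2 - p.2)).
  exact: (ca _ hf).
by apply: filterS hf' => w ->; rewrite -ep subrr cmulc0 addr0.
Qed.

Lemma cder2_slice2 f p d1 d2 : cder2 f p d1 d2 -> cder (fun w => f (p.1, w)) p.2 d2.
Proof.
move=> [g1 [g2 [_ c2 _ <- hf]]].
have ca : {for p.2, continuous (fun w : Cx => (p.1, w))}.
  by apply: cont_pair; [exact: cont_cst|exact: cvg_id].
have ep : p = (p.1, p.2) by case: (p).
rewrite {1}ep in hf; rewrite {1}ep in c2.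
exists (fun w => g2 (p.1, w)).
  split; last by rewrite -ep.
  exact: (continuous_comp ca).
have hf' : \forall w \near p.2, f (p.1, w) = f p + (cmul (g1 (p.1, w)) (p.1 - p.1) + cmul (g2 (p.1, w)) (w - p.2)).
  exact: (ca _ hf).
by apply: filterS hf' => w ->; rewrite -ep subrr cmulc0 add0r.
Qed.

Lemma cder2_curve f (c : R -> C2) t v d1 d2 : rder c t v -> cder2 f (c t) d1 d2 ->
  rder (fun s => f (c s)) t (clin d1 d2 v).
Proof.
move=> hc [g1 [g2 [c1 c2 <- <- hf]]]; have cc := rder_cont hc.
move: hc => [k [kc <-] hk].
exists (fun s => cmul (g1 (c s)) (k s).1 + cmul (g2 (c s)) (k s).2).
  split; last by [].
  apply: cont_cadd; apply: cont_cmul.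
  - exact: (continuous_comp cc).
  - exact: cont_fst.
  - exact: (continuous_comp cc).
  - exact: cont_snd.
have hf' : \forall s \near t, f (c s) = f (c t) +
    (cmul (g1 (c s)) ((c s).1 - (c t).1) + cmul (g2 (c s)) ((c s).2 - (c t).2)).
  exact: (cc _ hf).
apply: filterS2 hk hf' => s ek ->; congr (_ + _).
move: (g1 _) (g2 _) => G1 G2; rewrite ek.
by apply: cx_eq; rewrite !(cxE, c2E, cxZE); ring.
Qed.

Lemma rder_fst (c : R -> Cx) t v : rder c t v -> is_derive t 1 (fun s => (c s).1) v.1.
Proof.
move=> [k [kc <-] hk]; apply/(@rderP _ R); exists (fun s => (k s).1).
  by split; [exact: cont_fst|].
by apply: filterS hk => s ->.
Qed.

Lemma rder_snd (c : R -> Cx) t v : rder c t v -> is_derive t 1 (fun s => (c s).2) v.2.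
Proof.
move=> [k [kc <-] hk]; apply/(@rderP _ R); exists (fun s => (k s).2).
  by split; [exact: cont_snd|].
by apply: filterS hk => s ->.
Qed.

Lemma norm_fst_le (U U' : normedModType R) (x : U * U') : `|x.1| <= `|x|.
Proof. by rewrite {2}/Num.norm /= le_max lexx. Qed.
Lemma norm_snd_le (U U' : normedModType R) (x : U * U') : `|x.2| <= `|x|.
Proof. by rewrite {2}/Num.norm /= le_max lexx orbT. Qed.

Lemma norm_cmul (a b : Cx) : `|cmul a b| <= 4 * `|a| * `|b|.
Proof.
apply: (le_trans (cabs_ge_norm _)); rewrite cabsM.
apply: (@le_trans _ _ ((2 * `|a|) * (2 * `|b|))).
  by apply: ler_pM; rewrite ?cabs_ge0 // cabs_le_norm.
by rewrite le_eqVlt; apply/orP; left; apply/eqP; ring.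
Qed.

Lemma cder2_norm f p d1 d2 : cder2 f p d1 d2 -> forall e : R, 0 < e ->
  exists2 dl : R, 0 < dl & forall h, `|h| < dl -> `|f (p + h) - f p - clin d1 d2 h| <= e * `|h|.
Proof.
move=> [g1 [g2 [c1 c2 <- <- hf]]] e e0.
have e8 : 0 < e / 8 by lra.
have [a1 a10 h1] := (cont_normP g1 p).1 c1 _ e8.
have [a2 a20 h2] := (cont_normP g2 p).1 c2 _ e8.
have /near_normP[a3 a30 h3] := hf.
exists (Num.min a1 (Num.min a2 a3)); first by rewrite !lt_min a10 a20 a30.
move=> h; rewrite !lt_min => /and3P[b1 b2 b3].
have e1 : p + h - p = h by rewrite addrC addKr.
rewrite h3 ?e1 //.
have -> : f p + (cmul (g1 (p + h)) ((p + h).1 - p.1) + cmul (g2 (p + h)) ((p + h).2 - p.2)) - f p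
   - clin (g1 p) (g2 p) h = cmul (g1 (p + h) - g1 p) h.1 + cmul (g2 (p + h) - g2 p) h.2.
  rewrite /clin; move: (f p) (g1 _) (g2 _) (g1 _) (g2 _) => *.
  by apply: cx_eq; rewrite !cxE; ring.
have k1 : `|g1 (p + h) - g1 p| <= e / 8 by apply: h1; rewrite e1.
have k2 : `|g2 (p + h) - g2 p| <= e / 8 by apply: h2; rewrite e1.
apply: (le_trans (ler_normD _ _)).
have m1 := norm_cmul (g1 (p + h) - g1 p) h.1.
have m2 := norm_cmul (g2 (p + h) - g2 p) h.2.
have n1 := norm_fst_le h; have n2 := norm_snd_le h.
have w1 : 4 * `|g1 (p + h) - g1 p| * `|h.1| <= 4 * (e / 8) * `|h|.
  by apply: ler_pM => //; rewrite ?mulr_ge0 // ler_pM2l.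
have w2 : 4 * `|g2 (p + h) - g2 p| * `|h.2| <= 4 * (e / 8) * `|h|.
  by apply: ler_pM => //; rewrite ?mulr_ge0 // ler_pM2l.
have -> : e * `|h| = 4 * (e / 8) * `|h| + 4 * (e / 8) * `|h| by field.
by rewrite lerD // ?(le_trans m1) // (le_trans m2).
Qed.

(** The remainder [r] is distributed over the two increments with weights [conj (z_i - p_i) / n];
    paired with the increments these add up to one, and [r = o(|z - p|)] makes both corrections
    continuous with value zero at [p]. *)
Lemma norm_cder2 f p d1 d2 : (forall e : R, 0 < e ->
  exists2 dl : R, 0 < dl & forall h, `|h| < dl -> `|f (p + h) - f p - clin d1 d2 h| <= e * `|h|) ->
  cder2 f p d1 d2.
Proof.
move=> H.
pose r (z : C2) : Cx := f z - f p - clin d1 d2 (z - p).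
pose n z := cnorm2 (z.1 - p.1) + cnorm2 (z.2 - p.2).
pose k1 z := cmul (r z) (cmul (@creal R (n z)^-1) (cconj (z.1 - p.1))).
pose k2 z := cmul (r z) (cmul (@creal R (n z)^-1) (cconj (z.2 - p.2))).
have rp : r p = 0 by rewrite /r /clin !subrr /= !cmulc0 addr0 subr0.
have nle z : `|z - p| ^+ 2 <= n z.
  rewrite /n; have [h|h] := leP `|z.1 - p.1| `|z.2 - p.2|.
    have -> : `|z - p| = `|z.2 - p.2| by rewrite {1}/Num.norm /=; apply/max_idPr.
    by apply: ler_wpDl; rewrite ?cnorm2_ge0 // cnorm2_cabs ler_sqr ?nnegrE ?cabs_ge0 // cabs_ge_norm.
  have -> : `|z - p| = `|z.1 - p.1| by rewrite {1}/Num.norm /=; apply/max_idPl; exact: ltW.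
  by apply: ler_wpDr; rewrite ?cnorm2_ge0 // cnorm2_cabs ler_sqr ?nnegrE ?cabs_ge0 // cabs_ge_norm.
have n0 z : 0 <= n z by rewrite addr_ge0 ?cnorm2_ge0.
have small (i : bool) : forall e : R, 0 < e -> exists2 dl : R, 0 < dl &
    forall z, `|z - p| < dl -> `|cmul (r z) (cmul (@creal R (n z)^-1) (cconj (if i then z.1 - p.1 else z.2 - p.2)))| <= e.
  move=> e e0; have e4 : 0 < e / 4 by lra.
  have [dl dl0 hd] := H _ e4; exists dl => // z hz.
  have [->|zp] := eqVneq z p; first by rewrite rp cmul0c normr0 ltW.
  have zp0 : 0 < `|z - p| by rewrite normr_gt0 subr_eq0.
  have hr : `|r z| <= e / 4 * `|z - p|.
    have := hd (z - p) hz; rewrite /r; have -> : p + (z - p) = z by rewrite addrC subrK.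
    by [].
  apply: (le_trans (cabs_ge_norm _)); rewrite !cabsM.
  have a1 : cabs (r z) <= e / 2 * `|z - p|.
    by apply: (le_trans (cabs_le_norm _)); rewrite (_ : e / 2 * _ = 2 * (e / 4 * `|z - p|)) ?ler_pM2l //; field.
  have a2 : cabs (@creal R (n z)^-1) <= (`|z - p| ^+ 2)^-1.
    have np : 0 < n z by apply: lt_le_trans (nle z); rewrite exprn_gt0.
    by rewrite creal_abs ger0_norm ?invr_ge0 // lef_pV2 ?posrE ?exprn_gt0.
  have a3 : cabs (cconj (if i then z.1 - p.1 else z.2 - p.2)) <= 2 * `|z - p|.
    have -> (c : Cx) : cabs (cconj c) = cabs c by rewrite /cabs /cnorm2 /= sqrrN.
    apply: (le_trans (cabs_le_norm _)); rewrite ler_pM2l //.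
    by case: i; [exact: (norm_fst_le (z - p))|exact: (norm_snd_le (z - p))].
  apply: (@le_trans _ _ (e / 2 * `|z - p| * ((`|z - p| ^+ 2)^-1 * (2 * `|z - p|)))).
    apply: ler_pM => //; rewrite ?cabs_ge0 ?mulr_ge0 ?cabs_ge0 //.
    by apply: ler_pM => //; rewrite ?cabs_ge0.
  by rewrite le_eqVlt; apply/orP; left; apply/eqP; field; rewrite gt_eqF.
exists (fun z => d1 + k1 z), (fun z => d2 + k2 z).
have k1p : k1 p = 0 by rewrite /k1 rp cmul0c.
have k2p : k2 p = 0 by rewrite /k2 rp cmul0c.
split; rewrite ?k1p ?k2p ?addr0 //.
- apply: cont_cadd; first exact: cont_cst.
  apply/(@cont_normP R C2 Cx) => e e0; have [dl dl0 hd] := small true e e0.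
  by exists dl => // z /hd; rewrite k1p subr0.
- apply: cont_cadd; first exact: cont_cst.
  apply/(@cont_normP R C2 Cx) => e e0; have [dl dl0 hd] := small false e e0.
  by exists dl => // z /hd; rewrite k2p subr0.
- apply: nearT2 => z.
  have [->|zp] := eqVneq z p; first by rewrite !subrr !cmulc0 !addr0.
  have np : n z != 0.
    by rewrite gt_eqF // (lt_le_trans _ (nle z)) // exprn_gt0 // normr_gt0 subr_eq0.
  have e : r z = cmul (k1 z) (z.1 - p.1) + cmul (k2 z) (z.2 - p.2).
    rewrite /k1 /k2; move: (r z) np; rewrite /n /cnorm2.
    move: (z.1 - p.1) (z.2 - p.2) => [x1 y1] [x2 y2] [r1 r2] /= np.
    by apply: cx_eq; rewrite !cxE /=; field.
  have -> : cmul (d1 + k1 z) (z.1 - p.1) + cmul (d2 + k2 z) (z.2 - p.2) = clin d1 d2 (z - p) + r z.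
    rewrite e /clin; move: (k1 z) (k2 z) => *.
    by apply: cx_eq; rewrite !cxE; ring.
  rewrite /r; move: (f z) (f p) (clin _ _ _) => a b c.
  by rewrite [c + _]addrC subrK addrC subrK.
Qed.

End TwoVariables.

(** * Explicit form of the Frechet derivative *)

Section Frechet.
Variables (R : realType) (V W : normedModType R).

Lemma frechet_diff (f : V -> W) (L : {linear V -> W}) x : continuous L ->
  (forall e : R, 0 < e -> exists2 dl : R, 0 < dl &
     forall h, `|h| < dl -> `|f (x + h) - f x - L h| <= e * `|h|) ->
  differentiable f x /\ 'd f x = L :> (V -> W).
Proof.
move=> cL H.
have e : f \o shift x = cst (f x) + L +o_ 0 id.
  apply/eqaddoP => e e0; have [dl dl0 hd] := H e e0.
  apply/near_normP; exists dl => // h; rewrite subr0 => /hd.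
  have -> : (f \o shift x - (cst (f x) + L)) h = f (x + h) - f x - L h.
    by rewrite -[LHS]/(f (h + x) - (f x + L h)) opprD addrA [x + h]addrC.
  by [].
have ed : 'd f x = L :> (V -> W) by exact: diff_unique.
by split=> //; apply/diff_locallyP; rewrite ed.
Qed.

Lemma diff_frechet (f : V -> W) x : differentiable f x ->
  forall e : R, 0 < e -> exists2 dl : R, 0 < dl &
     forall h, `|h| < dl -> `|f (x + h) - f x - 'd f x h| <= e * `|h|.
Proof.
move=> df e e0.
have /eqaddoP/(_ e e0) := diff_locally df.
move=> /near_normP[dl dl0 hd]; exists dl => // h hh.
have := hd h; rewrite subr0 => /(_ hh).
have -> : (f \o shift x - (cst (f x) + 'd f x)) h = f (x + h) - f x - 'd f x h.
  by rewrite -[LHS]/(f (h + x) - (f x + 'd f x h)) opprD addrA [x + h]addrC.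
by [].
Qed.

End Frechet.

(** * Holomorphic functions of two variables and their Cauchy estimates *)

Section Holomorphic.
Variable R : realType.
Local Notation Cx := (Cx R).
Local Notation C2 := (C2 R).
Implicit Types (f g : C2 -> Cx) (p z h : C2) (d : Cx).

Lemma clin_is_linear d1 d2 : linear (clin d1 d2 : C2 -> Cx).
Proof. by move=> r x y; apply: cx_eq; rewrite /clin !(cxE, c2E, cxZE); ring. Qed.

HB.instance Definition _ d1 d2 :=
  GRing.isLinear.Build R C2 Cx *:%R (clin d1 d2) (clin_is_linear d1 d2).

Lemma clin_continuous d1 d2 : continuous (clin d1 d2 : C2 -> Cx).
Proof.
move=> z.
have h : {for z, continuous (fun h : C2 => cmul d1 h.1 + cmul d2 h.2)}.
  apply: cont_cadd; apply: cont_cmul.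
  - exact: cont_cst.
  - exact: cvg_fst.
  - exact: cont_cst.
  - exact: cvg_snd.
exact: h.
Qed.

Lemma cder2_diff f p d1 d2 : cder2 f p d1 d2 ->
  differentiable f p /\ forall h, 'd f p h = clin d1 d2 h.
Proof.
move=> hf.
have [df e] := @frechet_diff R C2 Cx f (clin d1 d2) p (@clin_continuous d1 d2) (cder2_norm hf).
by split => // h; rewrite e.
Qed.

Definition e1 : C2 := (cone R, 0).
Definition e2 : C2 := (0, cone R).
Definition pd1 f p : Cx := 'd f p e1.
Definition pd2 f p : Cx := 'd f p e2.

Lemma cder2_pd f p d1 d2 : cder2 f p d1 d2 -> pd1 f p = d1 /\ pd2 f p = d2.
Proof.
move=> /cder2_diff[_ h]; rewrite /pd1 /pd2 !h /clin /= !cmulc1 !cmulc0.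
by rewrite addr0 add0r.
Qed.

(** Commuting with [cI] makes the real differential complex linear, so that it is determined by its
    values on [e1] and [e2]. *)
Lemma diff_cder2 f p : differentiable f p ->
  (forall h, 'd f p (Defs.cscale (cI R) h) = cmul (cI R) ('d f p h)) ->
  cder2 f p (pd1 f p) (pd2 f p).
Proof.
move=> df hI.
have ed h : 'd f p h = clin (pd1 f p) (pd2 f p) h.
  have -> : h = h.1.1 *: e1 + h.1.2 *: Defs.cscale (cI R) e1
      + h.2.1 *: e2 + h.2.2 *: Defs.cscale (cI R) e2.
    case: h => [[x1 y1] [x2 y2]]; rewrite /e1 /e2 /Defs.cscale /=.
    by congr pair; apply: cx_eq; rewrite !(cxE, c2E, cxZE) /=; ring.
  rewrite !linearD !linearZ /= !hI -/(pd1 f p) -/(pd2 f p).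
  case: h => [[x1 y1] [x2 y2]].
  by apply: cx_eq; rewrite /clin /e1 /e2 !(cxE, c2E, cxZE) /=; ring.
apply: norm_cder2 => e e0; have [dl dl0 hd] := @diff_frechet R C2 Cx f p df e e0.
by exists dl => // h /hd; rewrite ed.
Qed.

Definition holat f p := exists d1 d2, cder2 f p d1 d2.

Lemma holat_pd f p : holat f p -> cder2 f p (pd1 f p) (pd2 f p).
Proof. by move=> [d1 [d2 h]]; have [-> ->] := cder2_pd h. Qed.

Lemma holat_d f p h : holat f p -> 'd f p h = clin (pd1 f p) (pd2 f p) h.
Proof. by move=> /holat_pd/cder2_diff[_ ->]. Qed.

Lemma holomorphic_onP (W : set C2) f :
  holomorphic_on W f <-> forall p, W p -> holat f p.
Proof.
split=> h p Wp.
- have [df hI] := h p Wp; exists (pd1 f p), (pd2 f p); exact: diff_cder2.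
- have hp := h p Wp; have [d1 [d2 /cder2_diff[df ed]]] := hp.
  split=> // v; rewrite !ed /clin /=.
  by apply: cx_eq; rewrite !(cxE, c2E); ring.
Qed.

Lemma holat_cont f p : holat f p -> {for p, continuous f}.
Proof. by move=> [d1 [d2 /cder2_cont]]. Qed.
Lemma holat_cst c p : holat (fun=> c) p.
Proof. by exists 0, 0; exact: cder2_cst. Qed.
Lemma holat_fst p : holat (fun z => z.1) p.
Proof. by exists (cone R), 0; exact: cder2_fst. Qed.
Lemma holat_snd p : holat (fun z => z.2) p.
Proof. by exists 0, (cone R); exact: cder2_snd. Qed.
Lemma holatD f g p : holat f p -> holat g p -> holat (fun z => f z + g z) p.
Proof. by move=> [? [? h]] [? [? h']]; eexists; eexists; exact: cder2D h h'. Qed.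
Lemma holatB f g p : holat f p -> holat g p -> holat (fun z => f z - g z) p.
Proof. by move=> [? [? h]] [? [? h']]; eexists; eexists; exact: cder2B h h'. Qed.
Lemma holatM f g p : holat f p -> holat g p -> holat (fun z => cmul (f z) (g z)) p.
Proof. by move=> [? [? h]] [? [? h']]; eexists; eexists; exact: cder2M h h'. Qed.
Lemma holatZ c f p : holat f p -> holat (fun z => cmul c (f z)) p.
Proof. by move=> h; apply: holatM => //; exact: holat_cst. Qed.
Lemma holatV f p : f p != 0 -> holat f p -> holat (fun z => cinv (f z)) p.
Proof. by move=> f0 [? [? h]]; exact: cder2V f0 h. Qed.
Lemma holat_comp (F : Cx -> Cx) f p d : cder F (f p) d -> holat f p ->
  holat (fun z => F (f z)) p.
Proof. by move=> hF [? [? h]]; eexists; eexists; exact: cder2_comp hF h. Qed.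
Lemma holat_shift f p (a : C2) : holat f (p + a) -> holat (fun z => f (z + a)) p.
Proof. by move=> [? [? h]]; eexists; eexists; exact: cder2_shift h. Qed.
Lemma pdB f g p : holat f p -> holat g p ->
  pd1 (fun z => f z - g z) p = pd1 f p - pd1 g p /\
  pd2 (fun z => f z - g z) p = pd2 f p - pd2 g p.
Proof. by move=> /holat_pd hf /holat_pd hg; have := cder2_pd (cder2B hf hg). Qed.

Lemma pdM f g p : holat f p -> holat g p ->
  pd1 (fun z => cmul (f z) (g z)) p = cmul (pd1 f p) (g p) + cmul (f p) (pd1 g p) /\
  pd2 (fun z => cmul (f z) (g z)) p = cmul (pd2 f p) (g p) + cmul (f p) (pd2 g p).
Proof. by move=> /holat_pd hf /holat_pd hg; have := cder2_pd (cder2M hf hg). Qed.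

Lemma pd_shift f p (a : C2) : holat f (p + a) ->
  pd1 (fun z => f (z + a)) p = pd1 f (p + a) /\ pd2 (fun z => f (z + a)) p = pd2 f (p + a).
Proof. by move=> /holat_pd hf; have := cder2_pd (cder2_shift hf). Qed.

Definition holball f p (r : R) := forall z, `|z - p| < r -> holat f z.

Lemma holball_sub f p q (r s : R) : `|q - p| + s <= r -> holball f p r -> holball f q s.
Proof.
move=> h hf z hz; apply: hf; have -> : z - p = (z - q) + (q - p) by rewrite addrA subrK.
by apply: le_lt_trans (ler_normD _ _) _; lra.
Qed.

Lemma cauchy_pd f p (r M : R) : 0 < r -> holball f p r ->
  (forall z, `|z - p| < r -> cabs (f z) <= M) ->
  cabs (pd1 f p) <= 16 * M / r /\ cabs (pd2 f p) <= 16 * M / r.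
Proof.
move=> r0 hf hM.
have hp : holat f p by apply: hf; rewrite subrr normr0.
have s0 : 0 < r / 2 by lra.
have np (a b : Cx) : `|((a, b) : C2)| = Num.max `|a| `|b| by [].
have n1 (w : Cx) : `|(w, p.2) - p| = `|w - p.1|.
  have -> : (w, p.2) - p = (w - p.1, p.2 - p.2) by [].
  by rewrite np subrr normr0; apply/max_idPl.
have n2 (w : Cx) : `|(p.1, w) - p| = `|w - p.2|.
  have -> : (p.1, w) - p = (p.1 - p.1, w - p.2) by [].
  by rewrite np subrr normr0; apply/max_idPr.
(* The estimate is applied at radius [r / 2], so that the closed square lies in the open ball, to
   increments bounded by [2 M]. *)
have e : 16 * M / r = 4 * (2 * M / (r / 2)) by field; rewrite gt_eqF.
have Mp : cabs (f p) <= M by apply: hM; rewrite subrr normr0.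
split; rewrite e.
- apply: (@cauchy_deriv R (fun w => f (w, p.2)) p.1 (r / 2)) => //.
  + move=> w hw; have hq : holat f (w, p.2) by apply: hf; rewrite n1; lra.
    by exists (pd1 f (w, p.2)); exact: (cder2_slice1 (holat_pd hq)).
  + exact: (cder2_slice1 (holat_pd hp)).
  + move=> w hw; apply: (le_trans (cabsB _ _)); rewrite -surjective_pairing.
    have : cabs (f (w, p.2)) <= M by apply: hM; rewrite n1; lra.
    lra.
- apply: (@cauchy_deriv R (fun w => f (p.1, w)) p.2 (r / 2)) => //.
  + move=> w hw; have hq : holat f (p.1, w) by apply: hf; rewrite n2; lra.
    by exists (pd2 f (p.1, w)); exact: (cder2_slice2 (holat_pd hq)).
  + exact: (cder2_slice2 (holat_pd hp)).
  + move=> w hw; apply: (le_trans (cabsB _ _)); rewrite -surjective_pairing.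
    have : cabs (f (p.1, w)) <= M by apply: hM; rewrite n2; lra.
    lra.
Qed.

Lemma rder_line p h t : rder (fun s : R => p + s *: h) t h.
Proof.
exists (fun=> h); first by split => //; exact: cont_cst.
apply/(@near_normP R R^o); exists 1 => // s _.
by rewrite -addrA -scalerDl addrCA subrr addr0.
Qed.

Lemma clin_bound d1 d2 h (D : R) : cabs d1 <= D -> cabs d2 <= D ->
  cabs (clin d1 d2 h) <= 4 * D * `|h|.
Proof.
move=> h1 h2; apply: (le_trans (cabsD _ _)); rewrite !cabsM.
have n1 := norm_fst_le h; have n2 := norm_snd_le h.
have c1 : cabs h.1 <= 2 * `|h| by apply: (le_trans (cabs_le_norm _)); rewrite ler_pM2l.
have c2 : cabs h.2 <= 2 * `|h| by apply: (le_trans (cabs_le_norm _)); rewrite ler_pM2l.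
have a1 : cabs d1 * cabs h.1 <= D * (2 * `|h|) by apply: ler_pM; rewrite ?cabs_ge0.
have a2 : cabs d2 * cabs h.2 <= D * (2 * `|h|) by apply: ler_pM; rewrite ?cabs_ge0.
apply: (le_trans (lerD a1 a2)).
by rewrite le_eqVlt; apply/orP; left; apply/eqP; ring.
Qed.

(** The mean value theorem gives different intermediate points for the real and the imaginary part,
    hence the factor 2. *)
Lemma segment_mvt f p h (L : Cx) (B : R) :
  (forall t : R, 0 <= t <= 1 -> holat f (p + t *: h)) ->
  (forall t : R, 0 <= t <= 1 -> cabs ('d f (p + t *: h) h - L) <= B) ->
  cabs (f (p + h) - f p - L) <= 2 * B.
Proof.
move=> hf hB.
have rd (t : R) : 0 <= t <= 1 -> rder (fun s : R => f (p + s *: h)) t ('d f (p + t *: h) h).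
  move=> ht; rewrite holat_d; last exact: hf.
  by apply: cder2_curve; [exact: rder_line|apply: holat_pd; exact: hf].
have fin (b : bool) (c := fun x : Cx => if b then x.1 else x.2) :
    `|c (f (p + h)) - c (f p) - c L| <= B.
  have der (t : R) : 0 <= t <= 1 -> is_derive t 1 (fun s : R => c (f (p + s *: h))) (c ('d f (p + t *: h) h)).
    move=> ht; rewrite /c; case: b @c => /=; first exact: rder_fst (rd t ht).
    exact: rder_snd (rd t ht).
  have [||t ht] := @MVT_segment R (fun s : R => c (f (p + s *: h)))
     (fun t => c ('d f (p + t *: h) h)) 0 1 ler01.
  - by move=> t; rewrite in_itv /= => /andP[t0 t1]; apply: der; rewrite !ltW.
  - apply: continuous_in_subspaceT => t; rewrite inE /= in_itv /= => ht.
    have /rderP/rder_cont := der t ht; exact.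
  rewrite scale1r scale0r addr0 subr0 mulr1 => e.
  rewrite e; have ht' : 0 <= t <= 1 by move: ht; rewrite in_itv.
  apply: le_trans (hB t ht'); rewrite /c; case: b @c der e => /= der e.
    exact: (cabs_ge_re ('d f (p + t *: h) h - L)).
  exact: (cabs_ge_im ('d f (p + t *: h) h - L)).
apply: (le_trans (cabs_le_sum _)).
have h1 := fin true; have h2 := fin false; rewrite /= in h1 h2.
by rewrite !cxE; lra.
Qed.

Lemma ball_seg p z h (r t : R) : `|z - p| < r -> `|z + h - p| < r -> 0 <= t <= 1 ->
  `|z + t *: h - p| < r.
Proof.
move=> h0 h1 /andP[t0 t1].
have -> : z + t *: h - p = (1 - t) *: (z - p) + t *: (z + h - p).
  case: z h p {h0 h1} => [[? ?] [? ?]] [[? ?] [? ?]] [[? ?] [? ?]].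
  by congr pair; apply: cx_eq; rewrite !(c2E, cxE, cxZE) /=; ring.
apply: (le_lt_trans (ler_normD _ _)); rewrite !normrZ (ger0_norm t0) ger0_norm ?subr_ge0 //.
have [t2|t2] := leP t (1 / 2).
  have : 0 < (1 - t) * (r - `|z - p|) by rewrite mulr_gt0 //; lra.
  have : 0 <= t * (r - `|z + h - p|) by rewrite mulr_ge0 //; lra.
  lra.
have : 0 <= (1 - t) * (r - `|z - p|) by rewrite mulr_ge0 //; lra.
have : 0 < t * (r - `|z + h - p|) by rewrite mulr_gt0 //; lra.
lra.
Qed.

Lemma holball_lip f p (r M : R) z h : 0 < r -> holball f p r ->
  (forall z, `|z - p| < r -> cabs (f z) <= M) ->
  `|z - p| < r / 2 -> `|z + h - p| < r / 2 ->
  cabs (f (z + h) - f z) <= 256 * M / r * `|h|.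
Proof.
move=> r0 hf hM hz hzh.
have H : cabs (f (z + h) - f z - 0) <= 2 * (4 * (32 * M / r) * `|h|).
  apply: segment_mvt => t ht; have hs := ball_seg hz hzh ht.
    by apply: hf; lra.
  have hs' : holat f (z + t *: h) by apply: hf; lra.
  have r2 : 0 < r / 2 by lra.
  have hb : holball f (z + t *: h) (r / 2) by apply: holball_sub hf; lra.
  have hbM w : `|w - (z + t *: h)| < r / 2 -> cabs (f w) <= M.
    move=> hw; apply: hM; have -> : w - p = (w - (z + t *: h)) + (z + t *: h - p) by rewrite addrA subrK.
    by apply: le_lt_trans (ler_normD _ _) _; lra.
  have [p1 p2] := cauchy_pd r2 hb hbM.
  have e : 16 * M / (r / 2) = 32 * M / r by field; rewrite gt_eqF.
  by rewrite subr0 holat_d //; apply: clin_bound; rewrite -e.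
rewrite subr0 in H; apply: (le_trans H); rewrite le_eqVlt; apply/orP; left; apply/eqP.
by field; rewrite gt_eqF.
Qed.

Definition Clip : R := 16 * 256 * 4.

Lemma Clip_ge0 : 0 <= Clip. Proof. by rewrite /Clip -!natrM ler0n. Qed.

(** Cauchy's estimate is applied to [f (z + h) - f z], which is already [O(|h|)] on a smaller ball.
    This controls the variation of the partial derivatives before they are known to be holomorphic.
    The factors of [Clip] come from [cauchy_pd], [holball_lip] and the radius [r / 4]. *)
Lemma pd_lip f p (r M : R) h : 0 < r -> holball f p r ->
  (forall z, `|z - p| < r -> cabs (f z) <= M) -> `|h| < r / 4 ->
  cabs (pd1 f (p + h) - pd1 f p) <= Clip * M / r ^+ 2 * `|h| /\
  cabs (pd2 f (p + h) - pd2 f p) <= Clip * M / r ^+ 2 * `|h|.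
Proof.
move=> r0 hf hM hh.
have hp : holat f p by apply: hf; rewrite subrr normr0.
have hph : holat f (p + h) by apply: hf; rewrite addrC addKr; lra.
have b z : `|z - p| < r / 4 -> `|z - p| < r / 2 /\ `|z + h - p| < r / 2.
  move=> hz; split; first lra.
  by rewrite addrAC; apply: le_lt_trans (ler_normD _ _) _; lra.
have r4 : 0 < r / 4 by lra.
have hs : holball (fun z => f (z + h) - f z) p (r / 4).
  move=> z /b[z1 z2]; apply: holatB; last by apply: hf; lra.
  by apply: holat_shift; apply: hf; lra.
have hb z : `|z - p| < r / 4 -> cabs (f (z + h) - f z) <= 256 * M / r * `|h|.
  by move=> /b[z1 z2]; exact: (holball_lip r0 hf hM).
have := cauchy_pd r4 hs hb.
have [-> ->] := pdB (holat_shift hph) hp.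
have [-> ->] := pd_shift hph.
by have -> : 16 * (256 * M / r * `|h|) / (r / 4) = Clip * M / r ^+ 2 * `|h|
  by rewrite /Clip; field; rewrite gt_eqF.
Qed.

Definition Ctay : R := 8 * Clip.

Lemma holball_taylor f p (r M : R) h : 0 < r -> holball f p r ->
  (forall z, `|z - p| < r -> cabs (f z) <= M) -> `|h| < r / 4 ->
  cabs (f (p + h) - f p - clin (pd1 f p) (pd2 f p) h) <= Ctay * M / r ^+ 2 * `|h| ^+ 2.
Proof.
move=> r0 hf hM hh.
have th (t : R) : 0 <= t <= 1 -> `|t *: h| <= `|h|.
  by move=> /andP[t0 t1]; rewrite normrZ ger0_norm // ler_piMl.
have M0 : 0 <= M by apply: le_trans (cabs_ge0 (f p)) (hM p _); rewrite subrr normr0.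
have hs (t : R) : 0 <= t <= 1 -> holat f (p + t *: h).
  by move=> /th ht; apply: hf; rewrite addrC addKr; lra.
have -> : Ctay * M / r ^+ 2 * `|h| ^+ 2 = 2 * (4 * (Clip * M / r ^+ 2 * `|h|) * `|h|).
  by rewrite /Ctay; field; rewrite gt_eqF.
apply: segment_mvt => // t ht.
have -> : 'd f (p + t *: h) h - clin (pd1 f p) (pd2 f p) h =
   clin (pd1 f (p + t *: h) - pd1 f p) (pd2 f (p + t *: h) - pd2 f p) h.
  rewrite (holat_d _ (hs t ht)) /clin.
  move: (pd1 f _) (pd2 f _) (pd1 f p) (pd2 f p) => *.
  by apply: cx_eq; rewrite !cxE; ring.
have [|a1 a2] := pd_lip r0 hf hM (h := t *: h); first by apply: le_lt_trans (th t ht) hh.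
have c0 : Clip * M / r ^+ 2 * `|t *: h| <= Clip * M / r ^+ 2 * `|h|.
  apply: ler_wpM2l; last exact: th.
  by apply: divr_ge0; [exact: mulr_ge0 Clip_ge0 M0|exact: exprn_ge0 (ltW r0)].
by apply: clin_bound; [exact: le_trans a1 c0|exact: le_trans a2 c0].
Qed.

End Holomorphic.

(** * Uniform limits of holomorphic functions; holomorphy of the derivatives *)

Section HolomorphicLimits.
Variable R : realType.
Local Notation Cx := (Cx R).
Local Notation C2 := (C2 R).
Implicit Types (f g : C2 -> Cx) (p z h : C2) (d : Cx).

Lemma real_cauchy (u : nat -> R) :
  (forall e : R, 0 < e -> exists N : nat, forall n m, (N <= n)%N -> (N <= m)%N -> `|u n - u m| <= e) ->
  exists l : R, forall e : R, 0 < e -> exists N : nat, forall n, (N <= n)%N -> `|u n - l| <= e.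
Proof.
move=> h.
have cu : cvgn u.
  apply/cauchy_cvgP/cauchy_ballP => e e0.
  have e2 : 0 < e / 2 by lra.
  have [N hN] := h _ e2.
  pose A := [set x | exists2 n, (N <= n)%N & x = u n].
  exists (A, A); first by split; exists N => // n Nn; exists n.
  move=> [x y] [/= [n Nn ->] [m Nm ->]].
  rewrite -ball_normE /ball_ /=; apply: (@le_lt_trans _ _ (e / 2)); last lra.
  exact: hN.
exists (limn u) => e e0.
have [N _ hN] := (cvgrPdist_le u (limn u)).1 cu e e0.
by exists N => n Nn; rewrite distrC; exact: hN.
Qed.

Lemma cx_cauchy (u : nat -> Cx) :
  (forall e : R, 0 < e -> exists N : nat, forall n m, (N <= n)%N -> (N <= m)%N -> cabs (u n - u m) <= e) ->
  exists l : Cx, forall e : R, 0 < e -> exists N : nat, forall n, (N <= n)%N -> cabs (u n - l) <= e.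
Proof.
move=> h.
have [l1 h1] : exists l : R, forall e : R, 0 < e -> exists N : nat, forall n, (N <= n)%N -> `|(u n).1 - l| <= e.
  apply: real_cauchy => e e0; have [N hN] := h e e0; exists N => n m Nn Nm.
  exact: le_trans (cabs_ge_re (u n - u m)) (hN _ _ Nn Nm).
have [l2 h2] : exists l : R, forall e : R, 0 < e -> exists N : nat, forall n, (N <= n)%N -> `|(u n).2 - l| <= e.
  apply: real_cauchy => e e0; have [N hN] := h e e0; exists N => n m Nn Nm.
  exact: le_trans (cabs_ge_im (u n - u m)) (hN _ _ Nn Nm).
exists (l1, l2) => e e0; have e2 : 0 < e / 2 by lra.
have [N1 k1] := h1 _ e2; have [N2 k2] := h2 _ e2.
exists (maxn N1 N2) => n; rewrite geq_max => /andP[n1 n2].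
apply: (le_trans (cabs_le_sum _)); rewrite !cxE /=.
by have := k1 n n1; have := k2 n n2; lra.
Qed.

Section Limit.
Variables (f_ : nat -> C2 -> Cx) (f : C2 -> Cx) (p : C2) (r M : R).
Hypotheses (r0 : 0 < r) (hf : forall n, holball (f_ n) p r).
Hypothesis hM : forall n z, `|z - p| < r -> cabs (f_ n z) <= M.
Hypothesis hlim : forall e : R, 0 < e -> exists N : nat, forall n, (N <= n)%N ->
  forall z, `|z - p| < r -> cabs (f_ n z - f z) <= e.

Let hp n : holat (f_ n) p.
Proof. by apply: hf; rewrite subrr normr0. Qed.

Lemma pd_diff_bound n m (e : R) :
  (forall z, `|z - p| < r -> cabs (f_ n z - f z) <= e) ->
  (forall z, `|z - p| < r -> cabs (f_ m z - f z) <= e) ->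
  cabs (pd1 (f_ n) p - pd1 (f_ m) p) <= 32 * e / r /\
  cabs (pd2 (f_ n) p - pd2 (f_ m) p) <= 32 * e / r.
Proof.
move=> hn hm.
have hb : holball (fun z => f_ n z - f_ m z) p r by move=> z hz; apply: holatB; exact: hf.
have hB z : `|z - p| < r -> cabs (f_ n z - f_ m z) <= 2 * e.
  move=> hz; have -> : f_ n z - f_ m z = (f_ n z - f z) - (f_ m z - f z).
    by rewrite opprB addrA subrK.
  by apply: (le_trans (cabsB _ _)); have := hn z hz; have := hm z hz; lra.
have := cauchy_pd r0 hb hB; have [-> ->] := pdB (hp n) (hp m).
by have -> : 16 * (2 * e) / r = 32 * e / r by field; rewrite gt_eqF.
Qed.

(** Cauchy's estimate on differences makes the derivatives at [p] a Cauchy sequence, and the Taylor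
    remainder of [f_ n] is bounded independently of [n], so the quadratic estimate survives in the
    limit and yields differentiability of [f]. *)
Lemma hol_limit : holat f p /\ forall e : R, 0 < e -> exists N : nat, forall n, (N <= n)%N ->
  cabs (pd1 (f_ n) p - pd1 f p) <= e /\ cabs (pd2 (f_ n) p - pd2 f p) <= e.
Proof.
have rpos : 0 < r := r0.
have C (e : R) : 0 < e -> exists N : nat, forall n m, (N <= n)%N -> (N <= m)%N ->
   cabs (pd1 (f_ n) p - pd1 (f_ m) p) <= e /\ cabs (pd2 (f_ n) p - pd2 (f_ m) p) <= e.
  move=> e0; have e1 : 0 < e * r / 32 by rewrite divr_gt0 // mulr_gt0.
  have [N hN] := hlim e1; exists N => n m Nn Nm.
  have := pd_diff_bound (hN n Nn) (hN m Nm).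
  by have -> : 32 * (e * r / 32) / r = e by field; rewrite gt_eqF.
have [l1 hl1] : exists l : Cx, forall e : R, 0 < e -> exists N : nat, forall n, (N <= n)%N -> cabs (pd1 (f_ n) p - l) <= e.
  by apply: cx_cauchy => e e0; have [N hN] := C e e0; exists N => n m a b; have [] := hN n m a b.
have [l2 hl2] : exists l : Cx, forall e : R, 0 < e -> exists N : nat, forall n, (N <= n)%N -> cabs (pd2 (f_ n) p - l) <= e.
  by apply: cx_cauchy => e e0; have [N hN] := C e e0; exists N => n m a b; have [] := hN n m a b.
set K := Ctay R * M / r ^+ 2.
have pr : `|p - p| < r by rewrite subrr normr0.
have T h : `|h| < r / 4 -> cabs (f (p + h) - f p - clin l1 l2 h) <= K * `|h| ^+ 2.
  move=> hh; apply/ler_addgt0Pl => e e0.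
  (* Two errors in values and the bound of [clin_bound] for the derivative terms add up to [e]. *)
  have e1 : 0 < e / (2 + 4 * `|h|) by rewrite divr_gt0 // ltr_wpDr // mulr_ge0.
  have [N1 h1] := hl1 _ e1; have [N2 h2] := hl2 _ e1; have [N3 h3] := hlim e1.
  pose n := maxn N1 (maxn N2 N3).
  have n1 : (N1 <= n)%N by rewrite /n leq_max leqnn.
  have n2 : (N2 <= n)%N by rewrite /n !leq_max leqnn orbT.
  have n3 : (N3 <= n)%N by rewrite /n !leq_max leqnn !orbT.
  have ht := holball_taylor r0 (hf n) (@hM n) hh; rewrite -/K in ht.
  have hph : `|p + h - p| < r by rewrite addrC addKr; lra.
  have a1 := h3 n n3 _ hph; have a2 := h3 n n3 _ pr.
  have a3 := clin_bound h (h1 n n1) (h2 n n2).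
  have -> : f (p + h) - f p - clin l1 l2 h =
    - (f_ n (p + h) - f (p + h)) + (f_ n p - f p) + clin (pd1 (f_ n) p - l1) (pd2 (f_ n) p - l2) h
    + (f_ n (p + h) - f_ n p - clin (pd1 (f_ n) p) (pd2 (f_ n) p) h).
    rewrite /clin; move: (f_ n _) (f_ n p) (f _) (f p) (pd1 _ _) (pd2 _ _) => *.
    by apply: cx_eq; rewrite !cxE; ring.
  apply: (le_trans (cabsD _ _)); rewrite lerD //.
  apply: (le_trans (cabsD _ _)).
  have := cabsD (- (f_ n (p + h) - f (p + h))) (f_ n p - f p).
  rewrite cabsN.
  have ee : e = 2 * (e / (2 + 4 * `|h|)) + 4 * (e / (2 + 4 * `|h|)) * `|h|.
    by field; rewrite gt_eqF // ltr_wpDr // mulr_ge0.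
  move: a1 a2 a3; rewrite {4}ee; lra.
have hc : cder2 f p l1 l2.
  apply: norm_cder2 => e e0.
  have K0 : 0 <= K.
    rewrite divr_ge0 ?exprn_ge0 ?(ltW r0) // mulr_ge0 //; first by rewrite mulr_ge0 // Clip_ge0.
    exact: le_trans (cabs_ge0 _) (hM 0 pr).
  exists (Num.min (r / 4) (e / (K + 1))).
    by rewrite lt_min; apply/andP; split; [lra|rewrite divr_gt0 // ltr_wpDl].
  move=> h; rewrite lt_min => /andP[h1 h2].
  apply: (le_trans (cabs_ge_norm _)); apply: (le_trans (T h h1)).
  rewrite expr2 mulrA ler_wpM2r //.
  have : `|h| * (K + 1) < e by rewrite -ltr_pdivlMr // ltr_wpDl.
  have := normr_ge0 h; nra.
have [-> ->] := cder2_pd hc.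
split; first by exists l1, l2.
move=> e e0; have [N1 h1] := hl1 _ e0; have [N2 h2] := hl2 _ e0.
exists (maxn N1 N2) => n; rewrite geq_max => /andP[n1 n2].
by split; [exact: h1|exact: h2].
Qed.

End Limit.

Section DerivativeHolomorphic.
Variables (f : C2 -> Cx) (p : C2) (r M : R).
Hypotheses (r0 : 0 < r) (hf : holball f p r).
Hypothesis hM : forall z, `|z - p| < r -> cabs (f z) <= M.

Lemma pd_bound z : `|z - p| < r / 2 ->
  cabs (pd1 f z) <= 32 * M / r /\ cabs (pd2 f z) <= 32 * M / r.
Proof.
move=> hz; have rpos : 0 < r := r0.
have r2 : 0 < r / 2 by lra.
have hb : holball f z (r / 2) by apply: holball_sub hf; lra.
have hbM w : `|w - z| < r / 2 -> cabs (f w) <= M.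
  move=> hw; apply: hM; have -> : w - p = (w - z) + (z - p) by rewrite addrA subrK.
  by apply: le_lt_trans (ler_normD _ _) _; lra.
by have := cauchy_pd r2 hb hbM; have -> : 16 * M / (r / 2) = 32 * M / r by field; rewrite gt_eqF.
Qed.

Lemma norm_e1 : `|e1 R| = 1.
Proof.
have n1 : `|cone R| = 1 by rewrite /cone norm_pair normr0 normr1 max_l.
by rewrite -[LHS]/(Num.max `|cone R| `|0 : Cx|) n1 normr0 max_l.
Qed.
Lemma norm_e2 : `|e2 R| = 1.
Proof.
have n1 : `|cone R| = 1 by rewrite /cone norm_pair normr0 normr1 max_l.
by rewrite -[LHS]/(Num.max `|0 : Cx| `|cone R|) n1 normr0 max_r.
Qed.

(** Each partial derivative is a uniform limit of holomorphic difference quotients [D n], with error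
    [O(s n)] by Taylor's formula, and [hol_limit] applies. *)
Lemma pd_holat : holat (pd1 f) p /\ holat (pd2 f) p.
Proof.
have rpos : 0 < r := r0.
pose K := Ctay R * M / (r / 2) ^+ 2.
have K0 : 0 <= K.
  rewrite divr_ge0 ?exprn_ge0 //; last lra.
  rewrite mulr_ge0 //; first by rewrite mulr_ge0 // Clip_ge0.
  by apply: le_trans (cabs_ge0 _) (hM (z := p) _); rewrite subrr normr0.
(* The sequence of steps is shifted by [N0] so that every translate stays in the ball where [f] is
   bounded. *)
have [N0 hN0] : exists N0 : nat, forall n, (N0 <= n)%N -> (n.+1%:R : R)^-1 < r / 8.
  exists (Num.truncn (8 / r)) => n hn.
  rewrite -[ltLHS]mul1r ltr_pdivrMr ?ltr0n // mulrC -ltr_pdivrMr; last lra.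
  have -> : 1 / (r / 8) = 8 / r by field; rewrite gt_eqF.
  by apply: (lt_le_trans (truncnS_gt _)); rewrite ler_nat.
have r8 : 0 < r / 8 by lra.
have key (i : bool) : holat (if i then pd1 f else pd2 f) p.
  pose e := if i then e1 R else e2 R.
  have en : `|e| = 1 by rewrite /e; case: (i); [exact: norm_e1|exact: norm_e2].
  pose s n : R := ((n + N0).+1%:R)^-1.
  have s0 n : 0 < s n by rewrite invr_gt0 ltr0n.
  have s8 n : s n < r / 8 by apply: hN0; exact: leq_addl.
  pose D n (z : C2) := cmul (creal (s n)^-1) (f (z + s n *: e) - f z).
  have se n : `|s n *: e| = s n by rewrite normrZ en mulr1 gtr0_norm.
  have hD n z : `|z - p| < r / 8 -> cabs (D n z - (if i then pd1 f else pd2 f) z) <= K * s n.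
    move=> hz.
    have r2 : 0 < r / 2 by lra.
    have hb : holball f z (r / 2) by apply: holball_sub hf; lra.
    have hbM w : `|w - z| < r / 2 -> cabs (f w) <= M.
      move=> hw; apply: hM; have -> : w - p = (w - z) + (z - p) by rewrite addrA subrK.
      by apply: le_lt_trans (ler_normD _ _) _; lra.
    have ht : `|s n *: e| < r / 2 / 4 by rewrite se; have := s8 n; lra.
    have := holball_taylor r2 hb hbM ht; rewrite -/K se.
    have -> : D n z - (if i then pd1 f else pd2 f) z =
       cmul (creal (s n)^-1) (f (z + s n *: e) - f z - clin (pd1 f z) (pd2 f z) (s n *: e)).
      rewrite /D [RHS]cmulBr; congr (_ - _).
      have sn : s n != 0 by rewrite gt_eqF.
      by rewrite /clin /e /e1 /e2; case: (i); apply: cx_eq; rewrite !(cxE, c2E, cxZE) /=; field.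
    rewrite cabsM creal_abs gtr0_norm ?invr_gt0 // => h.
    rewrite -(ler_pM2l (x := s n)) // mulrA divff ?gt_eqF // mul1r (le_trans h) //.
    by rewrite expr2 mulrCA.
  have B z : `|z - p| < r / 8 -> cabs ((if i then pd1 f else pd2 f) z) <= 32 * M / r.
    move=> hz; have hz2 : `|z - p| < r / 2 by lra.
    by have [a b] := pd_bound hz2; case: (i).
  have [|||h _] := @hol_limit D (if i then pd1 f else pd2 f) p (r / 8) (K * (r / 8) + 32 * M / r) r8.
  - move=> n z hz; apply: holatZ; apply: holatB; last by apply: hf; lra.
    apply: holat_shift; apply: hf; rewrite addrAC.
    by apply: le_lt_trans (ler_normD _ _) _; rewrite se; have := s8 n; lra.
  - move=> n z hz; have -> : D n z = (D n z - (if i then pd1 f else pd2 f) z) + (if i then pd1 f else pd2 f) z by rewrite subrK.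
    apply: (le_trans (cabsD _ _)); apply: lerD; last exact: B.
    by apply: (le_trans (hD n z hz)); rewrite ler_wpM2l // ltW.
  - move=> eps eps0; exists (Num.truncn ((K + 1) / eps)) => n hn z hz.
    apply: (le_trans (hD n z hz)).
    have h1 : (K + 1) / eps < (n + N0).+1%:R.
      by apply: (lt_le_trans (truncnS_gt _)); rewrite ler_nat ltnS (leq_trans hn) // leq_addr.
    rewrite /s ler_pdivrMr ?ltr0n // mulrC.
    by rewrite ltr_pdivrMr // in h1; lra.
  - exact: h.
by split; [exact: (key true)|exact: (key false)].
Qed.

End DerivativeHolomorphic.

End HolomorphicLimits.

(** * Cauchy's inequality on rectangles with independent sides *)

Section CauchyRectangle.
Variable R : realType.
Local Notation Cx := (Cx R).
Implicit Types (F : Cx -> Cx) (p w : Cx) (u v : R * R -> R).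

Lemma rint_norm_sub (f g : R -> R) (k a' a b b' : R) : a' <= a -> a <= b -> b <= b' -> 0 <= k ->
  ccont f a b -> ccont g a' b' -> (forall x, 0 <= g x) ->
  (forall x, a <= x <= b -> `|f x| <= k * g x) -> `|rint f a b| <= k * rint g a' b'.
Proof.
move=> ha ab hb k0 hf hg g0 h.
have hg1 : ccont g a b by exact: ccont_sub hg.
have hg2 : ccont g a b' by exact: ccont_sub hg.
apply: (le_trans (rint_norm_le hf (ccontZ hg1) h)); rewrite rintZ // ler_wpM2l //.
rewrite (rint_split ha (le_trans ab hb) hg) (rint_split ab hb hg2).
have p1 : 0 <= rint g a' a by apply: Rintegral_ge0.
have p2 : 0 <= rint g b b' by apply: Rintegral_ge0.
by rewrite addrCA lerDl addr_ge0.
Qed.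

Lemma ball_side_cont (F : Cx -> Cx) p (s a b c d : R) :
  p.1 - s <= a -> b <= p.1 + s -> p.2 - s <= c -> d <= p.2 + s ->
  (forall w, `|w - p| <= s -> {for w, continuous F}) ->
  rcont (fun w => cabs (F w)) a b c d.
Proof.
move=> ha hb hc hd cF x y /andP[x1 x2] /andP[y1 y2]; apply: cont_cabs; apply: cF.
by apply: norm_sub_le; apply/andP; split; [exact: le_trans x1|exact: le_trans hb
  |exact: le_trans y1|exact: le_trans hd].
Qed.

(** Each of the four terms depends on one side only and the integrals run over the full width, so
    the sides can be chosen independently of each other; [square_L1] exploits this to pass from line
    integrals to area integrals. *)
Lemma cauchy_rect F p (r a b c d : R) : 0 < r ->
  p.1 - 2 * r <= a <= p.1 - r -> p.1 + r <= b <= p.1 + 2 * r ->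
  p.2 - 2 * r <= c <= p.2 - r -> p.2 + r <= d <= p.2 + 2 * r ->
  (forall w, `|w - p| <= 2 * r -> exists e, cder F w e) ->
  2 * r * cabs (F p) <=
    rint (fun x => cabs (F (x, c))) (p.1 - 2 * r) (p.1 + 2 * r)
    + rint (fun x => cabs (F (x, d))) (p.1 - 2 * r) (p.1 + 2 * r)
    + rint (fun y => cabs (F (a, y))) (p.2 - 2 * r) (p.2 + 2 * r)
    + rint (fun y => cabs (F (b, y))) (p.2 - 2 * r) (p.2 + 2 * r).
Proof.
move=> r0 /andP[a1 a2] /andP[b1 b2] /andP[c1 c2] /andP[d1 d2] hF.
have ab : a <= b by order_lra.
have cd : c <= d by order_lra.
pose g w := cmul (F w) (ckernel p w).
have hg w : `|w - p| <= 2 * r -> w != p -> exists e, cder g w e.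
  move=> hw wp; have [e he] := hF w hw.
  have wp' : w - p != 0 by rewrite subr_eq0.
  have [e' he'] := ckernel_cder wp'.
  by eexists; exact: cderM he he'.
have nrm (x y : R) : a <= x <= b -> c <= y <= d -> `|(x, y) - p| <= 2 * r.
  move=> /andP[x1 x2] /andP[y1 y2].
  by apply: norm_sub_le; rewrite ?(le_trans a1) ?(le_trans x2) ?(le_trans c1) ?(le_trans y2).
have cF w : `|w - p| <= 2 * r -> {for w, continuous F} by move=> /hF[e /cder_cont].
have E : (rloop (fun w => (g w).1) (fun w => - (g w).2) a b c d,
   rloop (fun w => (g w).2) (fun w => (g w).1) a b c d) = cloop g p r.
  by apply: cloop_rect_square => // x y hx hy; apply: hg; exact: nrm.
have E3 : cabs (F p) * 4 <= cabs (cloop g p r).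
  rewrite -(@cauchy_square R F p r r0); last by apply: cF; rewrite subrr normr0 mulr_ge0 // ltW.
    by rewrite cabsM ler_wpM2l ?cabs_ge0 // cloop_kernel.
  by move=> w hw _; apply: hF; apply: (le_trans hw); rewrite ler_peMl ?ler1n // ltW.
pose A (y : R) := rint (fun x => cabs (F (x, y))) (p.1 - 2 * r) (p.1 + 2 * r).
pose B (x : R) := rint (fun y => cabs (F (x, y))) (p.2 - 2 * r) (p.2 + 2 * r).
have ri : 0 <= r^-1 by rewrite invr_ge0 ltW.
have gle w : r <= `|w - p| -> cabs (g w) <= r^-1 * cabs (F w).
  move=> h2; have wp : 0 < `|w - p| by exact: lt_le_trans h2.
  rewrite /g cabsM mulrC ler_wpM2r ?cabs_ge0 // /ckernel cabsV -?normr_gt0 //.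
  by rewrite lef_pV2 ?posrE ?cabs_gt0 -?normr_gt0 // (le_trans h2) // cabs_ge_norm.
have gc w : `|w - p| <= 2 * r -> r <= `|w - p| -> {for w, continuous g}.
  move=> h1 h2; have wp : w != p by rewrite -subr_eq0 -normr_gt0; exact: lt_le_trans h2.
  by have [e /cder_cont] := hg w h1 wp.
have lr : p.1 - 2 * r <= p.1 + 2 * r by order_lra.
have side_h (u : Cx -> R) (y : R) : (forall w, {for w, continuous g} -> {for w, continuous u}) ->
    (forall w, `|u w| <= cabs (g w)) -> c <= y <= d -> r <= `|y - p.2| ->
    `|rint (fun x => u (x, y)) a b| <= r^-1 * A y.
  move=> uc ug hy hyr.
  have h2 x : r <= `|(x, y) - p| by apply: (le_trans hyr); exact: (im_le_norm ((x, y) - p)).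
  apply: (rint_norm_sub a1 ab b2 ri).
  - move=> x hx; apply: (@continuous_comp _ _ _ (fun x => (x, y)) u).
      exact: (cvg_pair (@cvg_id _ _) (@cvg_cst _ _ _ _ _)).
    by apply: uc; apply: gc => //; exact: nrm.
  - apply: (rcont_h (u := fun w => cabs (F w)) _ hy); exact: (ball_side_cont _ _ _ _ cF).
  - by move=> x; exact: cabs_ge0.
  - by move=> x hx; apply: le_trans (gle _ (h2 x)).
have side_v (u : Cx -> R) (x : R) : (forall w, {for w, continuous g} -> {for w, continuous u}) ->
    (forall w, `|u w| <= cabs (g w)) -> a <= x <= b -> r <= `|x - p.1| ->
    `|rint (fun y => u (x, y)) c d| <= r^-1 * B x.
  move=> uc ug hx hxr.
  have h2 y : r <= `|(x, y) - p| by apply: (le_trans hxr); exact: (re_le_norm ((x, y) - p)).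
  apply: (rint_norm_sub c1 cd d2 ri).
  - move=> y hy; apply: (@continuous_comp _ _ _ (fun y => (x, y)) u).
      exact: (cvg_pair (@cvg_cst _ _ _ _ _) (@cvg_id _ _)).
    by apply: uc; apply: gc => //; exact: nrm.
  - apply: (rcont_v (u := fun w => cabs (F w)) _ hx); exact: (ball_side_cont _ _ _ _ cF).
  - by move=> y; exact: cabs_ge0.
  - by move=> y hy; apply: le_trans (gle _ (h2 y)).
have rc : r <= `|c - p.2| by rewrite distrC (le_trans _ (ler_norm _)) // lerBrDr addrC -lerBrDr.
have rd : r <= `|d - p.2| by rewrite (le_trans _ (ler_norm _)) // lerBrDr addrC.
have ra : r <= `|a - p.1| by rewrite distrC (le_trans _ (ler_norm _)) // lerBrDr addrC -lerBrDr.
have rb : r <= `|b - p.1| by rewrite (le_trans _ (ler_norm _)) // lerBrDr addrC.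
have ca : a <= a <= b by rewrite lexx.
have cb : a <= b <= b by rewrite lexx andbT.
have cc : c <= c <= d by rewrite lexx.
have cD : c <= d <= d by rewrite lexx andbT.
have loop_le (u v : Cx -> R) : (forall w, {for w, continuous g} -> {for w, continuous u}) ->
    (forall w, {for w, continuous g} -> {for w, continuous v}) ->
    (forall w, `|u w| <= cabs (g w)) -> (forall w, `|v w| <= cabs (g w)) ->
    `|rloop u v a b c d| <= r^-1 * (A c + A d + B a + B b).
  move=> uc vc ug vg; rewrite /rloop.
  have s1 := side_h u c uc ug cc rc; have s2 := side_h u d uc ug cD rd.
  have s3 := side_v v a vc vg ca ra; have s4 := side_v v b vc vg cb rb.
  have -> : r^-1 * (A c + A d + B a + B b) = r^-1 * A c + r^-1 * A d + (r^-1 * B b + r^-1 * B a).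
    by ring.
  apply: (le_trans (ler_normD _ _)); apply: lerD.
    by apply: (le_trans (ler_normB _ _)); exact: lerD.
  by apply: (le_trans (ler_normB _ _)); exact: lerD.
have L3 := le_trans E3 (cabs_le_sum _).
rewrite -E /= in L3.
have L4 : cabs (F p) * 4 <= r^-1 * (A c + A d + B a + B b) + r^-1 * (A c + A d + B a + B b).
  apply: (le_trans L3); apply: lerD; apply: loop_le => w.
  - exact: cont_fst.
  - by move=> /cont_snd h; apply: continuousN.
  - exact: (cabs_ge_re (g w)).
  - by rewrite normrN; exact: (cabs_ge_im (g w)).
  - exact: cont_snd.
  - exact: cont_fst.
  - exact: (cabs_ge_im (g w)).
  - exact: (cabs_ge_re (g w)).
have L5 : r * (cabs (F p) * 4) <= r * (r^-1 * (A c + A d + B a + B b) + r^-1 * (A c + A d + B a + B b)).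
  by rewrite ler_pM2l.
have rV t : r * (r^-1 * t + r^-1 * t) = t + t by rewrite -mulrDr mulVKf ?gt_eqF.
rewrite rV in L5.
rewrite -/(A c) -/(A d) -/(B a) -/(B b).
move: L5; move: (A c + A d + B a + B b) (cabs (F p)) => t q; order_lra.
Qed.

End CauchyRectangle.

(** * Countable bases and measurability of open sets *)

Section CountableBasis.

(** The sigma-algebra of a product is generated by measurable rectangles and does not mention the
    topology; a countable base inside it is what makes every open set measurable. *)
Definition cbasis (T : topologicalType) (M : set (set T)) :=
  exists B : nat -> set T, (forall n, M (B n)) /\
    forall x U, nbhs x U -> exists2 n, B n x & B n `<=` U.

Lemma cbasis_prod (T1 T2 : topologicalType) (M1 : set (set T1)) (M2 : set (set T2))
  (M : set (set (T1 * T2))) : (forall A B, M1 A -> M2 B -> M (A `*` B)) ->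
  cbasis M1 -> cbasis M2 -> cbasis M.
Proof.
move=> h [B1 [m1 b1]] [B2 [m2 b2]].
pose c n : nat * nat := odflt (0%N, 0%N) (unpickle n).
exists (fun n => B1 (c n).1 `*` B2 (c n).2); split; first by move=> n; exact: h.
move=> [x y] U [[U1 U2] [/= n1 n2] sU].
have [i Bi si] := b1 _ _ n1; have [j Bj sj] := b2 _ _ n2.
exists (pickle (i, j)); rewrite /c pickleK //=.
by move=> [a b] [/= /si ha /sj hb]; apply: sU.
Qed.

Lemma cbasis_open (T : topologicalType) (M : set (set T)) : M set0 ->
  (forall F : nat -> set T, (forall n, M (F n)) -> M (\bigcup_n F n)) ->
  cbasis M -> forall U, open U -> M U.
Proof.
move=> M0 Mu [B [mB bB]] U oU.
have -> : U = \bigcup_n (if pselect (B n `<=` U) then B n else set0).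
  apply/seteqP; split => [x Ux|x [n _]].
    have [n Bn sn] := bB x U (open_nbhs_nbhs (conj oU Ux)).
    by exists n => //; case: pselect.
  by case: pselect => // h /h.
by apply: Mu => n; case: (pselect (B n `<=` U)) => h /=; [exact: mB|exact: M0].
Qed.

End CountableBasis.

(** * Measurability of open sets and of continuous functions on the plane and on [C2] *)

Section OpenMeasurable.
Variable R : realType.
Local Notation Cx := (Cx R).
Local Notation C2 := (C2 R).

Lemma cbasis_R : cbasis (@measurable _ R).
Proof.
pose B n : set R := if unpickle n is Some (a, b) then `]ratr (a : rat), ratr (b : rat)[%classic else set0.
exists B; split.
  by move=> n; rewrite /B; case: unpickle => [[a b]|//]; exact: measurable_itv.
move=> x U /nbhs_ballP[e /= e0 he].
have [a] : exists q, ratr q \in `]x - e, x[ by apply: rat_in_itvoo; lra.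
have [b] : exists q, ratr q \in `]x, x + e[ by apply: rat_in_itvoo; lra.
rewrite !in_itv /= => /andP[b1 b2] /andP[a1 a2].
exists (pickle (a, b)); rewrite /B pickleK /= ?in_itv /=; first by rewrite a2 b1.
move=> y /=; rewrite in_itv /= => /andP[y1 y2]; apply: he.
by rewrite /ball /= ltr_norml; lra.
Qed.

Lemma cbasis_Cx : cbasis (@measurable _ Cx).
Proof. by apply: (cbasis_prod _ cbasis_R cbasis_R) => A B; exact: measurableX. Qed.

Lemma cbasis_C2 : cbasis (@measurable _ C2).
Proof. by apply: (cbasis_prod _ cbasis_Cx cbasis_Cx) => A B; exact: measurableX. Qed.

Lemma open_measurable_Cx (U : set Cx) : open U -> measurable U.
Proof.
apply: (cbasis_open _ _ cbasis_Cx); first exact: measurable0.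
by move=> F hF; exact: bigcup_measurable.
Qed.

Lemma open_measurable_C2 (U : set C2) : open U -> measurable U.
Proof.
apply: (cbasis_open _ _ cbasis_C2); first exact: measurable0.
by move=> F hF; exact: bigcup_measurable.
Qed.

(** Points of [D] are points of continuity in the whole plane, so on [D] the preimage of an open
    interval coincides with its interior, an open set. *)
Lemma measurable_cont_Cx (D : set Cx) (f : Cx -> R) : measurable D ->
  (forall z, D z -> {for z, continuous f}) -> measurable_fun D f.
Proof.
move=> mD hf; apply: (measurability _ (RGenOpens.measurableE R)).
move=> _ [_ [a [b ->] <-]].
have -> : D `&` f @^-1` `]a, b[%classic = D `&` (f @^-1` `]a, b[%classic)^°.
  apply/seteqP; split => x [Dx h]; split => //; last exact: (@interior_subset Cx _ _ h).
  apply: (hf x Dx); apply: open_nbhs_nbhs; split => //; exact: interval_open.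
by apply: measurableI => //; apply: open_measurable_Cx; exact: (@open_interior Cx).
Qed.

Lemma measurable_cont_C2 (D : set C2) (f : C2 -> R) : measurable D ->
  (forall z, D z -> {for z, continuous f}) -> measurable_fun D f.
Proof.
move=> mD hf; apply: (measurability _ (RGenOpens.measurableE R)).
move=> _ [_ [a [b ->] <-]].
have -> : D `&` f @^-1` `]a, b[%classic = D `&` (f @^-1` `]a, b[%classic)^°.
  apply/seteqP; split => x [Dx h]; split => //; last exact: (@interior_subset C2 _ _ h).
  apply: (hf x Dx); apply: open_nbhs_nbhs; split => //; exact: interval_open.
by apply: measurableI => //; apply: open_measurable_C2; exact: (@open_interior C2).
Qed.

Definition csq (p : Cx) (s : R) : set Cx := [set w | `|w - p| <= s].
Definition cbox (p : C2) (s : R) : set C2 := [set w | `|w - p| <= s].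

Lemma csqE p s : csq p s = `[p.1 - s, p.1 + s]%classic `*` `[p.2 - s, p.2 + s]%classic.
Proof.
apply/seteqP; split => [[x y]|[x y]]; rewrite /csq /=.
  have -> : (x, y) - p = (x - p.1, y - p.2) by [].
  by rewrite norm_pair ge_max !ler_norml !in_itv /= => /andP[/andP[? ?] /andP[? ?]]; split; apply/andP; split; lra.
have -> : (x, y) - p = (x - p.1, y - p.2) by [].
rewrite norm_pair ge_max !ler_norml !in_itv /= => -[/andP[? ?] /andP[? ?]].
by apply/andP; split; apply/andP; split; lra.
Qed.

Lemma cboxE p s : cbox p s = csq p.1 s `*` csq p.2 s.
Proof.
apply/seteqP; split => [[x y]|[x y]]; rewrite /cbox /csq /=.
  have -> : (x, y) - p = (x - p.1, y - p.2) by [].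
  by rewrite [`|_|]/(Num.max `|x - p.1| `|y - p.2|) ge_max => /andP[].
have -> : (x, y) - p = (x - p.1, y - p.2) by [].
by move=> [h1 h2]; rewrite [`|_|]/(Num.max `|x - p.1| `|y - p.2|) ge_max h1 h2.
Qed.

Lemma measurable_csq p s : measurable (csq p s).
Proof. by rewrite csqE; apply: measurableX; exact: measurable_itv. Qed.
Lemma measurable_cbox p s : measurable (cbox p s).
Proof. by rewrite cboxE; apply: measurableX; exact: measurable_csq. Qed.

Local Notation leb := (@lebesgue_measure R).

Local Notation leb2 := (leb \x leb)%E.

Lemma int_ge_itv (phi : R -> \bar R) (m a b : R) : measurable_fun [set: R] phi ->
  (forall x, (0 <= phi x)%E) -> a <= b -> 0 <= m ->
  (forall y, a <= y <= b -> (m%:E <= phi y)%E) ->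
  ((m * (b - a))%:E <= \int[leb]_y phi y)%E.
Proof.
move=> mphi p0 ab m0 h.
apply: (@le_trans _ _ (\int[leb]_(y in `[a, b]) phi y)%E); last first.
  by apply: ge0_subset_integral.
apply: (@le_trans _ _ (\int[leb]_(y in `[a, b]) (cst m%:E y))%E).
  rewrite integral_cst; last exact: measurable_itv.
  have e : leb `[a, b] = (b - a)%:E.
    rewrite lebesgue_measure_itv /= lte_fin.
    by case: ltP => h' //=; have -> : b = a; [lra|rewrite subrr].
  have -> : (m * (b - a))%:E = (m%:E * leb `[a, b])%E by rewrite e.
  exact: lexx.
apply: ge0_le_integral.
- exact: measurable_itv.
- by move=> x _ /=; rewrite lee_fin.
- exact: measurable_cst.
- exact: measurable_funTS.
- by move=> x; rewrite /= in_itv /=; exact: h.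
Qed.

Lemma integral_rint (f : R -> R) (a b : R) : ccont f a b ->
  (\int[leb]_x ((EFin \o f) \_ `[a, b]) x)%E = (rint f a b)%:E.
Proof.
move=> hf; rewrite -integral_mkcond /rint /Rintegral fineK //.
apply: integrable_fin_num => //; exact: ccont_integrable.
Qed.

End OpenMeasurable.

(* [leb4] lives on a product of Borel structures whose display differs from the
   canonical one on [C2]; integrals only depend on the family of measurable sets. *)
Section Transfer.
Import HBSimple HBNNSimple.
Variables (d1 d2 : measure_display) (T : Type) (c1 : Measurable.axioms_ d1 T) (c2 : Measurable.axioms_ d2 T) (R : realType).
Let T1 := Measurable.Pack c1.
Let T2 := Measurable.Pack c2.
Hypothesis h12 : forall A : set T, @measurable _ T1 A -> @measurable _ T2 A.

Lemma nnsfun_transfer (h : {nnsfun T1 >-> R}) : exists k : {nnsfun T2 >-> R}, (k : T -> R) = h.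
Proof.
have m : @measurable_fun _ _ T2 R setT (h : T2 -> R).
  by move=> _ Y mY; apply: h12; exact: (measurable_funPT h measurableT Y mY).
have f : finite_set (range (h : T2 -> R)) by exact: (@fimfunP _ _ (h : {fimfun T1 >-> R})).
have n (x : T2) : 0 <= (h : T2 -> R) x by exact: fun_ge0.
pose k : {nnsfun T2 >-> R} := HB.pack (h : T2 -> R) (isMeasurableFun.Build _ _ T2 R _ m)
  (FiniteImage.Build T2 R _ f) (isNonNegFun.Build T2 R _ n).
by exists k.
Qed.
End Transfer.

Section Transfer2.
Variables (d1 d2 : measure_display) (T : Type) (c1 : Measurable.axioms_ d1 T) (c2 : Measurable.axioms_ d2 T) (R : realType).
Let T1 := Measurable.Pack c1.
Let T2 := Measurable.Pack c2.
Hypothesis h12 : forall A : set T, @measurable _ T1 A <-> @measurable _ T2 A.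
Lemma integral_transfer (mu : set T -> \bar R) (D : set T) (f : T -> \bar R) :
  @integral _ T1 R mu D f = @integral _ T2 R mu D f.
Proof.
have a A : @measurable _ T1 A -> @measurable _ T2 A by move=> /h12.
have b A : @measurable _ T2 A -> @measurable _ T1 A by move=> /h12.
rewrite /integral; congr (ereal_sup _ - ereal_sup _)%E.
all: apply/seteqP; split => _ [h hf <-].
- by have [k e] := nnsfun_transfer a h; exists k; rewrite ?e //= e.
- by have [k e] := nnsfun_transfer b h; exists k; rewrite ?e //= e.
- by have [k e] := nnsfun_transfer a h; exists k; rewrite ?e //= e.
- by have [k e] := nnsfun_transfer b h; exists k; rewrite ?e //= e.
Qed.
End Transfer2.

(** * Tonelli's theorem and the control of point values by area integrals *)

Section AreaMeanValue.
Variable R : realType.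
Local Notation Cx := (Cx R).
Local Notation C2 := (C2 R).
Local Notation leb := (@lebesgue_measure R).
Local Notation leb2 := (leb \x leb)%E.

Lemma tonelli_Cx (G : Cx -> \bar R) : measurable_fun [set: Cx] G -> (forall w, (0 <= G w)%E) ->
  (\int[leb2]_w G w = \int[leb]_x \int[leb]_y G (x, y))%E /\
  (\int[leb2]_w G w = \int[leb]_y \int[leb]_x G (x, y))%E.
Proof.
move=> mG G0; rewrite -(@fubini_tonelli _ _ _ _ R leb leb G mG G0).
by rewrite (@fubini_tonelli1 _ _ _ _ R leb leb G mG G0).
Qed.

Lemma leb2_sigma_finite : sigma_finite [set: Cx] leb2.
Proof.
have /sigma_finiteP[F [TF ndF Foo]] := sigma_finiteT leb.
exists (fun n => F n `*` F n).
  rewrite -setXTT TF predeqE => -[x y]; split.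
    move=> [/= [n _ Fnx] [k _ Gky]]; exists (maxn n k) => //; split.
    - by move: x Fnx; exact/subsetPset/ndF/leq_maxl.
    - by move: y Gky; exact/subsetPset/ndF/leq_maxr.
  by move=> [n _ []/= ? ?]; split; exists n.
move=> k; have [? ?] := Foo k; split; first exact: measurableX.
by rewrite product_measure1E// lte_mul_pinfty// ge0_fin_numE.
Qed.

(** Tonelli's theorem on [C2] asks for the planar measure as a sigma-finite structure. *)
Definition leb2s : {sigma_finite_measure set _ -> \bar R} :=
  HB.pack leb2 (Measure_isSigmaFinite.Build _ _ _ leb2 leb2_sigma_finite).

Lemma tonelli_C2 (G : C2 -> \bar R) : measurable_fun [set: C2] G -> (forall w, (0 <= G w)%E) ->
  (\int[(leb2 \x leb2)]_w G w = \int[leb2]_x \int[leb2]_y G (x, y))%E.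
Proof.
by move=> mG G0; have H := @fubini_tonelli1 _ _ _ _ R leb2s leb2s G mG G0; refine H.
Qed.

Lemma tonelli_measurable_Cx (G : Cx -> \bar R) : measurable_fun [set: Cx] G -> (forall w, (0 <= G w)%E) ->
  measurable_fun [set: R] (fun x : R => \int[leb]_y G (x, y))%E /\
  measurable_fun [set: R] (fun y : R => \int[leb]_x G (x, y))%E.
Proof.
move=> mG G0; split.
- exact: (@measurable_fun_fubini_tonelli_F _ _ _ _ R leb G mG G0).
- exact: (@measurable_fun_fubini_tonelli_G _ _ _ _ R leb G mG G0).
Qed.

Lemma tonelli_measurable_C2 (G : C2 -> \bar R) : measurable_fun [set: C2] G -> (forall w, (0 <= G w)%E) ->
  measurable_fun [set: Cx] (fun x : Cx => \int[leb2]_y G (x, y))%E.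
Proof.
by move=> mG G0; have H := @measurable_fun_fubini_tonelli_F _ _ _ _ R leb2s G mG G0; refine H.
Qed.

Definition leb4m : {measure set _ -> \bar R} := (leb2s \x leb2s)%E.

(** Names the measurable type that [leb4m] lives on, to be compared with the canonical one on
    [C2]. *)
Definition carrier d (T : measurableType d) (m : set T -> \bar R) := T.
Definition C2oc : measurableType _ := carrier leb4m.
Lemma leb4_integralE (D : set C2) (f : C2 -> \bar R) :
  (\int[@leb4 R]_(z in D) f z = \int[leb4m]_(z in D) f z)%E.
Proof. by have H := (@integral_transfer _ _ C2 (Measurable.class (C2 : measurableType _)) (Measurable.class C2oc) R _ (@leb4 R) D f); refine (H _). Qed.
Lemma leb4_integrableE (D : set C2) (f : C2 -> \bar R) :
  (@leb4 R).-integrable D f <-> leb4m.-integrable D f.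
Proof.
have E := leb4_integralE D (fun x => `|f x|)%E.
by rewrite !unlock E; split => h; refine h.
Qed.

Lemma tonelli_C2_on (D : set C2) (g : C2 -> \bar R) :
   measurable_fun [set: C2] (g \_ D) -> (forall w, (0 <= (g \_ D) w)%E) ->
  (\int[leb4m]_(w in D) g w = \int[leb2]_x \int[leb2]_y (g \_ D) (x, y))%E.
Proof.
move=> mG G0; have H := @integral_mkcond _ _ R leb4m D g.
by refine (eq_trans H _); exact: tonelli_C2.
Qed.

(** A pigeonhole replaces averaging: if each of the four families of sides dropped below [m]
    somewhere, those four sides would violate [cauchy_rect], because [4 m = 2 r |F p|]. Hence one
    family stays above [m] on a strip of width [r], which contributes [r m]. *)
Lemma square_L1 (F : Cx -> Cx) (p : Cx) (r : R) : 0 < r ->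
  (forall w, `|w - p| <= 2 * r -> exists e, cder F w e) ->
  ((r ^+ 2 / 2 * cabs (F p))%:E <= \int[leb2]_(w in csq p (2 * r)) (cabs (F w))%:E)%E.
Proof.
move=> r0 hF.
pose g := fun w : Cx => (cabs (F w))%:E.
pose G : Cx -> \bar R := g \_ (csq p (2 * r)).
have cF w : `|w - p| <= 2 * r -> {for w, continuous (fun w => cabs (F w))}.
  by move=> /hF[e /cder_cont h]; exact: cont_cabs.
have mG : measurable_fun [set: Cx] G.
  apply/(measurable_restrictT _ (measurable_csq _ _)).
  by apply/measurable_EFinP; apply: measurable_cont_Cx => //; exact: measurable_csq.
have G0 w : (0 <= G w)%E.
  by rewrite /G patchE; case: ifP => // _; rewrite lee_fin cabs_ge0.
rewrite [leRHS]integral_mkcond -/G.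
have Gx (x y : R) : G (x, y) = if (p.1 - 2 * r <= x <= p.1 + 2 * r) && (p.2 - 2 * r <= y <= p.2 + 2 * r) then g (x, y) else 0%E.
  rewrite /G patchE csqE.
  have -> : ((x, y) \in `[p.1 - 2 * r, p.1 + 2 * r]%classic `*` `[p.2 - 2 * r, p.2 + 2 * r]%classic) =
    (p.1 - 2 * r <= x <= p.1 + 2 * r) && (p.2 - 2 * r <= y <= p.2 + 2 * r).
    by apply/idP/idP; rewrite inE /= !in_itv /= => /andP.
  by [].
pose A (y : R) := rint (fun x => cabs (F (x, y))) (p.1 - 2 * r) (p.1 + 2 * r).
pose B (x : R) := rint (fun y => cabs (F (x, y))) (p.2 - 2 * r) (p.2 + 2 * r).
have nrm (x y : R) : p.1 - 2 * r <= x <= p.1 + 2 * r -> p.2 - 2 * r <= y <= p.2 + 2 * r -> `|(x, y) - p| <= 2 * r.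
  move=> hx hy; have -> : (x, y) - p = (x - p.1, y - p.2) by [].
  by rewrite norm_pair ge_max !ler_norml; apply/andP; split; lra.
have GA y : p.2 - 2 * r <= y <= p.2 + 2 * r -> (\int[leb]_x G (x, y))%E = (A y)%:E.
  move=> hy; rewrite -integral_rint.
    apply: eq_integral => x _; rewrite Gx hy andbT patchE.
    have -> : (x \in `[p.1 - 2 * r, p.1 + 2 * r]%classic) = (p.1 - 2 * r <= x <= p.1 + 2 * r).
      by apply/idP/idP; rewrite inE /= in_itv.
    by [].
  move=> x hx; apply: (@continuous_comp _ _ _ (fun x => (x, y)) (fun w => cabs (F w))).
    exact: (cvg_pair (@cvg_id _ _) (@cvg_cst _ _ _ _ _)).
  by apply: cF; exact: nrm.
have GB x : p.1 - 2 * r <= x <= p.1 + 2 * r -> (\int[leb]_y G (x, y))%E = (B x)%:E.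
  move=> hx; rewrite -integral_rint.
    apply: eq_integral => y _; rewrite Gx hx /= patchE.
    have -> : (y \in `[p.2 - 2 * r, p.2 + 2 * r]%classic) = (p.2 - 2 * r <= y <= p.2 + 2 * r).
      by apply/idP/idP; rewrite inE /= in_itv.
    by [].
  move=> y hy; apply: (@continuous_comp _ _ _ (fun y => (x, y)) (fun w => cabs (F w))).
    exact: (cvg_pair (@cvg_cst _ _ _ _ _) (@cvg_id _ _)).
  by apply: cF; exact: nrm.
pose m := r * cabs (F p) / 2.
have m0 : 0 <= m by rewrite divr_ge0 // mulr_ge0 ?cabs_ge0 // ltW.
have [I1 I2] := tonelli_Cx mG G0.
have H : [\/ forall c, p.2 - 2 * r <= c <= p.2 - r -> m <= A c,
             forall d, p.2 + r <= d <= p.2 + 2 * r -> m <= A d,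
             forall a, p.1 - 2 * r <= a <= p.1 - r -> m <= B a |
             forall b, p.1 + r <= b <= p.1 + 2 * r -> m <= B b].
  apply: contrapT => H.
  have [c [hc Ac]] : exists c, p.2 - 2 * r <= c <= p.2 - r /\ A c < m.
    apply: contrapT => hn; apply: H; constructor 1 => c hc; rewrite leNgt; apply/negP => Ac.
    by apply: hn; exists c.
  have [d [hd Ad]] : exists d, p.2 + r <= d <= p.2 + 2 * r /\ A d < m.
    apply: contrapT => hn; apply: H; constructor 2 => c' hc'; rewrite leNgt; apply/negP => Ac'.
    by apply: hn; exists c'.
  have [a [ha Ba]] : exists a, p.1 - 2 * r <= a <= p.1 - r /\ B a < m.
    apply: contrapT => hn; apply: H; constructor 3 => c' hc'; rewrite leNgt; apply/negP => Ac'.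
    by apply: hn; exists c'.
  have [b [hb Bb]] : exists b, p.1 + r <= b <= p.1 + 2 * r /\ B b < m.
    apply: contrapT => hn; apply: H; constructor 4 => c' hc'; rewrite leNgt; apply/negP => Ac'.
    by apply: hn; exists c'.
  have := cauchy_rect r0 ha hb hc hd hF.
  rewrite -/(A c) -/(A d) -/(B a) -/(B b); rewrite /m in Ac Ad Ba Bb; lra.
have [mF2 mF1] := tonelli_measurable_Cx mG G0.
have p1 y : (0 <= \int[leb]_x G (x, y))%E by apply: integral_ge0.
have p2 x : (0 <= \int[leb]_y G (x, y))%E by apply: integral_ge0.
case: H => H.
- rewrite I2; have := @int_ge_itv R _ m (p.2 - 2 * r) (p.2 - r) mF1 p1.
  have -> : m * (p.2 - r - (p.2 - 2 * r)) = r ^+ 2 / 2 * cabs (F p) by rewrite /m; field.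
  by apply=> // [|y hy]; [lra|rewrite GA ?lee_fin; [exact: H|lra]].
- rewrite I2; have := @int_ge_itv R _ m (p.2 + r) (p.2 + 2 * r) mF1 p1.
  have -> : m * (p.2 + 2 * r - (p.2 + r)) = r ^+ 2 / 2 * cabs (F p) by rewrite /m; field.
  by apply=> // [|y hy]; [lra|rewrite GA ?lee_fin; [exact: H|lra]].
- rewrite I1; have := @int_ge_itv R _ m (p.1 - 2 * r) (p.1 - r) mF2 p2.
  have -> : m * (p.1 - r - (p.1 - 2 * r)) = r ^+ 2 / 2 * cabs (F p) by rewrite /m; field.
  by apply=> // [|y hy]; [lra|rewrite GB ?lee_fin; [exact: H|lra]].
- rewrite I1; have := @int_ge_itv R _ m (p.1 + r) (p.1 + 2 * r) mF2 p2.
  have -> : m * (p.1 + 2 * r - (p.1 + r)) = r ^+ 2 / 2 * cabs (F p) by rewrite /m; field.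
  by apply=> // [|y hy]; [lra|rewrite GB ?lee_fin; [exact: H|lra]].
Qed.

(** [|f|^2] is the modulus of the holomorphic function [f^2], so [square_L1] applies to it in each
    variable separately. *)
Lemma box_L2 (f : C2 -> Cx) (p : C2) (r : R) : 0 < r ->
  (forall z, `|z - p| <= 2 * r -> holat f z) ->
  (((r ^+ 2 / 2) ^+ 2 * cnorm2 (f p))%:E <=
     \int[leb4m]_(z in cbox p (2 * r)) (cnorm2 (f z))%:E)%E.
Proof.
move=> r0 hf.
pose g := fun z : C2 => (cnorm2 (f z))%:E.
pose G : C2 -> \bar R := g \_ (cbox p (2 * r)).
have gE z : g z = (cabs (cmul (f z) (f z)))%:E by rewrite /g cabsM cnorm2_cabs expr2.
have mG : measurable_fun [set: C2] G.
  apply/(measurable_restrictT _ (measurable_cbox _ _)).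
  apply/measurable_EFinP; apply: measurable_cont_C2; first exact: measurable_cbox.
  by move=> z /hf/holat_cont h; exact: cont_cnorm2.
have G0 w : (0 <= G w)%E.
  by rewrite /G patchE; case: ifP => // _; rewrite lee_fin cnorm2_ge0.
rewrite (tonelli_C2_on mG G0) -/G.
have nrm (x y : Cx) : `|x - p.1| <= 2 * r -> `|y - p.2| <= 2 * r -> `|(x, y) - p| <= 2 * r.
  move=> hx hy; have -> : (x, y) - p = (x - p.1, y - p.2) by [].
  by rewrite [`|_|]/(Num.max `|x - p.1| `|y - p.2|) ge_max hx.
have rr : 0 <= r ^+ 2 / 2 by rewrite divr_ge0 // exprn_ge0 // ltW.
have h0 (q : Cx) : `|q - q| <= 2 * r by rewrite subrr normr0; lra.
have inner x : `|x - p.1| <= 2 * r ->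
    ((r ^+ 2 / 2 * cabs (cmul (f (x, p.2)) (f (x, p.2))))%:E <= \int[leb2]_y G (x, y))%E.
  move=> hx.
  have -> : (\int[leb2]_y G (x, y) = \int[leb2]_(y in csq p.2 (2 * r)) (cabs (cmul (f (x, y)) (f (x, y))))%:E)%E.
    rewrite [RHS]integral_mkcond; apply: eq_integral => y _.
    rewrite /G !patchE cboxE.
    have -> : ((x, y) \in csq p.1 (2 * r) `*` csq p.2 (2 * r)) = (y \in csq p.2 (2 * r)).
      by apply/idP/idP; rewrite !inE /=; [case|split].
    by case: ifP => // _; exact: gE.
  apply: (@square_L1 (fun y => cmul (f (x, y)) (f (x, y))) p.2 r r0) => w hw.
  have hh := hf _ (nrm x w hx hw).
  by eexists; exact: (cder2_slice2 (holat_pd (holatM hh hh))).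
apply: (@le_trans _ _ (\int[leb2]_(x in csq p.1 (2 * r)) ((r ^+ 2 / 2)%:E * (cabs (cmul (f (x, p.2)) (f (x, p.2))))%:E))%E).
  have ms : measurable_fun (csq p.1 (2 * r)) (fun x : Cx => (cabs (cmul (f (x, p.2)) (f (x, p.2))))%:E).
    apply/measurable_EFinP; apply: measurable_cont_Cx; first exact: measurable_csq.
    move=> w hw; have hh := hf _ (nrm w p.2 hw (h0 _)).
    by apply: cont_cabs; exact: (cder_cont (cder2_slice1 (holat_pd (holatM hh hh)))).
  rewrite ge0_integralZl_EFin //; last 2 first.
  - exact: measurable_csq.
  - by move=> x _; rewrite lee_fin cabs_ge0.
  rewrite expr2 -mulrA EFinM lee_pmul2l //; last first.
    by rewrite lte_fin divr_gt0 // exprn_gt0.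
  have -> : cnorm2 (f p) = cabs (cmul (f (p.1, p.2)) (f (p.1, p.2))).
    by rewrite -surjective_pairing cabsM cnorm2_cabs expr2.
  apply: (@square_L1 (fun x => cmul (f (x, p.2)) (f (x, p.2))) p.1 r r0) => w hw.
  have hh := hf _ (nrm w p.2 hw (h0 _)).
  by eexists; exact: (cder2_slice1 (holat_pd (holatM hh hh))).
have mI := tonelli_measurable_C2 mG G0.
apply: (@le_trans _ _ (\int[leb2]_(x in csq p.1 (2 * r)) (\int[leb2]_y G (x, y)))%E).
  apply: ge0_le_integral.
  - exact: measurable_csq.
  - by move=> x _; rewrite -EFinM lee_fin mulr_ge0 // cabs_ge0.
  - apply: emeasurable_funM; first exact: measurable_cst.
    apply/measurable_EFinP; apply: measurable_cont_Cx; first exact: measurable_csq.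
    move=> w hw; have hh := hf _ (nrm w p.2 hw (h0 _)).
    by apply: cont_cabs; exact: (cder_cont (cder2_slice1 (holat_pd (holatM hh hh)))).
  - exact: measurable_funTS.
  - by move=> x hx; rewrite -EFinM; exact: inner.
apply: ge0_subset_integral => //; first exact: measurable_csq.
by move=> x _; apply: integral_ge0.
Qed.

End AreaMeanValue.

(** * The Bergman space as a real Hilbert space; expansion in an orthonormal system *)

Section BergmanSpace.
Variable R : realType.
Local Notation Cx := (Cx R).
Local Notation C2 := (C2 R).
Local Notation lm := (@leb4m R).
Implicit Types (f g h : C2 -> Cx) (p z v : C2).

(** The real part of [a conj(b)]. Square-integrable functions are handled as a real Hilbert space;
    the imaginary part of the Hermitian product is the real product with [i g], see [ip_imE]. *)
Definition rdot (a b : Cx) : R := a.1 * b.1 + a.2 * b.2.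

Lemma rdot_self a : rdot a a = cnorm2 a.
Proof. by rewrite /rdot /cnorm2 !expr2. Qed.

Lemma cnorm2_parallel (r : R) (a b : Cx) : cnorm2 (r *: a + b) <= 2 * r ^+ 2 * cnorm2 a + 2 * cnorm2 b.
Proof.
rewrite /cnorm2 !cxE !cxZE -subr_ge0.
have -> : 2 * r ^+ 2 * (a.1 ^+ 2 + a.2 ^+ 2) + 2 * (b.1 ^+ 2 + b.2 ^+ 2)
  - ((r * a.1 + b.1) ^+ 2 + (r * a.2 + b.2) ^+ 2) = (r * a.1 - b.1) ^+ 2 + (r * a.2 - b.2) ^+ 2 by ring.
by rewrite addr_ge0 // sqr_ge0.
Qed.

Lemma rdot_le a b : `|rdot a b| <= cnorm2 a + cnorm2 b.
Proof.
rewrite ler_norml /rdot /cnorm2.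
have := (sqr_ge0 (a.1 + b.1), sqr_ge0 (a.2 + b.2), sqr_ge0 (a.1 - b.1), sqr_ge0 (a.2 - b.2)).
have := (sqr_ge0 a.1, sqr_ge0 a.2, sqr_ge0 b.1, sqr_ge0 b.2).
by move=> [[[? ?] ?] ?] [[[? ?] ?] ?]; apply/andP; split; lra.
Qed.

Lemma cont_rdot f g p : {for p, continuous f} -> {for p, continuous g} ->
  {for p, continuous (fun z => rdot (f z) (g z))}.
Proof.
move=> cf cg; apply: cvgD; apply: cvgM.
- exact: (cont_fst cf).
- exact: (cont_fst cg).
- exact: (cont_snd cf).
- exact: (cont_snd cg).
Qed.

Section Domain.
Variable W : set C2.
Hypothesis oW : open W.

Let mW : @measurable _ (C2oc R) W := open_measurable_C2 oW.

Definition ipr f g : R := Rintegral lm W (fun z => rdot (f z) (g z)).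

Lemma A2P f : A2 W f <-> (forall p, W p -> holat f p) /\ lm.-integrable W (fun z => (cnorm2 (f z))%:E).
Proof. by rewrite /A2 holomorphic_onP leb4_integrableE. Qed.

Lemma A2_hol f p : A2 W f -> W p -> holat f p. Proof. by move=> /A2P[h _] /h. Qed.

Lemma A2_int f : A2 W f -> lm.-integrable W (EFin \o (fun z => cnorm2 (f z))).
Proof. by move=> /A2P[]. Qed.

Lemma hol_measurable f g : (forall p, W p -> holat f p) -> (forall p, W p -> holat g p) ->
  measurable_fun W (fun z => rdot (f z) (g z)).
Proof.
move=> hf hg; apply: measurable_cont_C2 => // z Wz.
by apply: cont_rdot; [exact: holat_cont (hf _ Wz)|exact: holat_cont (hg _ Wz)].
Qed.

Lemma A2_dom f g h (c d : R) : A2 W g -> A2 W h -> (forall p, W p -> holat f p) ->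
  (forall p, W p -> cnorm2 (f p) <= c * cnorm2 (g p) + d * cnorm2 (h p)) -> A2 W f.
Proof.
move=> Ag Ah hf le; apply/A2P; split => //.
have I := integrableD mW (integrableZl mW c (A2_int Ag)) (integrableZl mW d (A2_int Ah)).
apply: (le_integrable mW _ _ I).
  apply/measurable_EFinP; have := hol_measurable hf hf.
  by congr measurable_fun; apply/funext => z; rewrite rdot_self.
move=> z Wz /=; rewrite lee_fin ger0_norm ?cnorm2_ge0 //.
by apply: le_trans (le z Wz) _; exact: ler_norm.
Qed.

Lemma A2_0 : A2 W (fun=> 0).
Proof.
apply/A2P; split; first by move=> p _; exact: holat_cst.
have -> : (fun z : C2 => (cnorm2 (0 : Cx))%:E) = cst (0 : \bar R).
  by apply/funext => z; rewrite /cnorm2 /= expr0n /= addr0.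
exact: integrable0.
Qed.

Lemma holat_rZ (r : R) f p : holat f p -> holat (fun z => r *: f z) p.
Proof.
have -> : (fun z => r *: f z) = (fun z => cmul (creal r) (f z)).
  by apply/funext => z; apply: cx_eq; rewrite !cxE !cxZE /=; ring.
exact: holatZ.
Qed.

Lemma A2_lin (r : R) f g : A2 W f -> A2 W g -> A2 W (fun z => r *: f z + g z).
Proof.
move=> Af Ag; apply: (A2_dom Af Ag (c := 2 * r ^+ 2) (d := 2)).
  by move=> p Wp; apply: holatD; [apply: holat_rZ; exact: A2_hol|exact: A2_hol].
by move=> p _; exact: cnorm2_parallel.
Qed.

Lemma A2_mul f g (M : R) : (forall p, W p -> holat g p) -> (forall p, W p -> cnorm2 (g p) <= M) ->
  A2 W f -> A2 W (fun z => cmul (g z) (f z)).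
Proof.
move=> hg bg Af; apply: (A2_dom Af A2_0 (c := M) (d := 0)).
  by move=> p Wp; apply: holatM; [exact: hg|exact: A2_hol].
by move=> p Wp; rewrite cnorm2M mul0r addr0 ler_wpM2r ?cnorm2_ge0 // bg.
Qed.

Lemma A2_cZ (c : Cx) f : A2 W f -> A2 W (fun z => cmul c (f z)).
Proof. by apply: (A2_mul (M := cnorm2 c)) => // p _; exact: holat_cst. Qed.

Lemma A2_dot f g : A2 W f -> A2 W g -> lm.-integrable W (EFin \o (fun z => rdot (f z) (g z))).
Proof.
move=> Af Ag; have I := integrableD mW (A2_int Af) (A2_int Ag).
apply: (le_integrable mW _ _ I).
  by apply/measurable_EFinP; apply: hol_measurable => p; exact: A2_hol.
by move=> z Wz /=; rewrite lee_fin; apply: le_trans (rdot_le _ _) (ler_norm _).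
Qed.

Lemma iprC f g : ipr f g = ipr g f.
Proof. by apply: eq_Rintegral => z _; rewrite /rdot; ring. Qed.

Lemma ipr_lin (r : R) f g h : A2 W f -> A2 W g -> A2 W h ->
  ipr (fun z => r *: f z + g z) h = r * ipr f h + ipr g h.
Proof.
move=> Af Ag Ah; rewrite /ipr -RintegralZl //; last exact: A2_dot.
rewrite -RintegralD //; last 2 first.
- by have := integrableZl mW r (A2_dot Af Ah); apply: eq_integrable.
- exact: A2_dot.
by apply: eq_Rintegral => z _; rewrite /rdot !cxE !cxZE; ring.
Qed.

Lemma ipr_0 g : ipr (fun=> 0) g = 0.
Proof.
rewrite /ipr (eq_Rintegral lm (g := fun=> 0)); first by rewrite Rintegral_cst // mul0r.
by move=> z _; rewrite /rdot !cxE !mul0r addr0.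
Qed.

Lemma ipr_le f g : A2 W f -> A2 W g -> (forall z, W z -> cnorm2 (f z) <= cnorm2 (g z)) ->
  ipr f f <= ipr g g.
Proof.
move=> Af Ag h; apply: le_Rintegral; [exact: mW|exact: A2_dot|exact: A2_dot|].
by move=> z /h; rewrite !rdot_self.
Qed.

Lemma ipr_ge0 f : 0 <= ipr f f.
Proof. by apply: Rintegral_ge0 => z _; rewrite rdot_self cnorm2_ge0. Qed.

Lemma iprE f : A2 W f -> (\int[lm]_(z in W) (cnorm2 (f z))%:E)%E = (ipr f f)%:E.
Proof.
move=> Af; rewrite /ipr /Rintegral fineK; last exact: integrable_fin_num (A2_dot Af Af).
by apply: eq_integral => z _; rewrite rdot_self.
Qed.

Lemma ip_reE f g : A2 W f -> A2 W g -> ip_re W f g = (ipr f g)%:E.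
Proof.
move=> Af Ag; rewrite /ip_re leb4_integralE /ipr /Rintegral fineK //.
exact: integrable_fin_num (A2_dot Af Ag).
Qed.

Lemma ip_imE f g : A2 W f -> A2 W g -> ip_im W f g = (ipr f (fun z => cmul (cI R) (g z)))%:E.
Proof.
move=> Af Ag; rewrite /ip_im leb4_integralE /ipr /Rintegral fineK; last first.
  by apply: integrable_fin_num => //; apply: A2_dot => //; exact: A2_cZ.
by apply: eq_integral => z _; congr EFin; rewrite /rdot !cxE /=; ring.
Qed.

Lemma ball_bound p : W p -> exists2 r : R, 0 < r & exists2 k : R, 0 < k &
  (forall z, `|z - p| < r -> W z) /\
  forall f, A2 W f -> forall z, `|z - p| < r -> k * cnorm2 (f z) <= ipr f f.
Proof.
move=> Wp; have /near_normP[r r0 hr] : \forall z \near p, W z by exact: open_nbhs_nbhs.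
have r80 : 0 < r / 8 by lra.
exists (r / 4); first by lra.
exists (((r / 8) ^+ 2 / 2) ^+ 2); first by rewrite exprn_gt0 // divr_gt0 // exprn_gt0.
have sub z : `|z - p| < r -> W z by move=> h; apply: hr.
split=> [z hz|f Af z hz]; first by apply: sub; lra.
have sW w : `|w - z| <= 2 * (r / 8) -> W w.
  move=> hw; apply: sub; have -> : w - p = (w - z) + (z - p) by rewrite addrA subrK.
  by apply: le_lt_trans (ler_normD _ _) _; lra.
have H := @box_L2 R f z (r / 8) r80 (fun w hw => A2_hol Af (sW w hw)).
rewrite -lee_fin -iprE //; apply: le_trans H _.
apply: ge0_subset_integral => //; first exact: measurable_cbox.
  exact: measurable_int (A2_int Af).
by move=> w _; rewrite lee_fin cnorm2_ge0.
Qed.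

(** Fatou's lemma plays the part of weak compactness: a bound on the tail of the norms puts the
    pointwise limit into the space and bounds its norm. *)
Lemma A2_fatou (F : nat -> C2 -> Cx) h (B : R) : (forall n, A2 W (F n)) ->
  (forall p, W p -> holat h p) ->
  (forall z, W z -> (fun n => cnorm2 (F n z)) @ \oo --> cnorm2 (h z)) ->
  (exists N, forall n, (N <= n)%N -> ipr (F n) (F n) <= B) ->
  A2 W h /\ ipr h h <= B.
Proof.
move=> AF hh cv [N hN].
pose u n z : \bar R := (cnorm2 (F (n + N)%N z))%:E.
have mu n : measurable_fun W (u n) by have /integrableP[] := A2_int (AF (n + N)%N).
have mh : measurable_fun W (fun z => (cnorm2 (h z))%:E).
  apply/measurable_EFinP; have := hol_measurable hh hh.
  by congr measurable_fun; apply/funext => z; rewrite rdot_self.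
have u0 n z : W z -> (0 <= u n z)%E by move=> _; rewrite lee_fin cnorm2_ge0.
have := fatou lm mW mu u0.
have -> : (\int[lm]_(z in W) limn_einf (u ^~ z) = \int[lm]_(z in W) (cnorm2 (h z))%:E)%E.
  apply: eq_integral => z /[1!inE] Wz.
  have cvz : (u ^~ z) @ \oo --> (cnorm2 (h z))%:E.
    apply: cvg_EFin; first by apply: nearW.
    by rewrite (cvg_shiftn N (fun n => cnorm2 (F n z))); exact: cv.
  by have [] := cvg_limn_einf_sup cvz.
have lB : (limn_einf (fun n => \int[lm]_(z in W) u n z) <= B%:E)%E.
  rewrite limn_einf_lim; apply: lime_le; first exact: is_cvg_einfs.
  apply: nearW => n; apply: (@le_trans _ _ (\int[lm]_(z in W) u n z)%E).
    by apply: ereal_inf_lbound; exists n => /=.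
  by rewrite iprE // lee_fin hN // leq_addl.
move=> /le_trans/(_ lB) le.
have Ah : A2 W h.
  apply/A2P; split => //; apply/integrableP; split => //.
  apply: le_lt_trans (ltry B); apply: le_trans le.
  rewrite le_eqVlt; apply/orP; left; apply/eqP; apply: eq_integral => z _ /=.
  by rewrite ger0_norm // cnorm2_ge0.
by split => //; rewrite -lee_fin -iprE.
Qed.

Definition lcomb (c : nat -> R) (psi : nat -> C2 -> Cx) n z : Cx :=
  \sum_(m < n) c m *: psi m z.

Definition rlin (l : (C2 -> Cx) -> R) := forall (r : R) f g, A2 W f -> A2 W g ->
  l (fun z => r *: f z + g z) = r * l f + l g.

Lemma lcombS c psi n : lcomb c psi n.+1 = (fun z => c n *: psi n z + lcomb c psi n z).
Proof. by apply/funext => z; rewrite /lcomb big_ord_recr /= addrC. Qed.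

Lemma lcomb0 c psi : lcomb c psi 0 = (fun=> 0).
Proof. by apply/funext => z; rewrite /lcomb big_ord0. Qed.

Lemma rlin0 l : rlin l -> l (fun=> 0) = 0.
Proof.
move=> hl; have := hl 1 _ _ A2_0 A2_0.
have -> : (fun z : C2 => 1 *: (0 : Cx) + 0) = (fun=> 0) by apply/funext => z; rewrite scaler0 addr0.
by rewrite mul1r => /eqP; rewrite -subr_eq0 opprD addrA subrr sub0r oppr_eq0 => /eqP.
Qed.

Section Orthonormal.
Variable psi : nat -> C2 -> Cx.
Hypothesis Apsi : forall m, A2 W (psi m).
Hypothesis off : forall m n, m != n -> ipr (psi m) (psi n) = 0.
Hypothesis on : forall m, psi m = (fun=> 0) \/ ipr (psi m) (psi m) = 1.
Implicit Types c : nat -> R.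

Lemma lcombA2 c n : A2 W (lcomb c psi n).
Proof. by elim: n => [|n IH]; [rewrite lcomb0; exact: A2_0|rewrite lcombS; exact: A2_lin]. Qed.

Lemma rlin_lcomb l c n : rlin l -> l (lcomb c psi n) = \sum_(m < n) c m * l (psi m).
Proof.
move=> hl; elim: n => [|n IH]; first by rewrite lcomb0 rlin0 // big_ord0.
by rewrite lcombS hl ?IH ?big_ord_recr /= 1?addrC //; exact: lcombA2.
Qed.

Lemma rlin_ipr h : A2 W h -> rlin (fun f => ipr f h).
Proof. by move=> Ah r f g Af Ag; exact: ipr_lin. Qed.

Lemma ipr_lcomb_psi c n k : ipr (lcomb c psi n) (psi k) =
  if (k < n)%N then c k * ipr (psi k) (psi k) else 0.
Proof.
rewrite (rlin_lcomb c n (rlin_ipr (Apsi k))); elim: n => [|n IH]; first by rewrite big_ord0.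
rewrite big_ord_recr /= IH; case: (eqVneq k n) => [->|kn].
  by rewrite ltnn ltnSn add0r.
have nk : n != k by rewrite eq_sym.
by rewrite [(k < n.+1)%N]ltnS [(k <= n)%N]leq_eqVlt (negbTE kn) (off nk) mulr0 addr0.
Qed.

Lemma ipr_psi_le1 k : 0 <= ipr (psi k) (psi k) <= 1.
Proof. by rewrite ipr_ge0; case: (on k) => [->|->]; rewrite ?ipr_0 ?ler01 ?lexx. Qed.

Lemma ipr_lcomb c n : ipr (lcomb c psi n) (lcomb c psi n) <= \sum_(m < n) c m ^+ 2.
Proof.
rewrite (rlin_lcomb c n (rlin_ipr (lcombA2 c n))); apply: ler_sum => m _.
rewrite iprC ipr_lcomb_psi ltn_ord expr2 mulrA -[leRHS]mulr1.
apply: ler_wpM2l; first by rewrite -expr2 sqr_ge0.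
by case/andP: (ipr_psi_le1 m).
Qed.

(** Tested on the combination with coefficients [l (psi m)], the bound reads [s^2 <= B s] for the
    partial sum [s]: one half of the Riesz representation. *)
Lemma functional_bound l (B : R) n : rlin l -> (forall f, A2 W f -> l f ^+ 2 <= B * ipr f f) -> 0 <= B ->
  \sum_(m < n) l (psi m) ^+ 2 <= B.
Proof.
move=> hl hB B0; set s := \sum_(m < n) _.
have s0 : 0 <= s by apply: sumr_ge0 => m _; rewrite sqr_ge0.
have := hB _ (lcombA2 (fun m => l (psi m)) n).
rewrite rlin_lcomb // (eq_bigr (fun m : 'I_n => l (psi m) ^+ 2)) -/s; last by move=> m _; rewrite expr2.
move=> h; have := ipr_lcomb (fun m => l (psi m)) n; rewrite -/s => h2.
have h3 : s ^+ 2 <= B * s by apply: le_trans h _; rewrite ler_wpM2l.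
case: (ltP 0 s) => [s1|]; last by lra.
by rewrite -(ler_pM2r s1) -expr2.
Qed.

Lemma ipr_quad (r : R) f g : A2 W f -> A2 W g ->
  ipr (fun z => r *: f z + g z) (fun z => r *: f z + g z) =
    r ^+ 2 * ipr f f + 2 * r * ipr f g + ipr g g.
Proof.
move=> Af Ag; rewrite (ipr_lin r Af Ag (A2_lin r Af Ag)).
rewrite (iprC f) (iprC g) (ipr_lin r Af Ag Af) (ipr_lin r Af Ag Ag) (iprC g f); ring.
Qed.

Lemma ipr_sqr_le f k : A2 W f -> ipr f (psi k) ^+ 2 <= ipr f f.
Proof.
move=> Af; case: (on k) => [->|h]; first by rewrite iprC ipr_0 expr0n /= ipr_ge0.
have := ipr_ge0 (fun z => (- ipr f (psi k)) *: psi k z + f z).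
by rewrite (ipr_quad _ (Apsi k) Af) h (iprC (psi k) f); lra.
Qed.

Lemma bessel f n : A2 W f -> \sum_(m < n) ipr f (psi m) ^+ 2 <= ipr f f.
Proof.
move=> Af; set c := fun m => ipr f (psi m); set S := lcomb c psi n.
have AS : A2 W S := lcombA2 c n.
have fS : ipr S f = \sum_(m < n) c m ^+ 2.
  by rewrite (rlin_lcomb c n (rlin_ipr Af)); apply: eq_bigr => m _; rewrite iprC expr2.
have := ipr_ge0 (fun z => - 1 *: S z + f z).
rewrite (ipr_quad _ AS Af) fS.
by have := ipr_lcomb c n; rewrite -/S; lra.
Qed.

Lemma sum_diff (u : nat -> R) n m : (n <= m)%N ->
  \sum_(i < m) (if (n <= i)%N then u i else 0) = \sum_(i < m) u i - \sum_(i < n) u i.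
Proof.
elim: m => [|m IH]; first by rewrite leqn0 => /eqP ->; rewrite !big_ord0 subrr.
rewrite leq_eqVlt => /orP[/eqP ->|]; last first.
  by rewrite ltnS => h; rewrite !big_ord_recr /= IH // h; ring.
rewrite subrr big1 // => i _; by rewrite leqNgt ltn_ord.
Qed.

Lemma lcomb_diff c n m : (n <= m)%N ->
  (fun z => lcomb c psi m z - lcomb c psi n z) = lcomb (fun i => if (n <= i)%N then c i else 0) psi m.
Proof.
move=> nm; apply/funext => z; rewrite /lcomb.
elim: m nm => [|m IH]; first by rewrite leqn0 => /eqP ->; rewrite !big_ord0 subrr.
rewrite leq_eqVlt => /orP[/eqP ->|]; last first.
  by rewrite ltnS => h; rewrite !big_ord_recr /= -IH // h addrAC.
rewrite subrr big1 // => i _; by rewrite leqNgt ltn_ord scale0r.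
Qed.

Section Expansion.
Variable f : C2 -> Cx.
Hypothesis Af : A2 W f.
Let c m := ipr f (psi m).
Let S := lcomb c psi.
Let s n := \sum_(m < n) c m ^+ 2.

Lemma partial_sum_cauchy : forall e : R, 0 < e -> exists N, forall n m, (N <= n)%N -> (n <= m)%N ->
  s m - s n <= e.
Proof.
move=> e e0; have s0 n : 0 <= s n by apply: sumr_ge0 => m _; exact: sqr_ge0.
have inc : {homo s : n m / (n <= m)%N >-> n <= m}.
  move=> n m nm; rewrite -subr_ge0; have := sum_diff (fun i => c i ^+ 2) nm; rewrite /s => <-.
  by apply: sumr_ge0 => i _; case: ifP => // _; exact: sqr_ge0.
pose B := sup (range s).
have hs : has_sup (range s).
  by split; [exists (s 0%N), 0%N|exists (ipr f f) => _ [n _ <-]; exact: bessel].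
have [_ [N _ <-] hN] := sup_adherent e0 hs.
exists N => n m Nn nm.
have : s m <= sup (range s) by apply: sup_upper_bound => //; exists m.
by have := inc _ _ Nn; lra.
Qed.

Lemma ipr_partial n m : (n <= m)%N ->
  ipr (fun z => S m z - S n z) (fun z => S m z - S n z) <= s m - s n.
Proof.
move=> nm; rewrite /S lcomb_diff //; apply: le_trans (ipr_lcomb _ _) _.
have := sum_diff (fun i => c i ^+ 2) nm; rewrite /s => <-; apply: ler_sum => i _.
by case: ifP => // _; rewrite expr0n.
Qed.

Hypothesis total : forall h, A2 W h -> (forall m, ipr h (psi m) = 0) -> forall z, W z -> h z = 0.

Lemma A2B g h : A2 W g -> A2 W h -> A2 W (fun z => g z - h z).
Proof.
have -> : (fun z => g z - h z) = (fun z => - 1 *: h z + g z).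
  by apply/funext => z; rewrite scaleN1r addrC.
by move=> Ag Ah; exact: A2_lin.
Qed.

Lemma S_cauchy p : W p -> exists2 r : R, 0 < r & forall e : R, 0 < e -> exists N : nat, forall n m,
  (N <= n)%N -> (N <= m)%N -> forall z, `|z - p| < r -> cabs (S n z - S m z) <= e.
Proof.
move=> /ball_bound[r r0 [k k0 [sub bd]]]; exists r => // e e0.
have e1 : 0 < k * e ^+ 2 by rewrite mulr_gt0 // exprn_gt0.
have [N hN] := partial_sum_cauchy e1; exists N.
have H n m z : (N <= n)%N -> (n <= m)%N -> `|z - p| < r -> cabs (S m z - S n z) <= e.
  move=> Nn nm hz; have A : A2 W (fun z => S m z - S n z) by apply: A2B; exact: lcombA2.
  have := bd _ A z hz => h1; have h2 := ipr_partial nm; have h3 := hN n m Nn nm.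
  have : k * cnorm2 (S m z - S n z) <= k * e ^+ 2 by apply: le_trans h1 (le_trans h2 h3).
  by rewrite ler_pM2l // cnorm2_cabs ler_sqr ?nnegrE ?cabs_ge0 ?(ltW e0).
move=> n m Nn Nm z hz; case: (leqP n m) => nm; last by apply: H => //; exact: ltnW.
by rewrite cabs_distC; exact: H.
Qed.

(** Bessel's inequality and [ball_bound] make the partial sums converge locally uniformly; the limit
    [g] is in the space by Fatou, [f - g] is orthogonal to every [psi m], and totality gives
    [f = g]. Local uniformity also carries over the first derivatives, which the metric involves. *)
Lemma expansion p : W p -> forall e : R, 0 < e -> exists N : nat, forall n, (N <= n)%N ->
  [/\ cabs (S n p - f p) <= e, cabs (pd1 (S n) p - pd1 f p) <= e & cabs (pd2 (S n) p - pd2 f p) <= e].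
Proof.
move=> Wp.
have lim z : W z -> exists l : Cx, forall e : R, 0 < e -> exists N : nat, forall n, (N <= n)%N ->
    cabs (S n z - l) <= e.
  move=> /S_cauchy[r r0 h]; apply: cx_cauchy => e /h[N hN]; exists N => n m Nn Nm.
  by apply: hN => //; rewrite subrr normr0.
pose g z := if pselect (W z) is left Wz then projT1 (cid (lim z Wz)) else 0.
have glim z : W z -> forall e : R, 0 < e -> exists N : nat, forall n, (N <= n)%N -> cabs (S n z - g z) <= e.
  by move=> Wz; rewrite /g; case: pselect => // Wz'; case: cid.
have AS n : A2 W (S n) by exact: lcombA2.
have uni q : W q -> exists2 r : R, 0 < r & (forall z, `|z - q| < r -> W z) /\
    forall e : R, 0 < e -> exists N : nat, forall n, (N <= n)%N ->
      forall z, `|z - q| < r -> cabs (S n z - g z) <= e.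
  move=> Wq; have [r r0 h] := S_cauchy Wq; have [r' r'0 [k k0 [sub _]]] := ball_bound Wq.
  have rr : 0 < Num.min r r' by rewrite lt_min r0.
  exists (Num.min r r') => //; split; first by move=> z; rewrite lt_min => /andP[_ /sub].
  move=> e e0; have e20 : 0 < e / 2 by lra.
  have [N hN] := h _ e20; exists N => n Nn z; rewrite lt_min => /andP[hz /sub Wz].
  have [N' hN'] := glim z Wz _ e20.
  have := hN n (maxn N N') Nn (leq_maxl _ _) z hz; have := hN' (maxn N N') (leq_maxr _ _).
  have -> : S n z - g z = (S n z - S (maxn N N') z) + (S (maxn N N') z - g z) by rewrite addrA subrK.
  by have := cabsD (S n z - S (maxn N N') z) (S (maxn N N') z - g z); lra.
have lims q : W q -> holat g q /\ forall e : R, 0 < e -> exists N : nat, forall n, (N <= n)%N ->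
    cabs (pd1 (S n) q - pd1 g q) <= e /\ cabs (pd2 (S n) q - pd2 g q) <= e.
  move=> Wq; have [r r0 [sub hu]] := uni q Wq.
  have [r' r'0 [k k0 [_ bd]]] := ball_bound Wq.
  have rr : 0 < Num.min r r' by rewrite lt_min r0.
  have bb n z : `|z - q| < Num.min r r' -> cabs (S n z) <= 1 + ipr f f / k.
    rewrite lt_min => /andP[_ hz]; have h1 := bd _ (AS n) z hz.
    have h2 : k * cnorm2 (S n z) <= ipr f f by apply: le_trans h1 (le_trans (ipr_lcomb _ _) (bessel _ Af)).
    have h3 : cnorm2 (S n z) <= ipr f f / k by rewrite ler_pdivlMr // mulrC.
    have := sqr_ge0 (cabs (S n z) - 1); rewrite cnorm2_cabs in h3; have := cabs_ge0 (S n z); nra.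
  apply: (@hol_limit R S g q (Num.min r r') (1 + ipr f f / k) rr) => //.
    by move=> n z; rewrite lt_min => /andP[/sub Wz _]; exact: A2_hol (AS n) Wz.
  move=> e /hu[N hN]; exists N => n Nn z; rewrite lt_min => /andP[hz _]; exact: hN.
have hg q : W q -> holat g q by move=> /lims[].
have cn z : W z -> forall h : C2 -> Cx, (fun n => cnorm2 (S n z - h z)) @ \oo --> cnorm2 (g z - h z).
  move=> Wz h; have cvS : (fun n => S n z) @ \oo --> g z.
    apply/cvgrPdist_le => e e0; have [N hN] := glim z Wz e e0.
    near=> n; rewrite distrC; apply: le_trans (cabs_ge_norm _) _; apply: hN.
    by near: n; exact: nbhs_infty_ge.
  have cvSh : (fun n => S n z - h z) @ \oo --> g z - h z by apply: cvgB => //; exact: cvg_cst.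
  have := @cont_cnorm2 R _ (fun w : Cx => w) (g z - h z) (@cvg_id _ _).
  by move=> cc; exact: (cvg_comp _ _ cvSh cc).
have cn0 z : W z -> (fun n => cnorm2 (S n z)) @ \oo --> cnorm2 (g z).
  move=> Wz; have := cn z Wz (fun=> 0); rewrite subr0.
  have -> : (fun n => cnorm2 (S n z - 0)) = (fun n => cnorm2 (S n z)) by apply/funext => n; rewrite subr0.
  exact.
have [Ag _] : A2 W g /\ ipr g g <= ipr f f.
  apply: (@A2_fatou S g (ipr f f) AS hg cn0); exists 0%N => n _.
  by apply: le_trans (ipr_lcomb _ _) (bessel _ Af).
have fg z : W z -> f z = g z.
  move=> Wz; have : f z - g z = 0; last by move/eqP; rewrite subr_eq0 => /eqP.
  apply: (total (h := fun z => f z - g z)) => // [|m]; first exact: A2B.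
  have -> : ipr (fun z => f z - g z) (psi m) = ipr f (psi m) - ipr g (psi m).
    have -> : (fun z => f z - g z) = (fun z => - 1 *: g z + f z).
      by apply/funext => w; rewrite scaleN1r addrC.
    by rewrite ipr_lin // mulN1r addrC.
  apply/eqP; rewrite -sqrf_eq0 eq_le sqr_ge0 andbT; apply/ler_addgt0Pl => e e0; rewrite addr0.
  have [N hN] := partial_sum_cauchy e0.
  (* From index [m.+1] on the partial sum has its final component along [psi m], so the squared
     defect at [m] is bounded by the squared norm of the tail [g - S M], at most [e] by Fatou. *)
  pose M := maxn N m.+1.
  have AgS : A2 W (fun z => g z - S M z) by apply: A2B.
  have [_ le] : A2 W (fun z => g z - S M z) /\ ipr (fun z => g z - S M z) (fun z => g z - S M z) <= e.
    apply: (@A2_fatou (fun n z => S n z - S M z)) => //.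
    - by move=> n; apply: A2B.
    - by move=> p0 /(A2_hol AgS).
    - by move=> z0 Wz0; exact: cn.
    - exists M => n Mn; apply: le_trans (ipr_partial Mn) _; apply: hN => //; exact: leq_maxl.
  apply: le_trans le; apply: le_trans (ipr_sqr_le m AgS).
  have -> : ipr (fun z => g z - S M z) (psi m) = ipr g (psi m) - ipr (S M) (psi m).
    have -> : (fun z => g z - S M z) = (fun z => - 1 *: S M z + g z).
      by apply/funext => w; rewrite scaleN1r addrC.
    by rewrite ipr_lin // mulN1r addrC.
  rewrite ipr_lcomb_psi leq_maxr -/(c m).
  have -> : c m * ipr (psi m) (psi m) = c m.
    by case: (on m) => h; rewrite ?h ?mulr1 // /c h iprC !ipr_0 mul0r.
  by rewrite -sqrrN opprB.
move=> e e0; have [N hN] := glim p Wp e e0; have [hgp h] := lims p Wp; have [N' hN'] := h e e0.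
have near_fg : \forall z \near p, g z = f z.
  have : \forall z \near p, W z by exact: open_nbhs_nbhs.
  by apply: filterS => z /fg.
have [d1 d2] := cder2_pd (cder2_near near_fg (holat_pd hgp)).
exists (maxn N N') => n; rewrite geq_max => /andP[Nn N'n].
have [b1 b2] := hN' n N'n; have b0 := hN n Nn.
by rewrite d1 d2 (fg p Wp); split; [exact: b0|exact: b1|exact: b2].
Unshelve. all: by end_near. Qed.

End Expansion.
End Orthonormal.
End Domain.
End BergmanSpace.

(** * Square-summable complex sequences and their real inner product *)

Section SquareSummable.
Variable R : realType.
Local Notation Cx := (Cx R).
Implicit Types (a b c : nat -> Cx).

Lemma quadratic_discriminant (A X B : R) : 0 <= A -> (forall s : R, 0 <= s ^+ 2 * A + 2 * s * X + B) ->
  X ^+ 2 <= A * B.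
Proof.
move=> A0 h; case: (ltP 0 A) => [A1|A1].
  have := h (- X / A); have -> : (- X / A) ^+ 2 * A + 2 * (- X / A) * X + B = (A * B - X ^+ 2) / A.
    by field; exact: lt0r_neq0.
  by rewrite pmulr_lge0 ?invr_gt0 // subr_ge0.
have A00 : A = 0 by apply/eqP; rewrite eq_le A0 A1.
rewrite A00 mul0r; case: (eqVneq X 0) => [->|X0]; first by rewrite expr0n.
have := h (- (B + 1) / (2 * X)); rewrite A00.
have -> : (- (B + 1) / (2 * X)) ^+ 2 * 0 + 2 * (- (B + 1) / (2 * X)) * X + B = - 1 by field.
by move=> ?; lra.
Qed.

Definition psum a b n : R := \sum_(j < n) rdot (a j) (b j).
Definition ell2 a := exists B : R, forall n, psum a a n <= B.
(** The real inner product of [l^2]. As a [limn] it is controlled only when both arguments are in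
    [ell2], hence the side conditions below. *)
Definition dsum a b : R := limn (psum a b).

Lemma psum_lin (r : R) a a' b n : psum (fun j => r *: a j + a' j) b n = r * psum a b n + psum a' b n.
Proof.
rewrite /psum mulr_sumr -big_split /=; apply: eq_bigr => j _.
by rewrite /rdot !cxE !cxZE; ring.
Qed.

Lemma psumC a b n : psum a b n = psum b a n.
Proof. by apply: eq_bigr => j _; rewrite /rdot mulrC [X in _ + X]mulrC. Qed.

Lemma psum_ge0 a n : 0 <= psum a a n.
Proof. by apply: sumr_ge0 => j _; rewrite rdot_self cnorm2_ge0. Qed.

Lemma psum_nd a : nondecreasing_seq (psum a a).
Proof.
by apply/nondecreasing_seqP => n; rewrite /psum big_ord_recr /= lerDl rdot_self cnorm2_ge0.
Qed.

Lemma ell2_lin (r : R) a b : ell2 a -> ell2 b -> ell2 (fun j => r *: a j + b j).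
Proof.
move=> [A hA] [B hB]; exists (2 * r ^+ 2 * A + 2 * B) => n.
have : psum (fun j => r *: a j + b j) (fun j => r *: a j + b j) n <= 2 * r ^+ 2 * psum a a n + 2 * psum b b n.
  rewrite /psum !mulr_sumr -big_split /=; apply: ler_sum => j _.
  by rewrite !rdot_self; exact: cnorm2_parallel.
move/le_trans; apply; apply: lerD; last by rewrite ler_pM2l.
by rewrite ler_wpM2l // mulr_ge0 // sqr_ge0.
Qed.

Lemma psum_cvg_self a : ell2 a -> psum a a @ \oo --> dsum a a.
Proof.
move=> [B hB]; apply: nondecreasing_is_cvgn; first exact: psum_nd.
by exists B => _ [n _ <-].
Qed.

(** Polarization reduces convergence to that of squared norms, which are monotone and bounded. *)
Lemma psum_cvg a b : ell2 a -> ell2 b -> psum a b @ \oo --> dsum a b.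
Proof.
move=> ha hb; apply/cvg_ex; exists ((dsum (fun j => 1 *: a j + b j) (fun j => 1 *: a j + b j) - dsum a a - dsum b b) / 2).
have -> : psum a b = fun n => (psum (fun j => 1 *: a j + b j) (fun j => 1 *: a j + b j) n - psum a a n - psum b b n) * 2^-1.
  apply/funext => n; set c := fun j => _.
  by rewrite (psum_lin 1 a b c) (psumC a c) (psumC b c) (psum_lin 1 a b a) (psum_lin 1 a b b) (psumC b a); field.
apply: cvgMl; apply: cvgB; [apply: cvgB|]; apply: psum_cvg_self => //.
exact: ell2_lin.
Qed.

Lemma dsumC a b : dsum a b = dsum b a.
Proof. by rewrite /dsum; congr (limn _); apply/funext => n; exact: psumC. Qed.

Lemma dsum_lin (r : R) a a' b : ell2 a -> ell2 a' -> ell2 b ->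
  dsum (fun j => r *: a j + a' j) b = r * dsum a b + dsum a' b.
Proof.
move=> ha ha' hb; apply/cvg_lim => //.
have -> : psum (fun j => r *: a j + a' j) b = fun n => r * psum a b n + psum a' b n.
  by apply/funext => n; exact: psum_lin.
by apply: cvgD; [apply: cvgMr; exact: psum_cvg|exact: psum_cvg].
Qed.

Lemma dsum_ge a n : ell2 a -> psum a a n <= dsum a a.
Proof.
move=> ha; apply: (nondecreasing_cvgn_le (@psum_nd a)).
by apply/cvg_ex; exists (dsum a a); exact: psum_cvg.
Qed.

Lemma dsum_le a (B : R) : (forall n, psum a a n <= B) -> dsum a a <= B.
Proof.
move=> hB; have ha : ell2 a by exists B.
by apply: limr_le; [apply/cvg_ex; exists (dsum a a); exact: psum_cvg|exact: nearW].
Qed.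

Lemma dsum_ge0 a : ell2 a -> 0 <= dsum a a.
Proof. by move=> /(@dsum_ge a 0); rewrite /psum big_ord0. Qed.

Lemma dsum_cauchy a b : ell2 a -> ell2 b -> dsum a b ^+ 2 <= dsum a a * dsum b b.
Proof.
move=> ha hb; apply: quadratic_discriminant; first exact: dsum_ge0.
move=> s; have hs := ell2_lin s ha hb; have := dsum_ge0 hs.
rewrite (dsum_lin s ha hb hs) (dsumC a) (dsumC b) (dsum_lin s ha hb ha) (dsum_lin s ha hb hb) (dsumC b a); lra.
Qed.

Lemma dsum_bound a b (A B : R) : ell2 a -> ell2 b -> 0 <= A -> 0 <= B ->
  dsum a a <= A ^+ 2 -> dsum b b <= B ^+ 2 -> `|dsum a b| <= A * B.
Proof.
move=> ha hb A0 B0 hA hB; rewrite -ler_sqr ?nnegrE ?mulr_ge0 // real_normK ?num_real //.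
apply: le_trans (dsum_cauchy ha hb) _; rewrite exprMn.
by apply: ler_pM => //; exact: dsum_ge0.
Qed.

Lemma ell2_mul (k : Cx) a : ell2 a -> ell2 (fun j => cmul k (a j)).
Proof.
move=> [B hB]; exists (cnorm2 k * B) => n.
apply: (@le_trans _ _ (cnorm2 k * psum a a n)); last by rewrite ler_wpM2l ?cnorm2_ge0.
by rewrite /psum mulr_sumr; apply: ler_sum => j _; rewrite !rdot_self cnorm2M.
Qed.

(** The product rule in [l^2]. Remainders are small in norm, not termwise, which is the form in
    which [dsum_lev_bound] delivers them; expanding the bilinear product leaves only terms
    [O(t^2)]. *)
Lemma dsum_derive (a b r s : R -> nat -> Cx) (a' b' : nat -> Cx) (C d : R) :
  0 < d -> 0 <= C -> ell2 a' -> ell2 b' ->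
  (forall t, `|t| < d -> ell2 (a t) /\ ell2 (b t) /\ ell2 (r t) /\ ell2 (s t)) ->
  (forall t, `|t| < d -> a t = (fun j => 1 *: (t *: a' j + a 0 j) + r t j)) ->
  (forall t, `|t| < d -> b t = (fun j => 1 *: (t *: b' j + b 0 j) + s t j)) ->
  (forall t, `|t| < d -> dsum (r t) (r t) <= (C * t ^+ 2) ^+ 2 /\ dsum (s t) (s t) <= (C * t ^+ 2) ^+ 2) ->
  (forall t, `|t| < d -> dsum (b t) (b t) <= C ^+ 2 /\
     dsum (fun j => t *: a' j + a 0 j) (fun j => t *: a' j + a 0 j) <= C ^+ 2) ->
  exists D : R, forall t, `|t| < d ->
    `|dsum (a t) (b t) - dsum (a 0) (b 0) - t * (dsum a' (b 0) + dsum (a 0) b')| <= D * t ^+ 2.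
Proof.
move=> d0 C0 ea' eb' ell ha hb rs bb.
have [ea0 [eb0 _]] : ell2 (a 0) /\ ell2 (b 0) /\ ell2 (r 0) /\ ell2 (s 0) by apply: ell; rewrite normr0.
exists (`|dsum a' b'| + 2 * C ^+ 2) => t td.
have [ea [eb [er es]]] := ell t td; have [hr hs] := rs t td; have [hbt hat] := bb t td.
have eta : ell2 (fun j => t *: a' j + a 0 j) by exact: ell2_lin.
have etb : ell2 (fun j => t *: b' j + b 0 j) by exact: ell2_lin.
have e1 : dsum (a t) (b t) = dsum (fun j => t *: a' j + a 0 j) (b t) + dsum (r t) (b t).
  by rewrite {1}(ha t td) (dsum_lin 1 eta er eb) mul1r.
have e2 : dsum (fun j => t *: a' j + a 0 j) (b t) = dsum (fun j => t *: a' j + a 0 j) (fun j => t *: b' j + b 0 j)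
    + dsum (fun j => t *: a' j + a 0 j) (s t).
  by rewrite dsumC (hb t td) (dsum_lin 1 etb es eta) mul1r (dsumC _ (s t)) (dsumC _ (fun j => t *: b' j + b 0 j)).
have e3 : dsum (fun j => t *: a' j + a 0 j) (fun j => t *: b' j + b 0 j) =
    t ^+ 2 * dsum a' b' + t * (dsum a' (b 0) + dsum (a 0) b') + dsum (a 0) (b 0).
  rewrite (dsum_lin t ea' ea0 etb) (dsumC a') (dsumC (a 0)) (dsum_lin t eb' eb0 ea') (dsum_lin t eb' eb0 ea0).
  by rewrite (dsumC b' a') (dsumC (b 0) a') (dsumC b' (a 0)) (dsumC (b 0) (a 0)); ring.
have Ct : 0 <= C * t ^+ 2 by rewrite mulr_ge0 // sqr_ge0.
have b1 := dsum_bound er eb Ct C0 hr hbt; have b2 := dsum_bound eta es C0 Ct hat hs.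
rewrite e1 e2 e3.
have -> : t ^+ 2 * dsum a' b' + t * (dsum a' (b 0) + dsum (a 0) b') + dsum (a 0) (b 0) +
   dsum (fun j => t *: a' j + a 0 j) (s t) + dsum (r t) (b t) - dsum (a 0) (b 0) -
   t * (dsum a' (b 0) + dsum (a 0) b') = t ^+ 2 * dsum a' b' + (dsum (fun j => t *: a' j + a 0 j) (s t) + dsum (r t) (b t)) by ring.
apply: le_trans (ler_normD _ _) _; have := ler_normD (dsum (fun j => t *: a' j + a 0 j) (s t)) (dsum (r t) (b t)).
rewrite normrM (ger0_norm (sqr_ge0 t)); lra.
Qed.

End SquareSummable.

(** * Functionals on the Bergman space in coordinates, and differentiation of their products *)

Section BergmanKernel.
Variable R : realType.
Local Notation Cx := (Cx R).
Local Notation C2 := (C2 R).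
Implicit Types (f g h : C2 -> Cx) (p z v e : C2) (c : Cx).
Variable W : set C2.
Hypothesis oW : open W.

Definition holW f := forall p, W p -> holat f p.
Definition der e f z : Cx := clin (pd1 f z) (pd2 f z) e.

(** Meant for the identity, [der e] and their composites. Functions are total on [C2] while only
    their values on [W] matter; the last clause says that [D] respects this. *)
Definition clop (D : (C2 -> Cx) -> C2 -> Cx) :=
  [/\ forall f, holW f -> holW (D f),
      forall c f g, holW f -> holW g -> forall z, W z ->
        D (fun z => cmul c (f z) + g z) z = cmul c (D f z) + D g z &
      forall f g, holW f -> (forall z, W z -> f z = g z) -> forall z, W z -> D f z = D g z].

Lemma holW_lin c f g : holW f -> holW g -> holW (fun z => cmul c (f z) + g z).
Proof. by move=> hf hg p Wp; apply: holatD; [apply: holatZ; exact: hf|exact: hg]. Qed.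

Lemma clop_id : clop (fun f => f).
Proof. by split => // f g _ h z Wz; exact: h. Qed.

Lemma near_domain p : W p -> \forall z \near p, W z.
Proof. by move=> Wp; exact: open_nbhs_nbhs. Qed.

Lemma ballW p : W p -> exists2 r : R, 0 < r & forall z, `|z - p| < r -> W z.
Proof. by move=> /near_domain/near_normP[r r0 h]; exists r. Qed.

Lemma hol_der f p e : holW f -> W p -> holat (der e f) p.
Proof.
move=> hf Wp; have [r r0 hr] := ballW Wp.
have cf := cont_cabs (holat_cont (hf p Wp)).
have /near_normP[r' r'0 hr'] : \forall z \near p, cabs (f z) < cabs (f p) + 1.
  have : nbhs (cabs (f p)) [set x : R | x < cabs (f p) + 1].
    by apply: open_nbhs_nbhs; split; [exact: open_lt|rewrite /= ltrDl].
  by move=> h; exact: (cf _ h).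
have m0 : 0 < Num.min r r' by rewrite lt_min r0.
have hb : holball f p (Num.min r r').
  by move=> z; rewrite lt_min => /andP[/hr Wz _]; exact: hf.
have hM z : `|z - p| < Num.min r r' -> cabs (f z) <= cabs (f p) + 1.
  by rewrite lt_min => /andP[_ /hr' /ltW].
have [h1 h2] := pd_holat m0 hb hM.
have -> : der e f = (fun z => cmul (pd1 f z) e.1 + cmul (pd2 f z) e.2) by [].
apply: holatD.
  have -> : (fun z => cmul (pd1 f z) e.1) = (fun z => cmul e.1 (pd1 f z)) by apply/funext => z; rewrite cmulC.
  exact: holatZ.
have -> : (fun z => cmul (pd2 f z) e.2) = (fun z => cmul e.2 (pd2 f z)) by apply/funext => z; rewrite cmulC.
exact: holatZ.
Qed.

Lemma clop_der e : clop (der e).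
Proof.
split=> [f hf p Wp|c f g hf hg z Wz|f g hf fg z Wz]; first exact: hol_der.
  have [d1 d2] := cder2_pd (cder2D (cder2Z c (holat_pd (hf z Wz))) (holat_pd (hg z Wz))).
  by rewrite /der d1 d2 /clin !cmulDl cmulDr !cmulA addrACA.
have nfg : \forall w \near z, f w = g w by apply: filterS (near_domain Wz) => w /fg.
by rewrite /der; have [-> ->] := cder2_pd (cder2_near nfg (holat_pd (hf z Wz))).
Qed.

Lemma clop_comp D E : clop D -> clop E -> clop (fun f => D (E f)).
Proof.
move=> [D1 D2 D3] [E1 E2 E3]; split=> [f hf|c f g hf hg z Wz|f g hf fg z Wz].
- exact: D1 (E1 _ hf).
- rewrite -D2 //; [|exact: E1|exact: E1].
  by apply: D3 => // [|w Ww]; [apply: E1; exact: holW_lin|exact: E2].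
- by apply: D3 => //; [exact: E1|exact: E3].
Qed.

Definition nrm f : R := Num.sqrt (ipr W f f).
Lemma nrm_ge0 f : 0 <= nrm f. Proof. exact: sqrtr_ge0. Qed.
Lemma nrm_sqr f : nrm f ^+ 2 = ipr W f f. Proof. by rewrite sqr_sqrtr // ipr_ge0. Qed.

Definition lbounded (D : (C2 -> Cx) -> C2 -> Cx) := forall p, W p ->
  exists2 r : R, 0 < r & exists2 C : R, 0 <= C &
    (forall z, `|z - p| < r -> W z) /\
    forall f, A2 W f -> forall z, `|z - p| < r -> cabs (D f z) <= C * nrm f.

Lemma A2_holW f : A2 W f -> holW f.
Proof. by move=> Af p Wp; exact: A2_hol Af Wp. Qed.

Lemma lbounded_id : lbounded (fun f => f).
Proof.
move=> p Wp; have [r r0 [k k0 [sub bd]]] := ball_bound oW Wp.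
exists r => //; exists (Num.sqrt k^-1); first exact: sqrtr_ge0.
split => // f Af z hz; have h := bd f Af z hz.
have e2 : Num.sqrt k^-1 ^+ 2 = k^-1 by rewrite sqr_sqrtr // invr_ge0 ltW.
rewrite -ler_sqr ?nnegrE ?cabs_ge0 ?mulr_ge0 ?sqrtr_ge0 // exprMn e2 nrm_sqr -cnorm2_cabs.
by rewrite mulrC ler_pdivlMr // mulrC.
Qed.

Lemma lbounded_der e D : clop D -> lbounded D -> lbounded (fun f => der e (D f)).
Proof.
move=> [D1 D2 D3] lD p Wp; have [r r0 [C C0 [sub bd]]] := lD p Wp.
exists (r / 2); first by lra.
exists (4 * (16 * C / (r / 2)) * `|e|).
  by rewrite !mulr_ge0 // invr_ge0; lra.
split=> [z hz|f Af z hz]; first by apply: sub; lra.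
have r20 : 0 < r / 2 by lra.
have sub' w : `|w - z| < r / 2 -> `|w - p| < r.
  move=> hw; have -> : w - p = (w - z) + (z - p) by rewrite addrA subrK.
  by apply: le_lt_trans (ler_normD _ _) _; lra.
have hb : holball (D f) z (r / 2).
  by move=> w /sub'/sub Ww; exact: D1 (A2_holW Af) w Ww.
have hM w : `|w - z| < r / 2 -> cabs (D f w) <= C * nrm f by move=> /sub'; exact: bd.
have [b1 b2] := cauchy_pd r20 hb hM.
have -> : 4 * (16 * C / (r / 2)) * `|e| * nrm f = 4 * (16 * (C * nrm f) / (r / 2)) * `|e| by ring.
exact: clin_bound.
Qed.

Lemma lbounded_taylor e D p : clop D -> lbounded D -> W p -> `|e| <= 1 ->
  exists2 r : R, 0 < r & exists2 C : R, 0 <= C &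
    forall t : R, `|t| < r -> W (p + t *: e) /\
    forall f, A2 W f -> cabs (D f (p + t *: e) - D f p - t *: der e (D f) p) <= C * t ^+ 2 * nrm f.
Proof.
move=> [D1 D2 D3] lD Wp e1; have [r r0 [C C0 [sub bd]]] := lD p Wp.
exists (r / 4); first by lra.
have K0 : 0 <= Ctay R by rewrite mulr_ge0 // Clip_ge0.
have rr0 : 0 <= r ^+ 2 by rewrite exprn_ge0 // ltW.
exists (Ctay R * C / r ^+ 2); first by apply: divr_ge0 => //; exact: mulr_ge0.
have nte (t : R) : `|t *: e| <= `|t| by rewrite normrZ ler_piMr.
move=> t ht; split=> [|f Af].
  apply: sub; rewrite addrAC subrr add0r; have := nte t; lra.
have hb : holball (D f) p r by move=> w /sub Ww; exact: D1 (A2_holW Af) w Ww.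
have te4 : `|t *: e| < r / 4 by have := nte t; lra.
have H := holball_taylor r0 hb (bd f Af) te4.
have -> : t *: der e (D f) p = clin (pd1 (D f) p) (pd2 (D f) p) (t *: e).
  have := clin_is_linear (pd1 (D f) p) (pd2 (D f) p) t e 0.
  by rewrite addr0 => ->; rewrite /der {3}/clin !cmulc0 !addr0.
apply: le_trans H _.
have -> : Ctay R * C / r ^+ 2 * t ^+ 2 * nrm f = Ctay R * (C * nrm f) / r ^+ 2 * t ^+ 2 by ring.
apply: ler_wpM2l.
  by apply: divr_ge0 => //; apply: mulr_ge0 => //; apply: mulr_ge0 => //; exact: nrm_ge0.
by rewrite -(real_normK (num_real t)) ler_sqr ?nnegrE.
Qed.

Variables (J : set nat) (phi : nat -> C2 -> Cx).
Hypothesis onb : ONB W J phi.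

Definition phi0 j : C2 -> Cx := if pselect (J j) then phi j else (fun=> 0).
(** The real orthonormal system [phi 0], [i phi 0], [phi 1], [i phi 1] and so on, with zeros for the
    indices outside [J]. *)
Definition psi m : C2 -> Cx := if odd m then (fun z => cmul (cI R) (phi0 m./2 z)) else phi0 m./2.

Lemma A2_phi0 j : A2 W (phi0 j).
Proof. by rewrite /phi0; case: pselect => Jj; [exact: (onb.1 _ Jj)|exact: A2_0]. Qed.

Lemma A2_psi m : A2 W (psi m).
Proof.
rewrite /psi; case: ifP => _; last exact: A2_phi0.
by apply: A2_cZ => //; exact: A2_phi0.
Qed.

Lemma ipr_phi0 j k : ipr W (phi0 j) (phi0 k) = (if j == k then ipr W (phi0 j) (phi0 j) else 0) /\
  ipr W (phi0 j) (fun z => cmul (cI R) (phi0 k z)) = 0.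
Proof.
have i0 : (fun z : C2 => cmul (cI R) 0) = (fun=> 0) by apply/funext => z; rewrite cmulc0.
rewrite /phi0; case: pselect => [Jj|nj]; last by rewrite !ipr_0; case: (j == k).
case: pselect => [Jk|nk]; last first.
  have e0 : ipr W (phi j) (fun=> 0) = 0 by rewrite iprC ipr_0.
  rewrite /= i0 e0; split => //; case: eqVneq => // jk; by move: nk; rewrite -jk.
have [h1 h2] := onb.2.1 j k Jj Jk.
have [Aj Ak] := (onb.1 _ Jj, onb.1 _ Jk).
move: h1 h2; rewrite (ip_reE oW Aj Ak) (ip_imE oW Aj Ak) => -[h1] [h2]; split; last exact: h2.
by rewrite h1; case: eqVneq => // jk; move: h1; rewrite -jk eqxx.
Qed.

Lemma psi_off m n : m != n -> ipr W (psi m) (psi n) = 0.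
Proof.
move=> mn; rewrite /psi.
have ii f g : ipr W (fun z => cmul (cI R) (f z)) (fun z => cmul (cI R) (g z)) = ipr W f g.
  by apply: eq_Rintegral => z _; rewrite /rdot !cxE /=; ring.
have hh : odd m = odd n -> m./2 != n./2.
  move=> e; apply: contra mn => /eqP h; apply/eqP.
  by rewrite -(odd_double_half m) -(odd_double_half n) e h.
case: ifP => om; case: ifP => on.
- by rewrite ii (ipr_phi0 _ _).1 (negbTE (hh _)) // om on.
- by rewrite iprC (ipr_phi0 _ _).2.
- by rewrite (ipr_phi0 _ _).2.
- by rewrite (ipr_phi0 _ _).1 (negbTE (hh _)) // om on.
Qed.

Lemma psi_on m : psi m = (fun=> 0) \/ ipr W (psi m) (psi m) = 1.
Proof.
have ii f : ipr W (fun z => cmul (cI R) (f z)) (fun z => cmul (cI R) (f z)) = ipr W f f.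
  by apply: eq_Rintegral => z _; rewrite /rdot !cxE /=; ring.
rewrite /psi /phi0; case: pselect => [Jm|nJ]; last first.
  by left; case: ifP => // _; apply/funext => z; rewrite cmulc0.
right; have Aj := onb.1 _ Jm; have [] := onb.2.1 _ _ Jm Jm.
rewrite (ip_reE oW Aj Aj) eqxx => -[h] _; by case: ifP => _; rewrite ?ii.
Qed.

Lemma psi_total h : A2 W h -> (forall m, ipr W h (psi m) = 0) -> forall z, W z -> h z = 0.
Proof.
move=> Ah hm; apply: onb.2.2 => // j Jj; have Aj := onb.1 _ Jj.
have e0 : phi0 j = phi j by rewrite /phi0; case: pselect.
rewrite (ip_reE oW Ah Aj) (ip_imE oW Ah Aj); split; congr EFin.
  by have := hm j.*2; rewrite /psi odd_double doubleK e0.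
by have := hm j.*2.+1; rewrite /psi /= odd_double /= uphalf_double e0.
Qed.

Definition clfun (L : (C2 -> Cx) -> Cx) := forall c f g, holW f -> holW g ->
  L (fun z => cmul c (f z) + g z) = cmul c (L f) + L g.

Lemma clop_fun D z : clop D -> W z -> clfun (fun f => D f z).
Proof. by move=> [_ D2 _] Wz c f g hf hg; exact: D2. Qed.

Lemma clfun_add k L M : clfun L -> clfun M -> clfun (fun f => cmul k (L f) + M f).
Proof.
move=> hL hM c f g hf hg; rewrite hL // hM // !cmulDr !cmulA (cmulC c k).
by rewrite addrACA.
Qed.

(** Coordinates of the functional [L] on the basis. [psum_psi] identifies the partial sums of its
    squared length with sums over the real system, so that [dsum (lev L) (lev L)] plays the part of
    the squared norm of [L]. *)
Definition lev (L : (C2 -> Cx) -> Cx) : nat -> Cx := fun j => L (phi0 j).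

Lemma clfun_rlin L : clfun L -> rlin W (fun f => (L f).1).
Proof.
move=> hL r f g Af Ag.
have -> : (fun z => r *: f z + g z) = (fun z => cmul (creal r) (f z) + g z).
  by apply/funext => w; apply: cx_eq; rewrite !cxE !cxZE /=; ring.
by rewrite hL //; [rewrite !cxE /=; ring|exact: A2_holW|exact: A2_holW].
Qed.

Lemma clfunZ L c f : clfun L -> holW f -> L (fun z => cmul c (f z)) = cmul c (L f).
Proof.
move=> hL hf; have h0 : holW (fun=> 0) by move=> p _; exact: holat_cst.
have z0 : L (fun=> 0) = 0.
  have := hL (- cone R) _ _ h0 h0.
  have -> : (fun z : C2 => cmul (- cone R) (0 : Cx) + 0) = (fun=> 0).
    by apply/funext => w; rewrite cmulc0 addr0.
  by move=> ->; rewrite cmulNl cmul1c addNr.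
have -> : (fun z => cmul c (f z)) = (fun z => cmul c (f z) + 0) by apply/funext => w; rewrite addr0.
by rewrite hL // z0 addr0.
Qed.

Lemma psum_psi L n : clfun L -> psum (lev L) (lev L) n = \sum_(m < n.*2) (L (psi m)).1 ^+ 2.
Proof.
move=> hL; elim: n => [|n IH]; first by rewrite /psum !big_ord0.
rewrite /psum big_ord_recr /= -/(psum _ _ n) IH !big_ord_recr /= -addrA; congr (_ + _).
rewrite /psi /= odd_double /= doubleK uphalf_double rdot_self /cnorm2 /lev.
by rewrite (clfunZ (cI R) hL (A2_holW (A2_phi0 n))) cxE /=; ring.
Qed.

Lemma psum_bound L (B : R) n : clfun L -> 0 <= B ->
  (forall f, A2 W f -> cabs (L f) <= B * nrm f) -> psum (lev L) (lev L) n <= B ^+ 2.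
Proof.
move=> hL B0 hB; rewrite (psum_psi n hL).
apply: (functional_bound oW A2_psi psi_off psi_on _ (clfun_rlin hL)); last exact: sqr_ge0.
move=> f Af; rewrite -nrm_sqr -exprMn -(real_normK (num_real (L f).1)).
rewrite ler_sqr ?nnegrE ?mulr_ge0 ?nrm_ge0 //.
by apply: le_trans (cabs_ge_re _) (hB f Af).
Qed.

(** An operator bound becomes an [l^2] bound. A Taylor remainder that is uniform over the unit ball
    of the space is therefore small in [l^2], and series over the basis can be differentiated
    without any information on the single [phi j]. *)
Lemma dsum_lev_bound L (B : R) : clfun L -> 0 <= B ->
  (forall f, A2 W f -> cabs (L f) <= B * nrm f) -> ell2 (lev L) /\ dsum (lev L) (lev L) <= B ^+ 2.
Proof.
move=> hL B0 hB; have h n := psum_bound n hL B0 hB.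
by split; [exists (B ^+ 2)|exact: dsum_le].
Qed.

Definition ev D z : nat -> Cx := lev (fun f => D f z).

Lemma ell2_ev D z : clop D -> lbounded D -> W z -> ell2 (ev D z).
Proof.
move=> hD lD Wz; have [r r0 [C C0 [_ bd]]] := lD z Wz.
have [] := @dsum_lev_bound (fun f => D f z) C (clop_fun hD Wz) C0 => //.
by move=> f Af; apply: bd => //; rewrite subrr normr0.
Qed.

Lemma ev_derive D E z e : clop D -> lbounded D -> clop E -> lbounded E -> W z -> `|e| <= 1 ->
  is_derive z e (fun w => dsum (ev D w) (ev E w))
    (dsum (ev (fun f => der e (D f)) z) (ev E z) + dsum (ev D z) (ev (fun f => der e (E f)) z)).
Proof.
move=> hD lD hE lE Wz e1.
have [r r0 [C C0 T]] := lbounded_taylor hD lD Wz e1.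
have [r' r'0 [C' C'0 T']] := lbounded_taylor hE lE Wz e1.
have hdD : clop (fun f => der e (D f)) by exact: clop_comp (clop_der e) hD.
have hdE : clop (fun f => der e (E f)) by exact: clop_comp (clop_der e) hE.
have ldD := lbounded_der e hD lD; have ldE := lbounded_der e hE lE.
have [r2 r20 [C2 C20 [_ B2]]] := lE z Wz.
have [r3 r30 [C3 C30 [_ B3]]] := lD z Wz.
have [r4 r40 [C4 C40 [_ B4]]] := ldD z Wz.
have zz (s : R) : 0 < s -> `|z - z| < s by rewrite subrr normr0.
pose d := Num.min (Num.min r r') (Num.min r2 1).
have d0 : 0 < d by rewrite !lt_min r0 r'0 r20 ltr01.
pose M := C + C' + C2 + C3 + C4.
have M0 : 0 <= M by rewrite !addr_ge0.
have z0 : z + 0 *: e = z by rewrite scale0r addr0.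
have dd (t : R) : `|t| < d -> [/\ `|t| < r, `|t| < r', `|t| < r2 & `|t| < 1].
  by rewrite !lt_min => /andP[/andP[? ?] /andP[? ?]].
have rem D' C1 (t : R) : clop D' -> W (z + t *: e) -> 0 <= C1 -> C1 <= M ->
    (forall f, A2 W f -> cabs (D' f (z + t *: e) - D' f z - t *: der e (D' f) z) <= C1 * t ^+ 2 * nrm f) ->
    ell2 (lev (fun f => D' f (z + t *: e) - D' f z - t *: der e (D' f) z)) /\
    dsum (lev (fun f => D' f (z + t *: e) - D' f z - t *: der e (D' f) z))
      (lev (fun f => D' f (z + t *: e) - D' f z - t *: der e (D' f) z)) <= (M * t ^+ 2) ^+ 2.
  move=> hD' Wt C10 C1M b.
  have cl : clfun (fun f => D' f (z + t *: e) - D' f z - t *: der e (D' f) z).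
    have := clfun_add (- creal t) (clop_fun (clop_comp (clop_der e) hD') Wz)
      (clfun_add (- cone R) (clop_fun hD' Wz) (clop_fun hD' Wt)).
    congr clfun; apply/funext => f; move: (der e (D' f) z) (D' f z) (D' f _) => x y w.
    by apply: cx_eq; rewrite !cxE !cxZE /=; ring.
  apply: dsum_lev_bound => //; first by rewrite mulr_ge0 // sqr_ge0.
  move=> f Af; apply: le_trans (b f Af) _; rewrite ler_wpM2r ?nrm_ge0 //.
  by rewrite ler_wpM2r // sqr_ge0.
have nte (t : R) : `|t *: e| <= `|t| by rewrite normrZ ler_piMr.
have bE (t : R) : `|t| < d -> ell2 (ev E (z + t *: e)) /\ dsum (ev E (z + t *: e)) (ev E (z + t *: e)) <= M ^+ 2.
  move=> /dd[t1 _ t2 _]; have [Wt _] := T t t1.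
  apply: dsum_lev_bound => //; first exact: clop_fun.
  move=> f Af; apply: (@le_trans _ _ (C2 * nrm f)).
    by apply: B2 => //; rewrite addrAC subrr add0r; exact: le_lt_trans (nte t) t2.
  by rewrite ler_wpM2r ?nrm_ge0 // /M; order_lra.
have bD (t : R) : `|t| < d -> dsum (fun j => t *: ev (fun f => der e (D f)) z j + ev D z j)
    (fun j => t *: ev (fun f => der e (D f)) z j + ev D z j) <= M ^+ 2.
  move=> /dd[_ _ _ t1].
  have cl : clfun (fun f => t *: der e (D f) z + D f z).
    have := clfun_add (creal t) (clop_fun hdD Wz) (clop_fun hD Wz).
    congr clfun; apply/funext => f; move: (der e (D f) z) (D f z) => x y.
    by apply: cx_eq; rewrite !cxE !cxZE /=; ring.
  have [] := @dsum_lev_bound _ M cl M0; last by [].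
  move=> f Af; have b3 := B3 f Af z (zz _ r30); have b4 := B4 f Af z (zz _ r40).
  have tE : t *: der e (D f) z = cmul (creal t) (der e (D f) z).
    by apply: cx_eq; rewrite !cxE !cxZE /=; ring.
  apply: le_trans (cabsD _ _) _; rewrite tE cabsM creal_abs.
  have := nrm_ge0 f; have := cabs_ge0 (der e (D f) z) => c0 n0.
  have : `|t| * cabs (der e (D f) z) <= C4 * nrm f.
    by apply: le_trans b4; rewrite ler_piMl // ltW.
  have : 0 <= (C + C' + C2) * nrm f by rewrite mulr_ge0 // !addr_ge0.
  rewrite /M; order_lra.
have [K hK] : exists K : R, forall t, `|t| < d ->
    `|dsum (ev D (z + t *: e)) (ev E (z + t *: e)) - dsum (ev D (z + 0 *: e)) (ev E (z + 0 *: e))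
      - t * (dsum (ev (fun f => der e (D f)) z) (ev E (z + 0 *: e)) + dsum (ev D (z + 0 *: e)) (ev (fun f => der e (E f)) z))|
    <= K * t ^+ 2.
  apply: (@dsum_derive R (fun t => ev D (z + t *: e)) (fun t => ev E (z + t *: e))
    (fun t => lev (fun f => D f (z + t *: e) - D f z - t *: der e (D f) z))
    (fun t => lev (fun f => E f (z + t *: e) - E f z - t *: der e (E f) z)) _ _ M d d0 M0).
  - exact: ell2_ev.
  - exact: ell2_ev.
  - move=> t td; have [t1 t2 _ _] := dd t td; have [Wt b] := T t t1; have [_ b'] := T' t t2.
    split; first exact: ell2_ev.
    split; first exact: ell2_ev.
    split; [have [] := rem D C t hD Wt C0 _ b|have [] := rem E C' t hE Wt C'0 _ b'] => //; rewrite /M; order_lra.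
  - move=> t _; apply/funext => j; rewrite scale1r z0 /ev /lev.
    by rewrite [RHS]addrC addrA !subrK.
  - move=> t _; apply/funext => j; rewrite scale1r z0 /ev /lev.
    by rewrite [RHS]addrC addrA !subrK.
  - move=> t td; have [t1 t2 _ _] := dd t td; have [Wt b] := T t t1; have [_ b'] := T' t t2.
    split; [have [] := rem D C t hD Wt C0 _ b|have [] := rem E C' t hE Wt C'0 _ b'] => //; rewrite /M; order_lra.
  - move=> t td; split; first by have [] := bE t td.
    by rewrite z0; exact: bD.
rewrite z0 in hK; apply/is_deriveP => ep ep0.
have K1 : 0 < `|K| + 1 by rewrite ltr_wpDl.
exists (Num.min d (ep / (`|K| + 1))); first by rewrite lt_min d0 divr_gt0.
move=> t; rewrite lt_min => /andP[td te]; apply: le_trans (hK t td) _.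
rewrite -(real_normK (num_real t)) expr2 mulrA ler_wpM2r //.
have h : `|t| * (`|K| + 1) <= ep by rewrite -ler_pdivlMr // ltW.
by have := ler_norm K; have := normr_ge0 t; nra.
Qed.

End BergmanKernel.

(** * Chain and quotient rules for directional derivatives *)

Section DirectionalComposition.
Variables (R : realType) (V : normedModType R).
Implicit Types (f : V -> R) (z e : V).

Lemma is_derive_line f z e (d : R) : is_derive z e f d <-> is_derive (0 : R) 1 (fun s => f (z + s *: e)) d.
Proof.
by split => /is_deriveP h; apply/is_deriveP => ep /h[dl dl0 hd]; exists dl => // s /hd;
  rewrite scale0r addr0 add0r [s *: 1]mulr1.
Qed.

Lemma is_derive_comp (F : R -> R) f z e (D d : R) : is_derive (f z) 1 F D -> is_derive z e f d ->
  is_derive z e (fun w => F (f w)) (D * d).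
Proof.
move=> hF /is_derive_line hf; apply/is_derive_line.
by apply: (is_derive1_comp (f := F)) hf; rewrite scale0r addr0.
Qed.

Lemma is_derive_near f g z e (d : R) : (\forall w \near z, f w = g w) -> is_derive z e f d -> is_derive z e g d.
Proof.
move=> fg hf; apply: DeriveDef; last by rewrite -(near_eq_derive e fg) derive_val.
by apply: (near_eq_derivable fg); exact: ex_derive.
Qed.

Lemma is_derive_quot f g z e (df dg : R) : g z != 0 -> is_derive z e f df -> is_derive z e g dg ->
  is_derive z e (fun w => f w / g w) (df / g z - f z * dg / g z ^+ 2).
Proof.
move=> g0 hf hg; have hi : is_derive (g z) 1 (fun x : R => x^-1) (- (g z) ^- 2 * 1).
  by have := @is_deriveV R id (g z) 1 1 g0 (is_derive_id _ _); rewrite /GRing.scale /=.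
have := is_deriveM hf (is_derive_comp hi hg); rewrite /GRing.scale /= => h.
by apply: (is_derive_eq h); field.
Qed.

End DirectionalComposition.

(** * The Bergman kernel on the diagonal, duality, and the Levi form of its logarithm *)

Section BergmanMetric.
Variable R : realType.
Local Notation Cx := (Cx R).
Local Notation C2 := (C2 R).
Implicit Types (f g h : C2 -> Cx) (p z v e : C2) (c : Cx).
Variable W : set C2.
Hypothesis oW : open W.
Variables (J : set nat) (phi : nat -> C2 -> Cx).
Hypothesis onb : ONB W J phi.

Local Notation lev := (lev J phi).
Local Notation ev := (ev J phi).
Local Notation nrm := (nrm W).
(** Up to conjugation, [Phi z] represents evaluation at [z] and [dPhi e z] the derivative there; the
    kernel on the diagonal is the squared norm of the former. *)
Definition Phi z := ev (fun f => f) z.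
Definition dPhi e z := ev (der e) z.
Definition kern z := dsum (Phi z) (Phi z).

Lemma bergman_diagE z : W z -> bergman_diag W J phi z = (kern z)%:E.
Proof.
move=> Wz; have eP : ell2 (Phi z) := ell2_ev oW onb (@clop_id R W) (lbounded_id oW) Wz.
apply/cvg_lim => //.
have -> : (fun n => \sum_(0 <= i < n | i \in J) (cnorm2 (phi i z))%:E)%E =
  (fun n => (psum (Phi z) (Phi z) n)%:E).
  apply/funext => n; rewrite /psum -sumEFin big_mkcond big_mkord; apply: eq_bigr => i _.
  rewrite rdot_self /Phi /ev /lev /phi0; case: pselect => Ji; first by rewrite mem_set.
  by rewrite memNset // /cnorm2 /= expr0n /= addr0.
apply: cvg_EFin; first by apply: nearW.
exact: psum_cvg.
Qed.

Lemma sum_cauchy (a b : nat -> R) n :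
  (\sum_(m < n) a m * b m) ^+ 2 <= (\sum_(m < n) a m ^+ 2) * (\sum_(m < n) b m ^+ 2).
Proof.
apply: quadratic_discriminant; first by apply: sumr_ge0 => m _; exact: sqr_ge0.
move=> s; have -> : s ^+ 2 * (\sum_(m < n) a m ^+ 2) + 2 * s * (\sum_(m < n) a m * b m)
    + \sum_(m < n) b m ^+ 2 = \sum_(m < n) (s * a m + b m) ^+ 2.
  by rewrite !mulr_sumr -!big_split; apply: eq_bigr => m _ /=; ring.
by apply: sumr_ge0 => m _; exact: sqr_ge0.
Qed.

(** The functional of the extremal description of the metric; the free coefficient [c] is set in
    [extremal_functional]. *)
Definition pfun c v p f : Cx := cmul c (f p) + der v f p.

Lemma pfun_clfun c v p : W p -> clfun W (pfun c v p).
Proof. by move=> Wp; apply: clfun_add; exact: clop_fun (@clop_id R W) Wp || exact: clop_fun (clop_der oW v) Wp. Qed.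

Lemma ell2_pfun c v p : W p -> ell2 (lev (pfun c v p)).
Proof.
move=> Wp; have [r r0 [C C0 [_ b]]] := lbounded_id oW Wp.
have [r' r'0 [C' C'0 [_ b']]] := lbounded_der v (@clop_id R W) (lbounded_id oW) Wp.
have B0 : 0 <= cabs c * C + C' by rewrite addr_ge0 // mulr_ge0 // cabs_ge0.
have zz (s : R) : 0 < s -> `|p - p| < s by rewrite subrr normr0.
have [] // := dsum_lev_bound oW onb (pfun_clfun c v Wp) B0.
move=> f Af; apply: le_trans (cabsD _ _) _; rewrite cabsM.
have := b f Af p (zz _ r0); have := b' f Af p (zz _ r'0); have := cabs_ge0 c; nra.
Qed.

(** Cauchy-Schwarz for the coefficients settles the partial sums, and [expansion] passes to the
    limit, since the functional sees only the value and the first derivatives at [p]. *)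
Lemma duality_re c v p f : W p -> A2 W f ->
  (pfun c v p f).1 ^+ 2 <= dsum (lev (pfun c v p)) (lev (pfun c v p)) * ipr W f f.
Proof.
move=> Wp Af; set B := dsum _ _; have hL := pfun_clfun c v Wp.
have rl := clfun_rlin hL; have eL := ell2_pfun c v Wp.
have B0 : 0 <= B := dsum_ge0 eL.
pose cf m := ipr W f (psi J phi m).
pose S n := lcomb cf (psi J phi) n.
have bS n : `|(pfun c v p (S n)).1| <= Num.sqrt (B * ipr W f f).
  rewrite -ler_sqr ?nnegrE ?sqrtr_ge0 // real_normK ?num_real // sqr_sqrtr ?mulr_ge0 ?ipr_ge0 //.
  rewrite (rlin_lcomb oW (A2_psi oW onb) cf n rl).
  apply: le_trans (sum_cauchy cf (fun m => (pfun c v p (psi J phi m)).1) n) _; rewrite mulrC.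
  apply: ler_pM; try by apply: sumr_ge0 => m _; exact: sqr_ge0.
    (* Completing to [2 n] real coordinates gives exactly the first [n] complex ones. *)
    apply: (@le_trans _ _ (\sum_(m < n.*2) (pfun c v p (psi J phi m)).1 ^+ 2)).
      rewrite -addnn -!(big_mkord xpredT (fun m => (pfun c v p (psi J phi m)).1 ^+ 2)).
      rewrite [leRHS](big_cat_nat (n := n)) ?leq_addr //= lerDl.
      by apply: sumr_ge0 => m _; exact: sqr_ge0.
    by rewrite -(psum_psi onb n hL); exact: dsum_ge.
  exact: (bessel oW (A2_psi oW onb) (psi_off oW onb) (psi_on oW onb)).
have K0 : 0 <= cabs c + 8 * `|v| by rewrite addr_ge0 ?cabs_ge0 // mulr_ge0.
have le (e : R) : 0 < e -> `|(pfun c v p f).1| <= Num.sqrt (B * ipr W f f) + (cabs c + 8 * `|v|) * e.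
  move=> e0.
  have [N hN] := expansion oW (A2_psi oW onb) (psi_off oW onb) (psi_on oW onb) Af (psi_total oW onb) Wp e0.
  have [h0 h1 h2] := hN N (leqnn _); have b := bS N; rewrite -/(S N) in h0 h1 h2.
  have -> : (pfun c v p f).1 = (pfun c v p (S N)).1 - (pfun c v p (S N) - pfun c v p f).1.
    by move: (pfun c v p f) (pfun c v p (S N)) => x y; rewrite !cxE; ring.
  apply: le_trans (ler_normB _ _) _; apply: lerD => //.
  apply: le_trans (cabs_ge_re _) _.
  have -> : pfun c v p (S N) - pfun c v p f = cmul c (S N p - f p) +
     clin (pd1 (S N) p - pd1 f p) (pd2 (S N) p - pd2 f p) v.
    rewrite /pfun /der /clin !cmulBl cmulBr opprD addrACA; congr (_ + _).
    by rewrite opprD addrACA.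
  apply: le_trans (cabsD _ _) _; rewrite cabsM.
  have := clin_bound v h1 h2; have := cabs_ge0 c; have := normr_ge0 v; nra.
have fin : `|(pfun c v p f).1| <= Num.sqrt (B * ipr W f f).
  apply/ler_addgt0Pr => e e0.
  have K1 : 0 < cabs c + 8 * `|v| + 1 by lra.
  have e1 : 0 < e / (cabs c + 8 * `|v| + 1) by rewrite divr_gt0.
  apply: le_trans (le _ e1) _; rewrite lerD2l mulrA ler_pdivrMr //.
  by rewrite mulrC ler_wpM2l ?(ltW e0) //; lra.
rewrite -(real_normK (num_real _)) -(@sqr_sqrtr _ (B * ipr W f f)) ?mulr_ge0 ?ipr_ge0 //.
by rewrite ler_sqr ?nnegrE ?sqrtr_ge0.
Qed.

(** Multiplying [f] by the conjugate of [pfun c v p f] makes the value of the functional real, which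
    reduces the claim to [duality_re]. *)
Lemma duality c v p f : W p -> A2 W f ->
  cnorm2 (pfun c v p f) <= dsum (lev (pfun c v p)) (lev (pfun c v p)) * ipr W f f.
Proof.
move=> Wp Af; set B := dsum _ _; set w := pfun c v p f.
case: (eqVneq w 0) => [->|w0].
  rewrite /cnorm2 /= expr0n /= addr0 mulr_ge0 ?ipr_ge0 //; exact: dsum_ge0 (ell2_pfun _ _ Wp).
have Ag : A2 W (fun z => cmul (cconj w) (f z)) by exact: A2_cZ.
have := duality_re c v Wp Ag; rewrite (clfunZ _ (pfun_clfun c v Wp) (A2_holW Af)) -/w -/B.
have -> : (cmul (cconj w) w).1 = cnorm2 w by rewrite /cnorm2 cxE /=; ring.
have -> : ipr W (fun z => cmul (cconj w) (f z)) (fun z => cmul (cconj w) (f z)) = cnorm2 w * ipr W f f.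
  rewrite /ipr -RintegralZl; [|exact: (open_measurable_C2 oW)|exact: A2_dot].
  by apply: eq_Rintegral => z _; rewrite /rdot /cnorm2 !cxE /=; ring.
rewrite expr2 mulrCA ler_pM2l // cnorm2_gt0; exact: w0.
Qed.

Lemma lev_id z : lev (pfun (cone R) 0 z) = Phi z.
Proof.
apply/funext => j; rewrite /lev /Phi /ev /lev /pfun cmul1c /der /clin.
by rewrite -[RHS]addr0; congr (_ + _); rewrite !cmulc0 addr0.
Qed.

Lemma kern_lower z f : W z -> A2 W f -> cnorm2 (f z) <= kern z * ipr W f f.
Proof.
move=> Wz Af; have := duality (cone R) 0 Wz Af; rewrite lev_id /pfun cmul1c.
by have -> : f z + der 0 f z = f z by rewrite /der /clin !cmulc0 !addr0.
Qed.

Lemma kern_gt0 z f : W z -> A2 W f -> f z != 0 -> 0 < kern z.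
Proof.
move=> Wz Af f0; have := kern_lower Wz Af; have := f0; rewrite -cnorm2_gt0 => h1 h2.
have := ipr_ge0 W f; have k0 : 0 <= kern z := dsum_ge0 (ell2_ev oW onb (@clop_id R W) (lbounded_id oW) Wz).
by nra.
Qed.

Hypothesis kpos : forall z, W z -> 0 < kern z.

Local Notation ci := (Defs.cI R).
Let clD e := clop_der oW e.
Let lbD e : lbounded W (der e) := lbounded_der e (@clop_id R W) (lbounded_id oW).

Lemma kern_derive z e : W z -> `|e| <= 1 -> is_derive z e kern (2 * dsum (dPhi e z) (Phi z)).
Proof.
move=> Wz e1; have := ev_derive oW onb (@clop_id R W) (lbounded_id oW) (@clop_id R W) (lbounded_id oW) Wz e1.
move=> h; apply: (is_derive_eq h); rewrite -/(Phi z) -/(dPhi e z) (dsumC (Phi z)); ring.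
Qed.

Lemma pot_derive z e : W z -> `|e| <= 1 ->
  is_derive z e (bergman_pot W J phi) (2 * dsum (dPhi e z) (Phi z) / kern z).
Proof.
move=> Wz e1; have := is_derive_comp (is_derive1_ln (kpos Wz)) (kern_derive Wz e1).
rewrite mulrC; apply: is_derive_near.
have := near_domain oW Wz; apply: filterS => w Ww; by rewrite /bergman_pot bergman_diagE.
Qed.

Lemma pot_derive2 z e e' : W z -> `|e| <= 1 -> `|e'| <= 1 ->
  'D_e ('D_e' (bergman_pot W J phi)) z =
    2 * (dsum (ev (fun f => der e (der e' f)) z) (Phi z) + dsum (dPhi e' z) (dPhi e z)) / kern z
    - 4 * dsum (dPhi e z) (Phi z) * dsum (dPhi e' z) (Phi z) / kern z ^+ 2.
Proof.
move=> Wz e1 e1'.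
have h := ev_derive oW onb (clD e') (lbD e') (@clop_id R W) (lbounded_id oW) Wz e1.
have k0 : kern z != 0 by rewrite gt_eqF // kpos.
have h2 : is_derive z e (fun w => 2 * dsum (dPhi e' w) (Phi w))
   (2 * (dsum (ev (fun f => der e (der e' f)) z) (Phi z) + dsum (dPhi e' z) (dPhi e z))).
  have := is_deriveZ 2 h; exact.
have h3 := is_derive_quot k0 h2 (kern_derive Wz e1).
have h4 : is_derive z e ('D_e' (bergman_pot W J phi)) (2 * (dsum (ev (fun f => der e (der e' f)) z) (Phi z) + dsum (dPhi e' z) (dPhi e z)) / kern z
    - 2 * dsum (dPhi e' z) (Phi z) * (2 * dsum (dPhi e z) (Phi z)) / kern z ^+ 2).
  apply: is_derive_near h3; have := near_domain oW Wz; apply: filterS => w Ww.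
  by have := pot_derive Ww e1'; move=> ?; rewrite derive_val.
have E (x y : R) : 2 * x * (2 * y) = 4 * y * x by ring.
by rewrite derive_val E.
Qed.

Definition imul (X : nat -> Cx) : nat -> Cx := fun m => cmul ci (X m).

Lemma dsum_ii X Y : dsum (imul X) (imul Y) = dsum X Y.
Proof.
rewrite /dsum; congr (limn _); apply/funext => n; apply: eq_bigr => m _.
by rewrite /rdot /imul !cxE /=; ring.
Qed.

Lemma dsum_iN X Y : ell2 X -> ell2 Y -> dsum (imul X) Y = - dsum X (imul Y).
Proof.
move=> eX eY; have eiY : ell2 (imul Y) by exact: ell2_mul.
apply/cvg_lim => //; have -> : psum (imul X) Y = fun n => - psum X (imul Y) n.
  apply/funext => n; rewrite /psum -sumrN; apply: eq_bigr => m _.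
  by rewrite /rdot /imul !cxE /=; ring.
by apply: cvgN; exact: psum_cvg.
Qed.

Lemma ell2_imul X : ell2 X -> ell2 (imul X).
Proof. exact: ell2_mul. Qed.

Lemma dsum0 (Y : nat -> Cx) : dsum (fun=> 0) Y = 0.
Proof.
apply/cvg_lim => //; have -> : psum (fun=> 0) Y = fun=> 0.
  by apply/funext => n; apply: big1 => m _; rewrite /rdot !cxE !mul0r addr0.
exact: cvg_cst.
Qed.

Lemma ell2_0 : ell2 (fun=> 0 : Cx).
Proof. by exists 0 => n; rewrite /psum big1 // => m _; rewrite /rdot !cxE !mul0r addr0. Qed.

Lemma dsumZ (r : R) X Y : ell2 X -> ell2 Y -> ell2 (fun m => r *: X m) /\ dsum (fun m => r *: X m) Y = r * dsum X Y.
Proof.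
move=> eX eY; have e : (fun m => r *: X m) = (fun m => r *: X m + 0) by apply/funext => m; rewrite addr0.
rewrite e; split; first exact: ell2_lin eX ell2_0.
by rewrite (dsum_lin r eX ell2_0 eY) dsum0 addr0.
Qed.

Lemma dsum_lin4 (x y x' y' : R) (a b a' b' Y : nat -> Cx) :
  ell2 a -> ell2 b -> ell2 a' -> ell2 b' -> ell2 Y ->
  dsum (fun m => x *: a m + (y *: b m + (x' *: a' m + y' *: b' m))) Y =
    x * dsum a Y + y * dsum b Y + x' * dsum a' Y + y' * dsum b' Y.
Proof.
move=> ea eb ea' eb' eY; have [eb2 h] := dsumZ y' eb' eY.
have e1 := ell2_lin x' ea' eb2; have e2 := ell2_lin y eb e1.
by rewrite (dsum_lin x ea e2 eY) (dsum_lin y eb e1 eY) (dsum_lin x' ea' eb2 eY) h !addrA.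
Qed.

Lemma norm_ex j : `|ex R j| <= 1 /\ `|ey R j| <= 1.
Proof.
have n1 : `|(1, 0) : Cx| = 1 by rewrite norm_pair normr0 normr1 max_l.
have n2 : `|(0, 1) : Cx| = 1 by rewrite norm_pair normr0 normr1 max_r.
have n0 : `|(0, 0) : Cx| = 0 by rewrite norm_pair normr0 max_l.
rewrite /ex /ey; case: (j == 0%N); split.
- by rewrite -[leLHS]/(Num.max `|(1, 0) : Cx| `|(0, 0) : Cx|) n1 n0 max_l.
- by rewrite -[leLHS]/(Num.max `|(0, 1) : Cx| `|(0, 0) : Cx|) n2 n0 max_l.
- by rewrite -[leLHS]/(Num.max `|(0, 0) : Cx| `|(1, 0) : Cx|) n1 n0 max_r.
- by rewrite -[leLHS]/(Num.max `|(0, 0) : Cx| `|(0, 1) : Cx|) n2 n0 max_r.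
Qed.

Lemma der_ey j f : der (ey R j) f = (fun z => cmul ci (der (ex R j) f z)).
Proof.
apply/funext => z; rewrite /der /clin /ex /ey; case: (j == 0%N); apply: cx_eq;
  by rewrite !cxE /=; ring.
Qed.

Lemma dPhi_ey j z : dPhi (ey R j) z = imul (dPhi (ex R j) z).
Proof. by apply/funext => m; rewrite /dPhi /ev /lev der_ey. Qed.

Let A2phi := A2_phi0 onb.

Lemma dPhi2_ey e j z : W z ->
  ev (fun f => der e (der (ey R j) f)) z = imul (ev (fun f => der e (der (ex R j) f)) z).
Proof.
move=> Wz; apply/funext => m; rewrite /ev /lev der_ey /imul.
apply: (@clfunZ _ W (fun g => der e g z)); first exact: clop_fun (clD e) Wz.
by have hp := A2_holW (A2phi m); move=> p Wp; exact: (hol_der oW (ex R j) hp Wp).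
Qed.

Lemma dPhi2_ey' j (g : (C2 -> Cx) -> C2 -> Cx) z : ev (fun f => der (ey R j) (g f)) z = imul (ev (fun f => der (ex R j) (g f)) z).
Proof. by apply/funext => m; rewrite /ev /lev der_ey. Qed.

Let ellPhi z : W z -> ell2 (Phi z).
Proof. by move=> Wz; refine (ell2_ev oW onb (@clop_id R W) (lbounded_id oW) Wz). Qed.

Let ellD e z : W z -> ell2 (dPhi e z).
Proof. by move=> Wz; refine (ell2_ev oW onb (clD e) (lbD e) Wz). Qed.

Lemma dPhi_split v z : dPhi v z = (fun m => v.1.1 *: dPhi (ex R 0) z m + (v.1.2 *: imul (dPhi (ex R 0) z) m +
   (v.2.1 *: dPhi (ex R 1) z m + v.2.2 *: imul (dPhi (ex R 1) z) m))).
Proof.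
apply/funext => m; rewrite /dPhi /imul /ev /lev /der /clin /ex /=.
move: (pd1 _ z) (pd2 _ z) => a b; apply: cx_eq; rewrite !cxE !cxZE !cxE /=; ring.
Qed.

Local Opaque dsum imul Phi dPhi kern.

Lemma ddbarE (u : C2 -> R) z j k (a b c d : R) :
  'D_(ex R j) ('D_(ex R k) u) z = a -> 'D_(ey R j) ('D_(ey R k) u) z = b ->
  'D_(ex R j) ('D_(ey R k) u) z = c -> 'D_(ey R j) ('D_(ex R k) u) z = d ->
  ddbar u z j k = ((1 / 4) * (a + b), (1 / 4) * (c - d)).
Proof. by move=> <- <- <- <-. Qed.

(** A derivative along [ey] is [i] times the one along [ex], so the terms with second holomorphic
    derivatives cancel and only products of first derivatives remain. *)
Lemma ddbar_pot z j k : W z ->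
  ddbar (bergman_pot W J phi) z j k =
  (dsum (dPhi (ex R k) z) (dPhi (ex R j) z) / kern z
     - (dsum (dPhi (ex R j) z) (Phi z) * dsum (dPhi (ex R k) z) (Phi z)
        + dsum (imul (dPhi (ex R j) z)) (Phi z) * dsum (imul (dPhi (ex R k) z)) (Phi z)) / kern z ^+ 2,
   dsum (imul (dPhi (ex R k) z)) (dPhi (ex R j) z) / kern z
     - (dsum (dPhi (ex R j) z) (Phi z) * dsum (imul (dPhi (ex R k) z)) (Phi z)
        - dsum (imul (dPhi (ex R j) z)) (Phi z) * dsum (dPhi (ex R k) z) (Phi z)) / kern z ^+ 2).
Proof.
move=> Wz; have [x1 y1] := norm_ex j; have [x2 y2] := norm_ex k.
have k0 : kern z != 0 by rewrite gt_eqF // kpos.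
have eA : ell2 (ev (fun f => der (ex R j) (der (ex R k) f)) z).
  apply: (ell2_ev oW onb _ _ Wz); first exact: clop_comp (clD _) (clD _).
  exact: lbounded_der (clD _) (lbD _).
have ePh := ellPhi Wz; have eak := ellD (ex R k) Wz; have eaj := ellD (ex R j) Wz.
have d1 := pot_derive2 Wz x1 x2; have d2 := pot_derive2 Wz y1 y2.
have d3 := pot_derive2 Wz x1 y2; have d4 := pot_derive2 Wz y1 x2.
rewrite (dPhi2_ey' j (der (ey R k)) z) (dPhi2_ey (ex R j) k Wz) (dPhi_ey j z) (dPhi_ey k z) in d2.
rewrite (dPhi2_ey (ex R j) k Wz) (dPhi_ey k z) in d3.
rewrite (dPhi2_ey' j (der (ex R k)) z) (dPhi_ey j z) in d4.
rewrite (ddbarE d1 d2 d3 d4) {d1 d2 d3 d4 x1 x2 y1 y2}.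
move: (ev (fun f => der (ex R j) (der (ex R k) f)) z) (Phi z) (dPhi (ex R k) z) (dPhi (ex R j) z) (kern z)
  eA ePh eak eaj k0 => A P b a K eA eP eb ea k0.
rewrite (dsum_iN (ell2_imul eA) eP) !dsum_ii (dsumC b (imul a)) (dsum_iN ea eb) (dsumC a (imul b)).
by congr pair; field.
Qed.

(** A Gram determinant over a fourth power: in Hermitian notation [(|dPhi|^2 |Phi|^2 - |<dPhi,
    Phi>|^2) / |Phi|^4], where the two squares come from the real and the imaginary part of
    [<dPhi, Phi>]. *)
Lemma levi_pot z v : W z -> levi (bergman_pot W J phi) z v =
  dsum (dPhi v z) (dPhi v z) / kern z -
  (dsum (dPhi v z) (Phi z) ^+ 2 + dsum (imul (dPhi v z)) (Phi z) ^+ 2) / kern z ^+ 2.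
Proof.
move=> Wz; have k0 : kern z != 0 by rewrite gt_eqF // kpos.
pose T j k := (dsum (dPhi (ex R k) z) (dPhi (ex R j) z) / kern z
     - (dsum (dPhi (ex R j) z) (Phi z) * dsum (dPhi (ex R k) z) (Phi z)
        + dsum (imul (dPhi (ex R j) z)) (Phi z) * dsum (imul (dPhi (ex R k) z)) (Phi z)) / kern z ^+ 2)
     * (cmul (vc v j) (cconj (vc v k))).1
   - (dsum (imul (dPhi (ex R k) z)) (dPhi (ex R j) z) / kern z
     - (dsum (dPhi (ex R j) z) (Phi z) * dsum (imul (dPhi (ex R k) z)) (Phi z)
        - dsum (imul (dPhi (ex R j) z)) (Phi z) * dsum (dPhi (ex R k) z) (Phi z)) / kern z ^+ 2)
     * (cmul (vc v j) (cconj (vc v k))).2.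
rewrite /levi (eq_bigr (fun j : 'I_2 => \sum_(k < 2) T j k)); last first.
  by move=> j _; apply: eq_bigr => k _; rewrite (ddbar_pot j k Wz) cmul1E.
rewrite !big_ord_recr !big_ord0 /T /vc /= !add0r {T}.
have ePh := ellPhi Wz; have eiPh : ell2 (imul (Phi z)) by exact: ell2_mul.
have e0 := ellD (ex R 0) Wz; have e1 := ellD (ex R 1) Wz; have ev := ellD v Wz.
have i0 : ell2 (imul (dPhi (ex R 0) z)) by exact: ell2_mul.
have i1 : ell2 (imul (dPhi (ex R 1) z)) by exact: ell2_mul.
have iv : ell2 (imul (dPhi v z)) by exact: ell2_mul.
have ii0 : dsum (imul (dPhi (ex R 0) z)) (dPhi (ex R 0) z) = 0.
  by have := dsum_iN e0 e0; rewrite (dsumC (dPhi _ z)) => h; lra.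
have ii1 : dsum (imul (dPhi (ex R 1) z)) (dPhi (ex R 1) z) = 0.
  by have := dsum_iN e1 e1; rewrite (dsumC (dPhi _ z)) => h; lra.
have L Y (eY : ell2 Y) : dsum (dPhi v z) Y = v.1.1 * dsum (dPhi (ex R 0) z) Y + v.1.2 * dsum (imul (dPhi (ex R 0) z)) Y
   + v.2.1 * dsum (dPhi (ex R 1) z) Y + v.2.2 * dsum (imul (dPhi (ex R 1) z)) Y.
  by rewrite {1}dPhi_split dsum_lin4.
rewrite (dsum_iN ev ePh) (L _ ePh) (L _ eiPh) (L _ ev).
rewrite !(dsumC _ (dPhi v z)) !L //.
have n0 := dsum_iN e0 ePh; have n1 := dsum_iN e1 ePh.
rewrite !dsum_ii.
have -> : dsum (dPhi (ex R 0) z) (imul (Phi z)) = - dsum (imul (dPhi (ex R 0) z)) (Phi z) by rewrite n0 opprK.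
have -> : dsum (dPhi (ex R 1) z) (imul (Phi z)) = - dsum (imul (dPhi (ex R 1) z)) (Phi z) by rewrite n1 opprK.
rewrite (dsumC (dPhi (ex R 0) z) (imul (dPhi (ex R 0) z))) ii0.
rewrite (dsumC (dPhi (ex R 1) z) (imul (dPhi (ex R 1) z))) ii1.
rewrite (dsumC (dPhi (ex R 1) z) (dPhi (ex R 0) z)).
have m1 := dsum_iN e1 e0; have m0 := dsum_iN e0 e1.
rewrite (dsumC (dPhi (ex R 1) z) (imul (dPhi (ex R 0) z))) (dsumC (dPhi (ex R 0) z) (imul (dPhi (ex R 1) z))).
have m2 : dsum (imul (dPhi (ex R 0) z)) (dPhi (ex R 1) z) = - dsum (imul (dPhi (ex R 1) z)) (dPhi (ex R 0) z).
  by rewrite m0 dsumC.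
rewrite m2; move: (dsum (imul (dPhi (ex R 1) z)) (dPhi (ex R 0) z)) => B1.
move: (dsum (dPhi (ex R 0) z) (dPhi (ex R 1) z)) (dsum (dPhi (ex R 0) z) (dPhi (ex R 0) z)) (dsum (dPhi (ex R 1) z) (dPhi (ex R 1) z)) => B2 B3 B4.
move: (dsum (dPhi (ex R 0) z) (Phi z)) (dsum (imul (dPhi (ex R 0) z)) (Phi z)) (dsum (dPhi (ex R 1) z) (Phi z)) (dsum (imul (dPhi (ex R 1) z)) (Phi z)) => B5 B6 B7 B8.
by field.
Qed.

End BergmanMetric.

(** * Bounds for the Bergman length from below and above *)

Section BergmanBounds.
Variable R : realType.
Local Notation Cx := (Cx R).
Local Notation C2 := (C2 R).
Implicit Types (f g h : C2 -> Cx) (p z v e : C2) (c : Cx).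
Variable W : set C2.
Hypothesis oW : open W.
Variables (J : set nat) (phi : nat -> C2 -> Cx).
Hypothesis onb : ONB W J phi.
Hypothesis kpos : forall z, W z -> 0 < kern J phi z.

Local Notation Phi := (Phi J phi).
Local Notation dPhi := (dPhi J phi).
Local Notation kern := (kern J phi).
Local Notation psi := (psi J phi).
Local Notation lev := (lev J phi).

Lemma ell2_Phi z : W z -> ell2 (Phi z).
Proof. by move=> Wz; refine (ell2_ev oW onb (@clop_id R W) (lbounded_id oW) Wz). Qed.

Lemma ell2_dPhi v z : W z -> ell2 (dPhi v z).
Proof.
move=> Wz; refine (ell2_ev oW onb (clop_der oW v) _ Wz).
exact: (lbounded_der v (@clop_id R W) (lbounded_id oW)).
Qed.

Let L z v := levi (bergman_pot W J phi) z v.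

(** The coefficient [c] removes from the derivative at [z] its component along evaluation at [z];
    the squared norm of what is left is the Gram determinant divided by [kern z], that is [kern z]
    times the Levi form. *)
Lemma extremal_functional z v : W z -> exists c, [/\ ell2 (lev (pfun c v z)),
  0 <= dsum (lev (pfun c v z)) (lev (pfun c v z)) &
  dsum (lev (pfun c v z)) (lev (pfun c v z)) = kern z * L z v].
Proof.
move=> Wz; have k0 := kpos Wz; have kn0 : kern z != 0 by rewrite gt_eqF.
pose P := dsum (dPhi v z) (Phi z); pose Q := dsum (imul (dPhi v z)) (Phi z).
pose c : Cx := (- P / kern z, Q / kern z).
have eL := ell2_pfun oW onb c v Wz.
exists c; split => //; first exact: dsum_ge0.
have eP := ell2_Phi Wz; have eD := ell2_dPhi v Wz.
have eiP := ell2_imul eP; have eiD := ell2_imul eD.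
have lE : lev (pfun c v z) = fun m => c.1 *: Phi z m + (c.2 *: imul (Phi z) m + (1 *: dPhi v z m + 0 *: dPhi v z m)).
  apply/funext => m; rewrite /imul /lev /pfun /Phi /dPhi /ev /lev.
  by move: (der v _ z) (phi0 J phi m z) => x y; apply: cx_eq; rewrite !cxE !cxZE !cxE /=; ring.
have S Y (eY : ell2 Y) : dsum (lev (pfun c v z)) Y =
    c.1 * dsum (Phi z) Y + c.2 * dsum (imul (Phi z)) Y + dsum (dPhi v z) Y.
  by rewrite lE (dsum_lin4 c.1 c.2 1 0 eP eiP eD eD eY); ring.
have ii : dsum (imul (Phi z)) (Phi z) = 0.
  by have := dsum_iN eP eP; rewrite (dsumC (Phi z)) => h; lra.
have iD : dsum (imul (Phi z)) (dPhi v z) = - Q by rewrite (dsum_iN eP eD) /Q dsumC.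
have LE : L z v = dsum (dPhi v z) (dPhi v z) / kern z - (P ^+ 2 + Q ^+ 2) / kern z ^+ 2 := levi_pot oW onb kpos v Wz.
rewrite (S _ eL) (dsumC (Phi z)) (dsumC (imul (Phi z))) (dsumC (dPhi v z)) (S _ eP) (S _ eiP) (S _ eD).
rewrite dsum_ii (dsumC (Phi z) (imul (Phi z))) ii (dsumC (Phi z) (dPhi v z)) (dsumC (dPhi v z) (imul (Phi z))) iD LE.
by rewrite -/(kern z) -/P /c /=; field.
Qed.

Lemma levi_ge0 z v : W z -> 0 <= L z v.
Proof.
move=> Wz; have [c [_ h e]] := extremal_functional v Wz.
by move: h; rewrite e pmulr_rge0 // kpos.
Qed.

(** The function tested is [g h] with [h] approximating the kernel function at [z]. Since [g z = 0],
    the extremal functional sees only [der v g z] times [h z], and [|g| <= 1] keeps the norm of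
    [g h] below that of [h]. *)
Lemma bergman_lower z v g : W z -> holW W g -> (forall w, W w -> cnorm2 (g w) <= 1) -> g z = 0 ->
  cabs (der v g z) <= bergman_length W J phi z v.
Proof.
move=> Wz hg g1 gz; have k0 := kpos Wz.
have [c [eL L0 LE]] := extremal_functional v Wz; rewrite LE in L0.
have H n : cnorm2 (der v g z) * psum (Phi z) (Phi z) n <= kern z * L z v.
  (* A partial sum of the kernel function at [z]: pairing [phi j] with [i phi j] turns real
     coefficients into the conjugates of [phi j z]. *)
  pose h := lcomb (fun m => (psi m z).1) psi n.*2.
  have Ah : A2 W h := lcombA2 oW (A2_psi oW onb) _ _.
  have hE : \sum_(m < n.*2) (psi m z).1 ^+ 2 = psum (Phi z) (Phi z) n.
    by rewrite -(psum_psi onb n (clop_fun (@clop_id R W) Wz)).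
  have hz : (h z).1 = psum (Phi z) (Phi z) n.
    rewrite -hE (rlin_lcomb oW (A2_psi oW onb) _ _ (clfun_rlin (clop_fun (@clop_id R W) Wz))).
    by apply: eq_bigr => m _; rewrite expr2.
  have ih : ipr W h h <= psum (Phi z) (Phi z) n.
    by rewrite -hE; exact: (ipr_lcomb oW (A2_psi oW onb) (psi_off oW onb) (psi_on oW onb)).
  have Af : A2 W (fun w => cmul (g w) (h w)) by apply: (A2_mul oW hg g1 Ah).
  have if_ : ipr W (fun w => cmul (g w) (h w)) (fun w => cmul (g w) (h w)) <= ipr W h h.
    apply: ipr_le => // w Ww; rewrite cnorm2M -[leRHS]mul1r.
    by rewrite ler_wpM2r ?cnorm2_ge0 // g1.
  have hol_h : holat h z by exact: A2_hol Ah Wz.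
  have dE : pfun c v z (fun w => cmul (g w) (h w)) = cmul (der v g z) (h z).
    rewrite /pfun gz cmul0c cmulc0 add0r /der; have [-> ->] := pdM (hg z Wz) hol_h.
    by rewrite gz !cmul0c !addr0 /clin cmulDl -!cmulA ![cmul (h z) _]cmulC.
  have := duality oW onb c v Wz Af; rewrite dE cnorm2M LE => D.
  have p0 := psum_ge0 (Phi z) n.
  have h1 : psum (Phi z) (Phi z) n ^+ 2 <= cnorm2 (h z) by rewrite -hz /cnorm2 lerDl sqr_ge0.
  have D2 : cnorm2 (der v g z) * psum (Phi z) (Phi z) n ^+ 2 <= kern z * L z v * psum (Phi z) (Phi z) n.
    apply: (@le_trans _ _ (cnorm2 (der v g z) * cnorm2 (h z))); first by rewrite ler_wpM2l ?cnorm2_ge0.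
    by apply: le_trans D _; rewrite ler_wpM2l // (le_trans if_ ih).
  case: (ltP 0 (psum (Phi z) (Phi z) n)) => q0.
    by rewrite -(ler_pM2r q0) -mulrA -expr2.
  have -> : psum (Phi z) (Phi z) n = 0 by apply/eqP; rewrite eq_le p0 q0.
  by rewrite mulr0.
have DL : cnorm2 (der v g z) <= L z v.
  case: (ltP 0 (cnorm2 (der v g z))) => d0; last by apply: le_trans d0 (levi_ge0 v Wz).
  have : kern z <= kern z * L z v / cnorm2 (der v g z).
    by apply: dsum_le => n; rewrite ler_pdivlMr // mulrC.
  by rewrite ler_pdivlMr // ler_pM2l.
rewrite /bergman_length -/(L z v); exact: ler_wsqrtr DL.
Qed.

(** The negative term of [levi_pot] is dropped, the numerator is bounded by Cauchy's estimate over
    the unit ball of the space, and [kern_lower] with [f] keeps the denominator away from zero near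
    [p]. *)
Lemma bergman_upper p f : W p -> A2 W f -> f p != 0 ->
  exists2 r : R, 0 < r & exists2 C : R, 0 <= C & (forall z, `|z - p| < r -> W z) /\
    forall z v, `|z - p| < r -> bergman_length W J phi z v <= C * `|v|.
Proof.
move=> Wp Af f0.
have fp : 0 < cnorm2 (f p) by rewrite cnorm2_gt0.
have If : 0 < ipr W f f.
  by have := kern_lower oW onb Wp Af; have := ipr_ge0 W f; have := kpos Wp; nra.
have cf := cont_cnorm2 (holat_cont (A2_hol Af Wp)).
have /near_normP[r1 r10 hr1] : \forall z \near p, cnorm2 (f p) / 2 < cnorm2 (f z).
  have : nbhs (cnorm2 (f p)) [set x : R | cnorm2 (f p) / 2 < x].
    by apply: open_nbhs_nbhs; split; [exact: open_gt|rewrite /=; lra].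
  by move=> h; exact: (cf _ h).
have [r2 r20 [C2 C20 [sub b2]]] := lbounded_der (e1 R) (@clop_id R W) (lbounded_id oW) Wp.
have [r3 r30 [C3 C30 [_ b3]]] := lbounded_der (e2 R) (@clop_id R W) (lbounded_id oW) Wp.
pose k := cnorm2 (f p) / 2 / ipr W f f.
have k0 : 0 < k by rewrite !divr_gt0.
pose M := 4 * (C2 + C3); have M0 : 0 <= M by rewrite mulr_ge0 // addr_ge0.
exists (Num.min r1 (Num.min r2 r3)); first by rewrite !lt_min r10 r20.
exists (M / Num.sqrt k); first by rewrite divr_ge0 ?sqrtr_ge0.
split=> [z|z v]; rewrite !lt_min => /andP[h1 /andP[h2 h3]]; first exact: sub.
have Wz := sub z h2.
have kz : k <= kern z.
  rewrite /k ler_pdivrMr //; apply: le_trans (kern_lower oW onb Wz Af); apply: ltW; exact: hr1.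
have d1 g : der (e1 R) g z = pd1 g z by rewrite /der /clin /e1 /= cmulc1 cmulc0 addr0.
have d2 g : der (e2 R) g z = pd2 g z by rewrite /der /clin /e2 /= cmulc1 cmulc0 add0r.
have [_ dle] : ell2 (dPhi v z) /\ dsum (dPhi v z) (dPhi v z) <= (M * `|v|) ^+ 2.
  apply: (dsum_lev_bound oW onb (clop_fun (clop_der oW v) Wz)); first by rewrite mulr_ge0.
  move=> g Ag; have := b2 g Ag z h2; have := b3 g Ag z h3; rewrite d1 d2 => b5 b4.
  have n0 := nrm_ge0 W g.
  have -> : M * `|v| * nrm W g = 4 * ((C2 + C3) * nrm W g) * `|v| by rewrite /M; ring.
  by apply: clin_bound; nra.
have kz0 := kpos Wz.
have le1 : L z v <= (M * `|v|) ^+ 2 / k.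
  rewrite [L z v](levi_pot oW onb kpos v Wz).
  apply: (@le_trans _ _ (dsum (dPhi v z) (dPhi v z) / kern z)).
    by rewrite lerBlDr lerDl divr_ge0 ?addr_ge0 ?sqr_ge0.
  apply: ler_pM => //; first exact: dsum_ge0 (ell2_dPhi v Wz).
    by rewrite invr_ge0 ltW.
  by rewrite lef_pV2.
have -> : M / Num.sqrt k * `|v| = Num.sqrt ((M * `|v|) ^+ 2 / k).
  rewrite (@sqrtrM _ ((M * `|v|) ^+ 2) k^-1 (sqr_ge0 _)) (@sqrtr_sqr _ (M * `|v|)).
  rewrite (ger0_norm (mulr_ge0 M0 (normr_ge0 v))).
  by rewrite (@sqrtrV _ k (ltW k0)) mulrAC.
by rewrite /bergman_length -/(L z v); exact: ler_wsqrtr le1.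
Qed.

End BergmanBounds.

(** * Lower and upper bounds for lengths of curves *)

Section CurveLength.
Variable R : realType.
Local Notation leb := (@lebesgue_measure R).

Import HBNNSimple.

(* Monotonicity of the integral needs no measurability of the larger function:
   the Bergman and Caratheodory lengths need not be measurable along a curve. *)
Lemma ge0_integral_mono d (T : measurableType d) (mu : {measure set T -> \bar R}) (D : set T)
  (f1 f2 : T -> \bar R) : (forall x, D x -> (0 <= f1 x)%E) -> (forall x, D x -> (f1 x <= f2 x)%E) ->
  (\int[mu]_(x in D) f1 x <= \int[mu]_(x in D) f2 x)%E.
Proof.
move=> f0 f12.
have f20 x : D x -> (0 <= f2 x)%E by move=> Dx; apply: le_trans (f0 x Dx) (f12 x Dx).
rewrite !ge0_integralE //; apply: ge_ereal_sup => _ [h hle <-].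
apply: ereal_sup_ubound; exists h => // x; apply: le_trans (hle x) _.
rewrite !patchE; case: ifP => // /[1!inE] Dx; exact: f12.
Qed.

(** [h] continues the piece of [u] differentiably past its end points. The comparison with [w] is
    restricted to the open interval, since the whole curve may fail to be differentiable at a break
    point. *)
Definition pw_primitive (w : R -> \bar R) (u : R -> R) (a b : R) :=
  exists h dh : R -> R, [/\ (forall t, a <= t <= b -> is_derive t 1 h (dh t)),
    ccont dh a b, (forall t, a <= t <= b -> h t = u t) &
    forall t, a < t < b -> ((dh t)%:E <= w t)%E].

(** [m] is a measurable function below [w], supported in the open piece. Such minorants add up over
    the pieces, whereas additivity for [w] itself would ask for its measurability. *)
Lemma piece_length (w : R -> \bar R) (u : R -> R) (a b : R) : a < b -> pw_primitive w u a b ->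
  exists m : R -> \bar R, [/\ measurable_fun [set: R] m, (forall t, (0 <= m t)%E),
    (forall t, ~~ (a < t < b) -> m t = 0%E), (forall t, a < t < b -> (0 <= w t)%E -> (m t <= w t)%E) &
    ((u b - u a)%:E <= \int[leb]_t m t)%E].
Proof.
move=> ab [h [dh [dd cd hu dw]]].
pose m : R -> \bar R := (fun t => (Num.max (dh t) 0)%:E) \_ `]a, b[.
have cm : ccont (fun t => Num.max (dh t) 0) a b.
  move=> t tab; apply: (@continuous_comp _ _ _ dh (fun x : R => Num.max x 0)); first exact: cd.
  have -> : (fun x : R => Num.max x 0) = (fun x => (x + 0 + `|x - 0|) / 2) by apply/funext => x; rewrite maxr_absE.
  apply: cvgMl; apply: cvgD; first by apply: cvgD; [exact: cvg_id|exact: cvg_cst].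
  by apply: cvg_norm; apply: cvgB; [exact: cvg_id|exact: cvg_cst].
have mm : measurable_fun `]a, b[ (fun t => (Num.max (dh t) 0)%:E).
  apply/measurable_EFinP; apply: (measurable_funS (E := `[a, b])); first exact: measurable_itv.
    by move=> t /=; rewrite !in_itv /= => /andP[/ltW -> /ltW ->].
  by apply: subspace_continuous_measurable_fun; [exact: measurable_itv|exact: ccont_within].
exists m; split.
- by apply/(measurable_restrictT _ (measurable_itv _)).
- by move=> t; rewrite /m patchE; case: ifP => // _; rewrite lee_fin le_max lexx orbT.
- move=> t tab; rewrite /m patchE; case: ifP => // /[1!inE] /=; rewrite in_itv /= => h1.
  by rewrite h1 in tab.
- move=> t tab w0; rewrite /m patchE mem_set /= ?in_itv //.
  by rewrite /Num.max; case: ifP => // _; exact: dw.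
have -> : (\int[leb]_t m t)%E = (\int[leb]_(t in `]a, b[) (Num.max (dh t) 0)%:E)%E.
  by rewrite [RHS]integral_mkcond.
have hab : h b - h a = rint dh a b.
  have cdw : {within `[a, b], continuous dh} by exact: ccont_within.
  have ch t : a <= t <= b -> {for t, continuous h} by move=> /dd/rderP/rder_cont.
  have LR : derivable_oo_LRcontinuous h a b.
    split=> [t||].
    - by rewrite in_itv /= => /andP[/ltW t1 /ltW t2]; have [] := dd t; rewrite ?t1.
    - by apply: cvg_at_right_filter; apply: ch; rewrite lexx ltW.
    - by apply: cvg_at_left_filter; apply: ch; rewrite lexx ltW.
  have hd : {in `]a, b[, h^`()%classic =1 dh}.
    move=> t; rewrite in_itv /= => /andP[/ltW t1 /ltW t2]; rewrite derive1E.
    by have [|_ ->] := dd t; rewrite ?t1.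
  have := continuous_FTC2 ab cdw LR hd.
  by rewrite /rint /Rintegral => ->; rewrite -EFinB.
have fin : (rint (fun t => Num.max (dh t) 0) a b)%:E = (\int[leb]_(t in `[a, b]) (Num.max (dh t) 0)%:E)%E.
  rewrite /rint /Rintegral fineK //; apply: integrable_fin_num => //; exact: ccont_integrable.
rewrite -(integral_itv_bndoo true false mm) -fin lee_fin -!hu ?lexx ?(ltW ab) // hab.
by apply: rint_le => // t _; rewrite le_max lexx.
Qed.

Lemma pieces_length (w : R -> \bar R) (u : R -> R) (s : nat -> R) n :
  (forall i, (i < n)%N -> s i < s i.+1) ->
  (forall i, (i < n)%N -> pw_primitive w u (s i) (s i.+1)) ->
  (forall t, s 0%N <= t <= s n -> (0 <= w t)%E) ->
  s 0%N <= s n /\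
  exists m : R -> \bar R, [/\ measurable_fun [set: R] m, (forall t, (0 <= m t)%E),
    (forall t, ~~ (s 0%N < t < s n) -> m t = 0%E), (forall t, s 0%N < t < s n -> (m t <= w t)%E) &
    ((u (s n) - u (s 0%N))%:E <= \int[leb]_t m t)%E].
Proof.
elim: n => [|n IH] inc pp w0.
  split => //; exists (cst 0%E); split => //.
    by move=> t; rewrite lt_asym.
  by rewrite subrr integral0.
have sn := inc n (ltnSn n).
have [s0n [M [mM M0 Mout Min Mint]]] : s 0%N <= s n /\
  exists m : R -> \bar R, [/\ measurable_fun [set: R] m, (forall t, (0 <= m t)%E),
    (forall t, ~~ (s 0%N < t < s n) -> m t = 0%E), (forall t, s 0%N < t < s n -> (m t <= w t)%E) &
    ((u (s n) - u (s 0%N))%:E <= \int[leb]_t m t)%E].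
  apply: IH => [i ni|i ni|t /andP[t1 t2]]; [apply: inc|apply: pp|apply: w0]; rewrite ?ltnS ?(ltnW ni) //.
  by rewrite t1 (le_trans t2 (ltW sn)).
have [m [mm m0 mout min mint]] := piece_length sn (pp n (ltnSn n)).
split; first by apply: le_trans s0n (ltW sn).
exists (fun t => M t + m t)%E; split.
- exact: emeasurable_funD.
- by move=> t; rewrite adde_ge0.
- move=> t ht; rewrite Mout ?mout ?adde0 //; apply: contra ht => /andP[t1 t2]; apply/andP; split => //.
    by apply: le_lt_trans t1.
  by apply: lt_trans t2 sn.
- move=> t /andP[t1 t2]; have wt : (0 <= w t)%E by apply: w0; rewrite !ltW.
  case: (ltP t (s n)) => tn.
    rewrite mout ?adde0; first by apply: Min; rewrite t1.
    by rewrite negb_and -leNgt (ltW tn).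
  rewrite Mout ?add0e; last by rewrite negb_and -!leNgt tn orbT.
  case: (ltP (s n) t) => tn'; first by apply: min => //; rewrite tn'.
  by rewrite mout // negb_and -leNgt tn'.
- rewrite ge0_integralD //; have -> : u (s n.+1) - u (s 0%N) = (u (s n) - u (s 0%N)) + (u (s n.+1) - u (s n)).
    by ring.
  by rewrite EFinD; exact: leeD.
Qed.

Lemma length_lower (w : R -> \bar R) (u : R -> R) (s : nat -> R) n :
  s 0%N = 0 -> s n = 1 ->
  (forall i, (i < n)%N -> s i < s i.+1) ->
  (forall i, (i < n)%N -> pw_primitive w u (s i) (s i.+1)) ->
  (forall t, 0 <= t <= 1 -> (0 <= w t)%E) ->
  ((u 1 - u 0)%:E <= \int[leb]_(t in [set t : R | (0 <= t <= 1)%R]) w t)%E.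
Proof.
move=> s0 sn inc pp w0; have := pieces_length inc pp; rewrite s0 sn.
move=> /(_ w0)[_ [m [mm m0 mout min mint]]]; apply: le_trans mint _.
rewrite [leRHS]integral_mkcond; apply: ge0_integral_mono => [t _|t _]; first exact: m0.
rewrite patchE; case: ifPn => [/[1!inE] /= /andP[t0 t1]|/negP h]; last first.
  rewrite mout //; apply/negP => /andP[t1 t2]; apply: h.
  by rewrite inE /= !ltW.
case: (boolP (0 < t < 1)) => h; first exact: min.
by rewrite mout //; apply: w0; rewrite t0.
Qed.

Lemma length_upper (w : R -> \bar R) (C : R) : (forall t, 0 <= t <= 1 -> (0 <= w t <= C%:E)%E) ->
  (\int[leb]_(t in [set t : R | (0 <= t <= 1)%R]) w t <= C%:E)%E.
Proof.
move=> h; have -> : [set t : R | 0 <= t <= 1] = `[0, 1]%classic.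
  by apply/seteqP; split => t /=; rewrite in_itv.
apply: (@le_trans _ _ (\int[leb]_(t in `[(0 : R)%R, 1%R]) (cst C%:E) t)%E).
  by apply: ge0_integral_mono => t; rewrite /= in_itv /= => /h /andP[].
rewrite integral_cst; last exact: measurable_itv.
have e : leb `[(0 : R), 1]%classic = 1%E.
  by rewrite lebesgue_measure_itv /= lte_fin ltr01 oppr0 adde0.
by rewrite -[leRHS]mule1 le_eqVlt; apply/orP; left; apply/eqP; congr (_ * _)%E; exact: e.
Qed.

End CurveLength.

(** * Functions that are Lipschitz for an integrated metric *)

Section HyperbolicDistances.
Variable R : realType.
Local Notation Cx := (Cx R).
Local Notation C2 := (C2 R).
Implicit Types (f g : C2 -> Cx) (p q z v : C2).
Variable W : set C2.
Hypothesis oW : open W.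
Variable F : C2 -> C2 -> \bar R.

(** What is needed of a continuously differentiable function on [W]: the chain rule along curves and
    continuity of the resulting derivative. *)
Definition smooth (u : C2 -> R) (du : C2 -> C2 -> R) :=
  (forall (h : R -> C2) t k, W (h t) -> is_derive t 1 h k -> is_derive t 1 (fun s => u (h s)) (du (h t) k)) /\
  (forall (h k : R -> C2) t, W (h t) -> {for t, continuous h} -> {for t, continuous k} ->
     {for t, continuous (fun s => du (h s) (k s))}).

(** [F] dominates the Caratheodory length. This and [upper_metric], a local Euclidean bound from
    above, hold for both metrics, so that completeness is proved once. *)
Definition lower_metric := forall p v g, W p -> holW W g -> (forall w, W w -> cnorm2 (g w) < 1) ->
  g p = 0 -> ((cabs (der v g p))%:E <= F p v)%E.

Definition upper_metric := forall p, W p -> exists2 r : R, 0 < r & exists2 C : R, 0 <= C &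
  (forall z, `|z - p| < r -> W z) /\ forall z v, `|z - p| < r -> (F z v <= (C * `|v|)%:E)%E.

Hypothesis F0 : forall p v, W p -> (0 <= F p v)%E.

Lemma smooth_length u du (g : R -> C2) p q : smooth u du -> (forall p v, W p -> ((du p v)%:E <= F p v)%E) ->
  pw_C1_curve W g p q -> ((u q - u p)%:E <= curve_length F g)%E.
Proof.
move=> [s1 s2] duF [g0 [g1 [gW [n [s [sz [sn [inc pp]]]]]]]]; rewrite -g0 -g1 /curve_length.
have mon i j : (i <= j)%N -> (j <= n)%N -> s i <= s j.
  elim: j => [|j IH]; first by rewrite leqn0 => /eqP ->.
  rewrite leq_eqVlt => /orP[/eqP -> //|ij jn]; apply: le_trans (ltW (inc j jn)).
  by apply: IH => //; exact: ltnW.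
apply: (@length_lower R (fun t => F (g t) ('D_1 g t)) (fun t => u (g t)) s n) => //; last first.
  by move=> t /gW Wt; exact: F0.
move=> i ni; have [h [hd [hc hg]]] := pp i ni.
have in01 t : s i <= t <= s i.+1 -> 0 <= t <= 1.
  by move=> /andP[t1 t2]; have := mon 0%N i (leq0n _) (ltnW ni); have := mon i.+1 n ni (leqnn _); rewrite sz sn; lra.
have hW t : s i <= t <= s i.+1 -> W (h t) by move=> ht; rewrite hg //; exact: gW (in01 t ht).
exists (fun t => u (h t)), (fun t => du (h t) ('D_1 h t)); split.
- by move=> t ht; apply: s1; [exact: hW|exact/derivableP].
- move=> t ht; apply: s2; [exact: hW| |exact: hc].
  by have /derivableP/rderP/rder_cont := hd t.
- by move=> t ht; rewrite hg.
- move=> t /andP[t1 t2]; have ht : s i <= t <= s i.+1 by rewrite !ltW.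
  have -> : 'D_1 g t = 'D_1 h t.
    apply: near_eq_derive; have : nbhs t `]s i, s i.+1[%classic.
      by apply: open_nbhs_nbhs; split; [exact: interval_open|rewrite /= in_itv /= t1].
    by apply: filterS => x /=; rewrite in_itv /= => /andP[x1 x2]; rewrite hg // !ltW.
  by rewrite -(hg t ht); apply: duF; exact: hW.
Qed.

Lemma smooth_dist u du p q : smooth u du -> (forall p v, W p -> ((du p v)%:E <= F p v)%E) ->
  ((u q - u p)%:E <= int_dist W F p q)%E.
Proof.
by move=> su duF; apply: le_ereal_inf_tmp => _ [g hg <-]; exact: smooth_length su duF hg.
Qed.

Lemma segment_dist p q r (C : R) z : 0 < r -> 0 <= C -> (forall w, `|w - z| < r -> W w) ->
  (forall w v, `|w - z| < r -> (F w v <= (C * `|v|)%:E)%E) ->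
  `|p - z| < r -> `|q - z| < r -> (int_dist W F p q <= (C * `|q - p|)%:E)%E.
Proof.
move=> r0 C0 sub up hp hq; pose g (t : R) := p + t *: (q - p).
have gd (t : R) : is_derive t 1 g (q - p) by apply/rderP; exact: rder_line.
have gr t : 0 <= t <= 1 -> `|g t - z| < r.
  by move=> ht; apply: ball_seg => //; have -> : p + (q - p) = q by rewrite addrC subrK.
have dg : 'D_1 g = cst (q - p) by apply/funext => t; have [_ ->] := gd t.
apply: (@le_trans _ _ (curve_length F g)).
  apply: ereal_inf_lbound; exists g => //; split; first by rewrite /g scale0r addr0.
  split; first by rewrite /g scale1r addrC subrK.
  split; first by move=> t /gr/sub.
  exists 1%N, (fun i => i%:R); split => //; split => //; split.
    by move=> i _; rewrite ltr_nat.
  move=> i _; exists g; split; first by move=> t; have [] := gd t.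
  by split => //; rewrite dg; exact: cst_continuous.
rewrite /curve_length; apply: length_upper => t ht.
rewrite [X in F _ X](_ : _ = q - p); last by have [_ e] := gd t; exact: e.
rewrite F0 /=; last exact: sub (gr t ht).
exact: up (gr t ht).
Qed.

Lemma cont_pd f p : holW W f -> W p -> {for p, continuous (pd1 f)} /\ {for p, continuous (pd2 f)}.
Proof.
move=> hf Wp.
have d1 : pd1 f = der (e1 R) f by apply/funext => z; rewrite /der /clin /e1 /= cmulc1 cmulc0 addr0.
have d2 : pd2 f = der (e2 R) f by apply/funext => z; rewrite /der /clin /e2 /= cmulc1 cmulc0 add0r.
by rewrite d1 d2; split; exact: holat_cont (hol_der oW _ hf Wp).
Qed.

Lemma cont_der f (h k : R -> C2) t : holW W f -> W (h t) -> {for t, continuous h} -> {for t, continuous k} ->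
  {for t, continuous (fun s => der (k s) f (h s))}.
Proof.
move=> hf Wt ch ck; have [c1 c2] := cont_pd hf Wt.
apply: cont_cadd; apply: cont_cmul.
- exact: (@continuous_comp _ _ _ h (pd1 f)).
- exact: (cont_fst ck).
- exact: (@continuous_comp _ _ _ h (pd2 f)).
- exact: (cont_snd ck).
Qed.

Lemma smooth_re f : holW W f -> smooth (fun z => (f z).1) (fun p v => (der v f p).1).
Proof.
move=> hf; split=> [h t k Wt /rderP hk|h k t Wt ch ck].
  exact: rder_fst (cder2_curve hk (holat_pd (hf _ Wt))).
exact: (cont_fst (cont_der hf Wt ch ck)).
Qed.

Lemma smooth_ln f : holW W f -> (forall z, W z -> 0 < (f z).1) ->
  smooth (fun z => ln (f z).1 / 2) (fun p v => (der v f p).1 / (2 * (f p).1)).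
Proof.
move=> hf f0; split=> [h t k Wt hk|h k t Wt ch ck].
  have hd := (smooth_re hf).1 h t k Wt hk.
  have h1 := is_derive_comp (F := @ln R) (f := fun s => (f (h s)).1) (is_derive1_ln (f0 _ Wt)) hd.
  have h2 := is_deriveZ 2^-1 h1; have -> : (fun s => ln (f (h s)).1 / 2) = 2^-1 \*: (fun s => ln (f (h s)).1).
    by apply/funext => s; rewrite /= mulrC.
  apply: (is_derive_eq h2); rewrite /GRing.scale /= invfM; ring.
apply: cvgM; first exact: (cont_fst (cont_der hf Wt ch ck)).
apply: cvgV; first by rewrite mulf_neq0 // gt_eqF // f0.
apply: cvgMr; apply: cont_fst.
apply: (@continuous_comp _ _ _ h f) => //; exact: holat_cont (hf _ Wt).
Qed.

Hypothesis FL : lower_metric.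

Lemma der_subc f (c : Cx) v p : holat f p -> der v (fun z => f z - c) p = der v f p.
Proof.
move=> hf; have [d1 d2] := cder2_pd (cder2B (holat_pd hf) (cder2_cst c p)).
by rewrite /der d1 d2 !subr0.
Qed.

(** The bound [1 / 4] puts [f - f p] into the disc of radius [1 / 2], so it is a competitor for the
    metric at [p]. *)
Lemma re_lower f p v : holW W f -> (forall z, W z -> cabs (f z) <= 1 / 4) -> W p ->
  (((der v f p).1)%:E <= F p v)%E.
Proof.
move=> hf fb Wp; apply: (@le_trans _ _ (cabs (der v f p))%:E).
  by rewrite lee_fin; apply: le_trans (ler_norm _) (cabs_ge_re _).
rewrite -(der_subc (f p) v (hf p Wp)); apply: FL => //; last by rewrite subrr.
  by move=> w Ww; apply: holatB; [exact: hf|exact: holat_cst].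
move=> w Ww; rewrite cnorm2_cabs; have := cabsB (f w) (f p); have := fb w Ww; have := fb p Wp.
by have := cabs_ge0 (f w - f p); nra.
Qed.

Lemma re_dist f p q : holW W f -> (forall z, W z -> cabs (f z) <= 1 / 4) ->
  (((f q).1 - (f p).1)%:E <= int_dist W F p q)%E.
Proof.
move=> hf fb; apply: (smooth_dist p q (smooth_re hf)) => z v Wz; exact: re_lower.
Qed.

(* The Cayley transform [(f - f p) / (f + conj (f p))] maps the right half plane
   to the disc; its differential at [p] is [df / (2 Re (f p))]. *)
Lemma cayley_lower f p v : holW W f -> (forall z, W z -> 0 < (f z).1) -> W p ->
  (((der v f p).1 / (2 * (f p).1))%:E <= F p v)%E.
Proof.
move=> hf f0 Wp; set a := f p; have a0 : 0 < a.1 := f0 p Wp.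
pose d z := f z + cconj a.
have d1 z : W z -> 0 < (d z).1 by move=> Wz; rewrite /d cxE /=; have := f0 z Wz; lra.
have dn0 z : W z -> d z != 0.
  by move=> Wz; apply/eqP => h; have := d1 z Wz; rewrite h ltxx.
pose g z := cmul (f z - a) (cinv (d z)).
have hd z : W z -> holat d z by move=> Wz; apply: holatD; [exact: hf|exact: holat_cst].
have hg : holW W g.
  move=> z Wz; apply: holatM; first by apply: holatB; [exact: hf|exact: holat_cst].
  by apply: holatV; [exact: dn0|exact: hd].
have g1 w : W w -> cnorm2 (g w) < 1.
  move=> Ww; rewrite /g cnorm2M; have n0 : 0 < cnorm2 (d w) by rewrite cnorm2_gt0 dn0.
  have -> : cnorm2 (cinv (d w)) = (cnorm2 (d w))^-1.
    by rewrite cnorm2_cabs cabsV ?dn0 // exprVn -cnorm2_cabs.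
  rewrite ltr_pdivrMr // mul1r /cnorm2 /d !cxE /=; have := f0 w Ww; nra.
have gp : g p = 0 by rewrite /g /a subrr cmul0c.
have dp : d p = creal (2 * a.1) by rewrite /d /a; apply: cx_eq; rewrite !cxE /=; ring.
have hi : holat (fun z => cinv (d z)) p by apply: holatV; [exact: dn0|exact: hd].
have hm : holat (fun z => f z - a) p by apply: holatB; [exact: hf|exact: holat_cst].
have dg : der v g p = cmul (der v f p) (creal (2 * a.1)^-1).
  have [m1 m2] := pdM hm hi; have [b1 b2] := cder2_pd (cder2B (holat_pd (hf p Wp)) (cder2_cst a p)).
  rewrite /der m1 m2 b1 b2 /a subrr !cmul0c !addr0 !subr0 dp.
  have -> : cinv (creal (2 * (f p).1)) = creal (2 * (f p).1)^-1.
    by apply: (@cmulI R _ _ (creal (2 * (f p).1)));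
      [rewrite -dp dn0|rewrite cmulVc ?(=^~ dp) ?dn0 //; apply: cx_eq; rewrite !cxE /=; field; rewrite gt_eqF].
  by rewrite /clin cmulDl -!cmulA ![cmul (creal _) _]cmulC.
apply: le_trans (FL v Wp hg g1 gp); rewrite lee_fin dg cabsM creal_abs.
have i0 : 0 < (2 * a.1)^-1 by rewrite invr_gt0 mulr_gt0.
by rewrite gtr0_norm // ler_pM2r //; apply: le_trans (ler_norm _) (cabs_ge_re _).
Qed.

Lemma ln_dist f p q : holW W f -> (forall z, W z -> 0 < (f z).1) ->
  ((ln (f q).1 / 2 - ln (f p).1 / 2)%:E <= int_dist W F p q)%E.
Proof.
move=> hf f0; apply: (smooth_dist p q (smooth_ln hf f0)) => z v Wz; exact: cayley_lower.
Qed.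

Lemma int_dist_ge0 p q : (0 <= int_dist W F p q)%E.
Proof.
apply: le_ereal_inf_tmp => _ [g [_ [_ [gW _]]] <-]; apply: integral_ge0 => t ht.
by apply: F0; apply: gW.
Qed.

End HyperbolicDistances.

(** * The Leibniz rule for holomorphic derivatives *)

Section LeibnizRule.
Variable R : realType.
Local Notation C2 := (C2 R).
Local Notation Cx := (Cx R).
Implicit Types (f g : C2 -> Cx) (p v : C2).

Lemma derM f g p v : holat f p -> holat g p ->
  der v (fun z => cmul (f z) (g z)) p = cmul (der v f p) (g p) + cmul (f p) (der v g p).
Proof.
move=> hf hg; have [e1 e2] := pdM hf hg; rewrite /der e1 e2 /clin.
move: (pd1 f p) (pd2 f p) (pd1 g p) (pd2 g p) (f p) (g p) => a b c d x y.
rewrite !cmulDl cmulDr addrACA -!cmulA (cmulC y) (cmulC y) !cmulA; congr (_ + _ + _).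
Qed.

Lemma der_fst p v : der v (fun z => z.1) p = v.1.
Proof. by have [e1 e2] := cder2_pd (cder2_fst p); rewrite /der e1 e2 /clin cmul1c cmul0c addr0. Qed.

Lemma der_snd p v : der v (fun z => z.2) p = v.2.
Proof. by have [e1 e2] := cder2_pd (cder2_snd p); rewrite /der e1 e2 /clin cmul1c cmul0c add0r. Qed.

End LeibnizRule.

(** * Positivity and completeness from peak functions and separating bounded functions *)

Section Completeness.
Variable R : realType.
Local Notation Cx := (Cx R).
Local Notation C2 := (C2 R).
Implicit Types (f g : C2 -> Cx) (p q z v : C2).
Variable W : set C2.
Hypothesis oW : open W.

(* [f0] separates points together with [f0 z1] and [f0 z2]; [peak q] is a
   half-plane valued function tending to [0] at the boundary point [q]. *)
Variable f0 : C2 -> Cx.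
Hypotheses (hf0 : holW W f0) (Af0 : A2 W f0).
Hypothesis b0 : forall z, W z -> cabs (f0 z) <= 1 / 4.
Hypothesis b1 : forall z, W z -> cabs (cmul (f0 z) z.1) <= 1 / 4.
Hypothesis b2 : forall z, W z -> cabs (cmul (f0 z) z.2) <= 1 / 4.
Hypothesis low : forall r : R, exists2 d : R, 0 < d & forall z, W z -> `|z| <= r -> d <= cabs (f0 z).
Hypothesis infty : exists f, [/\ holW W f, forall z, W z -> 0 < (f z).1 &
  forall M : R, exists r : R, forall z, W z -> r <= `|z| -> M <= (f z).1].
Hypothesis peak : forall q, ~ W q -> exists f, [/\ holW W f, forall z, W z -> 0 < (f z).1 &
  forall e : R, 0 < e -> exists2 d : R, 0 < d & forall z, W z -> `|z - q| < d -> (f z).1 <= e].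

Let hf1 : holW W (fun z => cmul (f0 z) z.1).
Proof. by move=> p Wp; apply: holatM; [exact: hf0|exact: holat_fst]. Qed.
Let hf2 : holW W (fun z => cmul (f0 z) z.2).
Proof. by move=> p Wp; apply: holatM; [exact: hf0|exact: holat_snd]. Qed.

Lemma f0_neq0 z : W z -> f0 z != 0.
Proof. by move=> Wz; have [d d0 h] := low `|z|; rewrite -cabs_gt0; apply: lt_le_trans d0 (h _ Wz _). Qed.

(** If the derivative of [f0] along [v] vanishes, those of [f0 z1] and [f0 z2] are [f0 p] times the
    components of [v], one of which is not zero. *)
Lemma separating_competitor p v : W p -> v != 0 -> exists g, [/\ holW W g,
  forall w, W w -> cnorm2 (g w) < 1, g p = 0 & 0 < cabs (der v g p)].
Proof.
move=> Wp v0.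
have key f : holW W f -> (forall z, W z -> cabs (f z) <= 1 / 4) -> der v f p != 0 ->
    exists g, [/\ holW W g, forall w, W w -> cnorm2 (g w) < 1, g p = 0 & 0 < cabs (der v g p)].
  move=> hf bf df; exists (fun z => f z - f p); split.
  - by move=> w Ww; apply: holatB; [exact: hf|exact: holat_cst].
  - move=> w Ww; rewrite cnorm2_cabs; have := cabsB (f w) (f p); have := bf w Ww; have := bf p Wp.
    by have := cabs_ge0 (f w - f p); nra.
  - by rewrite subrr.
  - by rewrite der_subc ?cabs_gt0 //; exact: hf.
case: (eqVneq (der v f0 p) 0) => [d0|]; last exact: key.
have D1 : der v (fun z => cmul (f0 z) z.1) p = cmul (f0 p) v.1.
  by rewrite (derM v (hf0 Wp) (holat_fst p)) d0 cmul0c add0r der_fst.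
have D2 : der v (fun z => cmul (f0 z) z.2) p = cmul (f0 p) v.2.
  by rewrite (derM v (hf0 Wp) (holat_snd p)) d0 cmul0c add0r der_snd.
have := f0_neq0 Wp => fp.
case: (eqVneq v.1 0) => [v1|v1]; last by apply: (key _ hf1 b1); rewrite D1 cmul_eq0 negb_or fp.
case: (eqVneq v.2 0) => [v2|v2]; last by apply: (key _ hf2 b2); rewrite D2 cmul_eq0 negb_or fp.
by case/eqP: v0; rewrite (surjective_pairing v) v1 v2.
Qed.

Section Metric.
Variable F : C2 -> C2 -> \bar R.
Hypothesis F0 : forall p v, W p -> (0 <= F p v)%E.
Hypothesis FL : lower_metric W F.
Hypothesis FU : upper_metric W F.

Section CauchySequence.
Variable x : nat -> C2.
Hypothesis Wx : forall n, W (x n).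
Hypothesis cx : forall e : R, 0 < e -> exists N : nat, forall m n, (N <= m)%N -> (N <= n)%N ->
  (int_dist W F (x m) (x n) < e%:E)%E.

Lemma re_cauchy f : holW W f -> (forall z, W z -> cabs (f z) <= 1 / 4) ->
  forall e : R, 0 < e -> exists N : nat, forall m n, (N <= m)%N -> (N <= n)%N ->
    `|(f (x m)).1 - (f (x n)).1| <= e.
Proof.
move=> hf bf e /cx[N hN]; exists N => m n Nm Nn.
have h1 := le_lt_trans (re_dist oW F0 FL (x m) (x n) hf bf) (hN m n Nm Nn).
have h2 := le_lt_trans (re_dist oW F0 FL (x n) (x m) hf bf) (hN n m Nn Nm).
by rewrite !lte_fin in h1 h2; rewrite ler_norml; apply/andP; split; lra.
Qed.

Lemma value_cauchy f : holW W f -> (forall z, W z -> cabs (f z) <= 1 / 4) ->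
  exists l : Cx, forall e : R, 0 < e -> exists N : nat, forall n, (N <= n)%N -> cabs (f (x n) - l) <= e.
Proof.
move=> hf bf; apply: cx_cauchy => e e0; have e20 : 0 < e / 2 by lra.
have [N hN] := re_cauchy hf bf e20.
have hif : holW W (fun z => cmul (cI R) (f z)) by move=> p Wp; apply: holatZ; exact: hf.
have bif z : W z -> cabs (cmul (cI R) (f z)) <= 1 / 4.
  move=> Wz; rewrite cabsM; have -> : cabs (cI R) = 1; last by rewrite mul1r; exact: bf.
  by rewrite /cabs /cnorm2 /= expr0n expr1n add0r sqrtr1.
have [N' hN'] := re_cauchy hif bif e20.
exists (maxn N N') => m n; rewrite !geq_max => /andP[m1 m2] /andP[n1 n2].
have h1 := hN m n m1 n1; have h2 := hN' m n m2 n2.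
apply: le_trans (cabs_le_sum _) _.
have -> : (f (x m) - f (x n)).1 = (f (x m)).1 - (f (x n)).1 by [].
have -> : `|(f (x m) - f (x n)).2| = `|(cmul (cI R) (f (x m))).1 - (cmul (cI R) (f (x n))).1|.
  by rewrite !cxE /= -normrN; congr (`|_|); ring.
lra.
Qed.

(** From some [x N] on the distances are below 1, so [ln (f x).1] moves by less than 2. This keeps
    [(f x).1] between positive constants: the sequence can neither run to where the real part is
    infinite nor to where it vanishes. *)
Lemma ln_bounded f : holW W f -> (forall z, W z -> 0 < (f z).1) ->
  exists2 M : R, 0 < M & exists2 d : R, 0 < d & exists N : nat, forall n, (N <= n)%N -> d <= (f (x n)).1 <= M.
Proof.
move=> hf pf; have [N hN] := cx ltr01; set l := ln (f (x N)).1.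
exists (expR (l + 2)); first exact: expR_gt0.
exists (expR (l - 2)); first exact: expR_gt0.
exists N => n Nn.
have h1 := le_lt_trans (ln_dist oW F0 FL (x N) (x n) hf pf) (hN N n (leqnn _) Nn).
have h2 := le_lt_trans (ln_dist oW F0 FL (x n) (x N) hf pf) (hN n N Nn (leqnn _)).
rewrite !lte_fin -/l in h1 h2.
have e : expR (ln (f (x n)).1) = (f (x n)).1 by rewrite lnK // posrE; exact: pf.
by rewrite -e !ler_expR; apply/andP; split; lra.
Qed.

Lemma cvg_cabs (u : nat -> Cx) (l : Cx) :
  (forall e : R, 0 < e -> exists N : nat, forall n, (N <= n)%N -> cabs (u n - l) <= e) -> u @ \oo --> l.
Proof.
move=> h; apply/cvgrPdist_le => e /h[N hN]; near=> n.
rewrite distrC; apply: le_trans (cabs_ge_norm _) _; apply: hN.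
by near: n; exact: nbhs_infty_ge.
Unshelve. all: by end_near. Qed.

Lemma cvg_cmul (u w : nat -> Cx) (l k : Cx) : u @ \oo --> l -> w @ \oo --> k ->
  (fun n => cmul (u n) (w n)) @ \oo --> cmul l k.
Proof.
have f1 (s : nat -> Cx) (t : Cx) : s @ \oo --> t -> (fun n => (s n).1) @ \oo --> t.1.
  move=> /cvgrPdist_le h; apply/cvgrPdist_le => e /h; apply: filterS => n.
  by apply: le_trans; exact: (norm_fst_le (t - s n)).
have f2 (s : nat -> Cx) (t : Cx) : s @ \oo --> t -> (fun n => (s n).2) @ \oo --> t.2.
  move=> /cvgrPdist_le h; apply/cvgrPdist_le => e /h; apply: filterS => n.
  by apply: le_trans; exact: (norm_snd_le (t - s n)).
move=> cu cw; apply: (cvg_pair (G := nbhs (cmul l k).1) (H := nbhs (cmul l k).2)).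
  by apply: cvgB; apply: cvgM; [exact: f1|exact: f1|exact: f2|exact: f2].
by apply: cvgD; apply: cvgM; [exact: f1|exact: f2|exact: f2|exact: f1].
Qed.

(** The coordinates are quotients of [f0 z1] and [f0 z2] by [f0], whose values along the sequence
    converge; the sequence is bounded, so [low] keeps the limit of [f0] from zero. A limit outside
    [W] would contradict [ln_bounded] for its peak function. *)
Lemma euclidean_limit : exists2 y : C2, W y & x @ \oo --> y.
Proof.
have [fi [hfi pfi big]] := infty.
have [M M0 [d1 d10 [N1 hN1]]] := ln_bounded hfi pfi.
have [r hr] := big (M + 1).
have xb n : (N1 <= n)%N -> `|x n| <= r.
  move=> Nn; rewrite leNgt; apply/negP => /ltW /(hr _ (Wx n)).
  by have /andP[_] := hN1 n Nn; lra.
have [d d0 hd] := low r.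
have [a ha] := value_cauchy hf0 b0.
have [b hb] := value_cauchy hf1 b1.
have [c hc] := value_cauchy hf2 b2.
have a0 : a != 0.
  have d20 : 0 < d / 2 by lra.
  have [N hN] := ha _ d20; have h1 := hN (maxn N N1) (leq_maxl _ _).
  have h2 := hd _ (Wx (maxn N N1)) (xb _ (leq_maxr _ _)).
  apply/eqP => a0; rewrite a0 subr0 in h1; lra.
have ca := cvg_cabs ha; have cb := cvg_cabs hb; have cc := cvg_cabs hc.
have ci : (fun n => cinv (f0 (x n))) @ \oo --> cinv a.
  exact: (cvg_comp _ _ ca (@cont_cinv R _ (fun w : Cx => w) a a0 (@cvg_id _ _))).
have cm (u : nat -> Cx) l : u @ \oo --> l -> (fun n => cmul (u n) (cinv (f0 (x n)))) @ \oo --> cmul l (cinv a).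
  by move=> cu; exact: cvg_cmul.
pose y : C2 := (cmul b (cinv a), cmul c (cinv a)).
have xy : x @ \oo --> y.
  have -> : x = fun n => (cmul (cmul (f0 (x n)) (x n).1) (cinv (f0 (x n))), cmul (cmul (f0 (x n)) (x n).2) (cinv (f0 (x n)))).
    apply/funext => n; have fn := f0_neq0 (Wx n).
    by rewrite ![cmul (f0 (x n)) _]cmulC !cmulK // -surjective_pairing.
  exact: (cvg_pair (cm _ _ cb) (cm _ _ cc)).
exists y => //; apply: contrapT => nW; have [f [hf pf small]] := peak nW.
have [M2 M20 [e e0 [N hN]]] := ln_bounded hf pf.
have e20 : 0 < e / 2 by lra.
have [t t0 ht] := small _ e20.
have /cvgrPdist_lt/(_ t t0)[N' _ hN'] := xy.
have h1 : (f (x (maxn N N'))).1 <= e / 2.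
  by apply: ht => //; rewrite distrC; apply: hN'; exact: leq_maxr.
by have /andP[h2 _] := hN (maxn N N') (leq_maxl _ _); lra.
Qed.

Lemma cauchy_converges : exists y, W y /\ (fun n => int_dist W F (x n) y) @ \oo --> 0%E.
Proof.
have [y Wy xy] := euclidean_limit; exists y; split => //.
have [r r0 [C C0 [sub up]]] := FU Wy.
have yy : `|y - y| < r by rewrite subrr normr0.
have c0 : (fun n => (C * `|y - x n|)%:E) @ \oo --> 0%E.
  apply: cvg_EFin; first by apply: nearW.
  have -> : (0 : R) = C * `|y - y| by rewrite subrr normr0 mulr0.
  by apply: cvgMr; apply: cvg_norm; apply: cvgB => //; exact: cvg_cst.
apply: (squeeze_cvge _ (cvg_cst 0%E) c0).
have /cvgrPdist_lt/(_ r r0) := xy; apply: filterS => n hn.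
rewrite int_dist_ge0 //=; apply: (segment_dist F0 r0 C0 sub up) => //.
by rewrite distrC.
Qed.

End CauchySequence.

Lemma metric_complete : complete_dist W (int_dist W F).
Proof. by move=> x Wx cx; exact: cauchy_converges. Qed.

End Metric.

Lemma cara_lower : lower_metric W (cara_metric W).
Proof.
move=> p v g Wp hg g1 gp; apply: ereal_sup_ubound; exists g.
  by split; [apply/holomorphic_onP|split].
by rewrite holat_d //; exact: hg.
Qed.

Lemma cara_ge0 p v : W p -> (0 <= cara_metric W p v)%E.
Proof.
move=> Wp; apply: le_trans (cara_lower (g := fun=> 0) v Wp _ _ _) => //.
- by rewrite lee_fin cabs_ge0.
- by move=> w _; exact: holat_cst.
- by move=> w _; rewrite /cnorm2 /= expr0n /= addr0.
Qed.

Lemma cara_upper : upper_metric W (cara_metric W).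
Proof.
move=> p Wp; have [r r0 sub] := ballW oW Wp.
exists (r / 2); first by lra.
have C0 : 0 <= 4 * (16 * 1 / (r / 2)) by rewrite !mulr_ge0 // invr_ge0; lra.
exists (4 * (16 * 1 / (r / 2))) => //; split=> [z hz|z v hz]; first by apply: sub; lra.
apply: ge_ereal_sup => _ [f [/holomorphic_onP hf [f1 fz]] <-].
have sub' w : `|w - z| < r / 2 -> W w.
  move=> hw; apply: sub; have -> : w - p = (w - z) + (z - p) by rewrite addrA subrK.
  by apply: le_lt_trans (ler_normD _ _) _; lra.
have r20 : 0 < r / 2 by lra.
have hb : holball f z (r / 2) by move=> w /sub'; exact: hf.
have hM w : `|w - z| < r / 2 -> cabs (f w) <= 1.
  move=> /sub' /f1; rewrite cnorm2_cabs => h; have := cabs_ge0 (f w); nra.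
have Wz : W z by apply: sub'; rewrite subrr normr0.
rewrite holat_d; last exact: hf.
by have [d1 d2] := cauchy_pd r20 hb hM; rewrite lee_fin; exact: clin_bound.
Qed.

Lemma complete_cara_positive : cara_positive W.
Proof.
move=> p Wp v v0; have [g [hg g1 gp dg]] := separating_competitor Wp v0.
by apply: lt_le_trans (cara_lower v Wp hg g1 gp); rewrite lte_fin.
Qed.

Lemma complete_cara_complete : cara_complete W.
Proof. exact: metric_complete cara_ge0 cara_lower cara_upper. Qed.

Section Bergman.
Variables (J : set nat) (phi : nat -> C2 -> Cx).
Hypothesis onb : ONB W J phi.

Lemma complete_kern_gt0 z : W z -> 0 < kern J phi z.
Proof. by move=> Wz; exact: (kern_gt0 oW onb Wz Af0 (f0_neq0 Wz)). Qed.

Lemma bergman_lower_metric : lower_metric W (fun z v => (bergman_length W J phi z v)%:E).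
Proof.
move=> p v g Wp hg g1 gp; rewrite lee_fin; apply: (bergman_lower oW onb complete_kern_gt0) => //.
by move=> w /g1/ltW.
Qed.

Lemma bergman_upper_metric : upper_metric W (fun z v => (bergman_length W J phi z v)%:E).
Proof.
move=> p Wp.
have [r r0 [C C0 [sub h]]] := bergman_upper oW onb complete_kern_gt0 Wp Af0 (f0_neq0 Wp).
by exists r => //; exists C => //; split => // z v hz; rewrite lee_fin; exact: h.
Qed.

End Bergman.

Lemma complete_bergman_positive : bergman_positive W.
Proof.
move=> J phi onb z Wz; have k0 := complete_kern_gt0 onb Wz.
split; first by rewrite (bergman_diagE oW onb Wz) lte_fin k0 ltry.
move=> v v0; have [g [hg g1 gp dg]] := separating_competitor Wz v0.
apply: lt_le_trans dg _; rewrite -lee_fin; exact: (bergman_lower_metric onb v Wz hg g1 gp).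
Qed.

Lemma complete_bergman_complete : bergman_complete W.
Proof.
move=> J phi onb; apply: metric_complete.
- by move=> p v _; rewrite lee_fin sqrtr_ge0.
- exact: bergman_lower_metric.
- exact: bergman_upper_metric.
Qed.

Lemma complete_domain : bergman_positive W /\ bergman_complete W /\ cara_positive W /\ cara_complete W.
Proof.
split; first exact: complete_bergman_positive.
split; first exact: complete_bergman_complete.
by split; [exact: complete_cara_positive|exact: complete_cara_complete].
Qed.

End Completeness.

(** * Powers, roots of trinomials and the principal square root *)

Section ComplexPowers.
Variable R : realType.
Local Notation Cx := (Cx R).
Local Notation C2 := (C2 R).
Implicit Types (a b c w : Cx) (n : nat).

Lemma cpowS a n : cpow a n.+1 = cmul a (cpow a n). Proof. by []. Qed.

Lemma cpowD a n k : cpow a (n + k) = cmul (cpow a n) (cpow a k).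
Proof. by elim: n => [|n IH]; rewrite ?cmul1c // addSn !cpowS IH cmulA. Qed.

Lemma cpowM a b n : cpow (cmul a b) n = cmul (cpow a n) (cpow b n).
Proof.
elim: n => [|n IH]; first by rewrite cmul1c.
by rewrite !cpowS IH -!cmulA; congr cmul; rewrite !cmulA (cmulC b).
Qed.

Lemma cpow_comp a n k : cpow (cpow a n) k = cpow a (n * k).
Proof. by elim: k => [|k IH]; rewrite ?muln0 // cpowS IH mulnS cpowD. Qed.

Lemma cabs_cpow a n : cabs (cpow a n) = cabs a ^+ n.
Proof. by elim: n => [|n IH]; rewrite ?cabs1 ?expr0 // cpowS cabsM IH exprS. Qed.

Lemma cpow_creal (r : R) n : cpow (creal r) n = creal (r ^+ n).
Proof.
elim: n => [|n IH]; first by rewrite expr0.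
by rewrite cpowS IH exprS; apply: cx_eq; rewrite !cxE /=; ring.
Qed.

Lemma cont_cpow (T : topologicalType) (f : T -> Cx) (x : T) n : {for x, continuous f} ->
  {for x, continuous (fun t => cpow (f t) n)}.
Proof. by move=> cf; elim: n => [|n IH]; [exact: cont_cst|exact: cont_cmul]. Qed.

Lemma holat_cpow (f : C2 -> Cx) p n : holat f p -> holat (fun z => cpow (f z) n) p.
Proof. by move=> hf; elim: n => [|n IH]; [exact: holat_cst|exact: holatM]. Qed.

Lemma cx_add0 (x : Cx) (r : R) : cmul (creal r) x = r *: x.
Proof. by apply: cx_eq; rewrite !cxE !cxZE /=; ring. Qed.

Local Notation CC := (complex.complex R).
(** Transport to the algebraically closed field [complex R], where polynomials split into linear
    factors. *)
Let ofC (x : CC) : Cx := (complex.Re x, complex.Im x).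
Let toC (a : Cx) : CC := complex.Complex a.1 a.2.

Let ofCM (x y : CC) : ofC (x * y) = cmul (ofC x) (ofC y).
Proof. by case: x y => [a b] [c d]. Qed.
Let ofCB (x y : CC) : ofC (x - y) = ofC x - ofC y.
Proof. by case: x y => [a b] [c d]. Qed.
Let ofCD (x y : CC) : ofC (x + y) = ofC x + ofC y.
Proof. by case: x y => [a b] [c d]. Qed.
Let ofCX (x : CC) n : ofC (x ^+ n) = cpow (ofC x) n.
Proof. by elim: n => [|n IH] //; rewrite exprS ofCM IH. Qed.

Definition rprod (rs : seq Cx) (Y : Cx) : Cx := foldr (fun r acc => cmul (Y - r) acc) (cone R) rs.

Lemma trinomial_roots (r : R) (c v : Cx) n : r != 0 -> (1 < n)%N -> exists rs : seq Cx, size rs = n /\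
  forall Y, r *: cpow Y n + cmul c Y - v = r *: rprod rs Y.
Proof.
move=> r0 n1; pose p : {poly CC} := (toC (creal r)) *: 'X^n + ((toC c) *: 'X - (toC v)%:P).
have rc0 : toC (creal r) != 0.
  by apply/eqP => /(congr1 (@complex.Re R)) /= h; rewrite h eqxx in r0.
have sq : (size (((toC c) *: 'X - (toC v)%:P)%R : {poly CC}) < n.+1)%N.
  rewrite ltnS; apply: leq_trans n1; apply: leq_trans (size_polyD _ _) _; rewrite size_polyN geq_max.
  by rewrite (leq_trans (size_scale_leq _ _)) ?size_polyX // (leq_trans (size_polyC_leq1 _)).
have sp : size p = n.+1 by rewrite size_polyDl size_scale // size_polyXn.
have lp : lead_coef p = toC (creal r).
  by rewrite lead_coefDl ?size_scale ?size_polyXn // lead_coefZ lead_coefXn mulr1.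
have [rs prs] := closed_field_poly_normal p.
exists (map ofC rs); split.
  move: sp; rewrite {1}prs size_scale ?lp // size_prod_XsubC => -[<-].
  by rewrite size_map.
move=> Y; have tof : ofC (toC Y) = Y by rewrite /ofC /toC -surjective_pairing.
have := congr1 (fun q : {poly CC} => ofC q.[toC Y]) prs; rewrite lp.
rewrite /p !hornerE /= !(ofCM, ofCD, ofCB) ofCX tof.
have -> : ofC (toC (creal r)) = creal r by [].
have -> : ofC (toC c) = c by rewrite /ofC /toC -surjective_pairing.
have -> : ofC (- toC v) = - v by [].
rewrite cx_add0 => ->; rewrite -cx_add0; congr cmul.
elim: rs {prs} => [|x rs IH]; first by rewrite big_nil hornerC.
by rewrite big_cons hornerM ofCM IH /= hornerXsubC ofCB tof.
Qed.

Lemma rprod_root rs y : y \in rs -> rprod rs y = 0.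
Proof.
elim: rs => [|x rs IH] //; rewrite inE /= => /orP[/eqP ->|/IH ->].
  by rewrite subrr cmul0c.
by rewrite cmulc0.
Qed.

Lemma rprod_near rs Y : rs <> [::] -> exists2 r, r \in rs & cabs (Y - r) ^+ size rs <= cabs (rprod rs Y).
Proof.
elim: rs => [|x rs IH] // _; case: (eqVneq rs [::]) => [->|/eqP /IH[r rin h]].
  by exists x; rewrite ?inE //= cmulc1 expr1.
have c0 := cabs_ge0 (Y - x); have d0 := cabs_ge0 (Y - r).
case: (leP (cabs (Y - x)) (cabs (Y - r))) => le.
  exists x; first by rewrite inE eqxx.
  rewrite /= cabsM exprS ler_wpM2l //; apply: le_trans h; exact: lerXn2r.
exists r; first by rewrite inE rin orbT.
by rewrite /= cabsM exprS; apply: ler_pM => //; [exact: exprn_ge0|exact: ltW].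
Qed.

(* A finite form of continuity of roots: some root of [r X^n + c X - v] is
   within [(|q(Y) - v| / r)^(1/n)] of [Y]. *)
Lemma trinomial_near (r : R) (c v : Cx) n : 0 < r -> (1 < n)%N -> exists rs : seq Cx,
  (forall y, y \in rs -> r *: cpow y n + cmul c y = v) /\
  forall Y, exists2 y, y \in rs & r * cabs (Y - y) ^+ n <= cabs (r *: cpow Y n + cmul c Y - v).
Proof.
move=> r0 n1; have [rs [sz h]] := trinomial_roots c v (lt0r_neq0 r0) n1.
exists rs; split=> [y yin|Y].
  by apply/eqP; rewrite -subr_eq0 h (rprod_root yin) scaler0.
have [|y yin hy] := @rprod_near rs Y; first by move=> e; rewrite -sz e in n1.
exists y => //; rewrite h -cx_add0 cabsM creal_abs gtr0_norm // ler_pM2l //.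
by rewrite -sz.
Qed.

(** The principal square root; [slit] is the plane cut along the nonpositive reals, because
    [|w| + Re w] vanishes exactly there. *)
Definition csqrt w : Cx := let u := Num.sqrt ((cabs w + w.1) / 2) in (u, w.2 / (2 * u)).
Definition slit w := 0 < cabs w + w.1.

Lemma csqrt_gt0 w : slit w -> 0 < (csqrt w).1.
Proof. by move=> sw; rewrite sqrtr_gt0 divr_gt0. Qed.

Lemma csqrt_sqr w : slit w -> cmul (csqrt w) (csqrt w) = w.
Proof.
move=> sw; have u0 := csqrt_gt0 sw; move: u0; rewrite /csqrt /=; set u := Num.sqrt _ => u0.
have u2 : u ^+ 2 = (cabs w + w.1) / 2 by rewrite sqr_sqrtr // divr_ge0 // ltW.
have c2 : cabs w ^+ 2 = w.1 ^+ 2 + w.2 ^+ 2 by rewrite -cnorm2_cabs.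
have un : u != 0 by rewrite gt_eqF.
apply: cx_eq; rewrite !cxE /=; last by field.
have -> : u * u - w.2 / (2 * u) * (w.2 / (2 * u)) = (4 * (u ^+ 2) ^+ 2 - w.2 ^+ 2) / (4 * u ^+ 2) by field.
have s0 : cabs w + w.1 != 0 by rewrite gt_eqF.
have -> : w.2 ^+ 2 = cabs w ^+ 2 - w.1 ^+ 2 by rewrite c2; ring.
by rewrite u2; field.
Qed.

Lemma csqrt_re_le w : slit w -> (csqrt w).1 ^+ 2 <= cabs w.
Proof.
move=> sw; have -> : cabs w = cabs (csqrt w) ^+ 2 by rewrite expr2 -cabsM csqrt_sqr.
by rewrite -cnorm2_cabs /cnorm2 lerDl sqr_ge0.
Qed.

Lemma cont_csqrt w : slit w -> {for w, continuous csqrt}.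
Proof.
move=> sw; have cid : {for w, continuous (fun x : Cx => x)} by exact: cvg_id.
have cu : {for w, continuous (fun x : Cx => Num.sqrt ((cabs x + x.1) / 2))}.
  apply: (@continuous_comp _ _ _ (fun x : Cx => (cabs x + x.1) / 2) (@Num.sqrt R)); last exact: sqrt_continuous.
  by apply: cvgMl; apply: cvgD; [exact: (cont_cabs cid)|exact: (cont_fst cid)].
apply: cont_pair => //; apply: cvgM; first exact: (cont_snd cid).
apply: cvgV; first by rewrite mulf_neq0 // gt_eqF // (csqrt_gt0 sw).
by apply: cvgMr.
Qed.

Lemma slit_near w : slit w -> \forall x \near w, slit x.
Proof.
move=> sw; have cid : {for w, continuous (fun x : Cx => x)} by exact: cvg_id.
have cu : {for w, continuous (fun x : Cx => cabs x + x.1)}.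
  by apply: cvgD; [exact: (cont_cabs cid)|exact: (cont_fst cid)].
have : nbhs (cabs w + w.1) [set x : R | 0 < x] by apply: open_nbhs_nbhs; split; [exact: open_gt|].
by move=> h; exact: (cu _ h).
Qed.

Lemma cder_csqrt w : slit w -> exists d, cder csqrt w d.
Proof.
move=> sw; exists (cinv (csqrt w + csqrt w)).
have s0 := csqrt_gt0 sw.
exists (fun x => cinv (csqrt x + csqrt w)); first split => //.
  apply: cont_cinv; first by apply/eqP => /(congr1 fst) /= h; rewrite /csqrt /= in s0 h; lra.
  by apply: cont_cadd; [exact: cont_csqrt|exact: cont_cst].
apply: filterS (slit_near sw) => x sx; have sx0 := csqrt_gt0 sx.
have n0 : csqrt x + csqrt w != 0.
  by apply/eqP => /(congr1 fst) /= h; rewrite /csqrt /= in s0 sx0 h; lra.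
have e : x - w = cmul (csqrt x + csqrt w) (csqrt x - csqrt w).
  rewrite -{1}(csqrt_sqr sx) -{1}(csqrt_sqr sw); move: (csqrt x) (csqrt w) => s t.
  by apply: cx_eq; rewrite !cxE; ring.
by rewrite e cmulA cmulVc // cmul1c addrC subrK.
Qed.

End ComplexPowers.

(** * Connectedness of the unit interval *)

Section PathConnected.
Variable R : realType.

(** The indicator of a locally constant predicate, extended by clamping to [[0, 1]], would be a
    continuous function with values 0 and 1 only, against the intermediate value theorem. *)
Lemma unit_interval_connected (P : R -> Prop) :
  (forall s, 0 <= s <= 1 -> exists2 d : R, 0 < d & forall s', 0 <= s' <= 1 -> `|s' - s| < d -> (P s <-> P s')) ->
  P 1 -> P 0.
Proof.
move=> loc p1; apply: contrapT => p0.
pose cl (s : R) := Num.max 0 (Num.min 1 s).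
have clI s : 0 <= cl s <= 1 by rewrite /cl le_max lexx /= ge_max ler01 ge_min lexx.
have clL s t : `|cl s - cl t| <= `|s - t|.
  rewrite /cl /Num.max /Num.min; case: (ltP 1 s) => ?; case: (ltP 1 t) => ?; rewrite ?ltr01 ?subrr ?normr0 //.
  - by case: (ltP 0 t) => ?; case: (ger0P (s - t)) => ?; rewrite ler_norml; lra.
  - by case: (ltP 0 s) => ?; case: (ger0P (s - t)) => ?; rewrite ler_norml; lra.
  by case: (ltP 0 t) => ?; case: (ltP 0 s) => ?; rewrite ler_norml; have := ler_norm (s - t); have := ler_norm (t - s); rewrite (distrC t); lra.
pose f (s : R) : R := if pselect (P (cl s)) then 1 else 0.
have cf (s : R) : {for s, continuous f}.
  have [d d0 h] := loc _ (clI s); apply: (cont_near_eq (f := fun=> f s)); last exact: cont_cst.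
  have nd : \forall t \near s, `|s - t| < d.
    by have /cvgrPdist_lt/(_ d d0) : (fun x : R => x) @ s --> s by exact: cvg_id.
  near=> t; have : P (cl s) <-> P (cl t).
    apply: h; first exact: clI.
    by apply: le_lt_trans (clL _ _) _; rewrite distrC; near: t.
  by rewrite /f; case: pselect => ?; case: pselect => ? [? ?] //; exfalso; auto.
have f0 : f 0 = 0 by rewrite /f; case: pselect => // h; case: p0; move: h; rewrite /cl min_r ?ler01 // maxxx.
have f1 : f 1 = 1 by rewrite /f; case: pselect => // h; case: h; rewrite /cl minxx max_r ?ler01.
have [||c _ fc] := @IVT R f 0 1 (1 / 2) ler01.
- by apply: continuous_subspaceT => x; exact: cf.
- by rewrite f0 f1 ge_min le_max; apply/andP; split; apply/orP; [left|right]; lra.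
by move: fc; rewrite /f; case: pselect => [x|x] /= ?; lra.
Unshelve. all: end_near. Qed.

End PathConnected.

(** * The holomorphic root of the trinomial in a sector *)

Section RootBranch.
Variable R : realType.
Local Notation Cx := (Cx R).
Local Notation C2 := (C2 R).

(** The sum of [Y^i Z^(n-i)], that is the difference quotient of the power [n + 1], also defined at
    [Y = Z]. *)
Fixpoint gsum (Y Z : Cx) n : Cx := if n is l.+1 then cmul Y (gsum Y Z l) + cpow Z n else cone R.

Lemma gsumP Y Z n : cmul (Y - Z) (gsum Y Z n) = cpow Y n.+1 - cpow Z n.+1.
Proof.
elim: n => [|n IH]; first by rewrite /= !cmulc1.
rewrite -[gsum Y Z n.+1]/(cmul Y (gsum Y Z n) + cpow Z n.+1) cmulDr cmulA (cmulC _ Y) -cmulA IH.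
rewrite (cpowS Y n.+1) (cpowS Z n.+1); move: (cpow Y n.+1) (cpow Z n.+1) => s t.
by apply: cx_eq; rewrite !cxE; ring.
Qed.

Lemma cont_gsum (T : topologicalType) (f : T -> Cx) (x : T) Z n : {for x, continuous f} ->
  {for x, continuous (fun t => gsum (f t) Z n)}.
Proof.
move=> cf; elim: n => [|n IH]; first exact: cont_cst.
by apply: cont_cadd; [exact: cont_cmul|exact: cont_cst].
Qed.

Variables (m : nat) (rho a b kap : R).
Implicit Types (T : R) (mu v Y Z : Cx).
(** With [kap = 1] for [m = 2] and [kap = 3] for [m = 3] the second condition is
    [|arg Y| < pi / (2 m)]; so this is the component of [Re Y^m > T^m] around the positive axis, and
    [csector] closes it up. *)
Definition sector T (Y : Cx) := [/\ 0 < Y.1, kap * Y.2 ^+ 2 < Y.1 ^+ 2 & T ^+ m < (cpow Y m).1].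
Definition csector T (Y : Cx) := [/\ 0 <= Y.1, kap * Y.2 ^+ 2 <= Y.1 ^+ 2 & T ^+ m <= (cpow Y m).1].
Definition mono (z : Cx) := cpow z (2 * m).
(** [T] stands for [|z1|^2] and [mu] for [z1^(2 m)], so that [|mu| = T^m] throughout; this is the
    part of the defining function that depends on [z1] alone. *)
Definition pmin T (mu : Cx) := T ^+ m.+1 + b * T * mu.1.
Definition qpol mu Y : Cx := rho *: cpow Y m.+1 + cmul (a *: mu) Y.

(** Roots cannot leave the sector through the straight edges by [bd_edge], nor through the curve
    [Re Y^m = T^m] by [bd_boundary]; this gives existence. [bd_arho] and [bd_spread] give the
    difference quotient of [qpol] a positive real part; this gives uniqueness. *)
Record branch_data : Prop := BranchData {
  bd_m : (1 < m)%N;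
  bd_rho : 0 < rho;
  bd_a : 0 < a;
  bd_kap : 1 <= kap;
  bd_arho : a <= m.+1%:R * rho;
  bd_edge : forall Y, 0 < Y.1 -> kap * Y.2 ^+ 2 = Y.1 ^+ 2 -> (cpow Y m).1 <= 0;
  bd_boundary : forall T Y, 0 <= T -> 0 < Y.1 -> kap * Y.2 ^+ 2 <= Y.1 ^+ 2 -> (cpow Y m).1 = T ^+ m ->
    rho * (cpow Y m.+1).1 + T ^+ m * cabs (a *: Y - creal (b * T)) < T ^+ m.+1;
  bd_spread : forall T Y Z, 0 <= T -> sector T Y -> sector T Z -> m.+1%:R * T ^+ m < (gsum Y Z m).1
}.

Hypothesis BD : branch_data.
Let m1 := bd_m BD.
Let rho0 := bd_rho BD.
Let a0 := bd_a BD.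
Let kap1 := bd_kap BD.
Let arho := bd_arho BD.
Let edge := bd_edge BD.
Let boundary := bd_boundary BD.
Let spread := bd_spread BD.

Lemma cabs_mono z : cabs (mono z) = cnorm2 z ^+ m.
Proof. by rewrite cabs_cpow exprM -cnorm2_cabs. Qed.

Lemma qpol_diff mu Y Z : qpol mu Y - qpol mu Z = cmul (Y - Z) (rho *: gsum Y Z m + a *: mu).
Proof.
rewrite cmulDr -cx_add0 cmulA (cmulC _ (creal rho)) -cmulA gsumP cx_add0 /qpol.
move: (cpow Y m.+1) (cpow Z m.+1) => s t.
by apply: cx_eq; rewrite !(cxE, cxZE); ring.
Qed.

Lemma sector_open T Y : sector T Y -> exists2 d : R, 0 < d &
  forall T' Y', `|T' - T| < d -> `|Y' - Y| < d -> sector T' Y'.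
Proof.
move=> [x0 xy tm].
have cY : {for (T, Y), continuous (fun w : R * Cx => w.2)} by apply: cont_snd; exact: cvg_id.
have cT : {for (T, Y), continuous (fun w : R * Cx => w.1)} by apply: cont_fst; exact: cvg_id.
have pos (h : R * Cx -> R) : {for (T, Y), continuous h} -> 0 < h (T, Y) -> \forall w \near (T, Y), 0 < h w.
  by move=> ch h0; apply: (ch [set x | 0 < x]); apply: open_nbhs_nbhs; split; [exact: open_gt|].
have n1 := pos (fun w => w.2.1) (cont_fst cY) x0.
have n2 : \forall w \near (T, Y), 0 < w.2.1 ^+ 2 - kap * w.2.2 ^+ 2.
  apply: pos; last by rewrite subr_gt0.
  apply: cvgB; first by apply: cvgM; exact: (cont_fst cY).
  by apply: cvgMr; apply: cvgM; exact: (cont_snd cY).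
have n3 : \forall w \near (T, Y), 0 < (cpow w.2 m).1 - w.1 ^+ m.
  apply: pos; last by rewrite subr_gt0.
  have cm := cont_cpow (n := m) cY; apply: cvgB; first exact: (cont_fst cm).
  by apply: (@continuous_comp _ _ _ fst (fun x : R => x ^+ m)); [exact: cT|exact: exprn_continuous].
have : \forall w \near (T, Y), sector w.1 w.2.
  by near=> w; split; [near: w|rewrite -subr_gt0; near: w|rewrite -subr_gt0; near: w].
move=> /near_normP[d d0 h]; exists d => // T' Y' hT hY; apply: (h (T', Y')).
by rewrite /= prod_normE /= gt_max hT hY.
Unshelve. all: end_near. Qed.

Lemma csector_closed T Y : ~ csector T Y -> exists2 d : R, 0 < d & forall Y', `|Y' - Y| < d -> ~ csector T Y'.
Proof.
move=> nc.
have cY : {for Y, continuous (fun w : Cx => w)} by exact: cvg_id.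
have pos (h : Cx -> R) : {for Y, continuous h} -> (forall w, h w < 0 -> ~ csector T w) -> h Y < 0 ->
   exists2 d : R, 0 < d & forall Y', `|Y' - Y| < d -> ~ csector T Y'.
  move=> ch hw h0.
  have : \forall w \near Y, h w < 0.
    by apply: (ch [set x | x < 0]); apply: open_nbhs_nbhs; split; [exact: open_lt|].
  by move=> /near_normP[d d0 hd]; exists d => // Y' hY; apply: hw; exact: hd.
case: (ltP Y.1 0) => h1.
  by apply: (pos (fun w => w.1) (cont_fst cY) _ h1) => w w0 [w1 _ _]; rewrite ltNge w1 in w0.
case: (ltP (Y.1 ^+ 2 - kap * Y.2 ^+ 2) 0) => h2.
  apply: (pos (fun w => w.1 ^+ 2 - kap * w.2 ^+ 2) _ _ h2); last by move=> w w0 [_ w1 _]; rewrite subr_lt0 ltNge w1 in w0.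
  apply: cvgB; first by apply: cvgM; exact: (cont_fst cY).
  by apply: cvgMr; apply: cvgM; exact: (cont_snd cY).
case: (ltP ((cpow Y m).1 - T ^+ m) 0) => h3.
  apply: (pos (fun w => (cpow w m).1 - T ^+ m) _ _ h3); last by move=> w w0 [_ _ w1]; rewrite subr_lt0 ltNge w1 in w0.
  by have cm := cont_cpow (n := m) cY; apply: cvgB; [exact: (cont_fst cm)|exact: cvg_cst].
by case: nc; split; [|rewrite -subr_ge0|rewrite -subr_ge0].
Qed.

(** [bd_boundary] involves [mu] only through [|mu| = T^m]: its argument is estimated away, so a
    single real inequality covers all directions of [z1]. *)
Lemma boundary_re T mu Y : 0 <= T -> cabs mu = T ^+ m -> 0 < Y.1 -> kap * Y.2 ^+ 2 <= Y.1 ^+ 2 ->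
  (cpow Y m).1 = T ^+ m -> (qpol mu Y).1 < pmin T mu.
Proof.
move=> T0 hmu x1 xy e; have := boundary T0 x1 xy e; rewrite /pmin /qpol.
rewrite (_ : (rho *: cpow Y m.+1 + cmul (a *: mu) Y).1 = rho * (cpow Y m.+1).1 + (cmul (a *: mu) Y).1) //.
have := cabs_ge_re (cmul mu (a *: Y - creal (b * T))); rewrite cabsM hmu ler_norml => /andP[_].
have -> : (cmul mu (a *: Y - creal (b * T))).1 = (cmul (a *: mu) Y).1 - b * T * mu.1.
  by rewrite !(cxE, cxZE) /=; ring.
by move=> *; lra.
Qed.

(** The apex [Y = 0] can lie in [csector] only for [T = 0], where the last hypothesis excludes it.
    On an edge [bd_edge] forces [Re Y^m = T^m] as well, and on that curve [boundary_re] contradicts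
    the bound on the real part. *)
Lemma csector_sector T mu Y : 0 <= T -> cabs mu = T ^+ m -> csector T Y -> pmin T mu <= (qpol mu Y).1 ->
  (T = 0 -> qpol mu Y != 0) -> sector T Y.
Proof.
move=> T0 hmu [x0 xy tm] hq hn.
have [y0|y0] := eqVneq Y 0.
  have q0 : qpol mu Y = 0 by rewrite y0 /qpol cpowS cmul0c cmulc0 scaler0 addr0.
  have tm0 : T ^+ m = 0.
    apply/eqP; rewrite eq_le exprn_ge0 // andbT; apply: le_trans tm _.
    by rewrite y0 -[m]prednK ?(ltnW m1) // cpowS cmul0c.
  have T0' : T = 0 by move/eqP: tm0; rewrite expf_eq0 => /andP[_ /eqP].
  by have := hn T0'; rewrite q0 eqxx.
have x1 : 0 < Y.1.
  rewrite lt_neqAle x0 andbT; apply: contra y0 => /eqP e0; rewrite -e0 in xy.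
  apply/eqP; apply: cx_eq; rewrite -?e0 //=; apply/eqP; rewrite -sqrf_eq0 eq_le sqr_ge0 andbT.
  by have := sqr_ge0 Y.2; have := kap1; rewrite expr0n /= in xy; nra.
have bd : (cpow Y m).1 = T ^+ m -> sector T Y.
  by move=> e; have := boundary_re T0 hmu x1 xy e; rewrite ltNge hq.
move: xy tm; rewrite le_eqVlt => /orP[/eqP xy|xy]; rewrite le_eqVlt => /orP[/eqP tm|tm]; try exact: bd.
  apply: bd; apply/eqP; rewrite eq_le (ltW tm) andbT; apply: le_trans (edge x1 xy) _; exact: exprn_ge0.
by split.
Qed.

Lemma qpol_near mu v : exists rs : seq Cx, (forall y, y \in rs -> qpol mu y = v) /\
  forall Y, exists2 y, y \in rs & rho * cabs (Y - y) ^+ m.+1 <= cabs (qpol mu Y - v).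
Proof. by apply: trinomial_near => //; rewrite ltnS ltnW. Qed.

Lemma near_root_lt (c d e : R) : 0 <= c -> 0 < d -> rho * c ^+ m.+1 <= e -> e < rho * d ^+ m.+1 -> c < d.
Proof.
move=> c0 d0 h1 h2; rewrite ltNge; apply/negP => dc.
have : d ^+ m.+1 <= c ^+ m.+1 by apply: lerXn2r => //; rewrite nnegrE // ltW.
by rewrite -(ler_pM2l rho0) => ?; lra.
Qed.

Lemma solvable_open T mu Y : sector T Y -> exists2 d : R, 0 < d & forall v', cabs (v' - qpol mu Y) < d ->
  exists Y', sector T Y' /\ qpol mu Y' = v'.
Proof.
move=> /sector_open[d d0 h]; exists (rho * d ^+ m.+1); first by rewrite mulr_gt0 // exprn_gt0.
move=> v' hv; have [rs [hrs /(_ Y)[y yin hy]]] := qpol_near mu v'.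
exists y; split; last exact: hrs.
apply: h; first by rewrite subrr normr0.
apply: le_lt_trans (cabs_ge_norm _) _; rewrite cabs_distC.
by apply: near_root_lt hy _ => //; [exact: cabs_ge0|rewrite cabs_distC].
Qed.

(** None of the finitely many roots for [v] lies in the closed sector, so some neighbourhood of them
    misses it, and by [qpol_near] all roots for a nearby [v'] fall into that neighbourhood. *)
Lemma solvable_closed T mu v : 0 <= T -> cabs mu = T ^+ m -> pmin T mu <= v.1 -> (T = 0 -> v != 0) ->
  ~ (exists Y, sector T Y /\ qpol mu Y = v) -> exists2 d : R, 0 < d & forall v', cabs (v' - v) < d ->
  ~ exists Y', sector T Y' /\ qpol mu Y' = v'.
Proof.
move=> T0 hmu hv hn no; have [rs [hrs near]] := qpol_near mu v.
have nc y : y \in rs -> ~ csector T y.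
  move=> /hrs e cs; apply: no; exists y; split => //.
  by apply: (csector_sector T0 hmu cs); rewrite e.
have [d d0 hd] : exists2 d : R, 0 < d & forall y, y \in rs -> forall Y', `|Y' - y| < d -> ~ csector T Y'.
  move: nc; elim: rs {hrs near} => [|x rs IH] nc; first by exists 1.
  have [|d d0 hd] := IH; first by move=> y yin; apply: nc; rewrite inE yin orbT.
  have [|e e0 he] := csector_closed (nc x _); first by rewrite inE eqxx.
  exists (Num.min d e); first by rewrite lt_min d0.
  move=> y; rewrite inE => /orP[/eqP ->|yin] Y'; rewrite lt_min => /andP[h1 h2]; first exact: he.
  exact: hd h1.
exists (rho * d ^+ m.+1); first by rewrite mulr_gt0 // exprn_gt0.
move=> v' hv' [Y' [[x0 xy tm] e]]; have [y yin hy] := near Y'; rewrite e in hy.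
apply: (hd y yin Y') => //; last by split; exact: ltW.
apply: le_lt_trans (cabs_ge_norm _) _.
by apply: near_root_lt hy hv' => //; exact: cabs_ge0.
Qed.

(** The continuity method along the segment from [v] to the value [w] taken at a large real [x]:
    solvability is open and closed on the segment, whose real parts stay at least [pmin T mu], and
    it holds at [w]. *)
Lemma branch_exists T mu v : 0 <= T -> cabs mu = T ^+ m -> pmin T mu <= v.1 -> (T = 0 -> v != 0) ->
  exists Y, sector T Y /\ qpol mu Y = v.
Proof.
move=> T0 hmu hv hn.
have tm0 : 0 <= T ^+ m by exact: exprn_ge0.
(* Large enough for [x > T] and [x >= 1], and for [rho x] to absorb [a T^m] and [|pmin T mu|]. *)
pose x := 1 + T + (a * T ^+ m + `|pmin T mu|) / rho.
have rx : rho * x = rho + rho * T + (a * T ^+ m + `|pmin T mu|) by rewrite /x; field; rewrite gt_eqF.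
have px := ler_norm (pmin T mu).
have x1 : 1 <= x by rewrite /x -addrA lerDl addr_ge0 // divr_ge0 ?addr_ge0 ?mulr_ge0 // ltW.
have xT : T < x.
  have : 0 <= (a * T ^+ m + `|pmin T mu|) / rho by rewrite divr_ge0 ?addr_ge0 ?mulr_ge0 // ltW.
  by rewrite /x; lra.
have x0 : 0 <= x by lra.
have xm : x <= x ^+ m by rewrite -{1}[x]expr1; apply: ler_weXn2l => //; exact: ltnW.
pose w := qpol mu (creal x).
have w1 : `|pmin T mu| + rho <= w.1.
  rewrite /w /qpol cpow_creal !(cxE, cxZE) /= exprS.
  have := cabs_ge_re mu; rewrite hmu ler_norml => /andP[hmu1 _].
  have : rho * x <= rho * x ^+ m by rewrite ler_pM2l.
  rewrite rx => h.
  have h3 : a * - T ^+ m <= a * mu.1 by rewrite ler_pM2l.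
  have h2 : `|pmin T mu| + rho <= a * mu.1 + rho * x ^+ m by have := mulr_ge0 (ltW rho0) T0; lra.
  have h4 : 0 <= a * mu.1 + rho * x ^+ m by have := normr_ge0 (pmin T mu); have := rho0; lra.
  by have := ler_peMl h4 x1; lra.
have secx : sector T (creal x).
  split=> /=; [lra|by rewrite expr0n /= mulr0 exprn_gt0 //; lra|].
  by rewrite cpow_creal /= ltr_pXn2r ?nnegrE //; exact: ltnW.
pose vs (s : R) := v + s *: (w - v).
have vsB s s' : cabs (vs s' - vs s) = `|s' - s| * cabs (w - v).
  rewrite -creal_abs -cabsM; congr cabs; rewrite cx_add0 /vs.
  by move: (w - v) => u; apply: cx_eq; rewrite !(cxE, cxZE); ring.
have vs1 (s : R) : 0 <= s <= 1 -> pmin T mu <= (vs s).1.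
    have w2 : pmin T mu <= w.1 by have := rho0; lra.
  move=> /andP[s0 s1]; rewrite (_ : (vs s).1 = v.1 + s * (w.1 - v.1)) //; move: (pmin T mu) w.1 v.1 hv w2 => P w' v' h1 h2.
  have s2 : 0 <= 1 - s by lra.
  have := mulr_ge0 s2 (_ : 0 <= v' - P); have := mulr_ge0 s0 (_ : 0 <= w' - P); rewrite !subr_ge0.
  by move=> /(_ h2) ? /(_ h1) ?; lra.
(* For [T = 0] the segment must avoid 0, the value at the apex: real parts are nonnegative at [v]
   and positive at [w], and [v] itself is not zero. *)
have vs0 (s : R) : 0 <= s <= 1 -> T = 0 -> vs s != 0.
  move=> /andP[s0 s1] Tz; have v0 := hn Tz.
  have pz : pmin T mu = 0 by rewrite /pmin Tz expr0n /= mulr0 mul0r addr0.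
  apply/eqP => e; have e1 : v.1 + s * (w.1 - v.1) = 0 := congr1 fst e.
  rewrite pz in hv w1; rewrite normr0 add0r in w1.
  have k1 : 0 <= (1 - s) * v.1 by rewrite mulr_ge0 // subr_ge0.
  have k2 : 0 <= s * (w.1 - rho) by rewrite mulr_ge0 // subr_ge0.
  have : s * rho <= 0 by lra.
  rewrite pmulr_lle0 // => s2; have sz : s = 0 by apply/eqP; rewrite eq_le s2.
  by move: v0; rewrite -e sz /vs scale0r addr0 eqxx.
have vs_0 : vs 0 = v by rewrite /vs scale0r addr0.
have vs_1 : vs 1 = w by rewrite /vs scale1r addrC subrK.
rewrite -vs_0; apply: (unit_interval_connected (P := fun s => exists Y, sector T Y /\ qpol mu Y = vs s)); last first.
  by exists (creal x); rewrite vs_1.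
move=> s sI; have c0 : 0 < cabs (w - v) + 1 by have := cabs_ge0 (w - v); lra.
have step (d s' : R) : 0 < d -> `|s' - s| < d / (cabs (w - v) + 1) -> cabs (vs s' - vs s) < d.
  move=> d0; rewrite ltr_pdivlMr // vsB; have := normr_ge0 (s' - s); lra.
have [[Y [sY qY]]|no] := pselect (exists Y, sector T Y /\ qpol mu Y = vs s).
  have [d d0 hd] := solvable_open mu sY; exists (d / (cabs (w - v) + 1)); first exact: divr_gt0.
  move=> s' sI' hs; split=> [_|_]; last by exists Y.
  by apply: hd; rewrite qY; exact: step.
have [d d0 hd] := solvable_closed T0 hmu (vs1 _ sI) (vs0 _ sI) no.
exists (d / (cabs (w - v) + 1)); first exact: divr_gt0.
by move=> s' sI' hs; split=> // h; exfalso; apply: (hd (vs s')) => //; exact: step.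
Qed.

Lemma sector_deriv T mu Y Z : 0 <= T -> cabs mu = T ^+ m -> sector T Y -> sector T Z ->
  0 < (rho *: gsum Y Z m + a *: mu).1.
Proof.
move=> T0 hmu sY sZ; have h := spread T0 sY sZ; rewrite !(cxE, cxZE).
have := cabs_ge_re mu; rewrite hmu ler_norml => /andP[h1 _].
have tm0 : 0 <= T ^+ m by exact: exprn_ge0.
have : rho * (m.+1%:R * T ^+ m) < rho * (gsum Y Z m).1 by rewrite ltr_pM2l.
have : a * T ^+ m <= m.+1%:R * rho * T ^+ m by rewrite ler_wpM2r.
have : a * - T ^+ m <= a * mu.1 by rewrite ler_pM2l.
by lra.
Qed.

Lemma re_neq0 (w : Cx) : 0 < w.1 -> w != 0.
Proof. by move=> h; apply/eqP => e; rewrite e ltxx in h. Qed.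

Lemma branch_unique T mu Y Z : 0 <= T -> cabs mu = T ^+ m -> sector T Y -> sector T Z ->
  qpol mu Y = qpol mu Z -> Y = Z.
Proof.
move=> T0 hmu sY sZ e; have := qpol_diff mu Y Z; rewrite e subrr => /esym/eqP.
rewrite cmul_eq0 (negPf (re_neq0 (sector_deriv T0 hmu sY sZ))) orbF subr_eq0 => /eqP; exact.
Qed.

Definition branch z v : Cx := xget 0 [set Y | sector (cnorm2 z) Y /\ qpol (mono z) Y = v].

Lemma branchE z v Y : sector (cnorm2 z) Y -> qpol (mono z) Y = v -> branch z v = Y.
Proof.
move=> sY e; have : [set Y | sector (cnorm2 z) Y /\ qpol (mono z) Y = v] (branch z v).
  by apply: xgetPex; exists Y.
move=> /= [s2 e2]; apply: (branch_unique (cnorm2_ge0 z) (cabs_mono z) s2 sY).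
by rewrite e e2.
Qed.

(** Equality is allowed in the first clause because [peak_tangent] evaluates the branch at a
    boundary point; the second clause removes the branch point. *)
Definition bdom z v := pmin (cnorm2 z) (mono z) <= v.1 /\ (z = 0 -> v != 0).

Lemma branchP z v : bdom z v -> sector (cnorm2 z) (branch z v) /\ qpol (mono z) (branch z v) = v.
Proof.
move=> [hv hn]; have [|Y [sY e]] := branch_exists (cnorm2_ge0 z) (cabs_mono z) hv.
  by move=> /eqP; rewrite cnorm2_eq0 => /eqP.
by rewrite (branchE sY e).
Qed.

Lemma branch_gt0 z v : bdom z v -> 0 < (branch z v).1.
Proof. by move=> /branchP[[]]. Qed.

Lemma branch_near (X : topologicalType) (z v : X -> Cx) p : {for p, continuous z} -> {for p, continuous v} ->
  bdom (z p) (v p) -> forall e : R, 0 < e -> \forall x \near p,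
  [/\ sector (cnorm2 (z x)) (branch (z x) (v x)), qpol (mono (z x)) (branch (z x) (v x)) = v x &
      `|branch (z x) (v x) - branch (z p) (v p)| < e].
Proof.
move=> cz cv dom e e0; have [sY qY] := branchP dom; set Y := branch (z p) (v p) in sY qY *.
have [d d0 hd] := sector_open sY; pose d' := Num.min d e.
have d'0 : 0 < d' by rewrite lt_min d0.
have cmono : {for p, continuous (fun x => mono (z x))} by exact: cont_cpow.
have cq : {for p, continuous (fun x => qpol (mono (z x)) Y - v x)}.
  apply: cont_cadd; last exact: cont_copp.
  apply: cont_cadd; first exact: cont_cst.
  apply: cont_cmul; last exact: cont_cst.
  rewrite (_ : (fun x => a *: mono (z x)) = (fun x => cmul (creal a) (mono (z x)))); last by apply/funext => x; rewrite cx_add0.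
  by apply: cont_cmul => //; exact: cont_cst.
have n1 : \forall x \near p, cabs (qpol (mono (z x)) Y - v x) < rho * d' ^+ m.+1.
  have cc := cont_cabs cq; apply: (cc [set y | y < rho * d' ^+ m.+1]); apply: open_nbhs_nbhs; split; first exact: open_lt.
  by rewrite /= qY subrr cabs0 mulr_gt0 // exprn_gt0.
have n2 : \forall x \near p, `|cnorm2 (z x) - cnorm2 (z p)| < d.
  have cn := cont_cnorm2 cz.
  by have /cvgrPdist_lt/(_ _ d0) := cn; apply: filterS => x; rewrite distrC.
near=> x.
have [rs [hrs /(_ Y)[y yin hy]]] := qpol_near (mono (z x)) (v x).
have hy' : `|y - Y| < d'.
  apply: le_lt_trans (cabs_ge_norm _) _; rewrite cabs_distC.
  by apply: near_root_lt hy _ => //; [exact: cabs_ge0|near: x].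
have sy : sector (cnorm2 (z x)) y.
  by apply: hd; [near: x|move: hy'; rewrite lt_min => /andP[]].
rewrite (branchE sy (hrs _ yin)); split=> //; first exact: hrs.
by move: hy'; rewrite lt_min => /andP[].
Unshelve. all: end_near. Qed.

Lemma cont_branch (X : topologicalType) (z v : X -> Cx) p : {for p, continuous z} -> {for p, continuous v} ->
  bdom (z p) (v p) -> {for p, continuous (fun x => branch (z x) (v x))}.
Proof.
move=> cz cv dom; apply/cvgrPdist_lt => e e0.
by apply: filterS (branch_near cz cv dom e0) => x [_ _]; rewrite distrC.
Qed.

Lemma holat_div_near (f N D : C2 -> Cx) p : holat N p -> {for p, continuous D} -> D p != 0 ->
  (\forall z \near p, cmul (f z - f p) (D z) = N z - N p) -> holat f p.
Proof.
move=> [d1 [d2 [g1 [g2 [c1 c2 e1 e2 h]]]]] cD D0 hf.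
exists (cmul d1 (cinv (D p))), (cmul d2 (cinv (D p))).
exists (fun z => cmul (g1 z) (cinv (D z))), (fun z => cmul (g2 z) (cinv (D z))).
have ci := cont_cinv D0 cD.
split; [exact: cont_cmul|exact: cont_cmul|by rewrite e1|by rewrite e2|].
near=> z; have Dz : D z != 0 by near: z; exact: (cont_neq0_near D0 cD).
have hz : cmul (f z - f p) (D z) = N z - N p by near: z.
have nz : N z = N p + (cmul (g1 z) (z.1 - p.1) + cmul (g2 z) (z.2 - p.2)) by near: z.
have : f z - f p = cmul (N z - N p) (cinv (D z)) by rewrite -hz cmulK.
move=> /(canRL (subrK _)) ->; rewrite nz.
move: (N p) (g1 z) (g2 z) (cinv (D z)) (z.1 - p.1) (z.2 - p.2) (f p) => n s t u x y w.
by apply: cx_eq; rewrite !cxE; ring.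
Unshelve. all: end_near. Qed.

(** In place of an implicit function theorem, [qpol_diff] gives the increment of the branch as an
    exact quotient, with a denominator that is continuous and has positive real part at [p]. *)
Lemma holat_branch (v : C2 -> Cx) p : holat v p -> bdom p.1 (v p) -> holat (fun z => branch z.1 (v z)) p.
Proof.
move=> hv dom; have [sY qY] := branchP dom; set Y := branch p.1 (v p) in sY qY *.
have cv := holat_cont hv; have c1 := holat_cont (holat_fst p).
have cb : {for p, continuous (fun z : C2 => branch z.1 (v z))} by exact: (cont_branch c1 cv dom).
have ha (g : C2 -> Cx) : (fun z => a *: g z) = (fun z => cmul (creal a) (g z)).
  by apply/funext => x; rewrite cx_add0.
have hmono : holat (fun z : C2 => mono z.1) p by apply: holat_cpow; exact: holat_fst.
apply: (@holat_div_near _ (fun z => v z - cmul (a *: mono z.1) Y)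
   (fun z => rho *: gsum (branch z.1 (v z)) Y m + a *: mono z.1)).
- apply: holatB => //; apply: holatM; last exact: holat_cst.
  by rewrite (ha (fun z => mono z.1)); exact: holatZ.
- apply: cont_cadd.
    rewrite (_ : (fun x => _) = (fun x : C2 => cmul (creal rho) (gsum (branch x.1 (v x)) Y m))); last by apply/funext => x; rewrite cx_add0.
    by apply: cont_cmul; [exact: cont_cst|exact: cont_gsum].
  by rewrite (ha (fun z => mono z.1)); apply: cont_cmul; [exact: cont_cst|exact: holat_cont].
- by apply: re_neq0; exact: (sector_deriv (cnorm2_ge0 _) (cabs_mono _) sY sY).
apply: filterS (branch_near c1 cv dom ltr01) => z [sz qz _].
rewrite -/Y -qpol_diff; move: qz; set B := branch _ (v z) => <-; rewrite -qY /qpol.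
move: (cpow Y m.+1) (cpow B m.+1) (mono p.1) (mono z.1) => *; apply: cx_eq; rewrite !(cxE, cxZE); ring.
Qed.

(** For growth estimates: [z1] is bounded by the root because [T = |z1|^2], and the opening of the
    sector makes [Re Y] comparable to [|Y|]. *)
Lemma sector_cabs T Y : 0 <= T -> sector T Y -> T < cabs Y /\ cabs Y <= 2 * Y.1.
Proof.
move=> T0 [x0 xy tm]; split.
  rewrite ltNge; apply/negP => le; have := le_trans (ler_norm _) (cabs_ge_re (cpow Y m)).
  by rewrite cabs_cpow => h; have := lerXn2r m (cabs_ge0 Y) T0 le; lra.
apply: le_trans (cabs_le_sum _) _; rewrite (gtr0_norm x0).
have : `|Y.2| <= Y.1; last by lra.
rewrite -(ger0_norm (ltW x0)) -ler_sqr ?nnegrE // !real_normK ?num_real //.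
have k1 : 0 <= kap - 1 by have := kap1; lra.
by have := mulr_ge0 k1 (sqr_ge0 Y.2); lra.
Qed.

Lemma qpol_upper T mu Y : 0 <= T -> cabs mu = T ^+ m -> sector T Y ->
  cabs (qpol mu Y) <= (rho + a) * cabs Y ^+ m.+1.
Proof.
move=> T0 hmu sY; have [ty _] := sector_cabs T0 sY; apply: le_trans (cabsD _ _) _.
rewrite -!cx_add0 !cabsM !creal_abs hmu !gtr0_norm // cabs_cpow mulrDl.
rewrite [cabs Y * _]mulrC -exprSr lerD2l -mulrA ler_pM2l // exprSr.
by rewrite ler_wpM2r ?cabs_ge0 // lerXn2r // ?nnegrE ?cabs_ge0 // ltW.
Qed.

Lemma qpol_lower T mu Y : 0 <= T -> cabs mu = T ^+ m ->
  rho * cabs Y ^+ m.+1 <= cabs (qpol mu Y) + a * T ^+ m * cabs Y.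
Proof.
move=> T0 hmu; have := cabs_sub (rho *: cpow Y m.+1) (- cmul (a *: mu) Y).
have -> : cabs (- cmul (a *: mu) Y) = a * T ^+ m * cabs Y by rewrite cabsN -cx_add0 !cabsM creal_abs hmu gtr0_norm.
have -> : cabs (rho *: cpow Y m.+1) = rho * cabs Y ^+ m.+1 by rewrite -cx_add0 cabsM creal_abs gtr0_norm // cabs_cpow.
by rewrite opprK lerBlDr.
Qed.

Lemma branch_upper z v : bdom z v -> cabs (branch z v) <= 1 + (cabs v + a * cnorm2 z ^+ m) / rho.
Proof.
move=> /branchP[sY qY]; have := qpol_lower (branch z v) (cnorm2_ge0 z) (cabs_mono z); rewrite qY.
set y := cabs _; set t := cnorm2 z ^+ m => h.
have t0 : 0 <= t by rewrite exprn_ge0 // cnorm2_ge0.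
have v0 := cabs_ge0 v.
have q0 : 0 <= (cabs v + a * t) / rho by apply: divr_ge0; [apply: addr_ge0 => //; apply: mulr_ge0 => //|]; exact: ltW.
case: (lerP y 1) => y1; first by lra.
have ym : y <= y ^+ m by rewrite -{1}[y]expr1; apply: ler_weXn2l; [exact: ltW|exact: ltnW].
apply: le_trans (_ : y <= (cabs v + a * t) / rho) _; last by lra.
rewrite ler_pdivlMr // mulrC.
have : rho * y ^+ m <= cabs v + a * t; last first.
  by have : rho * y <= rho * y ^+ m; [rewrite ler_pM2l|lra].
rewrite exprS in h.
have : 0 < y by lra.
by move=> yp; rewrite -(ler_pM2l yp); nra.
Qed.

Lemma branch_small z v (e : R) : bdom z v -> 0 < e -> cabs v <= rho * e ^+ m.+1 / 4 ->
  a * cnorm2 z ^+ m <= rho * e ^+ m / 4 -> cabs (branch z v) <= e.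
Proof.
move=> /branchP[sY qY] e0 h1 h2; have := qpol_lower (branch z v) (cnorm2_ge0 z) (cabs_mono z); rewrite qY.
set y := cabs _ => h; rewrite leNgt; apply/negP => ey.
have ym : e ^+ m <= y ^+ m by apply: lerXn2r; rewrite ?nnegrE ?ltW // (lt_trans e0).
have em : 0 < e ^+ m by exact: exprn_gt0.
rewrite !exprS in h h1.
have y0 : 0 < y by lra.
have k1 : a * cnorm2 z ^+ m * y <= rho * e ^+ m / 4 * y by rewrite ler_pM2r.
have k2 : rho * (e * e ^+ m) / 4 <= rho * e ^+ m / 4 * y by have := mulr_gt0 rho0 em; nra.
have k3 : rho * e ^+ m * y <= rho * (y * y ^+ m) by rewrite [y * _]mulrC mulrA ler_pM2r // ler_pM2l.
by have := mulr_gt0 (mulr_gt0 rho0 em) y0; lra.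
Qed.

End RootBranch.

(** * Homogeneity of the trinomial and convexity along rays *)

Section Scaling.
Variable R : realType.
Local Notation Cx := (Cx R).
Variables (m : nat) (rho a b kap : R).
Implicit Types (l T : R) (mu Y e : Cx).

Lemma cpowZ l Y n : cpow (l *: Y) n = l ^+ n *: cpow Y n.
Proof. by rewrite -cx_add0 cpowM cpow_creal cx_add0. Qed.

Lemma qpolZ l mu Y : qpol m rho a (l ^+ m *: mu) (l *: Y) = l ^+ m.+1 *: qpol m rho a mu Y.
Proof.
rewrite /qpol cpowZ exprS; move: (l ^+ m) (cpow Y m.+1) => t w.
by apply: cx_eq; rewrite !(cxE, cxZE); ring.
Qed.

Lemma pminZ l T mu : pmin m b (l * T) (l ^+ m *: mu) = l ^+ m.+1 * pmin m b T mu.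
Proof. by rewrite /pmin cxZE exprMn exprS; ring. Qed.

Lemma sectorZ l T Y : 0 < l -> sector m kap (l * T) (l *: Y) -> sector m kap T Y.
Proof.
move=> l0 [x0 xy tm]; split.
- by move: x0; rewrite cxZE pmulr_rgt0.
- have l2 : 0 < l ^+ 2 by exact: exprn_gt0.
  by rewrite -(ltr_pM2l l2) mulrCA -!exprMn.
by move: tm; rewrite cpowZ cxZE exprMn ltr_pM2l // exprn_gt0.
Qed.

Lemma pow_tangent (x : R) n : 0 <= x -> exists2 d : R, 0 <= d & forall y : R, 0 <= y -> x ^+ n + d * (y - x) <= y ^+ n.
Proof.
move=> x0; elim: n => [|n [d d0 IH]]; first by exists 0 => // y _; rewrite mul0r addr0.
exists (x ^+ n + d * x); first by rewrite addr_ge0 ?exprn_ge0 ?mulr_ge0.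
move=> y y0; rewrite !exprS; have := ler_wpM2l y0 (IH y y0); have := mulr_ge0 d0 (sqr_ge0 (y - x)).
by rewrite expr2; lra.
Qed.

Lemma pow_root (s : R) n : 0 < s -> (0 < n)%N -> exists2 x : R, 0 < x & x ^+ n = s.
Proof.
move=> s0 n0; exists (s `^ n%:R^-1); first exact: powR_gt0.
by rewrite -powR_mulrn ?powR_ge0 // -powRrM mulVf ?powRr1 ?ltW // pnatr_eq0 -lt0n.
Qed.

(* The left-hand side is convex in [x]. *)
Lemma trinomial_max (A B g x0 x : R) n : 0 <= A -> 0 <= x0 -> x0 < x -> x <= 1 ->
  A * x0 ^+ n + B * x0 <= g -> A + B <= g -> A * x ^+ n + B * x <= g.
Proof.
move=> A0 p0 px x1 h0 h1; have x0' : 0 <= x by lra.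
have [d d0 hd] := pow_tangent n x0'.
have k0 := ler_wpM2l A0 (hd _ p0); have k1 := ler_wpM2l A0 (hd _ ler01); rewrite expr1n in k1.
rewrite leNgt; apply/negP => lt.
have j0 : (A * d + B) * (x0 - x) < 0 by lra.
have j1 : (A * d + B) * (1 - x) < 0 by lra.
have : 0 < A * d + B by rewrite -(nmulr_llt0 _ (_ : x0 - x < 0)) // subr_lt0.
by move=> /ltW /mulr_ge0 /(_ (_ : 0 <= 1 - x)); rewrite subr_ge0 => /(_ x1); lra.
Qed.

End Scaling.

(** * Rotating the root attached to a boundary point *)

Section Tangency.
Variable R : realType.
Local Notation Cx := (Cx R).
Variables (m : nat) (rho a b kap c0 kk Rr : R).
Implicit Types (l T : R) (mu Y e : Cx).
Let N : R := (2 * m.+1)%:R.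

(** [c0] is at most the cosine of the half opening of the sector ([td_c0]), [Rr] is a ratio
    [|Y| / T] that roots for [vtang] do not reach ([td_far]), and [kk] bounds from below the squared
    cosine of the argument of elements shorter than that ([td_near]). Two of these differ by an
    angle of cosine at least [2 kk - 1], so by [td_kk] the rotation is within the range of
    [td_tang]. The bound 8 on [b] serves [grow_bound]. *)
Record tangent_data : Prop := TangentData {
  td_b : 0 < b <= 8;
  td_R : 0 < Rr;
  td_c0 : c0 ^+ 2 * (kap + 1) <= kap;
  td_kk : c0 <= 2 * kk - 1;
  td_kk1 : 0 < kk <= 1;
  td_far : forall x : R, Rr <= x -> `|b - a * x| < rho * x ^+ m.+1 - 1;
  td_tang : forall e, cabs e = 1 -> c0 <= e.1 ->
    b * cabs (cpow e m - (((N - 1) / N) *: cpow e m.+1 + N^-1 *: cconj (cpow e m.+1))) <= 1 - (cpow e m.+1).1;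
  td_near : forall T Y, 0 < T -> sector m kap T Y -> cabs Y < Rr * T -> kk * cnorm2 Y <= Y.1 ^+ 2 /\ 0 <= (cpow Y m.+1).1
}.

Hypothesis BD : branch_data m rho a b kap.
Hypothesis TD : tangent_data.

(** The imaginary part is forced: both sides of [vtang_rot] agree at [e = 1], so their derivatives
    in the angle must agree too, which gives [Im v = b T (m / (m + 1)) Im mu]. With [N = 2 (m + 1)]
    this is the stated combination of [mu] and its conjugate. *)
Definition vtang T mu : Cx := creal (T ^+ m.+1) + (b * T) *: (((N - 1) / N) *: mu + N^-1 *: cconj mu).

Lemma N_gt0 : 0 < N. Proof. by rewrite ltr0n. Qed.

Lemma vtang_re T mu : (vtang T mu).1 = pmin m b T mu.
Proof. by rewrite /vtang /pmin !(cxE, cxZE) /=; field; rewrite gt_eqF // N_gt0. Qed.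

Lemma vtang_rot T mu e : 0 <= T -> cabs mu = T ^+ m -> cabs e = 1 -> c0 <= e.1 ->
  (cmul (cpow e m.+1) (vtang T mu)).1 <= pmin m b T (cmul (cpow e m) mu).
Proof.
move=> T0 hmu e1 ce; have h := td_tang TD e1 ce; have /andP[b0 _] := td_b TD.
move: h; set X := cpow e m.+1; set M := cpow e m; set D := (_ - _ : Cx) => h.
have -> : (cmul X (vtang T mu)).1 = T ^+ m.+1 * X.1 + b * T * ((cmul M mu).1 - (cmul mu D).1).
  by rewrite /vtang /D !(cxE, cxZE) /=; ring.
have := cabs_ge_re (cmul mu D); rewrite cabsM hmu ler_norml => /andP[h2 _].
have Tk : 0 <= T ^+ m.+1 by exact: exprn_ge0.
have h3 := ler_wpM2l Tk h.
have h4 : b * T * - (T ^+ m * cabs D) <= b * T * (cmul mu D).1 by rewrite ler_wpM2l // mulr_ge0 // ltW.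
have e2 : b * T * - (T ^+ m * cabs D) = - (T ^+ m.+1 * (b * cabs D)) by rewrite exprS; ring.
by rewrite /pmin; lra.
Qed.

Lemma sector_re T Y : sector m kap T Y -> 0 < Y.1 /\ c0 * cabs Y <= Y.1.
Proof.
move=> [x0 xy _]; split => //; have k1 := bd_kap BD; have hc := td_c0 TD.
case: (ltP c0 0) => c0s; first by have := mulr_ge0 (ltW (_ : 0 < - c0)) (cabs_ge0 Y); rewrite oppr_gt0 => /(_ c0s); lra.
rewrite -ler_sqr ?nnegrE; [|by rewrite mulr_ge0 // cabs_ge0|exact: ltW].
rewrite exprMn -cnorm2_cabs /cnorm2; have kp : 0 < kap by lra.
have := sqr_ge0 c0; have := sqr_ge0 Y.1; move: hc xy.
move: (c0 ^+ 2) (Y.1 ^+ 2) (Y.2 ^+ 2) => c x y hc xy x2 c2.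
rewrite -(ler_pM2l kp); have := ler_wpM2l c2 (ltW xy); have := ler_wpM2r x2 hc; lra.
Qed.

(** Rotating by [e = conj Y / |Y|] makes the root real. Then [vtang_rot] bounds a real polynomial in
    [x = |Y| / T] from above, against [td_far] once [x >= Rr]. *)
Lemma tangent_size T mu Y : 0 < T -> cabs mu = T ^+ m -> sector m kap T Y ->
  qpol m rho a mu Y = vtang T mu -> cabs Y < Rr * T.
Proof.
move=> T0 hmu sY qY; rewrite ltNge; apply/negP => le.
have [x0 cx] := sector_re sY.
have R0 := td_R TD; have Y0 : 0 < cabs Y by rewrite (lt_le_trans _ le) // mulr_gt0.
pose e := (cabs Y)^-1 *: cconj Y.
have e1 : cabs e = 1.
  rewrite /e -cx_add0 cabsM creal_abs gtr0_norm ?invr_gt0 //.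
  by have -> : cabs (cconj Y) = cabs Y; [rewrite /cabs /cnorm2 /= sqrrN|rewrite mulVf // gt_eqF].
have eY : cmul e Y = creal (cabs Y).
  have : cabs Y ^+ 2 = Y.1 ^+ 2 + Y.2 ^+ 2 by rewrite -cnorm2_cabs.
  move: (cabs Y) Y0 @e {e1} => r r0 e h.
  have rn : r != 0 by rewrite gt_eqF.
  apply: cx_eq; rewrite /e !(cxE, cxZE) /=; last by ring.
  by rewrite (_ : _ - _ = r^-1 * (Y.1 ^+ 2 + Y.2 ^+ 2)); [rewrite -h; field|ring].
have ce : c0 <= e.1 by rewrite /e cxZE /= mulrC ler_pdivlMr.
have := vtang_rot (ltW T0) hmu e1 ce; rewrite -qY.
have -> : cmul (cpow e m.+1) (qpol m rho a mu Y) = rho *: cpow (cmul e Y) m.+1 + cmul (cmul e Y) (a *: cmul (cpow e m) mu).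
  rewrite /qpol cpowM cpowS; move: (cpow e m) (cpow Y m.+1) => *; apply: cx_eq; rewrite !(cxE, cxZE); ring.
rewrite eY cpow_creal /pmin; set w := cmul (cpow e m) mu.
have hw : cabs w = T ^+ m by rewrite cabsM cabs_cpow e1 expr1n mul1r.
have -> : (rho *: creal (cabs Y ^+ m.+1) + cmul (creal (cabs Y)) (a *: w)).1 = rho * cabs Y ^+ m.+1 + a * cabs Y * w.1.
  by rewrite !(cxE, cxZE) /=; ring.
pose x := cabs Y / T; have xE : cabs Y = x * T by rewrite /x mulfVK // gt_eqF.
have xR : Rr <= x by rewrite /x ler_pdivlMr.
rewrite xE exprMn; have Tk : 0 < T ^+ m.+1 by exact: exprn_gt0.
have := td_far TD xR; rewrite -(ltr_pM2l Tk) => h1 h2.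
have := cabs_ge_re w; rewrite hw => h3.
have : (b - a * x) * T * w.1 <= `|b - a * x| * T * T ^+ m.
  apply: le_trans (ler_norm _) _; rewrite !normrM (gtr0_norm T0).
  by rewrite ler_wpM2l // mulr_ge0 // ltW.
by rewrite (_ : `|_| * T * T ^+ m = T ^+ m.+1 * `|b - a * x|); [lra|rewrite exprS; ring].
Qed.

(** Along the ray through [E] the left-hand side is [A s^(m+1) + B s] with [A >= 0], convex in the
    scale [s]. It is at most the right-hand side at [s = 1] by [vtang_rot], and at the scale where
    the ray meets [Re Y^m = T^m] by [boundary_re]; [t] lies between. *)
Lemma slit_key T mu Y e (t : R) : 0 < T -> cabs mu = T ^+ m -> sector m kap T Y ->
  qpol m rho a mu Y = vtang T mu -> cabs e = 1 -> 0 < t -> t <= 1 -> sector m kap T (t *: cmul e Y) ->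
  (qpol m rho a (cmul (cpow e m) mu) (t *: cmul e Y)).1 <= pmin m b T (cmul (cpow e m) mu).
Proof.
move=> T0 hmu sY qY e1 t0 t1 stE; set E := cmul e Y in stE *.
have m0 : (0 < m)%N := ltnW (bd_m BD).
have EY : cabs E = cabs Y by rewrite cabsM e1 mul1r.
have Ys := tangent_size T0 hmu sY qY.
have stE' : t ^+ m * T ^+ m <= T ^+ m.
  by apply: ler_piMl; [exact/exprn_ge0/ltW|apply: exprn_ile1 => //; exact: ltW].
have tm0 : 0 < t ^+ m by exact: exprn_gt0.
have hE : T ^+ m < t ^+ m * (cpow E m).1 by move: stE => [_ _]; rewrite cpowZ cxZE.
have sE : sector m kap T E.
  move: (stE) => [x0 xy _]; split.
  - by move: x0; rewrite cxZE pmulr_rgt0.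
  - have t2 : 0 < t ^+ 2 by exact: exprn_gt0.
    by rewrite -(ltr_pM2l t2) mulrCA -!exprMn.
  by rewrite -(ltr_pM2l tm0); exact: le_lt_trans stE' hE.
have [nY _] := td_near TD T0 sY Ys.
have [nE pE] : kk * cnorm2 E <= E.1 ^+ 2 /\ 0 <= (cpow E m.+1).1 by apply: (td_near TD T0 sE); rewrite EY.
have nEY : cnorm2 E = cnorm2 Y by rewrite !cnorm2_cabs EY.
have [YX _] := sector_re sY; have [EX _] := sector_re sE.
have /andP[kk0 kk1] := td_kk1 TD.
have r0 : 0 < cnorm2 Y by rewrite /cnorm2 ltr_wpDr ?sqr_ge0 // exprn_gt0.
(* [E] and [Y] both make an angle of squared cosine at least [kk] with the real axis, so the angle
   of [e] is at most twice the extreme one; [p1] and [p2] bound the two terms in the cosine of a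
   difference. *)
have ce : c0 <= e.1.
  have eq1 : E.1 * Y.1 + E.2 * Y.2 = e.1 * cnorm2 Y by rewrite /E /cnorm2 !cxE; ring.
  have p1 : kk * cnorm2 Y <= E.1 * Y.1.
    have A0 : 0 <= kk * cnorm2 Y by rewrite mulr_ge0 // ltW.
    move: nY nE EX YX; rewrite nEY; move: (kk * _) E.1 Y.1 A0 => A x y A0 *.
    by case: (lerP x y) => ?; nra.
  have p2 : - (E.2 * Y.2) <= (1 - kk) * cnorm2 Y.
    have : E.2 ^+ 2 <= (1 - kk) * cnorm2 Y by move: nE; rewrite -nEY /cnorm2; lra.
    have : Y.2 ^+ 2 <= (1 - kk) * cnorm2 Y by move: nY; rewrite /cnorm2; lra.
    by have := sqr_ge0 (E.2 + Y.2); lra.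
  have k2 := td_kk TD; have : c0 * cnorm2 Y <= (2 * kk - 1) * cnorm2 Y by rewrite ler_wpM2r // ltW.
  move=> p3; rewrite -(ler_pM2r r0) -eq1; lra.
set M := cmul (cpow e m) mu.
have hM : cabs M = T ^+ m by rewrite cabsM cabs_cpow e1 expr1n mul1r.
have qt (s : R) : (qpol m rho a M (s *: E)).1 = rho * (cpow E m.+1).1 * s ^+ m.+1 + a * (cmul M E).1 * s.
  by rewrite /qpol cpowZ; move: (cpow E m.+1) (s ^+ m.+1) => *; rewrite !(cxE, cxZE); ring.
have g1 : rho * (cpow E m.+1).1 + a * (cmul M E).1 <= pmin m b T M.
  have := vtang_rot (ltW T0) hmu e1 ce; rewrite -/M -qY; congr (_ <= _).
  rewrite /qpol /M /E cpowM cpowS; move: (cpow e m) (cpow Y m.+1) => *; rewrite !(cxE, cxZE); ring.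
(* The scale [r] with [r^m = s] is where the ray through [E] meets the boundary curve. *)
pose s := T ^+ m / (cpow E m).1.
have Em0 : 0 < (cpow E m).1 by move: sE => [_ _]; apply: le_lt_trans; rewrite exprn_ge0 // ltW.
have s0 : 0 < s by rewrite divr_gt0 // exprn_gt0.
have [r rp rm] := pow_root s0 m0.
have rt : r < t.
  rewrite ltNge; apply/negP => tr.
  have : t ^+ m <= r ^+ m by apply: lerXn2r tr; rewrite nnegrE ltW.
  by rewrite rm /s ler_pdivlMr // leNgt hE.
have g0 : (qpol m rho a M (r *: E)).1 <= pmin m b T M.
  move: (sE) => [x0 xy _]; apply: ltW; apply: (boundary_re BD (ltW T0) hM).
  - by rewrite cxZE mulr_gt0.
  - by rewrite !cxZE !exprMn mulrCA ler_pM2l ?exprn_gt0 // ltW.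
  by rewrite cpowZ cxZE rm /s mulfVK // gt_eqF.
rewrite qt in g0; rewrite qt; apply: (trinomial_max _ (ltW rp) rt t1 g0 g1).
by rewrite mulr_ge0 // ltW // (bd_rho BD).
Qed.

End Tangency.

(** * Peak functions, the barrier at infinity and growth on the model domain *)

Section ModelDomain.
Variable R : realType.
Local Notation Cx := (Cx R).
Local Notation C2 := (C2 R).
Variables (m : nat) (rho a b kap c0 kk Rr : R).
Hypothesis BD : branch_data m rho a b kap.
Hypothesis TD : tangent_data m rho a b kap c0 kk Rr.
Implicit Types (z p q : C2).

Definition rfun z : R := z.2.1 + cnorm2 z.1 * cnorm2 z.2 + pmin m b (cnorm2 z.1) (mono m z.1).
Definition model : set C2 := [set z | rfun z < 0].
Local Notation br := (branch m rho a kap).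

Let m1 := bd_m BD.
Let rho0 := bd_rho BD.
Let a0 := bd_a BD.

Lemma cont_rfun z : {for z, continuous rfun}.
Proof.
have c1 := holat_cont (holat_fst z); have c2 := holat_cont (holat_snd z).
have n1 := cont_cnorm2 c1; have n2 := cont_cnorm2 c2.
have cm : {for z, continuous (fun z => mono m z.1)} by exact: cont_cpow.
apply: cvgD; first by apply: cvgD; [exact: (cont_fst c2)|exact: cvgM].
apply: cvgD; last by apply: cvgM; [apply: cvgMr; exact: n1|exact: (cont_fst cm)].
by apply: (@continuous_comp _ _ _ (fun z : C2 => cnorm2 z.1) (fun x : R => x ^+ m.+1)) => //; exact: exprn_continuous.
Qed.

Lemma model_open : open model.
Proof.
rewrite openE => z; rewrite /interior /model /= => hz.
by have cr := @cont_rfun z; apply: (cr [set x | x < 0]); apply: open_nbhs_nbhs; split; [exact: open_lt|].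
Qed.

Lemma pmin0 mu : pmin m b 0 mu = 0 :> R.
Proof. by rewrite /pmin expr0n /= mulr0 mul0r addr0. Qed.

Lemma bdom_strict (z v : Cx) : pmin m b (cnorm2 z) (mono m z) < v.1 -> bdom m b z v.
Proof.
move=> h; split=> [|z0]; first exact: ltW.
apply: re_neq0; apply: le_lt_trans h; rewrite z0.
by have -> : cnorm2 (0 : Cx) = 0; [rewrite /cnorm2 /= expr0n addr0|rewrite pmin0].
Qed.

Definition vfun (d c : Cx) z : Cx := c - (z.2 + cmul d (cmul z.1 z.2)).

Lemma holat_vfun d c p : holat (vfun d c) p.
Proof.
apply: holatB; first exact: holat_cst.
apply: holatD; first exact: holat_snd.
by apply: holatZ; apply: holatM; [exact: holat_fst|exact: holat_snd].
Qed.

(* Completing the square absorbs [|z1 z2|^2] into the real part of a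
   holomorphic function. *)
Lemma vfun_re (w : Cx) (s : R) z :
  (vfun (2 *: cconj w) (cnorm2 w, s) z).1 = - z.2.1 - cnorm2 z.1 * cnorm2 z.2 + cnorm2 (cmul z.1 z.2 - w).
Proof. by rewrite /vfun /cnorm2 !(cxE, cxZE) /=; ring. Qed.

Lemma vfun_bdom (w : Cx) (s : R) z : model z -> pmin m b (cnorm2 z.1) (mono m z.1) < (vfun (2 *: cconj w) (cnorm2 w, s) z).1.
Proof.
rewrite vfun_re /model /rfun /= => h; have := cnorm2_ge0 (cmul z.1 z.2 - w); lra.
Qed.

Lemma near_le (f : C2 -> R) q (e : R) : {for q, continuous f} -> f q < e ->
  exists2 d : R, 0 < d & forall z, `|z - q| < d -> f z <= e.
Proof.
move=> cf fq; have : \forall z \near q, f z < e.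
  by apply: (cf [set x | x < e]); apply: open_nbhs_nbhs; split; [exact: open_lt|].
by move=> /near_normP[d d0 h]; exists d => // z /h /ltW.
Qed.

Let is_peak q := exists f, [/\ holW model f, forall z, model z -> 0 < (f z).1 &
   forall e : R, 0 < e -> exists2 d, 0 < d & forall z, model z -> `|z - q| < d -> (f z).1 <= e].

(** No point of the domain is near [q], so the constant 1 meets the smallness condition
    vacuously. *)
Lemma peak_outer q : 0 < rfun q -> is_peak q.
Proof.
move=> rq; exists (fun=> cone R); split=> [z _|z _|e e0]; first exact: holat_cst.
  by rewrite /= ltr01.
have [||d d0 h] := @near_le (fun z => - rfun z) q 0; [by apply: cvgN; exact: cont_rfun|by rewrite oppr_lt0|].
by exists d => // z mz /h; rewrite oppr_le0 leNgt mz.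
Qed.

(** The imaginary constant is chosen so that [v q = 0]; together with [q1 = 0] this is the apex of
    the branch, where [branch_small] makes the root tend to zero. *)
Lemma peak_axis q : rfun q = 0 -> q.1 = 0 -> is_peak q.
Proof.
move=> rq q1; pose v := vfun (2 *: cconj (0 : Cx)) (cnorm2 (0 : Cx), q.2.2).
have n0 : cnorm2 (0 : Cx) = 0 by rewrite /cnorm2 /= expr0n addr0.
have vq : v q = 0.
  move: rq; rewrite /rfun q1 n0 pmin0 mul0r !addr0 => q21.
  by rewrite /v /vfun n0 q1; apply: cx_eq; rewrite !(cxE, cxZE) /= ?q21; ring.
have dom z : model z -> bdom m b z.1 (v z) by move=> mz; apply: bdom_strict; exact: vfun_bdom.
have hv z : holat v z by exact: holat_vfun.
exists (fun z => br z.1 (v z)); split=> [z mz|z mz|e e0].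
- exact: (holat_branch BD (hv z) (dom z mz)).
- exact: (branch_gt0 BD (dom z mz)).
have [||d d0 hd] := @near_le (fun z => cabs (v z)) q (rho * e ^+ m.+1 / 4).
- by apply: cont_cabs; exact: holat_cont.
- by rewrite vq cabs0 divr_gt0 // mulr_gt0 // exprn_gt0.
have [||d' d'0 hd'] := @near_le (fun z => a * cnorm2 z.1 ^+ m) q (rho * e ^+ m / 4).
- apply: cvgMr; apply: (@continuous_comp _ _ _ (fun z : C2 => cnorm2 z.1) (fun x : R => x ^+ m)); last exact: exprn_continuous.
  by apply: cont_cnorm2; exact: holat_cont (holat_fst q).
- rewrite q1 n0 expr0n; have -> : (m == 0%N) = false by case: m m1.
  by rewrite mulr0 divr_gt0 // mulr_gt0 // exprn_gt0.
exists (Num.min d d'); first by rewrite lt_min d0.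
move=> z mz; rewrite lt_min => /andP[h h']; apply: le_trans (ler_norm _) _; apply: le_trans (cabs_ge_re _) _.
by apply: (branch_small BD (dom z mz) e0); [exact: hd|exact: hd'].
Qed.

(** A value on the cut would mean that the ratio is a real [t >= 1], so that [Y] is [Y0] rotated by
    the argument of [z1^2 / p1^2], rescaled by [|z1|^2 / |p1|^2] and shrunk by [t]. After removing
    the scale, [slit_key] bounds [Re v] by [pmin], against the strict inequality assumed. *)
Lemma slit_ratio (p1 z1 Y Y0 v : Cx) : p1 != 0 -> sector m kap (cnorm2 p1) Y0 ->
  qpol m rho a (mono m p1) Y0 = vtang m b (cnorm2 p1) (mono m p1) ->
  sector m kap (cnorm2 z1) Y -> qpol m rho a (mono m z1) Y = v -> pmin m b (cnorm2 z1) (mono m z1) < v.1 ->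
  slit (cone R - cmul (cmul (cinv (cpow p1 2)) Y0) (cmul (cpow z1 2) (cinv Y))).
Proof.
move=> p10 sY0 qY0 sY qY lt; rewrite /slit ltNge; apply/negP; set w := (_ - _ : Cx) => hw.
have T00 : 0 < cnorm2 p1 by rewrite cnorm2_gt0.
have hN (x : Cx) : cabs (cpow x 2) = cnorm2 x by rewrite cabs_cpow cnorm2_cabs.
have e00 : cpow p1 2 != 0 by rewrite -cabs_gt0 hN.
have Yn : Y != 0 by apply: re_neq0; case: sY.
have Y0n : Y0 != 0 by apply: re_neq0; case: sY0.
have w2 : w.2 = 0.
  have c2 : cabs w ^+ 2 = w.1 ^+ 2 + w.2 ^+ 2 by rewrite -cnorm2_cabs.
  apply/eqP; rewrite -sqrf_eq0 eq_le sqr_ge0 andbT; have := cabs_ge0 w; move: c2 hw; move: (cabs w) w.1 (w.2 ^+ 2) => *; nra.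
have w1 : w.1 <= 0 by have := cabs_ge0 w; lra.
pose t := 1 - w.1; have t1 : 1 <= t by rewrite /t; lra.
have tn : t != 0 by rewrite gt_eqF //; lra.
have ut : cmul (cmul (cinv (cpow p1 2)) Y0) (cmul (cpow z1 2) (cinv Y)) = creal t.
  have -> : cmul (cmul (cinv (cpow p1 2)) Y0) (cmul (cpow z1 2) (cinv Y)) = cone R - w by rewrite /w opprB addrC subrK.
  by apply: cx_eq => //; rewrite (_ : (cone R - w).2 = 0 - w.2) // w2 subr0.
pose g := cmul (cpow z1 2) (cinv (cpow p1 2)).
have YE : Y = t^-1 *: cmul g Y0.
  have : cmul (creal t) Y = cmul g Y0.
    rewrite -ut cmulA -cmulA cmulVc // cmulc1 /g; move: (cinv (cpow p1 2)) (cpow z1 2) => x y.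
    by apply: cx_eq; rewrite !cxE; ring.
  by rewrite cx_add0 => <-; rewrite scalerA mulVf // scale1r.
have T1 : 0 < cnorm2 z1.
  rewrite lt_neqAle cnorm2_ge0 andbT eq_sym cnorm2_eq0; apply/eqP => z0; move: Yn.
  by rewrite YE /g z0 !cpowS !cmul0c scaler0 eqxx.
pose l := cnorm2 z1 / cnorm2 p1; have l0 : 0 < l by exact: divr_gt0.
have ln : l != 0 by rewrite gt_eqF.
have lT : cnorm2 z1 = l * cnorm2 p1 by rewrite /l mulfVK // gt_eqF.
pose e := l^-1 *: g.
have gE : g = l *: e by rewrite /e scalerA divff // scale1r.
have e1 : cabs e = 1.
  rewrite /e -cx_add0 cabsM creal_abs gtr0_norm ?invr_gt0 // /g cabsM cabsV // !hN -/l.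
  by rewrite mulVf.
have YE' : Y = l *: (t^-1 *: cmul e Y0).
  rewrite YE gE -!cx_add0; move: (creal l) (creal t^-1) => x y.
  by rewrite -[cmul (cmul x e) Y0]cmulA !cmulA (cmulC y).
have mE : mono m z1 = l ^+ m *: cmul (cpow e m) (mono m p1).
  rewrite /mono -!cpow_comp; have -> : cpow z1 2 = cmul (l *: e) (cpow p1 2).
    by rewrite -gE /g -cmulA cmulVc // cmulc1.
  by rewrite cpowM cpowZ -!cx_add0 cmulA.
have sE : sector m kap (cnorm2 p1) (t^-1 *: cmul e Y0).
  by apply: (sectorZ l0); rewrite -lT -YE'.
have ti : 0 < t^-1 by rewrite invr_gt0; lra.
have ti1 : t^-1 <= 1 by rewrite invf_le1 //; lra.
have := slit_key BD TD T00 (cabs_mono m p1) sY0 qY0 e1 ti ti1 sE.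
move: lt; rewrite -qY mE YE' qpolZ lT pminZ cxZE ltr_pM2l ?exprn_gt0 // => h.
by rewrite leNgt h.
Qed.

(** The function [W] vanishes at [q] and avoids the cut on the domain, so its principal square root
    has positive real part and tends to zero; it is continuous at [q] because [bdom] includes the
    case of equality. *)
Lemma peak_tangent q : rfun q = 0 -> q.1 != 0 -> is_peak q.
Proof.
move=> rq q1; pose w := cmul q.1 q.2; pose T0 := cnorm2 q.1.
pose v0 := vtang m b T0 (mono m q.1).
(* The real part of [v q] is determined by [rfun q = 0]; its imaginary part is free and is moved to
   that of [vtang]. *)
pose s := v0.2 - (vfun (2 *: cconj w) (cnorm2 w, 0) q).2.
pose v := vfun (2 *: cconj w) (cnorm2 w, s).
have vq : v q = v0.
  apply: cx_eq; last by rewrite /v /vfun /s; move: (v0) => u; rewrite /vfun !(cxE, cxZE) /=; ring.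
  rewrite vtang_re /v vfun_re subrr; have -> : cnorm2 (0 : Cx) = 0 by rewrite /cnorm2 /= expr0n addr0.
  by move: rq; rewrite /rfun -/T0; lra.
have dom z : model z -> bdom m b z.1 (v z) by move=> mz; apply: bdom_strict; exact: vfun_bdom.
have domq : bdom m b q.1 (v q).
  by split=> [|/eqP]; [rewrite vq vtang_re|rewrite (negPf q1)].
have hv z : holat v z by exact: holat_vfun.
have [sY0 qY0] := branchP BD domq; set Y0 := br q.1 (v q) in sY0 qY0.
have nY z : bdom m b z.1 (v z) -> br z.1 (v z) != 0 by move=> d; exact: (re_neq0 (branch_gt0 BD d)).
have e00 : cpow q.1 2 != 0 by rewrite -cabs_gt0 cabs_cpow exprn_gt0 // cabs_gt0.
pose W z : Cx := cone R - cmul (cmul (cinv (cpow q.1 2)) Y0) (cmul (cpow z.1 2) (cinv (br z.1 (v z)))).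
have hW z : bdom m b z.1 (v z) -> holat W z.
  move=> d; apply: holatB; first exact: holat_cst.
  apply: holatZ; apply: holatM; first exact: holat_cpow (holat_fst z).
  by apply: holatV; [exact: nY|exact: (holat_branch BD (hv z) d)].
have sl z : model z -> slit (W z).
  move=> mz; have [sY qY] := branchP BD (dom z mz).
  apply: (slit_ratio q1 sY0 _ sY qY); [by rewrite qY0 vq|exact: vfun_bdom].
have Wq : W q = 0.
  rewrite /W -/Y0 -cmulA [cmul Y0 _]cmulA [cmul Y0 _]cmulC -cmulA cmulcV ?nY // cmulc1.
  by rewrite cmulVc // subrr.
exists (fun z => csqrt (W z)); split=> [z mz|z mz|e e0].
- have [d hd] := cder_csqrt (sl z mz); exact: (holat_comp hd (hW z (dom z mz))).
- exact: csqrt_gt0 (sl z mz).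
have [||d d0 hd] := @near_le (fun z => cabs (W z)) q (e ^+ 2).
- by apply: cont_cabs; exact: holat_cont (hW q domq).
- by rewrite Wq cabs0 exprn_gt0.
exists d => // z mz hz; have s0 := csqrt_gt0 (sl z mz).
rewrite -ler_sqr ?nnegrE; [|exact: ltW|exact: ltW]; apply: le_trans (csqrt_re_le (sl z mz)) _; exact: hd.
Qed.

Lemma model_peak q : ~ model q -> is_peak q.
Proof.
rewrite /model /= => /negP; rewrite -leNgt le_eqVlt => /orP[/eqP rq|]; last exact: peak_outer.
by case: (eqVneq q.1 0) => q1; [exact: peak_axis|exact: peak_tangent].
Qed.

(** With [v = - z2] one has [|z1|^2 < |Y|], [|z2| <= (rho + a) |Y|^(m+1)] and [|Y| <= 2 Re Y], so a
    bounded real part confines [z] to a bounded set. *)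
Lemma model_infty : exists f, [/\ holW model f, forall z, model z -> 0 < (f z).1 &
  forall M : R, exists r : R, forall z, model z -> r <= `|z| -> M <= (f z).1].
Proof.
pose v := vfun (2 *: cconj (0 : Cx)) (cnorm2 (0 : Cx), 0).
have n0 : cnorm2 (0 : Cx) = 0 by rewrite /cnorm2 /= expr0n addr0.
have vE z : v z = - z.2 by rewrite /v /vfun n0; apply: cx_eq; rewrite !(cxE, cxZE) /=; ring.
have dom z : model z -> bdom m b z.1 (v z) by move=> mz; apply: bdom_strict; exact: vfun_bdom.
have hv z : holat v z by exact: holat_vfun.
exists (fun z => br z.1 (v z)); split=> [z mz|z mz|M].
- exact: (holat_branch BD (hv z) (dom z mz)).
- exact: (branch_gt0 BD (dom z mz)).
pose K := 2 * (`|M| + 1); have M0 := normr_ge0 M.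
exists (1 + K + (rho + a) * K ^+ m.+1) => z mz; have [sY qY] := branchP BD (dom z mz).
have [TY Y2] := sector_cabs BD (cnorm2_ge0 z.1) sY.
have uY := qpol_upper BD (cnorm2_ge0 z.1) (cabs_mono m z.1) sY.
rewrite qY in uY; set Y := br z.1 (v z) in sY qY uY TY Y2 *; rewrite vE cabsN in uY.
move=> hz; rewrite leNgt; apply/negP => YM.
have yK : cabs Y <= K by rewrite /K; have := ler_norm M; lra.
have K0 : 0 <= K by rewrite /K; lra.
have K1 : 0 <= K ^+ m.+1 by exact: exprn_ge0.
have ra : 0 < rho + a by exact: addr_gt0.
have h2 : `|z.2| <= (rho + a) * K ^+ m.+1.
  apply: le_trans (cabs_ge_norm _) _; apply: le_trans uY _; rewrite ler_pM2l //.
  by apply: lerXn2r => //; rewrite nnegrE // cabs_ge0.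
have h1 : `|z.1| < 1 + K.
  apply: le_lt_trans (cabs_ge_norm _) _.
  have : cabs z.1 ^+ 2 <= K by rewrite -cnorm2_cabs; lra.
  by have := cabs_ge0 z.1; nra.
move: hz; rewrite leNgt => /negP; apply; rewrite prod_normE /= gt_max.
have k3 := mulr_ge0 (ltW ra) K1.
by apply/andP; split; lra.
Qed.

(** The shift by 1 keeps the argument of the branch off the boundary of its domain, so that the root
    stays away from zero and its negative powers are bounded. *)
Definition fgrow z : Cx := br z.1 (cone R - z.2).

Lemma grow_bdom z : model z -> pmin m b (cnorm2 z.1) (mono m z.1) + 1 < (cone R - z.2).1.
Proof.
rewrite (_ : (cone R - z.2).1 = 1 - z.2.1) // /model /rfun /= => h.
by have := mulr_ge0 (cnorm2_ge0 z.1) (cnorm2_ge0 z.2); lra.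
Qed.

Lemma grow_dom z : model z -> bdom m b z.1 (cone R - z.2).
Proof. by move=> /grow_bdom h; apply: bdom_strict; lra. Qed.

Lemma grow_bound : exists2 C : R, 1 <= C & forall z, model z -> let X := C * cabs (fgrow z) in
  [/\ 1 <= X, cnorm2 z.1 <= X & cabs z.2 <= X ^+ m.+1].
Proof.
have ra : 0 < rho + a by exact: addr_gt0.
pose C := 5 + 2 * (rho + a).
have C0 : 5 <= C by rewrite /C; lra.
exists (2 * C); first by lra.
move=> z mz /=; have h := grow_bdom mz; have [sY qY] := branchP BD (grow_dom mz).
have [TY Y2] := sector_cabs BD (cnorm2_ge0 z.1) sY.
have uY := qpol_upper BD (cnorm2_ge0 z.1) (cabs_mono m z.1) sY.
rewrite qY in uY; rewrite -/(fgrow z) in TY Y2 uY *; set D := cabs (fgrow z) in TY Y2 uY *.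
have D0 : 0 <= D := cabs_ge0 _; have t0 := cnorm2_ge0 z.1.
have CD : 1 <= C * D.
  (* For [|z1|^2 >= 1 / 4] the bound [T < |Y|] suffices; otherwise [b <= 8] gives [pmin >= - 1 / 2],
     so [|1 - z2| >= 1 / 2] and the upper bound on [qpol] keeps [Y] from zero. *)
  case: (lerP (1 / 4) (cnorm2 z.1)) => ht; first by nra.
  have /andP[b1 b8] := td_b TD.
  have tk : cnorm2 z.1 ^+ m.+1 <= 1 / 16.
    have : cnorm2 z.1 ^+ m.+1 <= cnorm2 z.1 ^+ 2 by apply: ler_wiXn2l => //; [lra|rewrite ltnS ltnW].
    by nra.
  have : 1 / 2 <= cabs (cone R - z.2).
    apply: le_trans (cabs_ge_re _); apply: le_trans (ler_norm _); apply: ltW; apply: le_lt_trans h.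
    have := cabs_ge_re (mono m z.1); rewrite cabs_mono ler_norml => /andP[hm _].
    have bt : 0 <= b * cnorm2 z.1 by rewrite mulr_ge0 //; lra.
    have tk0 : 0 <= cnorm2 z.1 ^+ m.+1 by exact: exprn_ge0.
    have e : b * cnorm2 z.1 * - cnorm2 z.1 ^+ m = - (b * cnorm2 z.1 ^+ m.+1) by rewrite exprS; ring.
    have := ler_wpM2l bt hm; rewrite /pmin e.
    by have := ler_pM (ltW b1) tk0 b8 tk; lra.
  move=> h2; have h3 : 1 / 2 <= (rho + a) * D ^+ m.+1 by lra.
  case: (lerP 1 D) => D1; first by nra.
  have : D ^+ m.+1 <= D by rewrite -[X in _ <= X]expr1; apply: ler_wiXn2l => //; lra.
  by move=> h4; have := ler_wpM2l (ltW ra) h4; rewrite /C; lra.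
split; first by lra.
  by apply: le_trans (ltW TY) _; have := ler_wpM2r D0 (_ : 1 <= 2 * C); rewrite mul1r; apply; lra.
have C1 : C <= C ^+ m.+1 by rewrite -[X in X <= _]expr1; apply: ler_weXn2l => //; lra.
have X1 : 1 <= (C * D) ^+ m.+1 by exact: exprn_ege1.
have Dk : 0 <= D ^+ m.+1 by exact: exprn_ge0.
have X2 : (rho + a) * D ^+ m.+1 <= (C * D) ^+ m.+1 by rewrite exprMn ler_wpM2r //; rewrite /C in C1 *; lra.
have X3 : 2 * (C * D) ^+ m.+1 <= (2 * C * D) ^+ m.+1.
  rewrite -[2 * C * D]mulrA [X in _ <= X]exprMn ler_wpM2r //; first by lra.
  by rewrite -[X in X <= _]expr1; apply: ler_weXn2l => //; lra.
have : cabs z.2 <= 1 + cabs (cone R - z.2).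
  by rewrite -cabs_distC; have := cabs_sub z.2 (cone R); rewrite cabs1; lra.
lra.
Qed.

End ModelDomain.

(** * Integrability of rapidly decreasing functions *)

Section Decay.
Variable R : realType.
Local Notation Cx := (Cx R).
Local Notation C2 := (C2 R).
Local Notation leb := (@lebesgue_measure R).
Local Notation leb2 := (leb \x leb)%E.
Let h (x : R) : R := (oneDsqr x)^-1.
Let h2 (w : Cx) : R := h w.1 * h w.2.

Let h_ge0 x : 0 <= h x. Proof. by rewrite invr_ge0 addr_ge0 // sqr_ge0. Qed.
Let h2_ge0 w : 0 <= h2 w. Proof. exact: mulr_ge0. Qed.
Let cont_h : continuous h. Proof. exact: continuous_oneDsqrV. Qed.

Let cont_h2 (T : topologicalType) (f : T -> Cx) (x : T) : {for x, continuous f} -> {for x, continuous (fun t => h2 (f t))}.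
Proof.
move=> cf; apply: cvgM; [have c := cont_fst cf|have c := cont_snd cf].
  by apply: (continuous_comp c); exact: cont_h.
by apply: (continuous_comp c); exact: cont_h.
Qed.

Let meas_h : measurable_fun [set: R] (fun x => (h x)%:E).
Proof. by apply/measurable_EFinP; apply: continuous_measurable_fun; exact: cont_h. Qed.

Let meas_h2 : measurable_fun [set: Cx] (fun w : Cx => (h2 w)%:E).
Proof.
apply/measurable_EFinP; apply: measurable_cont_Cx => [|w _]; first exact: measurableT.
by apply: cont_h2; exact: cvg_id.
Qed.

Let int_h : (\int[leb]_x (h x)%:E = pi%:E)%E.
Proof.
rewrite ge0_symfun_integralT //; last by move=> x; rewrite /h /= /oneDsqr sqrrN.
rewrite (_ : [set x : R | _] = `[(0:R), +oo[%classic); last by apply/seteqP; split => x /=; rewrite in_itv /= andbT.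
by rewrite integral0y_oneDsqr -EFinM mulrCA divff // mulr1.
Qed.

Let int_h2 : (\int[leb2]_w (h2 w)%:E = (pi * pi)%:E)%E.
Proof.
have [-> _] := tonelli_Cx meas_h2 (fun w => h2_ge0 w : (0 <= (h2 w)%:E)%E).
have e x : (\int[leb]_y (h2 (x, y))%:E = pi%:E * (h x)%:E)%E.
  rewrite muleC -int_h.
  transitivity (\int[leb]_y ((h x)%:E * (h y)%:E))%E; first by apply: eq_integral => y _; rewrite -EFinM.
  by rewrite ge0_integralZl_EFin // => y _; rewrite lee_fin.
under eq_integral do rewrite e.
rewrite ge0_integralZl_EFin ?pi_ge0 //; last by move=> y _; rewrite lee_fin.
by rewrite int_h -EFinM.
Qed.

(** The dominating function is a product of four unnormalized Cauchy densities, whose integral is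
    [pi^4] by Tonelli; the last hypothesis has the denominators multiplied out. *)
Lemma decay_integrable (W : set C2) (F : C2 -> R) : measurable W -> (forall z, W z -> {for z, continuous F}) ->
  (forall z, W z -> 0 <= F z) ->
  (forall z, W z -> F z * ((1 + z.1.1 ^+ 2) * (1 + z.1.2 ^+ 2) * ((1 + z.2.1 ^+ 2) * (1 + z.2.2 ^+ 2))) <= 1) ->
  (@leb4m R).-integrable W (fun z => (F z)%:E).
Proof.
move=> mW cF F0 FG.
have mF : measurable_fun W (fun z => (F z)%:E) by apply/measurable_EFinP; exact: measurable_cont_C2.
pose G (z : C2) : \bar R := (h2 z.1 * h2 z.2)%:E.
have FG' z : W z -> ((F z)%:E <= G z)%E.
  move=> Wz; have p (x : R) : 0 < 1 + x ^+ 2 by rewrite ltr_wpDr ?sqr_ge0.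
  have := FG z Wz; rewrite -ler_pdivlMr ?mulr_gt0 // div1r lee_fin => /le_trans; apply.
  by rewrite /h2 /h /oneDsqr !invfM.
have mG : measurable_fun [set: C2] G.
  apply/measurable_EFinP; apply: measurable_cont_C2 => [|z _]; first exact: measurableT.
  apply: cvgM; [exact: (cont_h2 (holat_cont (holat_fst z)))|exact: (cont_h2 (holat_cont (holat_snd z)))].
have G0 z : (0 <= G z)%E by rewrite lee_fin mulr_ge0.
have GT : G \_ [set: C2] = G by apply/funext => z; rewrite patchE mem_setT.
have IG : (\int[@leb4m R]_(z in [set: C2]) G z = (pi * pi * (pi * pi))%:E)%E.
  rewrite (@tonelli_C2_on _ [set: C2] G) ?GT //.
  have e (x : Cx) : (\int[leb2]_y G (x, y) = (pi * pi)%:E * (h2 x)%:E)%E.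
    rewrite muleC -int_h2.
    transitivity (\int[leb2s R]_y ((h2 x)%:E * (h2 y)%:E))%E; first by apply: eq_integral => y _; rewrite -EFinM.
    by rewrite ge0_integralZl_EFin // => y _; rewrite lee_fin.
  under eq_integral do rewrite e.
  transitivity ((pi * pi)%:E * \int[leb2s R]_x (h2 x)%:E)%E; last by rewrite int_h2 -EFinM.
  rewrite -ge0_integralZl_EFin //; first by move=> y _; rewrite lee_fin.
  by rewrite mulr_ge0 // pi_ge0.
apply/integrableP; split; first by [].
apply: le_lt_trans (ltry (pi * pi * (pi * pi) : R)); rewrite -IG.
have -> : (\int[@leb4m R]_(z in W) `|(F z)%:E| = \int[@leb4m R]_(z in W) (F z)%:E)%E.
  by apply: eq_integral => z /set_mem Wz; rewrite gee0_abs // lee_fin F0.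
have H1 := @ge0_integral_mono R _ _ (@leb4m R) W (fun z => (F z)%:E) G.
have {}H1 := H1 (fun z Wz => F0 z Wz : (0 <= (F z)%:E)%E) FG'.
refine (le_trans H1 _).
have H2 := @ge0_subset_integral _ _ R (@leb4m R) W [set: C2] mW measurableT G mG.
by refine (H2 _ _) => //.
Qed.

End Decay.

(** * Positivity and completeness for the model domain *)

Section ModelComplete.
Variable R : realType.
Local Notation Cx := (Cx R).
Local Notation C2 := (C2 R).
Variables (m : nat) (rho a b kap c0 kk Rr : R).
Hypothesis BD : branch_data m rho a b kap.
Hypothesis TD : tangent_data m rho a b kap c0 kk Rr.
Implicit Types (z p q : C2).
Local Notation W := (model m b).

Theorem model_complete : bergman_positive W /\ bergman_complete W /\ cara_positive W /\ cara_complete W.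
Proof.
have [C C1 hC] := grow_bound BD TD; pose g := fgrow m rho a kap : C2 -> Cx.
(* By [hC] the product of the four factors [1 + x^2] is at most [16 X^(2 + 4 (m + 1))], and
   [|f0|^2 = X^(-2 N) / 16] compensates it exactly for [N = 2 (m + 1) + 1]. *)
pose N := (2 * m.+1).+1; pose f0 z := 4^-1 *: cpow (cinv (C *: g z)) N.
have hg z : W z -> holat g z.
  move=> Wz; apply: (holat_branch BD); last exact: grow_dom.
  by apply: holatB; [exact: holat_cst|exact: holat_snd].
have Cn (w : Cx) : cabs (C *: w) = C * cabs w by rewrite -cx_add0 cabsM creal_abs gtr0_norm //; lra.
pose X z := C * cabs (g z).
have X1 z : W z -> 1 <= X z by move=> /hC[].
have gn z : W z -> C *: g z != 0 by move=> /X1 h; rewrite -cabs_gt0 Cn; move: h; rewrite /X; lra.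
have f0E z : W z -> cabs (f0 z) = 4^-1 * (X z ^+ N)^-1.
  move=> Wz; rewrite (_ : cabs (f0 z) = cabs (cmul (creal 4^-1) (cpow (cinv (C *: g z)) N))); last by rewrite cx_add0.
  rewrite cabsM creal_abs gtr0_norm ?invr_gt0 // cabs_cpow cabsV ?gn //.
  by rewrite Cn exprVn.
have hf0 : holW W f0.
  move=> z Wz; rewrite /f0 (_ : (fun z => _) = (fun z => cmul (creal 4^-1) (cpow (cinv (C *: g z)) N))); last first.
    by apply/funext => x; rewrite cx_add0.
  apply: holatZ; apply: holat_cpow; apply: holatV; first exact: gn.
  rewrite (_ : (fun z => C *: g z) = (fun z => cmul (creal C) (g z))); last by apply/funext => x; rewrite cx_add0.
  by apply: holatZ; exact: hg.
have XN z : W z -> 1 <= X z ^+ N by move=> /X1; exact: exprn_ege1.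
have bd z (w : Cx) : W z -> cabs w <= X z ^+ N -> cabs (cmul (f0 z) w) <= 1 / 4.
  move=> Wz hw; rewrite cabsM f0E // -mulrA div1r ler_piMr // mulrC ler_pdivrMr ?mul1r //.
  by have := XN z Wz; lra.
have pw z i j : W z -> (i <= j)%N -> X z ^+ i <= X z ^+ j by move=> Wz; apply: ler_weXn2l; exact: X1.
have oW : open W by exact: model_open.
apply: (complete_domain oW hf0 _ _ _ _ _ (model_infty BD) (fun q => model_peak BD TD (q := q))).
- apply/A2P; split=> //; apply: decay_integrable.
  + exact: open_measurable_C2.
  + by move=> z Wz; apply: cont_cnorm2; exact: holat_cont (hf0 z Wz).
  + by move=> z _; exact: cnorm2_ge0.
  move=> z Wz; rewrite cnorm2_cabs f0E //; have [_ h1 h2] := hC z Wz.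
  rewrite -/(g z) -/(X z) in h1 h2; have x1 := X1 z Wz; have k1 := XN z Wz.
  have e1 : (1 + z.1.1 ^+ 2) * (1 + z.1.2 ^+ 2) <= 4 * X z ^+ 2.
    have := sqr_ge0 z.1.1; have := sqr_ge0 z.1.2; move: h1; rewrite /cnorm2.
    by move: (z.1.1 ^+ 2) (z.1.2 ^+ 2) (X z) x1 => s t x *; nra.
  have h3 : cnorm2 z.2 <= (X z ^+ m.+1) ^+ 2.
    by rewrite cnorm2_cabs; apply: lerXn2r => //; rewrite nnegrE ?cabs_ge0 // exprn_ge0 //; lra.
  have e2 : (1 + z.2.1 ^+ 2) * (1 + z.2.2 ^+ 2) <= 4 * ((X z ^+ m.+1) ^+ 2) ^+ 2.
    have : 1 <= (X z ^+ m.+1) ^+ 2 by rewrite exprn_ege1 // exprn_ege1.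
    have := sqr_ge0 z.2.1; have := sqr_ge0 z.2.2; move: h3; rewrite /cnorm2.
    by move: (z.2.1 ^+ 2) (z.2.2 ^+ 2) ((X z ^+ m.+1) ^+ 2) => s t x *; nra.
  have p (x y : R) : 0 <= (1 + x ^+ 2) * (1 + y ^+ 2) by rewrite mulr_ge0 // addr_ge0 // sqr_ge0.
  have := ler_pM (p _ _) (p _ _) e1 e2.
  have -> : 4 * X z ^+ 2 * (4 * ((X z ^+ m.+1) ^+ 2) ^+ 2) = 16 * (X z ^+ N) ^+ 2.
    have -> : X z ^+ N = X z * (X z ^+ m.+1) ^+ 2 by rewrite /N exprS mulnC exprM.
    by move: (X z ^+ m.+1) => x; ring.
  have k0 : 0 < X z ^+ N by lra.
  have kn : X z ^+ N != 0 by rewrite gt_eqF.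
  move=> h; rewrite mulrC -ler_pdivlMr; last by rewrite exprn_gt0 // mulr_gt0 // invr_gt0.
  by apply: le_trans h _; rewrite le_eqVlt; apply/orP; left; apply/eqP; field.
- by move=> z Wz; rewrite f0E // div1r ler_piMr // invf_le1 ?XN //; have := XN z Wz; lra.
- move=> z Wz; apply: bd => //; have [_ h1 _] := hC z Wz; rewrite -/(g z) -/(X z) in h1.
  have x1 := X1 z Wz; apply: le_trans (pw z 1 N Wz _) => //; rewrite expr1.
  by rewrite cnorm2_cabs in h1; have := cabs_ge0 z.1; nra.
- move=> z Wz; apply: bd => //; have [_ _ h2] := hC z Wz.
  by apply: le_trans h2 (pw z _ _ Wz _); rewrite /N; lia.
move=> r; have rho0 := bd_rho BD; have a0 := bd_a BD.
pose S := 2 * `|r|; pose B := C * (1 + (1 + S + a * (S ^+ 2) ^+ m) / rho).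
have S0 : 0 <= S by rewrite mulr_ge0.
have q0 : 0 <= (1 + S + a * (S ^+ 2) ^+ m) / rho.
  by apply: divr_ge0; [apply: addr_ge0; [lra|apply: mulr_ge0; [exact: ltW|rewrite exprn_ge0 // sqr_ge0]]|exact: ltW].
have B0 : 0 < B by rewrite mulr_gt0 //; lra.
exists (4^-1 * (B ^+ N)^-1); first by rewrite mulr_gt0 // invr_gt0 ?exprn_gt0.
move=> z Wz zr; rewrite f0E // ler_pM2l ?invr_gt0 // lef_pV2 ?posrE ?exprn_gt0 //; last by have := X1 z Wz; lra.
have zS (w : Cx) : `|w| <= `|z| -> cabs w <= S.
  by move=> h; apply: le_trans (cabs_le_norm _) _; rewrite ler_pM2l //; apply: le_trans h (le_trans zr (ler_norm _)).
have s1 := zS z.1 (norm_fst_le z); have s2 := zS z.2 (norm_snd_le z).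
apply: lerXn2r; rewrite ?nnegrE ?(ltW B0) //; first by have := X1 z Wz; lra.
rewrite /X /B ler_pM2l; last by lra.
have dz : bdom m b z.1 (cone R - z.2) by exact: grow_dom.
have := branch_upper BD dz; rewrite -/(fgrow m rho a kap z) -/(g z) => /le_trans; apply; rewrite lerD2l ler_pM2r ?invr_gt0 //.
apply: lerD.
  by apply: le_trans (cabsB _ _) _; rewrite cabs1 lerD2l.
rewrite ler_pM2l //; apply: lerXn2r; rewrite ?nnegrE ?cnorm2_ge0 ?sqr_ge0 //.
by rewrite cnorm2_cabs; apply: lerXn2r; rewrite ?nnegrE ?cabs_ge0.
Qed.

End ModelComplete.

(** * Polynomial inequalities for the two sets of coefficients *)

Section Inequalities.
Variable R : realType.
Local Notation Cx := (Cx R).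
Implicit Types (Y Z e : Cx) (T : R).

Lemma cpow2E Y : cpow Y 2 = (Y.1 ^+ 2 - Y.2 ^+ 2, 2 * Y.1 * Y.2).
Proof. by apply: cx_eq; rewrite /=; ring. Qed.
Lemma cpow3E Y : cpow Y 3 = (Y.1 ^+ 3 - 3 * Y.1 * Y.2 ^+ 2, 3 * Y.1 ^+ 2 * Y.2 - Y.2 ^+ 3).
Proof. by apply: cx_eq; rewrite /=; ring. Qed.
Lemma cpow4E Y : cpow Y 4 = (Y.1 ^+ 4 - 6 * Y.1 ^+ 2 * Y.2 ^+ 2 + Y.2 ^+ 4, 4 * Y.1 ^+ 3 * Y.2 - 4 * Y.1 * Y.2 ^+ 3).
Proof. by apply: cx_eq; rewrite /=; ring. Qed.

Lemma cabs_lt (w : Cx) (r : R) : 0 < r -> cnorm2 w < r ^+ 2 -> cabs w < r.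
Proof.
by move=> r0; rewrite cnorm2_cabs ltr_pXn2r ?nnegrE ?cabs_ge0 // ltW.
Qed.

Lemma cabs_le (w : Cx) (b r : R) : 0 <= b -> 0 <= r -> b ^+ 2 * cnorm2 w <= r ^+ 2 -> b * cabs w <= r.
Proof.
move=> b0 r0; rewrite cnorm2_cabs -exprMn ler_pXn2r ?nnegrE ?mulr_ge0 ?cabs_ge0 //.
Qed.

Lemma cube_lt (p q : R) : 0 <= q -> q ^+ 3 < p ^+ 3 -> q < p.
Proof.
move=> q0 h; rewrite ltNge; apply/negP => pq; case: (ltP p 0) => p0.
  have := exprn_ge0 3 q0; have : p ^+ 3 = - ((- p) ^+ 3) by ring.
  have : 0 < - p by lra.
  by move=> /(exprn_gt0 3); lra.
by have : p ^+ 3 <= q ^+ 3 by [apply: lerXn2r|]; lra.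
Qed.

(* Boundary curve [Re Y^2 = T^2], parametrised by [u = x / T = 1 + s]. *)
Lemma boundary2 (s : R) : 0 <= s ->
  (9 / 5) ^+ 2 * (9 / 16 * (2 * (1 + s) ^+ 2 - 1) - 3 / 2 * (1 + s) + 1) <
  (1 - 9 / 20 * (3 * (1 + s) - 2 * (1 + s) ^+ 3)) ^+ 2.
Proof.
move=> s0; rewrite -subr_gt0.
have -> : (1 - 9 / 20 * (3 * (1 + s) - 2 * (1 + s) ^+ 3)) ^+ 2 -
   (9 / 5) ^+ 2 * (9 / 16 * (2 * (1 + s) ^+ 2 - 1) - 3 / 2 * (1 + s) + 1) =
   1 / 10 - 945 / 1000 * s + 11475 / 10000 * s ^+ 2 + 828 / 100 * s ^+ 3 + 972 / 100 * s ^+ 4 + 486 / 100 * s ^+ 5 + 81 / 100 * s ^+ 6.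
  by field.
have h1 : 0 <= s * (s - 14 / 100) ^+ 2 by rewrite mulr_ge0 // sqr_ge0.
have h2 : 0 <= (s * (s - 14 / 100)) ^+ 2 by rewrite sqr_ge0.
have h3 : 0 <= (s - 1437 / 10000) ^+ 2 by rewrite sqr_ge0.
have h5 : 0 <= s ^+ 5 by exact: exprn_ge0.
have h6 : 0 <= s ^+ 6 by exact: exprn_ge0.
have h22 : 0 <= s ^+ 2 by exact: exprn_ge0.
nra.
Qed.

(** At [u = 1] the boundary inequality compares [9/20 + b/4] with 1, and [bd_arho] reads [b <= 9/5]:
    the constants are balanced for the extreme value of [b]. *)
Lemma branch_data_For (b : R) : 1 < b < 9 / 5 -> branch_data 2 (9 / 20) (3 / 4 * b) b 1.
Proof.
move=> /andP[b1 b2]; split=> //; try lra.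
- by move=> Y _; rewrite mul1r cpow2E /= => ->; rewrite subrr.
- move=> T Y T0 x0 _; rewrite cpow2E cpow3E /= => e.
  case: (ltgtP T 0) T0 => // [T0 _|Tz _]; last first.
    rewrite Tz expr0n /= mul0r addr0 in e *; have : Y.2 ^+ 2 = Y.1 ^+ 2 by lra.
    by move=> h; rewrite expr0n /= -mulrA h; have := exprn_gt0 3 x0; lra.
  have [u u0 xu] : exists2 u, 0 < u & Y.1 = T * u.
    by exists (Y.1 / T); [exact: divr_gt0|rewrite mulrC mulfVK // gt_eqF].
  have y2 : Y.2 ^+ 2 = T ^+ 2 * (u ^+ 2 - 1) by rewrite xu in e; lra.
  have u1 : 1 <= u.
    have T2 : 0 < T ^+ 2 by exact: exprn_gt0.
    have := sqr_ge0 Y.2; rewrite y2 pmulr_rge0 // subr_ge0 => h.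
    by rewrite leNgt; apply/negP => ul; nra.
  have s0 : 0 <= u - 1 by lra.
  have := boundary2 s0; rewrite [1 + (u - 1)]addrC subrK => key.
  pose n := 1 - 9 / 20 * (3 * u - 2 * u ^+ 3).
  have n0 : 0 < n.
    have : 1 <= u ^+ 3 by exact: exprn_ege1.
    have -> : n = 1 + 9 / 20 * (2 * u ^+ 3 - 3 * u) by rewrite /n; ring.
    have h : 0 <= (u - 1) ^+ 2 * (u + 2) by rewrite mulr_ge0 ?sqr_ge0 //; lra.
    by rewrite (_ : (u - 1) ^+ 2 * (u + 2) = u ^+ 3 - 3 * u + 2) in h; [lra|ring].
  have A : cabs ((3 / 4 * b) *: Y - creal (b * T)) < T * n.
    apply: cabs_lt; first exact: mulr_gt0.
    rewrite /cnorm2 !(cxE, cxZE) /= subr0.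
    have -> : (3 / 4 * b * Y.1 - b * T) ^+ 2 + (3 / 4 * b * Y.2) ^+ 2 =
      T ^+ 2 * (b ^+ 2 * (9 / 16 * (2 * u ^+ 2 - 1) - 3 / 2 * u + 1)).
      by rewrite [(_ * Y.2) ^+ 2]exprMn y2 xu; field.
    rewrite [(T * n) ^+ 2]exprMn ltr_pM2l ?exprn_gt0 //; apply: le_lt_trans key.
    apply: ler_wpM2r; last by apply: lerXn2r; rewrite ?nnegrE; lra.
    by have := sqr_ge0 (u - 1); lra.
  have T2 : 0 < T ^+ 2 by exact: exprn_gt0.
  rewrite -(ltr_pM2l T2) in A.
  have -> : Y.1 ^+ 3 - 3 * Y.1 * Y.2 ^+ 2 = T ^+ 3 * (3 * u - 2 * u ^+ 3) by rewrite y2 xu; ring.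
  have : T ^+ 2 * (T * n) = T ^+ 3 - 9 / 20 * (T ^+ 3 * (3 * u - 2 * u ^+ 3)) by rewrite /n; ring.
  by lra.
move=> T Y Z T0 [x0 xy]; rewrite cpow2E /= => tY [u0 uv]; rewrite cpow2E /= => tZ.
have t2 : 0 <= T ^+ 2 by exact: exprn_ge0.
(* The real part of [Y Z] is bounded below by the reversed Cauchy-Schwarz inequality for the form
   [x^2 - y^2] on its positive cone. *)
suff : T ^+ 2 < Y.1 * Z.1 - Y.2 * Z.2 by lra.
have pos : 0 < Y.1 * Z.1 - Y.2 * Z.2.
  rewrite subr_gt0; apply: le_lt_trans (ler_norm _) _; rewrite normrM -[ltRHS]ger0_norm ?mulr_ge0 ?ltW // normrM.
  rewrite !mul1r in xy uv.
  apply: ltr_pM => //; rewrite -(ltr_pXn2r (n := 2)) ?nnegrE // !real_normK ?num_real //.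
rewrite -(ltr_pXn2r (n := 2)) ?nnegrE //; last exact: ltW.
apply: lt_le_trans (_ : (Y.1 ^+ 2 - Y.2 ^+ 2) * (Z.1 ^+ 2 - Z.2 ^+ 2) <= _).
  by rewrite expr2; apply: ltr_pM.
by have := sqr_ge0 (Y.1 * Z.2 - Y.2 * Z.1); lra.
Qed.

(** [7/5] confines the roots to [|arg Y| <= pi / 6], whose squared cosine is [3/4]; then
    [Re Y^3 >= 0], and two such arguments differ by at most [pi / 3], with cosine
    [1/2 = 2 kk - 1]. *)
Lemma tangent_data_For (b : R) : 1 < b < 9 / 5 -> tangent_data 2 (9 / 20) (3 / 4 * b) b 1 (1 / 2) (3 / 4) (7 / 5).
Proof.
move=> /andP[b1 b2]; split; try lra.
- move=> x hx; have -> : `|b - 3 / 4 * b * x| = b * (3 / 4 * x - 1).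
    by rewrite (_ : b - _ = - (b * (3 / 4 * x - 1))) ?normrN ?ger0_norm //; [nra|ring].
  have h : b * (3 / 4 * x - 1) <= 9 / 5 * (3 / 4 * x - 1) by rewrite ler_wpM2r //; lra.
  have s0 : 0 <= x - 7 / 5 by lra.
  have := exprn_ge0 3 s0; have := exprn_ge0 2 s0.
  by move: h; rewrite !exprS expr0; nra.
- move=> e e1 ce; rewrite cpow2E cpow3E; set c := e.1 in ce *; set s := e.2.
  have n1 : c ^+ 2 + s ^+ 2 = 1 by rewrite -[LHS]/(cnorm2 e) cnorm2_cabs e1 expr1n.
  have s2 : s ^+ 2 = 1 - c ^+ 2 by lra.
  have c1 : c <= 1 by have := sqr_ge0 s; nra.
  have -> : 1 - (c ^+ 3 - 3 * c * s ^+ 2, 3 * c ^+ 2 * s - s ^+ 3).1 = (1 - c) * (1 + 2 * c) ^+ 2.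
    by rewrite /= s2; ring.
  apply: cabs_le; [lra|by rewrite mulr_ge0 ?sqr_ge0 //; lra|].
  (* Both sides carry the factor [1 - c] before squaring: the choice of [vtang] makes the left one
     vanish to second order in the angle at [e = 1], like the right one. *)
  have -> : cnorm2 ((c ^+ 2 - s ^+ 2, 2 * c * s) -
     ((((2 * 3)%:R - 1) / (2 * 3)%:R) *: (c ^+ 3 - 3 * c * s ^+ 2, 3 * c ^+ 2 * s - s ^+ 3) +
        (2 * 3)%:R^-1 *: cconj (c ^+ 3 - 3 * c * s ^+ 2, 3 * c ^+ 2 * s - s ^+ 3))) =
    (1 - c) ^+ 2 * ((4 * c ^+ 2 + 2 * c - 1) ^+ 2 + 4 / 9 * (1 - c ^+ 2) * (4 * c + 1) ^+ 2).
    rewrite /cnorm2 !(cxE, cxZE) /=.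
    have -> : c ^+ 2 - s ^+ 2 - (((2 * 3)%:R - 1) / (2 * 3)%:R * (c ^+ 3 - 3 * c * s ^+ 2) + (2 * 3)%:R^-1 * (c ^+ 3 - 3 * c * s ^+ 2)) =
       (1 - c) * (4 * c ^+ 2 + 2 * c - 1).
      by rewrite s2; field.
    have -> : 2 * c * s - (((2 * 3)%:R - 1) / (2 * 3)%:R * (3 * c ^+ 2 * s - s ^+ 3) + (2 * 3)%:R^-1 * - (3 * c ^+ 2 * s - s ^+ 3)) =
       s * (2 / 3 * (1 - c) * (4 * c + 1)).
      by rewrite (exprS s 2) s2; field.
    by rewrite [(s * _) ^+ 2]exprMn s2; field.
  rewrite mulrCA exprMn -exprM ler_wpM2l ?sqr_ge0 //.
  set Q := (_ + _ : R); have Q0 : 0 <= Q.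
    by rewrite addr_ge0 ?sqr_ge0 // mulr_ge0 ?sqr_ge0 // mulr_ge0 //; nra.
  apply: le_trans (_ : (9 / 5) ^+ 2 * Q <= _); first by rewrite ler_wpM2r // lerXn2r // ?nnegrE; lra.
  rewrite -subr_ge0.
  have -> : (1 + 2 * c) ^+ (2 * 2) - (9 / 5) ^+ 2 * Q =
    (1 - c) * (128 / 10 * c ^+ 3 + 2112 / 100 * c ^+ 2 + 576 / 100 * c - 368 / 100) by rewrite /Q; field.
  apply: mulr_ge0; first by lra.
  have : 0 <= c ^+ 3 by rewrite exprn_ge0 //; lra.
  by nra.
move=> T Y T0 [x0 _]; rewrite cpow2E cpow3E /= => tY hY.
have h : cnorm2 Y < (7 / 5 * T) ^+ 2 by rewrite cnorm2_cabs ltr_pXn2r ?nnegrE ?cabs_ge0 // mulr_ge0 // ltW.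
rewrite exprMn in h; have : 3 * Y.2 ^+ 2 <= Y.1 ^+ 2 by move: h (sqr_ge0 Y.1); rewrite /cnorm2; lra.
move=> k; split; first by rewrite /cnorm2; lra.
by rewrite (_ : _ - _ = Y.1 * (Y.1 ^+ 2 - 3 * Y.2 ^+ 2)); [rewrite mulr_ge0 ?subr_ge0 // ltW|ring].
Qed.

(* Boundary curve [Re Y^3 = T^3], parametrised by [u = x / T = 1 + s]. *)
Lemma boundary3 (s : R) : 0 <= s ->
  9 * (1 + s) ^+ 3 * (192 * (1 + s) ^+ 3 - 360 * (1 + s) ^+ 2 + 225 * (1 + s) - 48) <
  (8 * (1 + s) ^+ 6 - 16 * (1 + s) ^+ 3 + 21 * (1 + s) ^+ 2 - 1) ^+ 2.
Proof.
move=> s0.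
have -> : 8 * (1 + s) ^+ 6 - 16 * (1 + s) ^+ 3 + 21 * (1 + s) ^+ 2 - 1 =
  12 + 42 * s + 93 * s ^+ 2 + 144 * s ^+ 3 + (120 * s ^+ 4 + 48 * s ^+ 5 + 8 * s ^+ 6) by ring.
have -> : 9 * (1 + s) ^+ 3 * (192 * (1 + s) ^+ 3 - 360 * (1 + s) ^+ 2 + 225 * (1 + s) - 48) =
  81 + 972 * s + 4374 * s ^+ 2 + 9828 * s ^+ 3 + 11745 * s ^+ 4 + 7128 * s ^+ 5 + 1728 * s ^+ 6 by ring.
set r := (120 * _ + _ + _ : R).
have p n : 0 <= s ^+ n by exact: exprn_ge0.
have r0 : 0 <= r by have := p 4; have := p 5; have := p 6; rewrite /r; lra.
have h0 : 0 <= 12 + 42 * s + 93 * s ^+ 2 + 144 * s ^+ 3 by have := p 2; have := p 3; lra.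
apply: lt_le_trans (_ : (12 + 42 * s + 93 * s ^+ 2 + 144 * s ^+ 3) ^+ 2 + 24 * r <= _); last first.
  by have := mulr_ge0 h0 r0; have := sqr_ge0 r; have := p 2; have := p 3; rewrite -subr_ge0; nra.
rewrite /r -subr_gt0.
have h1 : 0 <= s * (s - 13 / 100) ^+ 2 by rewrite mulr_ge0 // sqr_ge0.
have := p 2; have := p 3; have := p 4; have := p 5; have := p 6; have := sqr_ge0 (s - 1 / 5).
nra.
Qed.

(** [bd_arho] is an equality here, and at [u = 1] the boundary inequality reads [6/7 < 1]. With
    [kap = 3] the edges are the lines on which [Re Y^3] vanishes. *)
Lemma branch_data_KN : branch_data 3 (3 / 7) (12 / 7) (15 / 7 : R) 3.
Proof.
split=> //; try lra.
- by move=> Y _ h; rewrite cpow3E /= (_ : _ - _ = Y.1 * (Y.1 ^+ 2 - 3 * Y.2 ^+ 2)); [rewrite h subrr mulr0|ring].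
- move=> T Y T0 x0 xy; rewrite cpow3E cpow4E /= => e.
  case: (ltgtP T 0) T0 => // [T0 _|Tz _]; last first.
    have h : Y.1 ^+ 2 = 3 * Y.2 ^+ 2.
      have : Y.1 * (Y.1 ^+ 2 - 3 * Y.2 ^+ 2) = 0 by rewrite -[RHS](expr0n _ 3) -Tz -e; ring.
      by move=> /eqP; rewrite mulf_eq0 gt_eqF //= subr_eq0 => /eqP.
    have -> : Y.1 ^+ 4 - 6 * Y.1 ^+ 2 * Y.2 ^+ 2 + Y.2 ^+ 4 = - (8 / 9) * (Y.1 ^+ 2) ^+ 2.
      by rewrite (_ : Y.1 ^+ 4 = (Y.1 ^+ 2) ^+ 2); [rewrite h; field|ring].
    rewrite Tz !expr0n /= mul0r addr0.
    by have := exprn_gt0 2 (exprn_gt0 2 x0); lra.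
  have [u u0 xu] : exists2 u, 0 < u & Y.1 = T * u.
    by exists (Y.1 / T); [exact: divr_gt0|rewrite mulrC mulfVK // gt_eqF].
  have un : u != 0 by rewrite gt_eqF.
  have Tn : T != 0 by rewrite gt_eqF.
  have y2 : Y.2 ^+ 2 = T ^+ 2 * ((u ^+ 3 - 1) / (3 * u)).
    have n3 : 3 * T * u != 0 by rewrite mulf_neq0 // mulf_neq0 // pnatr_eq0.
    apply: (mulfI n3).
    have -> : 3 * T * u * (T ^+ 2 * ((u ^+ 3 - 1) / (3 * u))) = T ^+ 3 * u ^+ 3 - T ^+ 3 by field.
    by rewrite xu in e; lra.
  have u1 : 1 <= u.
    have T2 : 0 < T ^+ 2 by exact: exprn_gt0.
    have := sqr_ge0 Y.2; rewrite y2 pmulr_rge0 // pmulr_lge0; last by rewrite invr_gt0 mulr_gt0.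
    rewrite subr_ge0 => h.
    rewrite leNgt; apply/negP => ul; have : u ^+ 3 < 1 by rewrite exprn_ilt1 // ltW.
    by lra.
  have s0 : 0 <= u - 1 by lra.
  have := boundary3 s0; rewrite [1 + (u - 1)]addrC subrK => key.
  pose M := 8 * u ^+ 6 - 16 * u ^+ 3 + 21 * u ^+ 2 - 1.
  have M0 : 0 < M.
    have -> : M = 8 * (u ^+ 3 - 1) ^+ 2 + 21 * (u ^+ 2 - 1) + 12 by rewrite /M; ring.
    have : 1 <= u ^+ 2 by exact: exprn_ege1.
    by have := sqr_ge0 (u ^+ 3 - 1); lra.
  pose n := M / (21 * u ^+ 2); have n0 : 0 < n by rewrite divr_gt0 // mulr_gt0 // exprn_gt0.
  have A : cabs ((12 / 7) *: Y - creal (15 / 7 * T)) < T * n.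
    apply: cabs_lt; first exact: mulr_gt0.
    rewrite /cnorm2 !(cxE, cxZE) /= subr0.
    have -> : (12 / 7 * Y.1 - 15 / 7 * T) ^+ 2 + (12 / 7 * Y.2) ^+ 2 =
      T ^+ 2 * ((192 * u ^+ 3 - 360 * u ^+ 2 + 225 * u - 48) / (49 * u)).
      by rewrite [(_ * Y.2) ^+ 2]exprMn y2 xu; field.
    rewrite [(T * n) ^+ 2]exprMn ltr_pM2l ?exprn_gt0 //.
    rewrite ltr_pdivrMr ?mulr_gt0 //.
    have c0 : 0 < 9 * u ^+ 3 by rewrite mulr_gt0 // exprn_gt0.
    rewrite -(ltr_pM2l c0); apply: lt_le_trans key _; rewrite -/M /n le_eqVlt; apply/orP; left; apply/eqP.
    by field.
  have T3 : 0 < T ^+ 3 by exact: exprn_gt0.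
  rewrite -(ltr_pM2l T3) in A.
  have -> : Y.1 ^+ 4 - 6 * Y.1 ^+ 2 * Y.2 ^+ 2 + Y.2 ^+ 4 = T ^+ 4 * ((1 + 16 * u ^+ 3 - 8 * u ^+ 6) / (9 * u ^+ 2)).
    by rewrite (_ : Y.2 ^+ 4 = (Y.2 ^+ 2) ^+ 2); [rewrite y2 xu; field|ring].
  have : T ^+ 3 * (T * n) = T ^+ 4 - 3 / 7 * (T ^+ 4 * ((1 + 16 * u ^+ 3 - 8 * u ^+ 6) / (9 * u ^+ 2))).
    by rewrite /n /M; field.
  by lra.
move=> T Y Z T0 [x0 xy]; rewrite cpow3E /= => tY [u0 uv]; rewrite cpow3E /= => tZ.
have t3 : 0 <= T ^+ 3 by exact: exprn_ge0.
(* The cubic analogue of the reversed Cauchy-Schwarz inequality,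
   [(Re Y^2 Z)^3 >= (Re Y^3)^2 Re Z^3], an instance of Garding's inequality for hyperbolic
   polynomials; [id] exhibits the difference as a square times a bracket that is nonnegative in the
   sector. *)
have mixed (x y u w : R) : 0 < x -> 3 * y ^+ 2 < x ^+ 2 -> 0 < u -> 3 * w ^+ 2 < u ^+ 2 ->
    T ^+ 3 < x ^+ 3 - 3 * x * y ^+ 2 -> T ^+ 3 < u ^+ 3 - 3 * u * w ^+ 2 ->
    T ^+ 3 < (x ^+ 2 - y ^+ 2) * u - 2 * x * y * w.
  move=> hx hxy hu huw hp hq; apply: cube_lt => //.
  set p := x ^+ 3 - _ in hp *; set q := u ^+ 3 - _ in hq *.
  have id : ((x ^+ 2 - y ^+ 2) * u - 2 * x * y * w) ^+ 3 - p ^+ 2 * q =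
    (y * u - x * w) ^+ 2 * (3 * x ^+ 4 * u - 6 * x ^+ 2 * y ^+ 2 * u - y ^+ 4 * u - 8 * x * y ^+ 3 * w).
    by rewrite /p /q; ring.
  have yw : y * w <= x * u / 3.
    apply: le_trans (ler_norm _) _; rewrite -ler_sqr ?nnegrE ?divr_ge0 ?mulr_ge0 ?(ltW hx) ?(ltW hu) //.
    rewrite real_normK ?num_real // exprMn exprMn [(x * u) ^+ 2]exprMn.
    have := sqr_ge0 y; have := sqr_ge0 w; have := sqr_ge0 x.
    by move: (x ^+ 2) (y ^+ 2) (u ^+ 2) (w ^+ 2) hxy huw => X V U' W *; nra.
  have br : 0 <= 3 * x ^+ 4 * u - 6 * x ^+ 2 * y ^+ 2 * u - y ^+ 4 * u - 8 * x * y ^+ 3 * w.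
    have k1 : 8 * x * y ^+ 2 * (y * w) <= 8 * x * y ^+ 2 * (x * u / 3).
      by rewrite ler_wpM2l // mulr_ge0 ?sqr_ge0 // mulr_ge0 // ltW.
    have k2 : 0 <= u * (3 * (x ^+ 2) ^+ 2 - 26 / 3 * x ^+ 2 * y ^+ 2 - (y ^+ 2) ^+ 2).
      apply: mulr_ge0; first exact: ltW.
      by have := sqr_ge0 y; move: (x ^+ 2) (y ^+ 2) hxy => X V *; nra.
    have : 8 * x * y ^+ 2 * (y * w) = 8 * x * y ^+ 3 * w by ring.
    by move: k1 k2; rewrite -!exprM; lra.
  have : p ^+ 2 * q <= ((x ^+ 2 - y ^+ 2) * u - 2 * x * y * w) ^+ 3.
    by rewrite -subr_ge0 id mulr_ge0 // sqr_ge0.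
  apply: lt_le_trans; rewrite (exprS (T ^+ 3) 2) mulrC.
  apply: ltr_pM => //; first exact: exprn_ge0.
  by rewrite ltr_pXn2r ?nnegrE // ltW // (le_lt_trans t3).
have m1 := mixed _ _ _ _ x0 xy u0 uv tY tZ; have m2 := mixed _ _ _ _ u0 uv x0 xy tZ tY.
by lra.
Qed.

(** [13/10] confines the roots to arguments of squared cosine at least [87/100]; the cosine of twice
    that extreme angle is [74/100], which is below [cos (pi / 6)]. *)
Lemma tangent_data_KN : tangent_data 3 (3 / 7) (12 / 7) (15 / 7 : R) 3 (74 / 100) (87 / 100) (13 / 10).
Proof.
split; try lra.
- move=> x hx; have -> : `|15 / 7 - 12 / 7 * x| = 12 / 7 * x - 15 / 7 by rewrite ler0_norm; lra.
  have s0 : 0 <= x - 13 / 10 by lra.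
  have := exprn_ge0 4 s0; have := exprn_ge0 3 s0; have := exprn_ge0 2 s0.
  have e : x = x - 13 / 10 + 13 / 10 by lra.
  rewrite {4 5}e; move: (x - 13 / 10) s0 => s s0; lra.
- move=> e e1 ce; rewrite cpow3E cpow4E; set c := e.1 in ce *; set s := e.2.
  have n1 : c ^+ 2 + s ^+ 2 = 1 by rewrite -[LHS]/(cnorm2 e) cnorm2_cabs e1 expr1n.
  have s2 : s ^+ 2 = 1 - c ^+ 2 by lra.
  have s3 : s ^+ 3 = s * (1 - c ^+ 2) by rewrite exprS s2.
  have s4 : s ^+ 4 = (1 - c ^+ 2) ^+ 2 by rewrite -s2; ring.
  have c1 : c <= 1 by have := sqr_ge0 s; nra.
  have -> : 1 - (c ^+ 4 - 6 * c ^+ 2 * s ^+ 2 + s ^+ 4, 4 * c ^+ 3 * s - 4 * c * s ^+ 3).1 = (1 - c) * (8 * (1 + c) * c ^+ 2).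
    by rewrite /= s2 s4; ring.
  apply: cabs_le; [lra|by rewrite !mulr_ge0 ?sqr_ge0 //; lra|].
  have -> : cnorm2 ((c ^+ 3 - 3 * c * s ^+ 2, 3 * c ^+ 2 * s - s ^+ 3) -
     ((((2 * 4)%:R - 1) / (2 * 4)%:R) *: (c ^+ 4 - 6 * c ^+ 2 * s ^+ 2 + s ^+ 4, 4 * c ^+ 3 * s - 4 * c * s ^+ 3) +
        (2 * 4)%:R^-1 *: cconj (c ^+ 4 - 6 * c ^+ 2 * s ^+ 2 + s ^+ 4, 4 * c ^+ 3 * s - 4 * c * s ^+ 3))) =
    (1 - c) ^+ 2 * ((8 * c ^+ 3 + 4 * c ^+ 2 - 4 * c - 1) ^+ 2 + (1 - c ^+ 2) * (6 * c ^+ 2 + 2 * c - 1) ^+ 2).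
    rewrite /cnorm2 !(cxE, cxZE) /= s3 s4 s2.
    set A := (X in X ^+ 2 + _ = _); set B := (X in _ + X ^+ 2 = _).
    have -> : A = (1 - c) * (8 * c ^+ 3 + 4 * c ^+ 2 - 4 * c - 1) by rewrite /A; field.
    have -> : B = s * ((1 - c) * (6 * c ^+ 2 + 2 * c - 1)) by rewrite /B; field.
    by rewrite [(s * _) ^+ 2]exprMn s2; ring.
  rewrite mulrCA [((1 - c) * _) ^+ 2]exprMn ler_wpM2l ?sqr_ge0 //.
  have d0 : 0 <= c - 74 / 100 by lra.
  have d1 : 0 <= 1 - c by lra.
  have k1 := mulr_ge0 d0 d1.
  have k2 := mulr_ge0 k1 k1.
  rewrite -subr_ge0; set q := (X in 0 <= X).
  have : 0 <= q by rewrite /q; nra.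
  by [].
move=> T Y T0 [x0 xy]; rewrite cpow3E cpow4E /= => tY hY.
have h : cnorm2 Y < (13 / 10 * T) ^+ 2 by rewrite cnorm2_cabs ltr_pXn2r ?nnegrE ?cabs_ge0 // mulr_ge0 // ltW.
(* After squaring, both bounds on [T] involve only [p = Re^2] and [w = Im^2] and compare [(p + w)^3]
   with [p (p - 3 w)^2]; for [w > 13/87 p] they are incompatible. *)
have main : 13 * Y.1 ^+ 2 >= 87 * Y.2 ^+ 2.
  rewrite leNgt; apply/negP => lt.
  have tY2 : (T ^+ 2) ^+ 3 < Y.1 ^+ 2 * (Y.1 ^+ 2 - 3 * Y.2 ^+ 2) ^+ 2.
    have -> : (T ^+ 2) ^+ 3 = (T ^+ 3) ^+ 2 by ring.
    have -> : Y.1 ^+ 2 * (Y.1 ^+ 2 - 3 * Y.2 ^+ 2) ^+ 2 = (Y.1 ^+ 3 - 3 * Y.1 * Y.2 ^+ 2) ^+ 2 by ring.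
    have t3 : 0 <= T ^+ 3 by apply: exprn_ge0; exact: ltW.
    by rewrite ltr_pXn2r ?nnegrE // ltW // (le_lt_trans t3).
  have h3 : cnorm2 Y ^+ 3 < ((13 / 10 * T) ^+ 2) ^+ 3 by rewrite ltr_pXn2r ?nnegrE ?cnorm2_ge0 ?sqr_ge0.
  have e3 : ((13 / 10 * T) ^+ 2) ^+ 3 = (169 / 100) ^+ 3 * (T ^+ 2) ^+ 3 by field.
  move: h3 lt xy tY2; rewrite e3 /cnorm2; move: (exprn_gt0 2 x0) (sqr_ge0 Y.2) ((T ^+ 2) ^+ 3).
  move: (Y.1 ^+ 2) (Y.2 ^+ 2) => p w p0 w0 t h3 lt xy tY2.
  have a1 : 0 <= p - 3 * w <= 48 / 87 * p by lra.
  have a2 : (p - 3 * w) ^+ 2 <= (48 / 87 * p) ^+ 2 by apply: lerXn2r; rewrite ?nnegrE; lra.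
  have a3 : p * (p - 3 * w) ^+ 2 <= p * (48 / 87 * p) ^+ 2 by rewrite ler_pM2l.
  have a4 : (100 / 87 * p) ^+ 3 <= (p + w) ^+ 3 by apply: lerXn2r; rewrite ?nnegrE; lra.
  have p3 : 0 < p ^+ 3 by exact: exprn_gt0.
  have e1 : p * (48 / 87 * p) ^+ 2 = (48 / 87) ^+ 2 * p ^+ 3 by ring.
  have e2 : (100 / 87 * p) ^+ 3 = (100 / 87) ^+ 3 * p ^+ 3 by ring.
  by lra.
split; first by rewrite /cnorm2; lra.
rewrite (_ : _ + _ = (Y.1 ^+ 2) ^+ 2 - 6 * Y.1 ^+ 2 * Y.2 ^+ 2 + (Y.2 ^+ 2) ^+ 2); last by ring.
by have := sqr_ge0 Y.2; move: (Y.1 ^+ 2) (Y.2 ^+ 2) main => p w *; nra.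
Qed.

End Inequalities.

(** * The two domains as instances of the model *)

Lemma W_KN_model (R : realType) : @W_KN R = model 3 (15 / 7).
Proof. by apply/funext => z; rewrite /W_KN /model /rfun /pmin /= addrA. Qed.

Lemma W_For_model (R : realType) (t : R) : W_For t = model 2 t.
Proof. by apply/funext => z; rewrite /W_For /model /rfun /pmin /= addrA. Qed.

Theorem theorem1p3 (R : realType) :
  (bergman_positive (@W_KN R) /\ bergman_complete (@W_KN R) /\
   cara_positive (@W_KN R) /\ cara_complete (@W_KN R)) /\
  (forall t : R, 1 < t < 9 / 5 ->
     bergman_positive (W_For t) /\ bergman_complete (W_For t) /\
     cara_positive (W_For t) /\ cara_complete (W_For t)).
Proof.
split; first by rewrite W_KN_model; exact: (model_complete (branch_data_KN R) (tangent_data_KN R)).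
by move=> t ht; rewrite W_For_model; exact: (model_complete (branch_data_For ht) (tangent_data_For ht)).
Qed.
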